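(* Let $s\in(0,1)$ and let $N>2$ be an integer. Let $f\colon\mathbb{R}\to\mathbb{R}$, put $F(t)=\int_0^t f(\sigma)\,d\sigma$ and $\tilde F(t)=f(t)t-2F(t)$, and assume that: (1) $f$ is odd and continuous; (2) $\lim_{t\to 0} f(t)/|t|^{1+4s/N}=0$; (3) $\lim_{t\to+\infty} f(t)/|t|^{(N+2s)/(N-2s)}=0$; (4) $\lim_{t\to+\infty} F(t)/|t|^{2+4s/N}=+\infty$; (5) the function $t\mapsto \tilde F(t)/|t|^{2+4s/N}$ is strictly decreasing on $(-\infty,0)$ and strictly increasing on $(0,+\infty)$; (6) $f(t)t<\frac{2N}{N-2s}F(t)$ for all $t\in\mathbb{R}\setminus\{0\}$. Then for every $m>0$ the problem $$(-\Delta)^s u=f(u)-\mu u\ \text{ in }\mathbb{R}^N,\qquad \|u\|_{L^2(\mathbb{R}^N)}^2=m$$ (with unknowns $u\in H^s(\mathbb{R}^N)$ and $\mu\in\mathbb{R}$) admits infinitely many radial solutions $(u_k)_{k\in\mathbb{N}}$ (each with its own $\mu\in\mathbb{R}$). In particular, $I(u_{k+1})\ge I(u_k)$ for all $k\in\mathbb{N}$ and $I(u_k)\to+\infty$ as $k\to+\infty$.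
   Context: All functions are real valued. $H^s(\mathbb{R}^N)=\{u\in L^2(\mathbb{R}^N): [u]_{H^s(\mathbb{R}^N)}<\infty\}$, where $[u]_{H^s(\mathbb{R}^N)}^2=\int_{\mathbb{R}^N\times\mathbb{R}^N}\frac{|u(x)-u(y)|^2}{|x-y|^{N+2s}}\,dx\,dy$. The fractional Laplacian $(-\Delta)^s$ is rescaled by a constant so that, weakly, $\langle(-\Delta)^s u,\varphi\rangle=\int_{\mathbb{R}^N\times\mathbb{R}^N}\frac{(u(x)-u(y))(\varphi(x)-\varphi(y))}{|x-y|^{N+2s}}\,dx\,dy$ for $u,\varphi\in H^s(\mathbb{R}^N)$; equations are understood in the weak sense. The energy is $I(u)=\frac12[u]_{H^s(\mathbb{R}^N)}^2-\int_{\mathbb{R}^N}F(u)\,dx$. Radial means radially symmetric about the origin. *)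

(* Defs.v *)
From HB Require Import structures.
From mathcomp Require Import all_boot all_order all_algebra.
From mathcomp Require Import all_classical all_reals all_analysis.

Set Implicit Arguments.
Unset Strict Implicit.
Unset Printing Implicit Defensive.
Import Order.TTheory GRing.Theory Num.Theory.
Import numFieldNormedType.Exports.
Local Open Scope classical_set_scope.
Local Open Scope ring_scope.

Notation Rn R N := (N.-tuple (measurableTypeR R)).

Section lebesgue_measure_on_Rn.
Context {R : realType}.

Definition Rn_cons (n : nat) (p : measurableTypeR R * Rn R n) : Rn R n.+1 :=
  [the n.+1.-tuple (measurableTypeR R) of p.1 :: p.2].

Definition Rn_uncons (n : nat) (x : Rn R n.+1) : measurableTypeR R * Rn R n :=
  (thead x, [tuple of behead x]).

Lemma Rn_consK n : cancel (@Rn_cons n) (@Rn_uncons n).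
Proof.
by move=> [a x]; rewrite /Rn_uncons /Rn_cons theadE; congr (_, _); exact: val_inj.
Qed.

Lemma measurable_Rn_cons n : measurable_fun setT (@Rn_cons n).
Proof. exact: measurable_cons. Qed.

Lemma measurable_Rn_uncons n : measurable_fun setT (@Rn_uncons n).
Proof.
apply: measurable_fun_pair; first exact: measurable_tnth.
exact: measurable_behead.
Qed.

Section step.
Variables (n : nat) (mu : {sigma_finite_measure set (Rn R n) -> \bar R}).

Definition Rn_measureS : set (Rn R n.+1) -> \bar R :=
  pushforward (@lebesgue_measure R \x mu)%E (@Rn_cons n).

Let nu : {measure set (Rn R n.+1) -> \bar R} :=
  measure_function_pushforward__canonical__measure_function_Measure
    (@lebesgue_measure R \x mu)%E (@measurable_Rn_cons n).

HB.instance Definition _ := isMeasure.Build _ _ _ Rn_measureS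
  (measure0 nu) (measure_ge0 nu) (@measure_semi_sigma_additive _ _ _ nu).

Lemma Rn_measureS_sigma_finite : sigma_finite setT Rn_measureS.
Proof.
have /sigma_finiteP[F [TF ndF Foo]] := sigma_finiteT (@lebesgue_measure R).
have /sigma_finiteP[G [TG ndG Goo]] := sigma_finiteT mu.
exists (fun i => @Rn_uncons n @^-1` (F i `*` G i)).
  apply/esym; rewrite -preimage_bigcup -subTset => x _ /=.
  have [i _ Fi] : (\bigcup_i F i) (Rn_uncons x).1 by rewrite -TF.
  have [j _ Gj] : (\bigcup_i G i) (Rn_uncons x).2 by rewrite -TG.
  exists (maxn i j) => //; split.
  - by move: Fi; exact/subsetPset/ndF/leq_maxl.
  - by move: Gj; exact/subsetPset/ndG/leq_maxr.
move=> i; have [mF Fi] := Foo i; have [mG Gi] := Goo i; split.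
  rewrite -[X in measurable X]setTI; apply: measurable_Rn_uncons => //.
  exact: measurableX.
rewrite /Rn_measureS /pushforward -comp_preimage.
rewrite (_ : _ \o _ = id); last by apply/funext => p /=; rewrite Rn_consK.
by rewrite preimage_id product_measure1E// lte_mul_pinfty// ge0_fin_numE.
Qed.

HB.instance Definition _ :=
  Measure_isSigmaFinite.Build _ _ _ Rn_measureS Rn_measureS_sigma_finite.

End step.

(* The n-dimensional Lebesgue measure, obtained by iterating the binary
   product measure of the library; it is characterized by Rn_lebesgue_box. *)
Fixpoint Rn_lebesgue (n : nat) : {sigma_finite_measure set (Rn R n) -> \bar R} :=
  match n with
  | 0 => \d_ ([tuple] : Rn R 0)
  | m.+1 => Rn_measureS (Rn_lebesgue m)
  end.

Lemma Rn_lebesgue_box (n : nat) (A : 'I_n -> set (measurableTypeR R)) :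
  (forall i, measurable (A i)) ->
  Rn_lebesgue n [set x | forall i, A i (tnth x i)] =
  (\prod_(i < n) lebesgue_measure (A i))%E.
Proof.
elim: n A => [|n IHn] A mA.
  rewrite big_ord0 /= diracE mem_set//=; by case.
rewrite big_ord_recl -IHn//= /Rn_measureS /pushforward.
set B := [set x | _]; rewrite -product_measure1E//; last first.
  rewrite (_ : [set x | _] =
      \bigcap_(i in [set: 'I_n]) ((@tnth _ _)^~ i @^-1` A (lift ord0 i))).
    apply: fin_bigcap_measurable => // i _; rewrite -[X in measurable X]setTI.
    exact: measurable_tnth.
  by apply/seteqP; split => x /= Ax i; [move=> _|]; exact: Ax.
congr (_ _); apply/seteqP; split => -[a x] /=.
- move=> Bx; split; first by have := Bx ord0; rewrite tnth0.
  by move=> i; have := Bx (lift ord0 i); rewrite tnthS.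
- move=> [a0 Ax] i; have [j ->|->] := unliftP ord0 i.
    by rewrite tnthS; exact: Ax.
  by rewrite tnth0.
Qed.

End lebesgue_measure_on_Rn.

Section fractional_sobolev.
Context {R : realType} {N : nat}.
Implicit Types (s mu : R) (f : R -> R) (u v phi : Rn R N -> R) (x y : Rn R N).
Notation leb := (@Rn_lebesgue R N).

Definition enorm x : R := Num.sqrt (\sum_(i < N) tnth x i ^+ 2).

Definition edist x y : R :=
  Num.sqrt (\sum_(i < N) (tnth x i - tnth y i) ^+ 2).

Definition radial u : Prop := forall x y, enorm x = enorm y -> u x = u y.

(* The kernel takes the value 0 on the diagonal (0^-1 = 0), a null set. *)
Definition gag_kernel s x y : R := (edist x y `^ (N%:R + 2 * s))^-1.

Definition gagliardo_sq s u : \bar R :=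
  (\int[leb \x leb]_z
     (`|u z.1 - u z.2| ^+ 2 * gag_kernel s z.1 z.2)%:E)%E.

Definition Hs s : set (Rn R N -> R) :=
  [set u | u \in Lfun leb 2%:E /\ (gagliardo_sq s u < +oo)%E].

Definition fraclap s u phi : R :=
  \int[(leb \x leb)%E]_z
    ((u z.1 - u z.2) * (phi z.1 - phi z.2) * gag_kernel s z.1 z.2).

(* u in H^s solves (-Delta)^s u = f(u) - mu u weakly; the integrability clause
   is needed because the real-valued integral is 0 by convention when its
   extended-real counterpart is infinite. *)
Definition weak_solution s f mu u : Prop :=
  Hs s u /\
  forall phi, Hs s phi ->
    leb.-integrable setT (fun x => ((f (u x) - mu * u x) * phi x)%:E) /\
    fraclap s u phi = \int[leb]_x ((f (u x) - mu * u x) * phi x).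

(* F(t) is the oriented integral of f from 0 to t. *)
Definition primitive f (t : R) : R :=
  if 0 <= t then \int[lebesgue_measure]_(r in `[0, t]) f r
  else - \int[lebesgue_measure]_(r in `[t, 0]) f r.

Definition Ftilde f (t : R) : R := f t * t - 2 * primitive f t.

Definition energy s f u : R :=
  2^-1 * fine (gagliardo_sq s u) - \int[leb]_x primitive f (u x).

End fractional_sobolev.

(* Main.v *)
(* The solutions are minimax critical points of I on the sphere |u|_2^2 = m.
   Along the mass-preserving dilations t^(N/2) u(t x), monotonicity of
   Ftilde(t)/|t|^(2+4s/N) makes t -> I have a single critical time t(u), its
   maximum, so that J(u) = max_t I(t^(N/2) u(t x)) plays the role of the energy
   and the dilated function lies on the Pohozaev set P = 0, on which I is
   coercive.  For n+1 independent rotation invariant functions one minimizes the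
   maximum of J over the odd continuous maps from the l1 sphere of R^(n+1) into
   the rotation invariant functions of mass m.  A gradient step commuting with
   the dilations preserves these maps, hence there are near critical points on
   the Pohozaev set at the minimax level.

   Compactness comes from rotation invariance: a bounded rotation invariant
   function with small integrals over finitely many dyadic cubes is small in
   measure.  Since P = 0 and f(t)t < q F(t) keep the Lagrange multiplier away
   from 0, near critical sequences converge.  The same compactness makes the
   levels unbounded: by Borsuk-Ulam some member of each odd family has small
   cube integrals, while functions on the Pohozaev set with bounded energy are
   not small in measure.

   Rotation invariance is an almost everywhere statement; averages over balls
   are exactly rotation invariant and converge to the function, which yields a
   radial representative. *)

From HB Require Import structures.
From mathcomp Require Import all_boot all_order all_algebra.
From mathcomp Require Import all_classical all_reals all_analysis.
From mathcomp Require Import measurable_realfun ring lra zify.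
Require Import Defs.

Set Implicit Arguments.
Unset Strict Implicit.
Unset Printing Implicit Defensive.
Import Order.TTheory GRing.Theory Num.Theory.
Import numFieldNormedType.Exports.
Local Open Scope classical_set_scope.
Local Open Scope ring_scope.

(** * Lebesgue measure under shears and dilations *)

(** The delicate operation is the dilation: strong continuity of [t -> hs_dil t u] in H^s would call
    for a density argument. It is bypassed: the descent is made at the Pohozaev point of [u] and
    pulled back by [(poh_time u)^-1], so that only the gradient conjugated by a dilation close to 1
    must be continuous, which follows by testing its defining equation with the difference. In the
    Borsuk-Ulam argument weak continuity, against cubes, suffices. The Pohozaev time is an
    arbitrarily chosen root; a quantitative uniqueness makes it continuous, and maximality of the
    energy along rays removes its variation from the expansion of the energy, so that it is never
    differentiated. Averages over dyadic cubes give both the critical Sobolev inequality and the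
    compactness. There is no multiplicity theory at a fixed level: for each [C] the number of
    parameters is taken so large that the minimax level is at least [C], and solutions are picked
    with energies growing by at least 1. The l1 sphere is triangulated by the octahedron, which
    allows a combinatorial proof of Borsuk-Ulam in the manner of Ky Fan. *)

Section lebesgue_line.
Context {R : realType}.
Local Notation mu := (@lebesgue_measure R).
Local Open Scope ereal_scope.

(** The translated measure agrees with Lebesgue measure on half-open intervals, and these determine
    it. The scaling lemma below follows the same pattern. *)
Lemma ge0_integral_lebesgue_shift (f : measurableTypeR R -> \bar R) (c : R) :
  measurable_fun setT f -> (forall x, 0 <= f x) ->
  \int[mu]_x f (x + c)%R = \int[mu]_x f x.
Proof.
move=> mf f0.
pose phi : measurableTypeR R -> measurableTypeR R := fun x => (x + c)%R.
have mphi : measurable_fun setT phi by exact: measurable_funD.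
rewrite -[LHS](@ge0_integral_pushforward _ _ _ _ _ phi mphi mu setT f)//.
apply: eq_measure_integral => A mA _; apply/esym.
apply: (lebesgue_measure_unique (mu := pushforward mu phi)) => //.
move=> _ [[a b]] _ <-.
rewrite [RHS](_ : _ = mu (`](a - c)%R, (b - c)%R]%classic)); last first.
  by congr (mu _); apply/seteqP; split=> x; rewrite /= !in_itv/= /phi => ?; lra.
rewrite !lebesgue_measure_itv/= !lte_fin ltrD2r.
by rewrite -!EFinB opprB addrA subrK.
Qed.

Lemma ge0_integral_lebesgue_scale (f : measurableTypeR R -> \bar R) (c : R) :
  (0 < c)%R -> measurable_fun setT f -> (forall x, 0 <= f x) ->
  \int[mu]_x f (c * x)%R = (c^-1)%:E * \int[mu]_x f x.
Proof.
move=> c0 mf f0.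
have ic0 : (0 <= c)%R by exact: ltW.
pose phi : measurableTypeR R -> measurableTypeR R := fun x => (c * x)%R.
have mphi : measurable_fun setT phi by exact: measurable_funM.
rewrite -[LHS](@ge0_integral_pushforward _ _ _ _ _ phi mphi mu setT f)//.
suff -> : \int[mu]_x f x = c%:E * \int[pushforward mu phi]_x f x.
  by rewrite muleA -EFinM mulVf ?gt_eqF// mul1e.
rewrite -[X in X%:E * _]/((NngNum ic0)%:num)%R -ge0_integral_mscale//.
apply: eq_measure_integral => A mA _.
apply: (lebesgue_measure_unique (mu := mscale (NngNum ic0) (pushforward mu phi))) => //.
move=> _ [[a b]] _ <-.
rewrite [RHS](_ : _ = c%:E * mu (`](a / c)%R, (b / c)%R]%classic)); last first.
  congr (_ * mu _); apply/seteqP; split=> x; rewrite /= !in_itv/= /phi.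
    by rewrite ltr_pdivrMr// ler_pdivlMr// ![(x * c)%R]mulrC.
  by rewrite ltr_pdivrMr// ler_pdivlMr// ![(x * c)%R]mulrC.
rewrite !lebesgue_measure_itv/= !lte_fin ltr_pM2r ?invr_gt0//.
case: ifP => _; last by rewrite mule0.
by rewrite -!EFinB -EFinM; congr (_%:E); field; rewrite gt_eqF.
Qed.

End lebesgue_line.

Section coordinates.
Context {R : realType}.
Local Open Scope ereal_scope.

Lemma measurable_mktuple d (T : measurableType d) n (f : 'I_n -> T -> R) :
  (forall i, measurable_fun setT (f i)) ->
  measurable_fun setT (fun x => [tuple f i x | i < n] : Rn R n).
Proof.
move=> mf; apply/measurable_fun_tnthP => i.
by apply: eq_measurable_fun (mf i) => x _ /=; rewrite tnth_mktuple.
Qed.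

Lemma ge0_integral_Rn_cons n (f : Rn R n.+1 -> \bar R) :
  measurable_fun setT f -> (forall x, 0 <= f x) ->
  \int[Rn_lebesgue n.+1]_x f x =
  \int[@lebesgue_measure R]_a \int[Rn_lebesgue n]_x f (Rn_cons (a, x)).
Proof.
move=> mf f0.
rewrite (@ge0_integral_pushforward _ _ _ _ _ _ (@measurable_Rn_cons R n)
  (@lebesgue_measure R \x Rn_lebesgue n) setT f)//.
rewrite preimage_setT (fubini_tonelli1 (f \o @Rn_cons R n))//; last first.
  by move=> x; exact: f0.
exact: measurableT_comp (@measurable_Rn_cons R n).
Qed.

Lemma measurable_Rn_consr n (a : R) :
  measurable_fun setT (fun x : Rn R n => Rn_cons (a, x)).
Proof. exact: measurableT_comp (@measurable_Rn_cons R n) _. Qed.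

Lemma measurable_Rn_consl n (x : Rn R n) :
  measurable_fun setT (fun a : measurableTypeR R => Rn_cons (a, x)).
Proof. exact: measurableT_comp (@measurable_Rn_cons R n) _. Qed.

Definition upd n (x : Rn R n) (i : 'I_n) (v : R) : Rn R n :=
  [tuple if k == i then v else tnth x k | k < n].

Lemma tnth_upd n (x : Rn R n) i v k :
  tnth (upd x i v) k = if k == i then v else tnth x k.
Proof. by rewrite tnth_mktuple. Qed.

Lemma upd_cons0 n (a v : R) (x : Rn R n) :
  upd (Rn_cons (a, x)) ord0 v = Rn_cons (v, x).
Proof.
apply: eq_from_tnth => k; rewrite tnth_upd; case: (unliftP ord0 k) => [j|] ->.
  by rewrite eq_sym (negbTE (neq_lift _ _)) !tnthS.
by rewrite eqxx tnth0.
Qed.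

Lemma upd_consS n (a v : R) (x : Rn R n) i :
  upd (Rn_cons (a, x)) (lift ord0 i) v = Rn_cons (a, upd x i v).
Proof.
apply: eq_from_tnth => k; rewrite tnth_upd; case: (unliftP ord0 k) => [j|] ->.
  by rewrite (inj_eq lift_inj) !tnthS tnth_upd.
by rewrite (negbTE (neq_lift _ _)) !tnth0.
Qed.

Lemma measurable_upd n (i : 'I_n) (t : Rn R n -> R) : measurable_fun setT t ->
  measurable_fun setT (fun x : Rn R n => upd x i (t x)).
Proof.
move=> mt; apply: measurable_mktuple => k; case: (k == i) => //.
exact: measurable_tnth.
Qed.

(** Induction on the dimension. A shear along a later coordinate is treated at fixed first
    coordinate; for the first coordinate the order of integration is exchanged, and since [t] does
    not see the sheared coordinate the inner integral is merely translated. Rotations are later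
    assembled from shears, which replaces a general change of variables. *)
Lemma ge0_integral_Rn_shear n (i : 'I_n) (t : Rn R n -> R) (f : Rn R n -> \bar R) :
  measurable_fun setT t -> (forall x v, t (upd x i v) = t x) ->
  measurable_fun setT f -> (forall x, 0 <= f x) ->
  \int[Rn_lebesgue n]_x f (upd x i (tnth x i + t x)%R) =
  \int[Rn_lebesgue n]_x f x.
Proof.
elim: n i t f => [[]//|n IH] i t f mt tE mf f0.
have mshear : measurable_fun setT (fun x : Rn R n.+1 => upd x i (tnth x i + t x)%R).
  by apply: measurable_upd; apply: measurable_funD => //; exact: measurable_tnth.
rewrite ge0_integral_Rn_cons//; last exact: measurableT_comp mf mshear.
rewrite [RHS](ge0_integral_Rn_cons mf f0).
have mcons : measurable_fun setT (fun z : measurableTypeR R * Rn R n => f (Rn_cons z)).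
  exact: measurableT_comp mf (@measurable_Rn_cons R n).
have [j ij|ij] := unliftP ord0 i; subst i.
  apply: eq_integral => a _.
  rewrite -[RHS](IH j (fun x => t (Rn_cons (a, x))) (fun x => f (Rn_cons (a, x))))//.
  - by apply: eq_integral => x _; rewrite upd_consS tnthS.
  - exact: measurableT_comp mt (measurable_Rn_consr a).
  - by move=> x v; rewrite -upd_consS tE.
  - exact: measurableT_comp mf (measurable_Rn_consr a).
rewrite -(fubini_tonelli1 (fun z => f (Rn_cons z)))//.
rewrite -(fubini_tonelli1 (fun z => f (upd (Rn_cons z) ord0 _)))//; last first.
  exact: (measurableT_comp mf (measurableT_comp mshear (@measurable_Rn_cons R n))).
have msh := measurableT_comp mf (measurableT_comp mshear (@measurable_Rn_cons R n)).
rewrite (fubini_tonelli2 _ msh); last by move=> z; exact: f0.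
rewrite (fubini_tonelli2 _ mcons); last by move=> z; exact: f0.
apply: eq_integral => x _; rewrite /fubini_G/=.
rewrite -[RHS](ge0_integral_lebesgue_shift (t (Rn_cons (0%R, x))))//; last first.
  exact: measurableT_comp mf (measurable_Rn_consl x).
apply: eq_integral => a _.
by rewrite upd_cons0 tnth0 -[in LHS](tE _ 0%R) upd_cons0.
Qed.

Definition dil n (c : R) (x : Rn R n) : Rn R n := [tuple (c * tnth x k)%R | k < n].

Lemma tnth_dil n (c : R) (x : Rn R n) k : tnth (dil c x) k = (c * tnth x k)%R.
Proof. by rewrite tnth_mktuple. Qed.

Lemma measurable_dil n (c : R) : measurable_fun setT (@dil n c).
Proof.
by apply: measurable_mktuple => i; apply: measurable_funM => //; exact: measurable_tnth.
Qed.

Lemma ge0_integral_Rn_dil n (c : R) (f : Rn R n -> \bar R) : (0 < c)%R ->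
  measurable_fun setT f -> (forall x, 0 <= f x) ->
  \int[Rn_lebesgue n]_x f (dil c x) = (c ^- n)%:E * \int[Rn_lebesgue n]_x f x.
Proof.
move=> c0; elim: n f => [|n IH] f mf f0.
  rewrite expr0 invr1 mul1e; apply: eq_integral => x _.
  by rewrite (tuple0 x) (tuple0 (dil _ _)).
have mcons a : measurable_fun setT (fun x : Rn R n => f (Rn_cons (a, x))).
  exact: measurableT_comp mf (measurable_Rn_consr a).
rewrite ge0_integral_Rn_cons//; last exact: measurableT_comp mf (@measurable_dil _ c).
rewrite [X in _ * X]ge0_integral_Rn_cons//.
under eq_integral => a _.
  under eq_integral => x _.
    have -> : dil c (Rn_cons (a, x)) = Rn_cons ((c * a)%R, dil c x).
      apply: eq_from_tnth => k; rewrite tnth_dil.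
      by case: (unliftP ord0 k) => [j|] ->; rewrite ?tnthS ?tnth_dil ?tnth0.
    over.
  rewrite (IH (fun x => f (Rn_cons ((c * a)%R, x))))//.
  over.
have mF : measurable_fun setT
    (fun a : measurableTypeR R => \int[Rn_lebesgue n]_x f (Rn_cons (a, x))).
  apply: (measurable_fun_fubini_tonelli_F (fun z => f (Rn_cons z))) => //.
  exact: measurableT_comp mf (@measurable_Rn_cons R n).
have mFc : measurable_fun setT (fun a : measurableTypeR R =>
    \int[Rn_lebesgue n]_x f (Rn_cons ((c * a)%R, x))).
  by apply: measurableT_comp (mF) _; exact: measurable_funM.
rewrite ge0_integralZl; [|exact: measurableT|exact: mFc| |]; last 2 first.
- by move=> a _; apply: integral_ge0.
- by rewrite lee_fin invr_ge0 exprn_ge0// ltW.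
rewrite (ge0_integral_lebesgue_scale
  (f := fun a => \int[Rn_lebesgue n]_x f (Rn_cons (a, x))))//.
  by rewrite muleA -EFinM exprSr invfM.
by move=> a; exact: integral_ge0.
Qed.

End coordinates.

(** * Positive semidefinite forms *)

Lemma null_sequence (R : realType) : exists r : nat -> R,
  [/\ forall n, 0 < r n, forall n i, (n <= i)%N -> r i <= r n
    & forall e : R, 0 < e -> exists n, r n <= e].
Proof.
exists (fun n => n.+1%:R^-1); split=> [n|n i ni|e e0].
- by rewrite invr_gt0.
- by rewrite lef_pV2 ?posrE// ler_nat.
- by have [n] := ltr_add_invr e0; rewrite add0r => /ltW; exists n.
Qed.

Lemma discriminant_le (R : realType) (a b c : R) : 0 <= c ->
  (forall t, 0 <= a + 2 * t * b + t ^+ 2 * c) -> b ^+ 2 <= a * c.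
Proof.
move=> c0 h; have [cz|cz] := eqVneq c 0.
  rewrite cz mulr0; have [->|b0] := eqVneq b 0; first by rewrite expr0n.
  (* For [c = 0] the polynomial is affine in [t]; at this point its value is -1. *)
  have := h (- (a + 1) / (2 * b)); rewrite cz mulr0 addr0.
  have -> : 2 * (- (a + 1) / (2 * b)) * b = - (a + 1) by field.
  lra.
have cp : 0 < c by rewrite lt_def cz.
have := h (- b / c).
have -> : a + 2 * (- b / c) * b + (- b / c) ^+ 2 * c = (a * c - b ^+ 2) / c by field.
by rewrite pmulr_lge0 ?invr_gt0// subr_ge0.
Qed.

Section semi_inner_product.
Context {R : realType} {V : lmodType R}.

(** Only semidefinite: elements of H^s are kept as functions, not as classes modulo null sets, so
    [ip u u = 0] does not force [u = 0]. Consequently limits and Riesz representers below exist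
    without being unique. *)
Record psd_form (ip : V -> V -> R) : Prop := PsdForm {
  ipC : forall u v, ip u v = ip v u;
  ipDl : forall u v w, ip (u + v) w = ip u w + ip v w;
  ipZl : forall c u v, ip (c *: u) v = c * ip u v;
  ip_ge0 : forall u, 0 <= ip u u }.

Definition sq_dist (ip : V -> V -> R) u v := ip (u - v) (u - v).

Definition complete_form (ip : V -> V -> R) := forall u : nat -> V,
  (forall e : R, 0 < e -> exists n, forall i j, (n <= i)%N -> (n <= j)%N ->
    sq_dist ip (u i) (u j) <= e) ->
  exists l, forall e : R, 0 < e -> exists n, forall i, (n <= i)%N ->
    sq_dist ip (u i) l <= e.

Variable ip : V -> V -> R.
Hypothesis ipP : psd_form ip.

Lemma ipDr u v w : ip w (u + v) = ip w u + ip w v.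
Proof. by rewrite ipC// ipDl// !(ipC ipP w). Qed.

Lemma ipZr c u v : ip v (c *: u) = c * ip v u.
Proof. by rewrite ipC// ipZl// (ipC ipP v). Qed.

Lemma ipNl u v : ip (- u) v = - ip u v.
Proof. by rewrite -scaleN1r ipZl// mulN1r. Qed.

Lemma ipNr u v : ip v (- u) = - ip v u.
Proof. by rewrite ipC// ipNl (ipC ipP v). Qed.

Lemma ipBl u v w : ip (u - v) w = ip u w - ip v w.
Proof. by rewrite ipDl// ipNl. Qed.

Lemma ipBr u v w : ip w (u - v) = ip w u - ip w v.
Proof. by rewrite ipDr ipNr. Qed.

Lemma ip0l v : ip 0 v = 0.
Proof. by rewrite -(scale0r v) ipZl// mul0r. Qed.

Lemma ip_sqD u v : ip (u + v) (u + v) = ip u u + 2 * ip u v + ip v v.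
Proof. by rewrite ipDl// !ipDr (ipC ipP v u); ring. Qed.

Lemma ip_sqB u v : ip (u - v) (u - v) = ip u u - 2 * ip u v + ip v v.
Proof. by rewrite ip_sqD ipNr ipNl ipNr; ring. Qed.

Lemma ip_sqZ c u : ip (c *: u) (c *: u) = c ^+ 2 * ip u u.
Proof. by rewrite ipZl// ipZr; ring. Qed.

Lemma ip_cauchy_schwarz u v : ip u v ^+ 2 <= ip u u * ip v v.
Proof.
apply: discriminant_le; first exact: ip_ge0.
move=> t; have := ip_ge0 ipP (u + t *: v); rewrite ip_sqD ip_sqZ ipZr.
by rewrite mulrA.
Qed.

Definition nrm u := Num.sqrt (ip u u).

Lemma nrm_ge0 u : 0 <= nrm u. Proof. exact: sqrtr_ge0. Qed.

Lemma nrm_sq u : nrm u ^+ 2 = ip u u.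
Proof. by rewrite sqr_sqrtr// ip_ge0. Qed.

Lemma ler_ip_nrm u v : `|ip u v| <= nrm u * nrm v.
Proof.
rewrite -(@ler_pXn2r _ 2)// ?nnegrE ?mulr_ge0 ?nrm_ge0//.
by rewrite exprMn !nrm_sq real_normK ?num_real// ip_cauchy_schwarz.
Qed.

Lemma ler_nrmD u v : nrm (u + v) <= nrm u + nrm v.
Proof.
rewrite -(@ler_pXn2r _ 2)// ?nnegrE ?addr_ge0 ?nrm_ge0//.
rewrite nrm_sq ip_sqD sqrrD !nrm_sq.
have := ler_ip_nrm u v; have := ler_norm (ip u v); rewrite -mulr_natl; nra.
Qed.

Lemma nrmZ c u : nrm (c *: u) = `|c| * nrm u.
Proof. by rewrite /nrm ip_sqZ sqrtrM ?sqr_ge0// sqrtr_sqr. Qed.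

Lemma nrmN u : nrm (- u) = nrm u.
Proof. by rewrite -scaleN1r nrmZ normrN1 mul1r. Qed.

Lemma nrmB u v : nrm (u - v) = nrm (v - u).
Proof. by rewrite -opprB nrmN. Qed.

Lemma nrm0 : nrm 0 = 0.
Proof. by rewrite /nrm ip0l sqrtr0. Qed.

Lemma ler_nrmB u v : `|nrm u - nrm v| <= nrm (u - v).
Proof.
have h x y : nrm x <= nrm y + nrm (x - y).
  by rewrite -{1}(subrK y x) addrC ler_nrmD.
have := h u v; have := h v u; rewrite nrmB => *; rewrite ler_norml; lra.
Qed.

Lemma ip_eq0 u v : ip u u = 0 -> ip u v = 0.
Proof.
move=> u0; have := ip_cauchy_schwarz u v; rewrite u0 mul0r => h.
by apply/eqP; rewrite -sqrf_eq0 eq_le h sqr_ge0.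
Qed.

(* The representer minimizes [ip v v - 2 L v]; minimizing sequences are Cauchy
   by the parallelogram identity. *)
Lemma riesz_representation (L : V -> R) (C : R) : complete_form ip ->
  (forall u v, L (u + v) = L u + L v) -> (forall c u, L (c *: u) = c * L u) ->
  (forall u, `|L u| <= C * nrm u) ->
  exists v, forall u, ip v u = L u.
Proof.
move=> cpl LD LZ Lb.
pose Q u := ip u u - 2 * L u.
have Qlb u : - C ^+ 2 <= Q u.
  rewrite /Q -nrm_sq; have := Lb u; have := ler_norm (L u).
  by move=> h1 h2; have := sqr_ge0 (nrm u - C); nra.
pose S := [set - Q u | u in [set: V]].
have [r [r0 invle small]] := null_sequence R.
have supS : has_sup S.
  split; first by exists (- Q 0), 0.
  by exists (C ^+ 2) => _ [u _ <-]; rewrite lerNl Qlb.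
pose q := - sup S.
have qle u : q <= Q u by rewrite /q lerNl; apply: ub_le_sup; [case: supS|exists u].
have /choice[u uq] n : exists u, Q u <= q + r n.
  have [_ [u _ <-] hu] := @sup_adherent _ S (r n) (r0 n) supS.
  by exists u; move: hu; rewrite /q; lra.
have parall x y : sq_dist ip x y = 2 * (Q x + Q y) - 4 * Q (2^-1 *: (x + y)).
  rewrite /sq_dist /Q ip_sqB ip_sqZ ip_sqD LZ LD; lra.
have cauchy i j : sq_dist ip (u i) (u j) <= 2 * (r i + r j).
  rewrite parall; have := qle (2^-1 *: (u i + u j)); have := uq i; have := uq j.
  lra.
have [v uv] : exists l, forall e : R, 0 < e -> exists n, forall i, (n <= i)%N ->
    sq_dist ip (u i) l <= e.
  apply: cpl => e e0; have [|n hn] := small (e / 4); first by rewrite divr_gt0.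
  exists n => i j ni nj; apply: le_trans (cauchy i j) _.
  by have := invle _ _ ni; have := invle _ _ nj; lra.
have Qv w : Q v <= Q w.
  apply: le_trans (qle w); apply/ler_addgt0Pr => e e0.
  (* Dominates the coefficients of [nrm (u k - v)] in [Q v - Q (u k)], by means of
     [2 * C <= C ^+ 2 + 1]. *)
  pose K := 2 * (nrm v + 1 + C ^+ 2 + 1).
  have K0 : 0 < K by rewrite /K; have := nrm_ge0 v; have := sqr_ge0 C; lra.
  pose d := Num.min 1 (e / (4 * K)).
  have d0 : 0 < d by rewrite lt_min ltr01/= divr_gt0// mulr_gt0.
  have [n1 h1] := uv (d ^+ 2) (exprn_gt0 _ d0).
  have [n2 h2] := small (e / 4) ltac:(by rewrite divr_gt0).
  pose k := maxn n1 n2.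
  have := h1 k (leq_maxl _ _); rewrite /sq_dist -nrm_sq ler_pXn2r ?nnegrE ?nrm_ge0// ?(ltW d0)// => hk.
  have := uq k; have := invle _ _ (leq_maxr n1 n2); rewrite -/k => h3 h4.
  have -> : Q v = Q (u k) + (Q v - Q (u k)) by rewrite addrC subrK.
  have : Q v - Q (u k) <= e / 2; last lra.
  have -> : Q v - Q (u k) = - (ip (u k - v) (u k - v)) - 2 * ip v (u k - v) + 2 * L (u k - v).
    have -> : L (u k - v) = L (u k) - L v by rewrite LD -scaleN1r LZ; ring.
    by rewrite /Q ip_sqB ipBr (ipC ipP v (u k)); ring.
  have := ip_ge0 ipP (u k - v); have := ler_ip_nrm v (u k - v).
  have := Lb (u k - v); have := ler_norm (L (u k - v)).
  have := ler_norm (- ip v (u k - v)); rewrite normrN.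
  have Kd : K * d <= e / 4.
    apply: (@le_trans _ _ (K * (e / (4 * K)))); first by rewrite ler_pM2l// ge_min lexx orbT.
    by rewrite le_eqVlt; apply/orP; left; apply/eqP; field; rewrite gt_eqF.
  move: Kd; rewrite /K; have := nrm_ge0 v; have := nrm_ge0 (u k - v).
  have := sqr_ge0 (C - 1); nra.
exists v => w.
have var t : 0 <= 2 * t * (ip v w - L w) + t ^+ 2 * ip w w.
  have := Qv (v + t *: w); rewrite /Q ip_sqD ip_sqZ ipZr LD LZ; lra.
apply/eqP; rewrite -subr_eq0; apply/negPn/negP => a0.
(* The natural step [- a / b] is replaced by [- a / (b + 1)], because [b = ip w w] may vanish for a
   semidefinite form. *)
have := var (- (ip v w - L w) / (ip w w + 1)).
have w0 := ip_ge0 ipP w.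
set a := ip v w - L w in a0 *; set b := ip w w in w0 *.
have -> : 2 * (- a / (b + 1)) * a + (- a / (b + 1)) ^+ 2 * b =
    - (a ^+ 2 * ((b + 2) / (b + 1) ^+ 2)) by field; lra.
rewrite oppr_ge0 leNgt => /negP; apply.
by rewrite mulr_gt0 ?exprn_even_gt0// divr_gt0 ?exprn_gt0//; lra.
Qed.

End semi_inner_product.

(** * Euclidean distance and plane rotations *)

Section euclidean_distance.
Context {R : realType} {N : nat}.
Implicit Types x y z : Rn R N.

Let dot (a b : 'I_N -> R) : R := \sum_(i < N) a i * b i.

Let dot_psd : psd_form dot.
Proof.
split=> [u v|u v w|c u v|u]; rewrite /dot.
- by apply: eq_bigr => i _; rewrite mulrC.
- by rewrite -big_split; apply: eq_bigr => i _; rewrite mulrDl.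
- by rewrite mulr_sumr; apply: eq_bigr => i _; rewrite mulrA.
- by apply: sumr_ge0 => i _; rewrite -expr2 sqr_ge0.
Qed.

Let edistE x y : edist x y = nrm dot (fun i => tnth x i - tnth y i).
Proof. by []. Qed.

Lemma edist_ge0 x y : 0 <= edist x y. Proof. exact: sqrtr_ge0. Qed.

Lemma edist_sq x y : edist x y ^+ 2 = \sum_(i < N) (tnth x i - tnth y i) ^+ 2.
Proof. by rewrite sqr_sqrtr// sumr_ge0// => i _; rewrite sqr_ge0. Qed.

Lemma edistC x y : edist x y = edist y x.
Proof. by congr Num.sqrt; apply: eq_bigr => i _; rewrite -sqrrN opprB. Qed.

Lemma edist_triangle y x z : edist x z <= edist x y + edist y z.
Proof.
rewrite !edistE; apply: le_trans (ler_nrmD dot_psd _ _).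
rewrite le_eqVlt; apply/orP; left; apply/eqP; congr nrm.
by apply/funext => i; rewrite /GRing.add/= addrA subrK.
Qed.

Lemma ler_edist_coord x y i : `|tnth x i - tnth y i| <= edist x y.
Proof.
rewrite -sqrtr_sqr ler_wsqrtr// (bigD1 i)//= lerDl sumr_ge0// => j _.
exact: sqr_ge0.
Qed.

Lemma edist_le_coord x y (r : R) : 0 <= r ->
  (forall i, `|tnth x i - tnth y i| <= r) -> edist x y <= N%:R * r.
Proof.
move=> r0 h; rewrite -(@ler_pXn2r _ 2)// ?nnegrE ?mulr_ge0 ?edist_ge0//.
rewrite edist_sq; apply: (@le_trans _ _ (\sum_(i < N) r ^+ 2)).
  apply: ler_sum => i _; rewrite -[leLHS]real_normK ?num_real//.
  by rewrite ler_pXn2r ?nnegrE.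
rewrite sumr_const card_ord exprMn -[leLHS]mulr_natl ler_wpM2r ?sqr_ge0// -natrX ler_nat.
by rewrite -mulnn; case: (N) => // n; rewrite leq_pmulr.
Qed.

Lemma edist_dil (c : R) x y : 0 <= c -> edist (dil c x) (dil c y) = c * edist x y.
Proof.
move=> c0; rewrite -[X in X * _](ger0_norm c0) -sqrtr_sqr -sqrtrM ?sqr_ge0//.
congr Num.sqrt; rewrite mulr_sumr; apply: eq_bigr => i _.
by rewrite !tnth_dil -mulrBr exprMn.
Qed.

Lemma enorm_ge0 x : 0 <= enorm x. Proof. exact: sqrtr_ge0. Qed.

Lemma ler_enormB x y : `|enorm x - enorm y| <= edist x y.
Proof.
have -> : enorm x = nrm dot (tnth x) by [].
have -> : enorm y = nrm dot (tnth y) by [].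
by rewrite edistE; exact: ler_nrmB.
Qed.

Lemma ler_enorm_coord x i : `|tnth x i| <= enorm x.
Proof.
rewrite -sqrtr_sqr ler_wsqrtr// (bigD1 i)//= lerDl sumr_ge0// => j _.
exact: sqr_ge0.
Qed.

Lemma enorm_le_coord x (r : R) : 0 <= r ->
  (forall i, `|tnth x i| <= r) -> enorm x <= N%:R * r.
Proof.
move=> r0 h; pose o : Rn R N := [tuple 0 | i < N].
have -> : enorm x = edist x o.
  by congr Num.sqrt; apply: eq_bigr => i _; rewrite tnth_mktuple subr0.
by apply: edist_le_coord => // i; rewrite tnth_mktuple subr0.
Qed.

Lemma measurable_enorm : measurable_fun setT (@enorm R N).
Proof.
rewrite /enorm; apply: measurableT_comp => //.
  exact: continuous_measurable_fun (@sqrt_continuous R).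
apply: measurable_sum => i; apply: measurable_funX; exact: measurable_tnth.
Qed.

Lemma measurable_edist :
  measurable_fun setT (fun z : Rn R N * Rn R N => edist z.1 z.2).
Proof.
rewrite /edist; apply: measurableT_comp => //.
  exact: continuous_measurable_fun (@sqrt_continuous R).
apply: measurable_sum => i; apply: measurable_funX; apply: measurable_funB.
  by apply: (measurableT_comp (@measurable_tnth _ _ _ i)).
by apply: (measurableT_comp (@measurable_tnth _ _ _ i)).
Qed.

(** Invariance of integrals is a field of its own: for rotations it comes from the factorization
    into shears and is not deduced from [isometry_edist]. *)
Record isometry (g : Rn R N -> Rn R N) : Prop := Isometry {
  isometry_measurable : measurable_fun setT g;
  isometry_integral : forall f : Rn R N -> \bar R, measurable_fun setT f ->
    (forall x, (0 <= f x)%E) ->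
    (\int[Rn_lebesgue N]_x f (g x) = \int[Rn_lebesgue N]_x f x)%E;
  isometry_edist : forall x y, edist (g x) (g y) = edist x y }.

End euclidean_distance.

Section plane_rotations.
Context {R : realType} {N : nat}.
Implicit Types x y : Rn R N.

Definition rot (i j : 'I_N) (c s : R) x : Rn R N :=
  upd (upd x i (c * tnth x i - s * tnth x j)) j (s * tnth x i + c * tnth x j).

Lemma tnth_rot i j c s x k : tnth (rot i j c s x) k =
  if k == j then s * tnth x i + c * tnth x j
  else if k == i then c * tnth x i - s * tnth x j else tnth x k.
Proof. by rewrite !tnth_upd. Qed.

Let sum_ij (i j : 'I_N) (F : 'I_N -> R) : i != j ->
  \sum_k F k = F j + F i + \sum_(k < N | (k != j) && (k != i)) F k.
Proof. by move=> ij; rewrite (bigD1 j)//= (bigD1 i)//= addrA. Qed.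

Lemma edist_rot i j c s x y : i != j -> c ^+ 2 + s ^+ 2 = 1 ->
  edist (rot i j c s x) (rot i j c s y) = edist x y.
Proof.
move=> ij cs; congr Num.sqrt; rewrite !(sum_ij _ ij) !tnth_rot eqxx (negbTE ij) eqxx.
congr (_ + _).
  set a := tnth x i; set b := tnth x j; set a' := tnth y i; set b' := tnth y j.
  transitivity ((c ^+ 2 + s ^+ 2) * ((a - a') ^+ 2 + (b - b') ^+ 2)); first by ring.
  by rewrite cs; ring.
by apply: eq_bigr => k /andP[kj ki]; rewrite !tnth_rot (negbTE kj) (negbTE ki).
Qed.

Lemma enorm_rot i j c s x : i != j -> c ^+ 2 + s ^+ 2 = 1 ->
  enorm (rot i j c s x) = enorm x.
Proof.
move=> ij cs; congr Num.sqrt; rewrite !(sum_ij _ ij) !tnth_rot eqxx (negbTE ij) eqxx.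
congr (_ + _).
  set a := tnth x i; set b := tnth x j.
  by transitivity ((c ^+ 2 + s ^+ 2) * (a ^+ 2 + b ^+ 2)); [ring|rewrite cs; ring].
by apply: eq_bigr => k /andP[kj ki]; rewrite !tnth_rot (negbTE kj) (negbTE ki).
Qed.

(** The two moved coordinates contribute exactly [((c - c')^2 + (s - s')^2) * (a^2 + b^2)]. This
    quantifies how far apart the points of an orbit are, and later allows many disjoint balls to be
    placed on one orbit. *)
Lemma edist_rot_coord i j c s c' s' x : i != j ->
  (c - c') ^+ 2 * tnth x i ^+ 2 <= edist (rot i j c s x) (rot i j c' s' x) ^+ 2.
Proof.
move=> ij; rewrite edist_sq (sum_ij _ ij) !tnth_rot eqxx (negbTE ij) eqxx.
set S := \sum_(_ < N | _) _.
have S0 : 0 <= S by apply: sumr_ge0 => k _; exact: sqr_ge0.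
set a := tnth x i; set b := tnth x j.
have -> : (s * a + c * b - (s' * a + c' * b)) ^+ 2 + (c * a - s * b - (c' * a - s' * b)) ^+ 2
  = ((c - c') ^+ 2 + (s - s') ^+ 2) * (a ^+ 2 + b ^+ 2) by ring.
have := sqr_ge0 a; have := sqr_ge0 b; have := sqr_ge0 (c - c'); have := sqr_ge0 (s - s').
nra.
Qed.

(* A rotation is a product of three shears, except for the half turn. *)
Lemma isometry_rot i j c s : i != j -> c ^+ 2 + s ^+ 2 = 1 -> -1 < c ->
  isometry (rot i j c s).
Proof.
move=> ij cs c1.
have mt k := @measurable_tnth _ (measurableTypeR R) N k.
have mrot : measurable_fun setT (rot i j c s).
  apply: measurable_mktuple => k; case: (k == j).
    by apply: measurable_funD; apply: measurable_funM => //; exact: mt.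
  rewrite (_ : (fun x => _) = fun x => if k == i then c * tnth x i - s * tnth x j
    else tnth x k); last by apply/funext => x; rewrite tnth_upd.
  case: (k == i); last exact: mt.
  by apply: measurable_funB; apply: measurable_funM => //; exact: mt.
split=> [//|f mf f0|x y]; last exact: edist_rot.
(* The tangent of the half angle, finite precisely because [c = -1] is excluded. *)
pose t := s / (1 + c).
pose S1 x : Rn R N := upd x i (tnth x i + - t * tnth x j).
pose S2 x : Rn R N := upd x j (tnth x j + s * tnth x i).
have mS1 : measurable_fun setT S1.
  apply: measurable_upd; apply: measurable_funD; first exact: mt.
  by apply: measurable_funM => //; exact: mt.
have mS2 : measurable_fun setT S2.
  apply: measurable_upd; apply: measurable_funD; first exact: mt.
  by apply: measurable_funM => //; exact: mt.
have ji : j != i by rewrite eq_sym.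
have rotE x : rot i j c s x = S1 (S2 (S1 x)).
  apply: eq_from_tnth => k; rewrite tnth_rot /S1 /S2 !tnth_upd.
  rewrite eqxx (negbTE ij) (negbTE ji) !eqxx.
  have [->|kj] := eqVneq k j.
    rewrite (negbTE ji)/t.
    (* The identity holds only modulo [c ^+ 2 + s ^+ 2 = 1]; a multiple of [c ^+ 2 + s ^+ 2 - 1] is
       inserted so that [field] meets a rational identity. *)
    transitivity (s * tnth x i + (c * (1 + c) - (c ^+ 2 + s ^+ 2 - 1)) / (1 + c) * tnth x j);
      last by field; lra.
    by rewrite cs; field; lra.
  case: (k == i); last by [].
  rewrite /t.
  transitivity ((c - (c ^+ 2 + s ^+ 2 - 1) / (1 + c)) * tnth x i +
     (- s + s * (c ^+ 2 + s ^+ 2 - 1) / (1 + c) ^+ 2) * tnth x j).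
    by rewrite cs; field; lra.
  by field; lra.
have mt1 : measurable_fun setT (fun x : Rn R N => - t * tnth x j).
  by apply: measurable_funM => //; exact: mt.
have mt2 : measurable_fun setT (fun x : Rn R N => s * tnth x i).
  by apply: measurable_funM => //; exact: mt.
have sh1 (h : Rn R N -> \bar R) : measurable_fun setT h -> (forall x, 0 <= h x)%E ->
    (\int[Rn_lebesgue N]_x h (S1 x) = \int[Rn_lebesgue N]_x h x)%E.
  move=> mh h0; apply: (ge0_integral_Rn_shear (t := fun x => - t * tnth x j)) => //.
  by move=> x v; rewrite tnth_upd (negbTE ji).
have sh2 (h : Rn R N -> \bar R) : measurable_fun setT h -> (forall x, 0 <= h x)%E ->
    (\int[Rn_lebesgue N]_x h (S2 x) = \int[Rn_lebesgue N]_x h x)%E.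
  move=> mh h0; apply: (ge0_integral_Rn_shear (t := fun x => s * tnth x i)) => //.
  by move=> x v; rewrite tnth_upd (negbTE ij).
under eq_integral do rewrite rotE.
rewrite (sh1 (fun x => f (S1 (S2 x)))) ?(sh2 (fun x => f (S1 x))) ?sh1//.
- exact: measurableT_comp mf mS1.
- by apply: measurableT_comp mf _; exact: measurableT_comp mS1 mS2.
Qed.

End plane_rotations.

(** * Square integrable functions *)

Section square_integrable.
Context d {T : measurableType d} {R : realType} (mu : {measure set T -> \bar R}).
Implicit Types u v w : T -> R.

Definition L2 u := measurable_fun setT u /\ (\int[mu]_x (u x ^+ 2)%:E < +oo)%E.

Lemma measurable_EFin_sq u : measurable_fun setT u ->
  measurable_fun setT (fun x => (u x ^+ 2)%:E).
Proof. by move=> mu_; apply/measurable_EFinP; exact: measurable_funX. Qed.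

Lemma L2_sq_integrable u : L2 u -> mu.-integrable setT (fun x => (u x ^+ 2)%:E).
Proof.
move=> [mu_ ui]; apply/integrableP; split; first exact: measurable_EFin_sq.
by under eq_integral do rewrite gee0_abs ?lee_fin ?sqr_ge0//.
Qed.

Lemma integrable_le (g h : T -> R) : measurable_fun setT g ->
  (forall x, `|g x| <= h x) -> mu.-integrable setT (EFin \o h) ->
  mu.-integrable setT (EFin \o g).
Proof.
move=> mg gh; apply: le_integrable => //; first exact/measurable_EFinP.
by move=> x _ /=; rewrite lee_fin (le_trans (gh x))// ler_norm.
Qed.

Lemma L2_mul_integrable u v : L2 u -> L2 v ->
  mu.-integrable setT (fun x => (u x * v x)%:E).
Proof.
move=> Lu Lv; apply: (@integrable_le _ (fun x => u x ^+ 2 + v x ^+ 2)).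
- by apply: measurable_funM; [case: Lu|case: Lv].
- move=> x; rewrite normrM -(real_normK (num_real (u x))) -(real_normK (num_real (v x))).
  by have := sqr_ge0 (`|u x| - `|v x|); have := normr_ge0 (u x); have := normr_ge0 (v x); nra.
- rewrite (_ : _ \o _ = (fun x => (u x ^+ 2)%:E) \+ (fun x => (v x ^+ 2)%:E))%E//.
  by apply: integrableD => //; exact: L2_sq_integrable.
Qed.

Lemma L2_le u (h : T -> R) : measurable_fun setT u ->
  (forall x, u x ^+ 2 <= h x) -> mu.-integrable setT (EFin \o h) -> L2 u.
Proof.
move=> mu_ uh hi; split=> //.
have : mu.-integrable setT (EFin \o (fun x => u x ^+ 2)).
  apply: integrable_le hi; first exact: measurable_funX.
  by move=> x; rewrite ger0_norm ?sqr_ge0.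
move=> /integrableP[_]; apply: le_lt_trans.
rewrite le_eqVlt; apply/orP; left; apply/eqP; apply: eq_integral => x _ /=.
by rewrite ger0_norm ?sqr_ge0.
Qed.

Lemma L2_0 : L2 0.
Proof.
split; first exact: measurable_cst.
by under eq_integral do rewrite /= expr0n/=; rewrite integral0.
Qed.

Lemma L2Z c u : L2 u -> L2 (c *: u).
Proof.
move=> Lu; apply: (@L2_le _ (fun x => c ^+ 2 * u x ^+ 2)).
- by apply: measurable_funM => //; case: Lu.
- by move=> x; rewrite -exprMn.
- have := integrableZl measurableT (c ^+ 2) (L2_sq_integrable Lu).
  by apply: eq_integrable => // x _ /=; rewrite EFinM.
Qed.

Lemma L2D u v : L2 u -> L2 v -> L2 (u + v).
Proof.
move=> Lu Lv; apply: (@L2_le _ (fun x => (2 * u x ^+ 2) + 2 * v x ^+ 2)).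
- by apply: measurable_funD; [case: Lu|case: Lv].
- move=> x; have := sqr_ge0 (u x - v x); have -> : (u + v) x = u x + v x by []; nra.
- rewrite (_ : _ \o _ = (fun x => 2%:E * (u x ^+ 2)%:E) \+
      (fun x => 2%:E * (v x ^+ 2)%:E))%E//.
  by apply: integrableD => //; apply: integrableZl => //; exact: L2_sq_integrable.
Qed.

Lemma L2N u : L2 u -> L2 (- u).
Proof. by rewrite -scaleN1r; exact: L2Z. Qed.

Lemma L2B u v : L2 u -> L2 v -> L2 (u - v).
Proof. by move=> Lu Lv; apply: L2D => //; exact: L2N. Qed.

Definition l2 u v : R := \int[mu]_x (u x * v x).

Lemma l2C u v : l2 u v = l2 v u.
Proof. by apply: eq_Rintegral => x _; rewrite mulrC. Qed.

Lemma l2Dl u v w : L2 u -> L2 v -> L2 w -> l2 (u + v) w = l2 u w + l2 v w.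
Proof.
move=> Lu Lv Lw; rewrite /l2 -RintegralD//; last 2 first.
- exact: L2_mul_integrable.
- exact: L2_mul_integrable.
by apply: eq_Rintegral => x _; rewrite -mulrDl.
Qed.

Lemma l2Zl c u w : L2 u -> L2 w -> l2 (c *: u) w = c * l2 u w.
Proof.
move=> Lu Lw; rewrite /l2 -RintegralZl//; last exact: L2_mul_integrable.
by apply: eq_Rintegral => x _; rewrite mulrA.
Qed.

Lemma l2_ge0 u : 0 <= l2 u u.
Proof. by apply: Rintegral_ge0 => x _; rewrite -expr2 sqr_ge0. Qed.

Lemma l2_sqE u : L2 u -> ((l2 u u)%:E = \int[mu]_x (u x ^+ 2)%:E)%E.
Proof.
move=> [mu_ ui]; rewrite /l2 /Rintegral fineK//.
by rewrite ge0_fin_numE ?integral_ge0// => x _; rewrite lee_fin -expr2 sqr_ge0.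
Qed.

Lemma l2_cauchy_schwarz u v : L2 u -> L2 v -> l2 u v ^+ 2 <= l2 u u * l2 v v.
Proof.
move=> Lu Lv; apply: discriminant_le => [|t]; first exact: l2_ge0.
have Ltv : L2 (t *: v) by exact: L2Z.
have := l2_ge0 (u + t *: v).
rewrite l2Dl//; last exact: L2D.
rewrite (l2C u) (l2C (t *: v)) !l2Dl// (l2C _ u) !l2Zl// (l2C u) !l2Zl// (l2C v (t *: v)) l2Zl//.
by rewrite (l2C v u); lra.
Qed.

(** Fatou's lemma for the tail starting at [n0]. It carries Cauchy estimates over to an almost
    everywhere limit, first on R^N and then on pairs of points. *)
Lemma fatou_sq (u : nat -> T -> R) v (e : \bar R) n0 :
  (forall k, measurable_fun setT (u k)) -> measurable_fun setT v ->
  {ae mu, forall x, u k x @[k --> \oo] --> v x} ->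
  (forall k, (n0 <= k)%N -> \int[mu]_x (u k x ^+ 2)%:E <= e)%E ->
  (\int[mu]_x (v x ^+ 2)%:E <= e)%E.
Proof.
move=> mu_ mv uv ue.
pose w k x := (u (k + n0)%N x ^+ 2)%:E.
have mw k : measurable_fun setT (w k) by exact: measurable_EFin_sq.
have w0 k x : (0 <= w k x)%E by rewrite lee_fin sqr_ge0.
have := fatou mu measurableT mw (fun n x _ => w0 n x).
rewrite (_ : \int[mu]_(x in setT) limn_einf (w^~ x) = \int[mu]_x (v x ^+ 2)%:E)%E.
  move=> /le_trans; apply; rewrite limn_einf_lim; apply: lime_le => //.
    exact: is_cvg_einfs.
  near=> k; apply: (@le_trans _ _ (\int[mu]_x w k x)%E); last by apply: ue; rewrite leq_addl.
  by apply: ereal_inf_lbound; exists k => /=.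
apply: ge0_ae_eq_integral => //.
- rewrite (_ : (fun x => _) = \- (fun x => limn_esup (fun k => (- w k x)%E)))%E.
    by apply: measurableT_comp => //; apply: measurable_fun_limn_esup => k; exact: measurableT_comp.
  by apply/funext => x; rewrite -[LHS]oppeK -limn_esupN.
- exact: measurable_EFin_sq.
- move=> x _; rewrite limn_einf_lim; apply: lime_ge => //; first exact: is_cvg_einfs.
  by apply: nearW => n; apply: le_ereal_inf_tmp => _ [k _ <-].
- by move=> x _; rewrite lee_fin sqr_ge0.
- apply: filterS uv => x uvx _.
  have : w k x @[k --> \oo] --> (v x ^+ 2)%:E.
    apply/cvg_EFin; first by apply: nearW.
    rewrite /comp/= (cvg_shiftn n0 (fun k => u k x ^+ 2)).
    exact: (cvg_comp _ _ uvx (@exprn_continuous _ 2 _)).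
  by move=> /cvg_limn_einf_sup[].
Unshelve. all: by end_near. Qed.

(** Choose indices whose consecutive squared distances are at most [8^-k]. Weighted by [4^k], the
    squared increments still have a finite total integral, hence a finite sum almost everywhere;
    there the increments are bounded by a multiple of [2^-k]. *)
Lemma ae_cvg_subsequence (u : nat -> T -> R) : (forall n, measurable_fun setT (u n)) ->
  (forall e : R, 0 < e -> exists n, forall i j, (n <= i)%N -> (n <= j)%N ->
    (\int[mu]_x ((u i x - u j x) ^+ 2)%:E <= e%:E)%E) ->
  exists (phi : nat -> nat) (l : T -> R), [/\ forall k, (k <= phi k)%N, measurable_fun setT l
    & {ae mu, forall x, u (phi k) x @[k --> \oo] --> l x}].
Proof.
move=> mu_ cu.
have /choice[n0 n0P] k : exists n, forall i j, (n <= i)%N -> (n <= j)%N ->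
    (\int[mu]_x ((u i x - u j x) ^+ 2)%:E <= ((8^-1) ^+ k)%:E)%E.
  by apply: cu; rewrite exprn_gt0.
pose phi k := (\max_(i < k.+1) n0 i + k)%N.
have n0phi k : (n0 k <= phi k)%N.
  by apply: leq_trans (leq_addr _ _); apply: (leq_bigmax (F := fun i : 'I_k.+1 => n0 i) ord_max).
have phiS k : (phi k <= phi k.+1)%N.
  by apply: leq_add => //; rewrite [leqRHS]big_ord_recr/= leq_max leqnn.
pose D k x := u (phi k.+1) x - u (phi k) x.
have mD k : measurable_fun setT (D k) by exact: measurable_funB.
pose w k x := (4 ^+ k * D k x ^+ 2)%:E.
have w0 k x : (0 <= w k x)%E by rewrite lee_fin mulr_ge0 ?sqr_ge0.
have mw k : measurable_fun setT (w k).
  by apply/measurable_EFinP; apply: measurable_funM => //; exact: measurable_funX.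
pose W x := (\sum_(0 <= k <oo) w k x)%E.
have W0 x : (0 <= W x)%E by apply: nneseries_ge0.
have mW : measurable_fun setT W by apply: ge0_emeasurable_sum.
have iW : (\int[mu]_x W x <= 2%:E)%E.
  rewrite integral_nneseries//; apply: lime_le.
    by apply: is_cvg_nneseries => n _ _; exact: integral_ge0.
  apply: nearW => n; apply: (@le_trans _ _ (\sum_(0 <= k < n) ((2^-1) ^+ k)%:E)%E).
    apply: lee_sum => k _; rewrite /w.
    under eq_integral do rewrite EFinM.
    rewrite (ge0_integralZl mu measurableT (measurable_EFin_sq (mD k))) ?lee_fin//; last first.
      by move=> x _; rewrite lee_fin sqr_ge0.
    have -> : ((2^-1 : R) ^+ k)%:E = ((4 ^+ k)%:E * ((8^-1) ^+ k)%:E)%E.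
      by rewrite -EFinM -exprMn; congr ((_ ^+ k)%:E); field.
    rewrite lee_wpmul2l//; apply: n0P; rewrite ?n0phi//.
    exact: leq_trans (n0phi k) (phiS k).
  rewrite sumEFin lee_fin.
  suff -> : \sum_(0 <= i < n) (2^-1 : R) ^+ i = 2 - 2 * 2^-1 ^+ n.
    by rewrite gerBl mulr_ge0// exprn_ge0.
  elim: n => [|n IH]; first by rewrite big_geq// expr0; ring.
  by rewrite big_nat_recr//= IH exprS; field.
have {iW}WI : mu.-integrable setT W.
  apply/integrableP; split=> //; under eq_integral do rewrite gee0_abs//.
  exact: le_lt_trans iW (ltry _).
(* The upper limit is measurable and defined everywhere, also at the exceptional points where the
   subsequence diverges. *)
exists phi, (fun x => fine (limn_esup (fun k => (u (phi k) x)%:E))); split.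
- by move=> k; exact: leq_addl.
- apply: (measurableT_comp (@fine_measurable R setT measurableT)).
  by apply: measurable_fun_limn_esup => k; apply/measurable_EFinP.
apply: filterS (integrable_ae measurableT WI) => x /(_ I) Wfin.
have [C CE] : exists C, W x = C%:E by exists (fine (W x)); rewrite fineK.
have DC k : 4 ^+ k * D k x ^+ 2 <= C.
  rewrite -lee_fin -CE; apply: le_trans (nneseries_lim_ge k.+1 _) => //.
  rewrite big_nat_recr//=.
  by apply: leeDr; apply: sume_ge0.
have C0 : 0 <= C by rewrite -lee_fin -CE.
have DM k : `|D k x| <= geometric (Num.sqrt C) 2^-1 k.
  rewrite /geometric/= -(@ler_pXn2r _ 2)// ?nnegrE ?mulr_ge0 ?sqrtr_ge0 ?exprn_ge0//.
  rewrite real_normK ?num_real// exprMn sqr_sqrtr// -exprM mulnC exprM.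
  have -> : (2^-1 : R) ^+ 2 = 4^-1 by field.
  by rewrite exprVn ler_pdivlMr ?exprn_gt0// mulrC.
have cvD : cvgn (series (fun k => D k x)).
  apply: normed_cvg; apply: (series_le_cvg _ _ DM) => [n|n|] //.
    exact: le_trans (normr_ge0 _) (DM n).
  by apply: is_cvg_geometric_series; rewrite ger0_norm// invf_lt1// ltr1n.
have cvu : cvgn (fun k => u (phi k) x).
  rewrite (_ : (fun k => u (phi k) x) =
      (fun k => u (phi 0%N) x + series (fun k => D k x) k)).
    exact: is_cvgD (is_cvg_cst _) cvD.
  by apply/funext => k; rewrite [LHS](eq_sum_telescope (fun k => u (phi k) x)).
have /cvg_limn_einf_sup[_ ->] : (u (phi k) x)%:E @[k --> \oo] -->
    (limn (fun k => u (phi k) x))%:E by apply/cvg_EFin => //; exact: nearW.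
exact: cvu.
Qed.

End square_integrable.

Section null_sets_of_products.
Context d1 d2 {T1 : measurableType d1} {T2 : measurableType d2} {R : realType}.
Variables (m1 : {sigma_finite_measure set T1 -> \bar R}).
Variables (m2 : {sigma_finite_measure set T2 -> \bar R}).

Lemma ae_fst (P : set T1) : {ae m1, forall x, P x} -> {ae (m1 \x m2)%E, forall z, P z.1}.
Proof.
move=> [A [mA A0 PA]]; exists (A `*` setT); split.
- exact: measurableX.
- by rewrite product_measure1E// [X in (X * _)%E]A0 mul0e.
- by move=> z Pz; split => //; exact: PA.
Qed.

Lemma ae_snd (P : set T2) : {ae m2, forall x, P x} -> {ae (m1 \x m2)%E, forall z, P z.2}.
Proof.
move=> [A [mA A0 PA]]; exists (setT `*` A); split.
- exact: measurableX.
- by rewrite product_measure1E// [X in (_ * X)%E]A0 mule0.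
- by move=> z Pz; split => //; exact: PA.
Qed.

End null_sets_of_products.

(** * The space H^s *)

Section Hs_space.
Context {R : realType} {N : nat}.
Variable s : R.
Notation leb := (@Rn_lebesgue R N).
Notation leb2 := (leb \x leb)%E.
Implicit Types u v : Rn R N -> R.

Lemma gag_kernel_ge0 x y : 0 <= @gag_kernel R N s x y.
Proof. by rewrite invr_ge0 powR_ge0. Qed.

Lemma measurable_gag_kernel :
  measurable_fun setT (fun z : Rn R N * Rn R N => gag_kernel s z.1 z.2).
Proof.
rewrite /gag_kernel; under eq_fun do rewrite -powRN.
by apply: (measurableT_comp (measurable_powR _)); exact: measurable_edist.
Qed.

(** The square root of the kernel is put into the function, so that the Gagliardo form becomes the
    [L2] product of [diffq u] and [diffq v] over pairs of points. Bilinearity, Cauchy-Schwarz and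
    completeness are then inherited from [L2]. *)
Definition diffq u (z : Rn R N * Rn R N) : R :=
  (u z.1 - u z.2) * Num.sqrt (gag_kernel s z.1 z.2).

Lemma diffq_sq u z : diffq u z ^+ 2 = `|u z.1 - u z.2| ^+ 2 * gag_kernel s z.1 z.2.
Proof. by rewrite exprMn sqr_sqrtr ?gag_kernel_ge0// real_normK ?num_real. Qed.

Lemma diffqD u v : diffq (u + v) = diffq u + diffq v.
Proof.
apply/funext => z; rewrite /diffq.
have -> : (diffq u + diffq v) z = diffq u z + diffq v z by [].
by rewrite /diffq -mulrDl; congr (_ * _); rewrite opprD addrACA.
Qed.

Lemma diffqZ c u : diffq (c *: u) = c *: diffq u.
Proof.
apply/funext => z; rewrite /diffq.
have -> : (c *: diffq u) z = c * diffq u z by [].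
by rewrite /diffq mulrA mulrBr.
Qed.

Lemma diffqB u v : diffq (u - v) = diffq u - diffq v.
Proof. by rewrite -[- v]scaleN1r diffqD diffqZ scaleN1r. Qed.

Lemma measurable_diffq u : measurable_fun setT u -> measurable_fun setT (diffq u).
Proof.
move=> mu_; apply: measurable_funM.
  apply: measurable_funB.
    exact: measurableT_comp mu_ _.
  exact: measurableT_comp mu_ _.
apply: measurableT_comp measurable_gag_kernel.
exact: continuous_measurable_fun (@sqrt_continuous R).
Qed.

Definition in_Hs u := L2 leb u /\ L2 leb2 (diffq u).

Lemma gagliardo_sqE u : (gagliardo_sq s u = \int[leb2]_z (diffq u z ^+ 2)%:E)%E.
Proof. by apply: eq_integral => z _; rewrite diffq_sq. Qed.

Lemma Lfun2P d (T : measurableType d) (mu : {measure set T -> \bar R}) (w : T -> R) :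
  w \in Lfun mu 2%:E <-> L2 mu w.
Proof.
split=> [wL|[mw wi]].
  split; first by have /andP[] := wL; rewrite inE.
  have := Lfun2_integrable_sqr wL => /integrableP[_]; apply: le_lt_trans.
  rewrite le_eqVlt; apply/orP; left; apply/eqP; apply: eq_integral => x _ /=.
  by rewrite ger0_norm ?sqr_ge0.
rewrite inE/=; apply/andP; split; first by rewrite inE.
rewrite inE /= /finite_norm unlock /Lnorm/=.
apply: poweR_lty; rewrite (eq_integral (fun x => (w x ^+ 2)%:E))// => x _ /=.
by rewrite powR_mulrn// real_normK ?num_real.
Qed.

Lemma HsE u : Hs s u <-> in_Hs u.
Proof.
rewrite /Hs/=; split=> [[/Lfun2P Lu gu]|[Lu [mg gu]]].
  split=> //; split; first by apply: measurable_diffq; case: Lu.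
  by rewrite -gagliardo_sqE.
by split; [apply/Lfun2P|rewrite gagliardo_sqE].
Qed.

Definition Hs_pred : {pred (Rn R N -> R)} := mem [set u | in_Hs u].

Lemma Hs_predP u : u \in Hs_pred <-> in_Hs u.
Proof. by rewrite inE. Qed.

Lemma Hs_submod_closed : submod_closed Hs_pred.
Proof.
split.
  apply/Hs_predP; split; first exact: L2_0.
  rewrite -[0](scale0r (0 : Rn R N -> R)) diffqZ scale0r; exact: L2_0.
move=> c u v /Hs_predP[Lu gu] /Hs_predP[Lv gv]; apply/Hs_predP; split.
  by apply: L2D => //; exact: L2Z.
by rewrite diffqD diffqZ; apply: L2D => //; exact: L2Z.
Qed.

HB.instance Definition _ := GRing.isSubmodClosed.Build _ _ Hs_pred Hs_submod_closed.

Record hs := HsElt { hs_fun : Rn R N -> R; hs_funP : hs_fun \in Hs_pred }.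
HB.instance Definition _ := [isSub for hs_fun].
HB.instance Definition _ := [Choice of hs by <:].
HB.instance Definition _ := [SubChoice_isSubLmodule of hs by <:].

Coercion hs_fun : hs >-> Funclass.

Lemma hsP (u : hs) : in_Hs u.
Proof. exact/Hs_predP/hs_funP. Qed.

Lemma hs_L2 (u : hs) : L2 leb u. Proof. by case: (hsP u). Qed.

Lemma hs_measurable (u : hs) : measurable_fun setT u. Proof. by case: (hs_L2 u). Qed.

Lemma hs_diffq (u : hs) : L2 leb2 (diffq u). Proof. by case: (hsP u). Qed.

Lemma hs_funD (u v : hs) : hs_fun (u + v) = hs_fun u + hs_fun v.
Proof. by []. Qed.

Lemma hs_funZ c (u : hs) : hs_fun (c *: u) = c *: hs_fun u.
Proof. by []. Qed.

Lemma hs_funB (u v : hs) : hs_fun (u - v) = hs_fun u - hs_fun v.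
Proof. by []. Qed.

Definition aform (u v : hs) : R := fraclap s u v.
Definition bform (u v : hs) : R := l2 leb u v.

Lemma aformE (u v : hs) : aform u v = l2 leb2 (diffq u) (diffq v).
Proof.
apply: eq_Rintegral => z _; rewrite /diffq.
transitivity ((u z.1 - u z.2) * (v z.1 - v z.2) *
    Num.sqrt (gag_kernel s z.1 z.2) ^+ 2); last by ring.
by rewrite sqr_sqrtr ?gag_kernel_ge0.
Qed.

Lemma aform_psd : psd_form aform.
Proof.
split=> [u v|u v w|c u v|u]; rewrite !aformE.
- exact: l2C.
- by rewrite hs_funD diffqD l2Dl//; exact: hs_diffq.
- by rewrite hs_funZ diffqZ l2Zl//; exact: hs_diffq.
- exact: l2_ge0.
Qed.

Lemma bform_psd : psd_form bform.
Proof.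
split=> [u v|u v w|c u v|u]; rewrite /bform.
- exact: l2C.
- by rewrite hs_funD l2Dl//; exact: hs_L2.
- by rewrite hs_funZ l2Zl//; exact: hs_L2.
- exact: l2_ge0.
Qed.

Lemma aform_sqE (u : hs) : ((aform u u)%:E = \int[leb2]_z (diffq u z ^+ 2)%:E)%E.
Proof. by rewrite aformE l2_sqE//; exact: hs_diffq. Qed.

Lemma bform_sqE (u : hs) : ((bform u u)%:E = \int[leb]_x (u x ^+ 2)%:E)%E.
Proof. by rewrite /bform l2_sqE//; exact: hs_L2. Qed.

Lemma aform_gagliardo (u : hs) : (gagliardo_sq s u = (aform u u)%:E)%E.
Proof. by rewrite gagliardo_sqE aform_sqE. Qed.

Definition tform (t : R) (u v : hs) : R := t * aform u v + bform u v.

Lemma tform_psd t : 0 <= t -> psd_form (tform t).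
Proof.
move=> t0; split=> [u v|u v w|c u v|u]; rewrite /tform.
- by rewrite (ipC aform_psd) (ipC bform_psd).
- by rewrite (ipDl aform_psd) (ipDl bform_psd); ring.
- by rewrite (ipZl aform_psd) (ipZl bform_psd); ring.
- by rewrite addr_ge0 ?mulr_ge0 ?(ip_ge0 aform_psd) ?(ip_ge0 bform_psd).
Qed.

(** A Cauchy sequence is Cauchy for both forms since [t > 0]. A subsequence converges almost
    everywhere to some [l], hence [diffq] converges almost everywhere on pairs, and Fatou bounds
    both squares of [u i - l]. Membership of [l] follows by writing it as [u n0 - (u n0 - l)]. *)
Lemma tform_complete t : 0 < t -> complete_form (tform t).
Proof.
move=> t0 u cu; have tP := tform_psd (ltW t0).
have cua e : 0 < e -> exists n, forall i j, (n <= i)%N -> (n <= j)%N ->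
    aform (u i - u j) (u i - u j) <= e /\ bform (u i - u j) (u i - u j) <= e.
  move=> e0; have [|n hn] := cu (Num.min (t * e) e).
    by rewrite lt_min e0 mulr_gt0.
  exists n => i j ni nj; have := hn i j ni nj; rewrite /sq_dist /tform le_min => /andP[].
  have := ip_ge0 aform_psd (u i - u j); have := ip_ge0 bform_psd (u i - u j).
  move=> b0 a0 h1 h2; split; last by have := mulr_ge0 (ltW t0) a0; lra.
  by rewrite -(ler_pM2l t0); lra.
have [|phi [l [phiP ml ul]]] := @ae_cvg_subsequence _ _ R leb u (fun n => hs_measurable (u n)).
  move=> e /cua[n hn]; exists n => i j ni nj; have [_] := hn i j ni nj.
  by rewrite -lee_fin bform_sqE hs_funB.
have lim i e n : 0 < e -> (forall k, (n <= k)%N -> aform (u i - u k) (u i - u k) <= e /\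
      bform (u i - u k) (u i - u k) <= e) ->
    (\int[leb]_x ((hs_fun (u i) - l) x ^+ 2)%:E <= e%:E)%E /\
    (\int[leb2]_z (diffq (hs_fun (u i) - l) z ^+ 2)%:E <= e%:E)%E.
  move=> e0 hn; split.
    apply: (@fatou_sq _ _ _ _ (fun k => hs_fun (u i - u (phi k))) _ _ n).
    - by move=> k; exact: hs_measurable.
    - by apply: measurable_funB => //; exact: hs_measurable.
    - apply: filterS ul => x ux; under eq_fun do rewrite hs_funB.
      by apply: cvgB => //; exact: cvg_cst.
    - move=> k nk; rewrite -bform_sqE lee_fin.
      by have [] := hn (phi k) (leq_trans nk (phiP k)).
  apply: (@fatou_sq _ _ _ _ (fun k => diffq (u i - u (phi k))) _ _ n).
  - by move=> k; apply: measurable_diffq; exact: hs_measurable.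
  - by apply: measurable_diffq; apply: measurable_funB => //; exact: hs_measurable.
  - apply: filterS2 (ae_fst leb ul) (ae_snd leb ul) => z u1 u2.
    under eq_fun do rewrite hs_funB /diffq.
    apply: cvgMl; apply: cvgB; apply: cvgB => //; exact: cvg_cst.
  - move=> k nk; rewrite -aform_sqE lee_fin.
    by have [] := hn (phi k) (leq_trans nk (phiP k)).
have [n0 hn0] := cua 1 ltr01.
have [lb la] := lim n0 1 n0 ltr01 (fun k => hn0 n0 k (leqnn _)).
have lH : l \in Hs_pred.
  have : hs_fun (u n0) - l \in Hs_pred.
    apply/Hs_predP; split; split.
    - by apply: measurable_funB => //; exact: hs_measurable.
    - exact: le_lt_trans lb (ltry _).
    - by apply: measurable_diffq; apply: measurable_funB => //; exact: hs_measurable.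
    - exact: le_lt_trans la (ltry _).
  by move=> h; rewrite -[l](subKr (hs_fun (u n0))) rpredB// hs_funP.
exists (HsElt lH) => e e0.
have e1 : 0 < e / (t + 1) by rewrite divr_gt0// ltr_wpDr// ltW.
have [n hn] := cua _ e1; exists n => i ni.
have [] := lim i _ n e1 (fun k => hn i k ni).
rewrite /sq_dist /tform.
have -> : hs_fun (u i) - l = hs_fun (u i - HsElt lH) by rewrite hs_funB.
rewrite -aform_sqE -bform_sqE !lee_fin => h1 h2.
apply: (@le_trans _ _ (t * (e / (t + 1)) + e / (t + 1))).
  by rewrite lerD// ler_pM2l.
have t1 : t + 1 != 0 by rewrite gt_eqF// ltr_wpDr// ltW.
by rewrite le_eqVlt; apply/orP; left; apply/eqP; field.
Qed.

End Hs_space.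

(** * Changes of variables and their action on H^s *)

Section change_of_variables.
Context {R : realType} {N : nat}.
Notation leb := (@Rn_lebesgue R N).
Notation leb2 := (leb \x leb)%E.

(** [c] is the inverse Jacobian determinant: 1 for the rotations, [t ^- N] for the dilation by
    [t]. *)
Record scales (g : Rn R N -> Rn R N) (c : R) : Prop := Scales {
  scales_measurable : measurable_fun setT g;
  scales_ge0 : 0 <= c;
  scales_integral : forall f : Rn R N -> \bar R, measurable_fun setT f ->
    (forall x, (0 <= f x)%E) -> (\int[leb]_x f (g x) = c%:E * \int[leb]_x f x)%E }.

Lemma isometry_scales g : isometry g -> scales g 1.
Proof. by case=> mg ig _; split=> // f mf f0; rewrite ig// mul1e. Qed.

Lemma dil_scales t : 0 < t -> scales (dil t) (t ^- N).
Proof.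
move=> t0; split; first exact: measurable_dil.
  by rewrite invr_ge0 exprn_ge0// ltW.
by move=> f mf f0; rewrite ge0_integral_Rn_dil.
Qed.

Lemma scales2 g c (f : Rn R N * Rn R N -> \bar R) : scales g c ->
  measurable_fun setT f -> (forall z, (0 <= f z)%E) ->
  (\int[leb2]_z f (g z.1, g z.2) = (c * c)%:E * \int[leb2]_z f z)%E.
Proof.
move=> [mg c0 ig] mf f0.
have mg2 : measurable_fun setT (fun z : Rn R N * Rn R N => (g z.1, g z.2)).
  by apply: measurable_fun_pair; exact: measurableT_comp mg _.
have mgg := measurableT_comp mf mg2.
rewrite (fubini_tonelli1 _ mgg); last by move=> z; exact: f0.
rewrite (fubini_tonelli1 _ mf f0).
have mF := measurable_fun_fubini_tonelli_F f mf f0.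
transitivity (\int[leb]_x (c%:E * \int[leb]_y f (g x, y)))%E.
  apply: eq_integral => x _; rewrite /fubini_F /= (ig (fun y => f (g x, y)))//.
  exact: measurableT_comp mf (measurable_pair1 _).
rewrite (ge0_integralZl leb measurableT); last 3 first.
- exact: (measurableT_comp (mF leb) mg).
- by move=> x _; exact: integral_ge0.
- by rewrite lee_fin.
rewrite (ig (fun x => \int[leb]_y f (x, y))%E (mF leb)); last by move=> x; exact: integral_ge0.
by rewrite muleA -EFinM.
Qed.

Lemma scales_integrable g c (f : Rn R N -> R) : scales g c ->
  leb.-integrable setT (EFin \o f) -> leb.-integrable setT (EFin \o (f \o g)).
Proof.
move=> [mg c0 ig] /integrableP[mf fi]; apply/integrableP.
split; first exact: (measurableT_comp mf mg).
rewrite (ig (fun x => `|(f x)%:E|%E)); [|exact: measurableT_comp|by move=> x; exact: abse_ge0].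
by apply: lte_mul_pinfty.
Qed.

Lemma scales_Rintegral g c (f : Rn R N -> R) : scales g c ->
  leb.-integrable setT (EFin \o f) -> \int[leb]_x f (g x) = c * \int[leb]_x f x.
Proof.
move=> [mg c0 ig] fi; have mf : measurable_fun setT (EFin \o f) by case/integrableP: fi.
rewrite /Rintegral -[c in RHS]/(fine c%:E) -fineM//; last exact: integrable_fin_num.
congr fine; rewrite integralE [in RHS]integralE.
have hp := ig _ (measurable_funepos mf) (funepos_ge0 _).
have hn := ig _ (measurable_funeneg mf) (funeneg_ge0 _).
have neg : (\int[leb]_x (EFin \o f)^\- x)%E \is a fin_num by exact: integrable_neg_fin_num.
rewrite [RHS]muleBr//; last by rewrite fin_num_adde_defl// fin_numN.
by congr (_ - _)%E; [apply: etrans hp|apply: etrans hn]; apply: eq_integral => x _; rewrite ?funeposE ?funenegE.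
Qed.

End change_of_variables.

Section hs_transport.
Context {R : realType} {N : nat} {s : R}.
Notation leb := (@Rn_lebesgue R N).
Notation leb2 := (leb \x leb)%E.
Local Notation hs := (@hs R N s).

(** Effects of rotations and dilations on the two forms need to be checked on squares only. *)
Lemma polarization (V W : lmodType R) (ipV : V -> V -> R) (ipW : W -> W -> R)
  (T : V -> W) c : psd_form ipV -> psd_form ipW ->
  (forall u v, T (u + v) = T u + T v) ->
  (forall u, ipW (T u) (T u) = c * ipV u u) ->
  forall u v, ipW (T u) (T v) = c * ipV u v.
Proof.
move=> pV pW TD Tc u v; have := Tc (u + v).
by rewrite TD (ip_sqD pW) (ip_sqD pV) !Tc; lra.
Qed.

Lemma isometry_in_Hs g (gP : isometry g) (u : hs) : (hs_fun u \o g) \in @Hs_pred R N s.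
Proof.
have gs := isometry_scales gP; have [mg _ dg] := gP.
apply/Hs_predP; split; split.
- exact: measurableT_comp (hs_measurable u) mg.
- rewrite (scales_integral gs (f := fun x => (u x ^+ 2)%:E)) ?mul1e.
  + by case: (hs_L2 u).
  + by apply: measurable_EFin_sq; exact: hs_measurable.
  + by move=> x; rewrite lee_fin sqr_ge0.
- by apply: measurable_diffq; exact: measurableT_comp (hs_measurable u) mg.
- rewrite (eq_integral (fun z => ((diffq s u (g z.1, g z.2)) ^+ 2)%:E)); last first.
    by move=> z _; rewrite /diffq /gag_kernel /= dg.
  rewrite (scales2 gs (measurable_EFin_sq (measurable_diffq s (hs_measurable u)))).
    by rewrite mul1r mul1e; case: (hs_diffq u).
  by move=> x; rewrite lee_fin sqr_ge0.
Qed.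

Definition hs_comp g (gP : isometry g) (u : hs) : hs := HsElt (isometry_in_Hs gP u).

Lemma hs_compD g (gP : isometry g) u v : hs_comp gP (u + v) = hs_comp gP u + hs_comp gP v.
Proof. exact: val_inj. Qed.

Lemma hs_compZ g (gP : isometry g) c u : hs_comp gP (c *: u) = c *: hs_comp gP u.
Proof. exact: val_inj. Qed.

Lemma hs_compB g (gP : isometry g) u v : hs_comp gP (u - v) = hs_comp gP u - hs_comp gP v.
Proof. exact: val_inj. Qed.

Lemma bform_comp g (gP : isometry g) (u v : hs) :
  bform (hs_comp gP u) (hs_comp gP v) = bform u v.
Proof.
rewrite (polarization (c := 1) (@bform_psd R N s) (@bform_psd R N s) (hs_compD gP)) ?mul1r//.
move=> w; rewrite mul1r; apply: EFin_inj; rewrite !bform_sqE.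
rewrite (scales_integral (isometry_scales gP) (f := fun x => (w x ^+ 2)%:E)) ?mul1e//.
- by apply: measurable_EFin_sq; exact: hs_measurable.
- by move=> x; rewrite lee_fin sqr_ge0.
Qed.

Lemma aform_comp g (gP : isometry g) (u v : hs) :
  aform (hs_comp gP u) (hs_comp gP v) = aform u v.
Proof.
rewrite (polarization (c := 1) (@aform_psd R N s) (@aform_psd R N s) (hs_compD gP)) ?mul1r//.
move=> w; rewrite mul1r; apply: EFin_inj; rewrite !aform_sqE.
rewrite (eq_integral (fun z => ((diffq s w (g z.1, g z.2)) ^+ 2)%:E)); last first.
  by move=> z _; rewrite /diffq /gag_kernel /= (isometry_edist gP).
have mw := measurable_EFin_sq (measurable_diffq s (hs_measurable w)).
apply: (etrans (scales2 (isometry_scales gP) mw _)); last by rewrite mul1r mul1e.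
by move=> x; rewrite lee_fin sqr_ge0.
Qed.

Definition dilate (t : R) (u : Rn R N -> R) : Rn R N -> R :=
  fun x => t `^ (N%:R / 2) * u (dil t x).

Lemma powR_half_sq (t : R) : 0 < t -> (t `^ (N%:R / 2)) ^+ 2 = t ^+ N.
Proof.
move=> t0; rewrite -(powR_mulrn 2 (powR_ge0 _ _)) -powRrM divfK//.
by rewrite powR_mulrn// ltW.
Qed.

Lemma dilate_sq t u x : 0 < t -> dilate t u x ^+ 2 = t ^+ N * u (dil t x) ^+ 2.
Proof.
move=> t0; rewrite /dilate; have := powR_half_sq t0.
by move: (_ `^ _) (u _) => p a <-; rewrite exprMn.
Qed.

Lemma gag_kernel_dil t (x y : Rn R N) : 0 < t -> gag_kernel s x y =
  t ^+ N * t `^ (2 * s) * gag_kernel s (dil t x) (dil t y).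
Proof.
move=> t0.
have tE : t `^ (N%:R + 2 * s) = t ^+ N * t `^ (2 * s).
  by rewrite powRD ?powR_mulrn ?(ltW t0)//; rewrite (gt_eqF t0) implybT.
have tN : t ^+ N != 0 by rewrite expf_neq0// gt_eqF.
have ts : t `^ (2 * s) != 0 by rewrite gt_eqF// powR_gt0.
rewrite /gag_kernel edist_dil ?(ltW t0)// powRM ?edist_ge0 ?(ltW t0)// tE !invfM.
by set k := (_ `^ _)^-1; field; rewrite tN ts.
Qed.

Lemma diffq_dilate t (u : Rn R N -> R) z : 0 < t ->
  diffq s (dilate t u) z ^+ 2 =
  t `^ (2 * s) * (t ^+ N * t ^+ N) * diffq s u (dil t z.1, dil t z.2) ^+ 2.
Proof.
move=> t0; rewrite /diffq /dilate [(dil t z.1, dil t z.2).1]/= [(dil t z.1, dil t z.2).2]/=.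
transitivity ((t `^ (N%:R / 2)) ^+ 2 * (u (dil t z.1) - u (dil t z.2)) ^+ 2 *
    Num.sqrt (gag_kernel s z.1 z.2) ^+ 2); first by ring.
rewrite powR_half_sq// sqr_sqrtr ?gag_kernel_ge0// (gag_kernel_dil z.1 z.2 t0).
rewrite -[X in _ * X = _](mulr1) -[in LHS](sqr_sqrtr (gag_kernel_ge0 s (dil t z.1) (dil t z.2))).
by ring.
Qed.

Lemma dilate_integral t (u : Rn R N -> R) : 0 < t -> measurable_fun setT u ->
  (\int[leb]_x (dilate t u x ^+ 2)%:E = \int[leb]_x (u x ^+ 2)%:E)%E.
Proof.
move=> t0 mu_; have msq := measurable_EFin_sq mu_.
rewrite (eq_integral (fun x => (t ^+ N)%:E * (u (dil t x) ^+ 2)%:E)%E); last first.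
  by move=> x _; congr EFin; exact: dilate_sq.
have tN0 : 0 <= t ^+ N by rewrite exprn_ge0// ltW.
rewrite (ge0_integralZl leb measurableT); last 3 first.
- exact: measurableT_comp msq (@measurable_dil R N t).
- by move=> x _; rewrite lee_fin sqr_ge0.
- by rewrite lee_fin.
rewrite (scales_integral (dil_scales t0) msq); last by move=> x; rewrite lee_fin sqr_ge0.
by rewrite muleA -EFinM mulfV ?mul1e// expf_neq0// gt_eqF.
Qed.

Lemma dilate_integral2 t (u : Rn R N -> R) : 0 < t -> measurable_fun setT u ->
  (\int[leb2]_z (diffq s (dilate t u) z ^+ 2)%:E =
   (t `^ (2 * s))%:E * \int[leb2]_z (diffq s u z ^+ 2)%:E)%E.
Proof.
move=> t0 mu_; have msq := measurable_EFin_sq (measurable_diffq s mu_).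
have md : measurable_fun setT (fun z : Rn R N * Rn R N => (dil t z.1, dil t z.2)).
  by apply: measurable_fun_pair; exact: measurableT_comp (@measurable_dil R N t) _.
have sq0 z : (0 <= (diffq s u z ^+ 2)%:E)%E by rewrite lee_fin sqr_ge0.
pose c := t `^ (2 * s) * (t ^+ N * t ^+ N).
have c0 : 0 <= c by rewrite !mulr_ge0 ?powR_ge0// exprn_ge0// ltW.
rewrite (eq_integral (fun z => c%:E * (diffq s u (dil t z.1, dil t z.2) ^+ 2)%:E)%E); last first.
  by move=> z _; congr EFin; exact: diffq_dilate.
rewrite (ge0_integralZl _ measurableT); last 3 first.
- exact: measurableT_comp msq md.
- by move=> z _; rewrite lee_fin sqr_ge0.
- by rewrite lee_fin.
transitivity (c%:E * ((t ^- N * t ^- N)%:E * \int[leb2]_z (diffq s u z ^+ 2)%:E))%E.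
  by congr (_ * _)%E; exact: (scales2 (dil_scales t0) msq sq0).
rewrite muleA; congr (_ * _)%E; congr EFin.
have tN : t ^+ N != 0 by rewrite expf_neq0// gt_eqF.
by rewrite /c; field.
Qed.

Lemma dilate_in_Hs t (u : hs) : 0 < t -> dilate t u \in @Hs_pred R N s.
Proof.
move=> t0; have mu_ := hs_measurable u.
have md : measurable_fun setT (dilate t u).
  by apply: measurable_funM => //; exact: measurableT_comp mu_ (@measurable_dil R N t).
apply/Hs_predP; split; split=> //.
- by rewrite dilate_integral//; case: (hs_L2 u).
- exact: measurable_diffq.
- rewrite dilate_integral2//; apply: lte_mul_pinfty; rewrite ?lee_fin ?powR_ge0//.
  by case: (hs_diffq u).
Qed.

Definition hs_dil t (u : hs) : hs :=
  if pselect (0 < t) is left t0 then HsElt (dilate_in_Hs u t0) else u.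

Lemma hs_dilE t (u : hs) : 0 < t -> hs_fun (hs_dil t u) = dilate t u.
Proof. by rewrite /hs_dil; case: pselect. Qed.

Lemma hs_dilD t u v : 0 < t -> hs_dil t (u + v) = hs_dil t u + hs_dil t v.
Proof.
move=> t0; apply: val_inj => /=; rewrite hs_dilE// hs_funD !hs_dilE//.
by apply/funext => x; rewrite /dilate [LHS]mulrDr.
Qed.

Lemma hs_dilZ t c u : 0 < t -> hs_dil t (c *: u) = c *: hs_dil t u.
Proof.
move=> t0; apply: val_inj => /=; rewrite hs_dilE// hs_funZ !hs_dilE//.
by apply/funext => x; rewrite /dilate; exact: mulrCA.
Qed.

Lemma hs_dilB t u v : 0 < t -> hs_dil t (u - v) = hs_dil t u - hs_dil t v.
Proof. by move=> t0; rewrite -[- v]scaleN1r hs_dilD// hs_dilZ// scaleN1r. Qed.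

Lemma hs_dilM t r u : 0 < t -> 0 < r -> hs_dil t (hs_dil r u) = hs_dil (r * t) u.
Proof.
move=> t0 r0; have rt0 : 0 < r * t by rewrite mulr_gt0.
apply: val_inj => /=; rewrite !hs_dilE//; apply/funext => x.
rewrite /dilate mulrA powRM ?ltW// [_ `^ _ * _]mulrC; congr (_ * u _).
by apply: eq_from_tnth => i; rewrite !tnth_dil mulrA.
Qed.

Lemma hs_dil1 u : hs_dil 1 u = u.
Proof.
apply: val_inj => /=; rewrite hs_dilE//; apply/funext => x.
rewrite /dilate powR1 mul1r; congr (u _).
by apply: eq_from_tnth => i; rewrite !tnth_dil mul1r.
Qed.

Lemma hs_dilVK t u : 0 < t -> hs_dil t^-1 (hs_dil t u) = u.
Proof. by move=> t0; rewrite hs_dilM ?invr_gt0// mulfV ?gt_eqF// hs_dil1. Qed.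

Lemma bform_dil t (u v : hs) : 0 < t -> bform (hs_dil t u) (hs_dil t v) = bform u v.
Proof.
move=> t0; rewrite (polarization (c := 1) (T := hs_dil t) (@bform_psd R N s) (@bform_psd R N s)) ?mul1r//.
  by move=> *; exact: hs_dilD.
move=> w; rewrite mul1r; apply: EFin_inj; rewrite !bform_sqE hs_dilE//.
by rewrite dilate_integral//; exact: hs_measurable.
Qed.

Lemma aform_dil t (u v : hs) : 0 < t ->
  aform (hs_dil t u) (hs_dil t v) = t `^ (2 * s) * aform u v.
Proof.
move=> t0; apply: (polarization (c := t `^ (2 * s)) (T := hs_dil t) (@aform_psd R N s) (@aform_psd R N s)).
  by move=> *; exact: hs_dilD.
move=> w; apply: EFin_inj; rewrite EFinM !aform_sqE hs_dilE//.
by rewrite dilate_integral2//; exact: hs_measurable.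
Qed.

End hs_transport.

(** * Dyadic cubes and the Sobolev inequality *)

Section dyadic_cubes.
Context {R : realType} {N : nat}.
Notation leb := (@Rn_lebesgue R N).
Implicit Types x y z : Rn R N.

Lemma measurable_floor : measurable_fun setT (fun a : R => (Num.floor a)%:~R : R).
Proof.
apply: (measurability _ (measurable_realfun.RGenOInfty.measurableE R)).
move=> _ [_ [c ->] <-]; rewrite setTI.
rewrite (_ : _ @^-1` _ = `[(Num.floor c + 1)%:~R, +oo[%classic)//.
apply/seteqP; split=> a; rewrite /= !in_itv/= !andbT.
  by rewrite -floor_lt_int -floor_ge_int lezD1.
by rewrite -floor_lt_int -floor_ge_int lezD1.
Qed.

(** The dyadic grid of side [2 ^- j], given as an equivalence relation: a cube is named by any of
    its points, and membership is an equality of integer parts. *)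
Definition same_cube (j : nat) x y :=
  [forall i, Num.floor (2 ^+ j * tnth x i) == Num.floor (2 ^+ j * tnth y i)].

Definition cube (j : nat) x y : R := (same_cube j x y)%:R.

Lemma same_cubeP j x y :
  reflect (forall i, Num.floor (2 ^+ j * tnth x i) = Num.floor (2 ^+ j * tnth y i))
    (same_cube j x y).
Proof. by apply: (iffP forallP) => h i; apply/eqP. Qed.

Lemma same_cube_trans j x y z : same_cube j x y -> same_cube j x z = same_cube j y z.
Proof. by move=> /same_cubeP h; apply: eq_forallb => i; rewrite h. Qed.

Lemma same_cubeS j x y : same_cube j.+1 x y -> same_cube j x y.
Proof.
move=> /same_cubeP h; apply/same_cubeP => i; have := h i; rewrite !exprS -!mulrA.
move: (2 ^+ j * tnth x i) (2 ^+ j * tnth y i) => a b.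
have key (c : R) : 2 * Num.floor c <= Num.floor (2 * c) <= 2 * Num.floor c + 1.
  have /andP[h1 h2] := floor_itv c.
  rewrite floor_ge_int rmorphM/= ler_pM2l// h1/=.
  rewrite -ltzD1 floor_lt_int !rmorphD rmorphM/=; lra.
have := key a; have := key b => /andP[? ?] /andP[? ?] ?; lia.
Qed.

Lemma same_cube_edist j x y : same_cube j x y -> edist x y <= N%:R * 2 ^- j.
Proof.
move=> /same_cubeP h; apply: edist_le_coord => [|i]; first by rewrite invr_ge0 exprn_ge0.
have j0 : (0 : R) < 2 ^+ j by rewrite exprn_gt0.
rewrite -(ler_pM2l j0) mulfV ?gt_eqF// -(gtr0_norm j0) -normrM mulrBr.
have := h i; move: (2 ^+ j * tnth x i) (2 ^+ j * tnth y i) => a b ab.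
have := floor_itv a; have := floor_itv b; rewrite ab rmorphD/= => /andP[? ?] /andP[? ?].
by rewrite ler_norml; lra.
Qed.

Lemma cube01 j x y : cube j x y = 0 \/ cube j x y = 1.
Proof. by rewrite /cube; case: same_cube; [right|left]. Qed.

Lemma cube_ge0 j x y : 0 <= cube j x y.
Proof. by rewrite /cube ler0n. Qed.

Lemma cube_sq j x y : cube j x y * cube j x y = cube j x y.
Proof. by case: (cube01 j x y) => ->; rewrite ?mulr0 ?mulr1. Qed.

Lemma measurable_cube2 j : measurable_fun setT (fun z : Rn R N * Rn R N => cube j z.1 z.2).
Proof.
pose fl (x : Rn R N) i : R := (Num.floor (2 ^+ j * tnth x i))%:~R.
have mfl i : measurable_fun setT (fl ^~ i).
  apply: measurableT_comp measurable_floor _; apply: measurable_funM => //.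
  exact: measurable_tnth.
pose A := \bigcap_(i in [set: 'I_N])
  (fun z : Rn R N * Rn R N => fl z.1 i - fl z.2 i) @^-1` [set 0].
have mA : measurable A.
  apply: fin_bigcap_measurable => // i _; rewrite -[X in measurable X]setTI.
  by apply: measurable_funB => //; exact: measurableT_comp (mfl i) _.
rewrite (_ : (fun z : Rn R N * Rn R N => cube j z.1 z.2) = \1_A); first exact: measurable_indic.
apply/funext => z; rewrite /cube indicE; congr (_%:R); congr nat_of_bool.
apply/same_cubeP/idP => [h|/set_mem h i].
  by apply/mem_set => i _ /=; rewrite /fl h subrr.
by have /= := h i I; rewrite /fl => /eqP; rewrite subr_eq0 eqr_int => /eqP.
Qed.

Lemma measurable_cube j x : measurable_fun setT (cube j x).
Proof. exact: measurableT_comp (measurable_cube2 j) (measurable_pair1 x). Qed.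

Lemma cube_measure j x : (\int[leb]_y (cube j x y)%:E = (2 ^- (j * N))%:E)%E.
Proof.
pose a i : R := (Num.floor (2 ^+ j * tnth x i))%:~R.
have j0 : (0 : R) < 2 ^+ j by rewrite exprn_gt0.
pose A i : set (measurableTypeR R) := `[a i / 2 ^+ j, (a i + 1) / 2 ^+ j[%classic.
rewrite (_ : (fun y => _) = (fun y => (\1_[set y : Rn R N | forall i, A i (tnth y i)] y)%:E)); last first.
  apply/funext => y; rewrite /cube indicE; congr (_%:R%:E); congr nat_of_bool.
  apply/same_cubeP/idP => [h|/set_mem h i].
    apply/mem_set => i /=; rewrite /A/= in_itv/= /a h.
    rewrite ler_pdivrMr// ltr_pdivlMr// [_ * 2 ^+ j]mulrC.
    by have := floor_itv (2 ^+ j * tnth y i); rewrite rmorphD.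
  have /= := h i; rewrite /A/= in_itv/= ler_pdivrMr// ltr_pdivlMr// [_ * 2 ^+ j]mulrC => ha.
  by apply/esym/eqP; rewrite floor_eq rmorphD.
have mA : measurable [set y : Rn R N | forall i, A i (tnth y i)].
  rewrite (_ : [set y | _] = \bigcap_(i in [set: 'I_N]) ((@tnth _ _)^~ i @^-1` A i)).
    apply: fin_bigcap_measurable => // i _; rewrite -[X in measurable X]setTI.
    by apply: (@measurable_tnth _ (measurableTypeR R) N i measurableT); exact: measurable_itv.
  by apply/seteqP; split => y /= Ay i; [move=> _|]; exact: Ay.
rewrite integral_indic// setIT.
transitivity (\prod_(i < N) lebesgue_measure (A i))%E.
  by apply: Rn_lebesgue_box => i; exact: measurable_itv.
under eq_bigr => i _.
  rewrite /A lebesgue_measure_itv/= lte_fin ltr_pM2r ?invr_gt0// ltrDl ltr01.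
  rewrite -EFinB -mulrBl addrAC subrr add0r mul1r; over.
by rewrite prodEFin prodr_const card_ord exprM exprVn.
Qed.

Lemma cube_L2 j x : L2 leb (cube j x).
Proof.
split; first exact: measurable_cube.
under eq_integral do rewrite expr2 cube_sq.
by rewrite cube_measure ltry.
Qed.

Lemma l2_cube j x : l2 leb (cube j x) (cube j x) = 2 ^- (j * N).
Proof.
apply: EFin_inj; rewrite l2_sqE; last exact: cube_L2.
by under eq_integral do rewrite expr2 cube_sq; rewrite cube_measure.
Qed.

Lemma L2_mul_cube j x (w : Rn R N -> R) : L2 leb w -> L2 leb (w \* cube j x).
Proof.
move=> Lw; apply: L2_le (L2_sq_integrable Lw).
  by apply: measurable_funM; [case: Lw|exact: measurable_cube].
by move=> y /=; case: (cube01 j x y) => ->; rewrite ?mulr0 ?mulr1// expr0n sqr_ge0.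
Qed.

Lemma l2_cube_le j x (w : Rn R N -> R) : L2 leb (w \* cube j x) ->
  (l2 leb w (cube j x) ^+ 2 <= 2 ^- (j * N) * l2 leb (w \* cube j x) (w \* cube j x)).
Proof.
move=> Lw; rewrite mulrC -(l2_cube j x).
rewrite [X in X ^+ 2](_ : _ = l2 leb (w \* cube j x) (cube j x)).
  by apply: l2_cauchy_schwarz => //; exact: cube_L2.
by apply: eq_Rintegral => y _ /=; rewrite -mulrA cube_sq.
Qed.

Definition cube_avg (j : nat) (u : Rn R N -> R) x : R := 2 ^+ (j * N) * l2 leb u (cube j x).

Lemma cube_avg_same j u x y : same_cube j x y -> cube_avg j u x = cube_avg j u y.
Proof.
move=> xy; congr (_ * _); apply: eq_Rintegral => z _; congr (_ * _).
by rewrite /cube (same_cube_trans z xy).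
Qed.

Lemma measurable_cube_avg j u : L2 leb u -> measurable_fun setT (cube_avg j u).
Proof.
move=> Lu; apply: measurable_funM => //; rewrite /l2 /Rintegral.
apply: (measurableT_comp (@fine_measurable R setT measurableT)) => //.
have Lc x : leb.-integrable setT (fun y => (u y * cube j x y)%:E).
  by apply: L2_mul_integrable => //; exact: cube_L2.
have mz (F : R -> R) : measurable_fun setT F -> measurable_fun setT
   (fun z : Rn R N * Rn R N => (F (u z.2) * cube j z.1 z.2)%:E).
  move=> mF; apply/measurable_EFinP; apply: measurable_funM; last exact: measurable_cube2.
  by apply: measurableT_comp mF _; apply: measurableT_comp => //; case: Lu.
pose p (a : R) := Num.max a 0; pose n (a : R) := Num.max (- a) 0.
rewrite (_ : (fun x => _) = (fun x => \int[leb]_y (p (u y) * cube j x y)%:E -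
    \int[leb]_y (n (u y) * cube j x y)%:E)%E); last first.
  apply/funext => x; rewrite integralE; congr (_ - _)%E; apply: eq_integral => y _.
    rewrite funeposE /p; case: (cube01 j x y) => ->.
      by rewrite !mulr0 maxxx.
    by rewrite !mulr1 EFin_max.
  rewrite funenegE /n; case: (cube01 j x y) => ->.
    by rewrite !mulr0 oppe0 maxxx.
  by rewrite !mulr1 EFin_max EFinN.
have h (F : R -> R) : measurable_fun setT F -> (forall a, 0 <= F a) ->
    measurable_fun setT (fun x => \int[leb]_y (F (u y) * cube j x y)%:E)%E.
  move=> mF F0.
  have z0 (z : Rn R N * Rn R N) : (0 <= (F (u z.2) * cube j z.1 z.2)%:E)%E.
    by rewrite lee_fin mulr_ge0 ?cube_ge0.
  exact: (measurable_fun_fubini_tonelli_F (m2 := leb) _ (mz F mF) z0).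
apply: emeasurable_funB; apply: h.
- exact: measurable_maxr.
- by move=> a; rewrite /p le_max lexx orbT.
- by apply: measurable_maxr => //; exact: measurable_funN.
- by move=> a; rewrite /n le_max lexx orbT.
Qed.

Lemma cube_avg_bound j u x : L2 leb u -> cube_avg j u x ^+ 2 <= 2 ^+ (j * N) * l2 leb (u \* cube j x) (u \* cube j x).
Proof.
move=> Lu; rewrite exprMn; have p0 : (0 : R) < 2 ^+ (j * N) by rewrite exprn_gt0.
have := l2_cube_le (L2_mul_cube j x Lu); rewrite -(ler_pM2l (exprn_gt0 2 p0)).
move/le_trans; apply; rewrite le_eqVlt; apply/orP; left; apply/eqP.
by field; rewrite gt_eqF.
Qed.

(* [c - cube_avg j u x] is the average of [c - u] over the cube of [x]. *)
Lemma cube_avg_dev j u x c : L2 leb u ->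
  (((c - cube_avg j u x) ^+ 2)%:E <=
   (2 ^+ (j * N))%:E * \int[leb]_y ((c - u y) ^+ 2 * cube j x y)%:E)%E.
Proof.
move=> Lu; pose w : Rn R N -> R := c *: cube j x - (u \* cube j x).
have Lw : L2 leb w by apply: L2B; [apply: L2Z; exact: cube_L2|exact: L2_mul_cube].
have wE y : w y = (c - u y) * cube j x y by rewrite mulrBl.
have wc : w \* cube j x = w by apply/funext => y /=; rewrite !wE -mulrA cube_sq.
have p0 : (0 : R) < 2 ^+ (j * N) by rewrite exprn_gt0.
have pn0 : (2 : R) ^+ (j * N) != 0 by rewrite gt_eqF.
have -> : c - cube_avg j u x = 2 ^+ (j * N) * l2 leb w (cube j x).
  rewrite /w l2Dl ?l2Zl ?l2_cube; [|try exact: cube_L2..]; last 2 first.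
  - by apply: L2Z; exact: cube_L2.
  - by apply: L2N; exact: L2_mul_cube.
  have -> : l2 leb (- (u \* cube j x)) (cube j x) = - l2 leb u (cube j x).
    rewrite -scaleN1r l2Zl ?mulN1r; [|exact: L2_mul_cube|exact: cube_L2].
    by congr (- _); apply: eq_Rintegral => y _ /=; rewrite -mulrA cube_sq.
  by rewrite /cube_avg; field.
have := @l2_cube_le j x w; rewrite wc => /(_ Lw) h.
apply: (@le_trans _ _ (2 ^+ (j * N) * l2 leb w w)%:E).
  move: h; rewrite -(ler_pM2l (exprn_gt0 2 p0)) => h.
  rewrite lee_fin exprMn; move: h.
  by move/le_trans; apply; rewrite le_eqVlt; apply/orP; left; apply/eqP; field.
rewrite EFinM l2_sqE// lee_wpmul2l ?lee_fin ?(ltW p0)//.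
rewrite le_eqVlt; apply/orP; left; apply/eqP; apply: eq_integral => y _.
by rewrite wE exprMn; congr (EFin (_ * _)); rewrite expr2 cube_sq.
Qed.

End dyadic_cubes.

Lemma exists_expr_itv (R : realType) (r y : R) : 1 < r -> 1 <= y ->
  exists j, r ^+ j <= y < r ^+ j.+1.
Proof.
move=> r1 y1.
have ex : exists n, y < r ^+ n.
  have bern n : 1 + n%:R * (r - 1) <= r ^+ n.
    elim: n => [|n IH]; first by rewrite mul0r addr0 expr0.
    have r0 : 0 <= r by lra.
    rewrite exprS; apply: le_trans (ler_wpM2l r0 IH).
    rewrite -natr1; have n0 : (0 : R) <= n%:R by rewrite ler0n.
    by have := mulr_ge0 n0 (sqr_ge0 (r - 1)); nra.
  have r10 : 0 < r - 1 by lra.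
  have [n hn] : exists n : nat, y / (r - 1) < n%:R.
    exists (Num.bound (y / (r - 1))); apply: archi_boundP.
    by rewrite divr_ge0//; lra.
  by exists n; move: hn; rewrite ltr_pdivrMr// => hn; have := bern n; lra.
have [[|n] hn hmin] := ex_minnP ex; first by move: hn; rewrite expr0; lra.
exists n; rewrite hn andbT leNgt; apply/negP => /hmin.
by rewrite ltnn.
Qed.

Section sobolev_inequality.
Context {R : realType} {N : nat} {s : R}.
Hypotheses (s01 : 0 < s < 1) (N2 : (2 < N)%N).
Notation leb := (@Rn_lebesgue R N).
Notation leb2 := (leb \x leb)%E.
Local Notation hs := (@hs R N s).
Implicit Types (u : hs) (x y : Rn R N).

Let p : R := N%:R + 2 * s.
Definition crit_exp : R := 2 * N%:R / (N%:R - 2 * s).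
Local Notation q := crit_exp.

Let N3 : (3 : R) <= N%:R. Proof. by rewrite ler_nat. Qed.
Let s0 : 0 < s. Proof. by case/andP: s01. Qed.
Let s1 : s < 1. Proof. by case/andP: s01. Qed.
Let N2s : 0 < N%:R - 2 * s. Proof. by have := N3; have := s1; lra. Qed.

Lemma crit_expE : q - 2 = 4 * s / (N%:R - 2 * s).
Proof. by rewrite /crit_exp; field; rewrite gt_eqF. Qed.

Lemma crit_exp_gt2 : 2 < q.
Proof. by rewrite -subr_gt0 crit_expE divr_gt0 ?mulr_gt0. Qed.

(** Averaging contributes [2 ^+ (j * N)] and the inverse of the kernel on a cube, whose diameter is
    at most [N * 2 ^- j], contributes the power [p]. The powers of 2 combine to [2^(-2sj)], a gain
    at every refinement. *)
Let dev_rate j : R := N%:R `^ p * (2 `^ (- (2 * s))) ^+ j.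

Let dev_rateE j : 2 ^+ (j * N) * (N%:R * 2 ^- j) `^ p = dev_rate j.
Proof.
rewrite powRM ?invr_ge0 ?exprn_ge0// mulrCA; congr (_ * _).
have e (n : nat) : (2 : R) ^+ n = 2 `^ n%:R by rewrite powR_mulrn.
rewrite !e -powRN -powRrM -powRD; last by rewrite pnatr_eq0 implybT.
rewrite -(powR_mulrn j (powR_ge0 _ _)) -powRrM; congr powR.
by rewrite /p natrM; ring.
Qed.

(** Rate at which averages over cubes of side [2 ^- j] may grow on the unit ball of H^s;
    [rho ^+ 2 = 2^N * 2^(-2s)] balances the volume of a cube against [dev_rate]. *)
Let rho : R := 2 `^ (N%:R / 2 - s).

Let rho1 : 1 < rho.
Proof.
have : (1 : R) `^ (N%:R / 2 - s) < rho; last by rewrite powR1.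
apply: gt0_ltr_powR; rewrite ?nnegrE ?ltr1n//.
by have := N3; have := s1; lra.
Qed.

Lemma integrand_le_cube (u : Rn R N -> R) j x y :
  (u x - u y) ^+ 2 * cube j x y <= (N%:R * 2 ^- j) `^ p * diffq s u (x, y) ^+ 2.
Proof.
have [cE|cE] := cube01 j x y; rewrite cE ?mulr0 ?mulr1.
  by rewrite mulr_ge0 ?powR_ge0 ?sqr_ge0.
have d0 := edist_ge0 x y.
have dle : edist x y <= N%:R * 2 ^- j.
  apply: same_cube_edist; move: cE; rewrite /cube; case: same_cube => //= /eqP.
  by rewrite eq_sym oner_eq0.
have [dE|dE] := eqVneq (edist x y) 0.
  have -> : x = y.
    apply: eq_from_tnth => i; have := ler_edist_coord x y i.
    by rewrite dE normr_le0 subr_eq0 => /eqP.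
  by rewrite subrr expr0n mulr_ge0 ?powR_ge0 ?sqr_ge0.
have dp : 0 < edist x y by rewrite lt_def dE.
rewrite diffq_sq /= real_normK ?num_real// mulrCA ler_peMr ?sqr_ge0//.
rewrite /gag_kernel -/p ler_pdivlMr ?powR_gt0// mul1r.
apply: ge0_ler_powR => //; rewrite ?nnegrE ?mulr_ge0 ?invr_ge0 ?exprn_ge0//.
by have := N3; have := s0; rewrite /p; lra.
Qed.

Lemma measurable_inner (u : Rn R N -> R) : measurable_fun setT u ->
  measurable_fun setT (fun x => \int[leb]_y (diffq s u (x, y) ^+ 2)%:E)%E.
Proof.
move=> mu_; have md := measurable_EFin_sq (measurable_diffq s mu_).
apply: (measurable_fun_fubini_tonelli_F (m2 := leb) _ md).
by move=> z; rewrite lee_fin sqr_ge0.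
Qed.

Lemma inner_ge0 (u : Rn R N -> R) x : (0 <= \int[leb]_y (diffq s u (x, y) ^+ 2)%:E)%E.
Proof. by apply: integral_ge0 => y _; rewrite lee_fin sqr_ge0. Qed.

Lemma integral_inner u :
  (\int[leb]_x \int[leb]_y (diffq s u (x, y) ^+ 2)%:E = (aform u u)%:E)%E.
Proof.
have md := measurable_EFin_sq (measurable_diffq s (hs_measurable u)).
rewrite aform_sqE; apply/esym/(fubini_tonelli1 _ md).
by move=> z; rewrite lee_fin sqr_ge0.
Qed.

Let dev_le u j x : (((u x - cube_avg j u x) ^+ 2)%:E <=
  (dev_rate j)%:E * \int[leb]_y (diffq s u (x, y) ^+ 2)%:E)%E.
Proof.
apply: le_trans (cube_avg_dev j x (u x) (hs_L2 u)) _.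
rewrite -dev_rateE EFinM -muleA lee_wpmul2l ?lee_fin ?exprn_ge0//.
have md := measurableT_comp (measurable_EFin_sq (measurable_diffq s (hs_measurable u)))
  (measurable_pair1 x).
rewrite -(ge0_integralZl leb measurableT md); last 2 first.
- by move=> y _; rewrite lee_fin sqr_ge0.
- by rewrite lee_fin powR_ge0.
apply: ge0_le_integral => //.
- by move=> y _; rewrite lee_fin mulr_ge0 ?sqr_ge0 ?cube_ge0.
- apply/measurable_EFinP; apply: measurable_funM; last exact: measurable_cube.
  by apply: measurable_funX; apply: measurable_funB => //; exact: hs_measurable.
- by apply: emeasurable_funM.
- by move=> y _ /=; rewrite -EFinM lee_fin integrand_le_cube.
Qed.

(** A fractional Poincare inequality on the dyadic grid, with a constant tending to 0 as the grid is
    refined. It serves the Sobolev inequality and, later, the compactness of rotation invariant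
    functions. *)
Lemma cube_avg_L2_dist u j :
  (\int[leb]_x ((u x - cube_avg j u x) ^+ 2)%:E <= (dev_rate j * aform u u)%:E)%E.
Proof.
rewrite EFinM -integral_inner -(ge0_integralZl leb measurableT); last 3 first.
- by apply: measurable_inner; exact: hs_measurable.
- by move=> x _; exact: inner_ge0.
- by rewrite lee_fin mulr_ge0 ?powR_ge0// exprn_ge0// powR_ge0.
apply: ge0_le_integral => //.
- by move=> x _; rewrite lee_fin sqr_ge0.
- apply/measurable_EFinP; apply: measurable_funX; apply: measurable_funB.
    exact: hs_measurable.
  by apply: measurable_cube_avg; exact: hs_L2.
- by apply: emeasurable_funM => //; by apply: measurable_inner; exact: hs_measurable.
Qed.

(** [C1 * rho ^+ j] bounds the change of the average under one refinement. [C0] is chosen with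
    [C1 <= C0 * (rho - 1)], which closes the induction for [|cube_avg j u x| <= C0 * rho ^+ j]. *)
Let C1 : R := Num.sqrt (2 ^+ N * N%:R `^ p).
Let C0 : R := Num.max 1 (C1 / (rho - 1)).

Let C0_ge1 : 1 <= C0. Proof. by rewrite le_max lexx. Qed.

Let rho_sq j : 2 ^+ (j * N) * (2 `^ (- (2 * s))) ^+ j = (rho ^+ j) ^+ 2.
Proof.
have e (n : nat) : (2 : R) ^+ n = 2 `^ n%:R by rewrite powR_mulrn.
rewrite -exprM -(powR_mulrn (j * 2) (powR_ge0 _ _)) -(powR_mulrn j (powR_ge0 _ _)) e.
rewrite -!powRrM -powRD.
  by congr powR; rewrite !natrM; field.
by rewrite pnatr_eq0 implybT.
Qed.

Let cube_avg_step u j x : aform u u <= 1 ->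
  `|cube_avg j.+1 u x - cube_avg j u x| <= C1 * rho ^+ j.
Proof.
move=> a1; set c := cube_avg j u x.
have rj0 : 0 <= rho ^+ j by rewrite exprn_ge0// ltW// (lt_trans ltr01 rho1).
rewrite distrC -(@ler_pXn2r _ 2)// ?nnegrE ?mulr_ge0 ?sqrtr_ge0//.
rewrite real_normK ?num_real// exprMn sqr_sqrtr ?mulr_ge0 ?exprn_ge0 ?powR_ge0//.
rewrite -lee_fin; apply: le_trans (cube_avg_dev j.+1 x c (hs_L2 u)) _.
have -> : 2 ^+ N * N%:R `^ p * (rho ^+ j) ^+ 2 = 2 ^+ (j.+1 * N) * dev_rate j.
  by rewrite -rho_sq mulSn exprD /dev_rate; ring.
rewrite EFinM lee_wpmul2l ?lee_fin ?exprn_ge0//.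
apply: (@le_trans _ _ (\int[leb]_y ((u y - cube_avg j u y) ^+ 2)%:E)%E); last first.
  apply: le_trans (cube_avg_L2_dist u j) _; rewrite lee_fin ler_piMr//.
  by rewrite mulr_ge0 ?powR_ge0// exprn_ge0// powR_ge0.
apply: ge0_le_integral => //.
- by move=> y _; rewrite lee_fin mulr_ge0 ?sqr_ge0 ?cube_ge0.
- apply/measurable_EFinP; apply: measurable_funM; last exact: measurable_cube.
  by apply: measurable_funX; apply: measurable_funB => //; exact: hs_measurable.
- apply/measurable_EFinP; apply: measurable_funX; apply: measurable_funB.
    exact: hs_measurable.
  by apply: measurable_cube_avg; exact: hs_L2.
- move=> y _; rewrite lee_fin /cube; case: (boolP (same_cube j.+1 x y)) => xy /=.
    by rewrite mulr1 -sqrrN opprB /c (cube_avg_same u (same_cubeS xy)).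
  by rewrite mulr0 sqr_ge0.
Qed.

Let cube_avg_le u j x : aform u u + bform u u <= 1 -> `|cube_avg j u x| <= C0 * rho ^+ j.
Proof.
move=> ab1; have a0 := ip_ge0 (@aform_psd R N s) u; have b0 := ip_ge0 (@bform_psd R N s) u.
elim: j => [|j IH].
  rewrite expr0 mulr1; apply: le_trans C0_ge1.
  rewrite -(@ler_pXn2r _ 2)// ?nnegrE// real_normK ?num_real// expr1n.
  apply: le_trans (cube_avg_bound 0 x (hs_L2 u)) _; rewrite mul0n expr0 mul1r.
  apply: (@le_trans _ _ (bform u u)); last lra.
  rewrite -lee_fin bform_sqE l2_sqE; last by apply: L2_mul_cube; exact: hs_L2.
  apply: ge0_le_integral => //.
  - by move=> y _; rewrite lee_fin sqr_ge0.
  - apply: measurable_EFin_sq; apply: measurable_funM; first exact: hs_measurable.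
    exact: measurable_cube.
  - by apply: measurable_EFin_sq; exact: hs_measurable.
  - move=> y _ /=; rewrite lee_fin; case: (cube01 0 x y) => ->; rewrite ?mulr0 ?mulr1//.
    by rewrite expr0n sqr_ge0.
have rj0 : 0 <= rho ^+ j by rewrite exprn_ge0// ltW// (lt_trans ltr01 rho1).
have C0C1 : C1 <= C0 * (rho - 1) by rewrite -ler_pdivrMr ?subr_gt0// le_max lexx orbT.
have := cube_avg_step j x (u := u) ltac:(lra).
have := ler_normD (cube_avg j.+1 u x - cube_avg j u x) (cube_avg j u x).
rewrite subrK exprSr => h1 h2; have := ler_wpM2r rj0 C0C1; nra.
Qed.

Lemma powR_sq_split (a r : R) : 0 <= a -> 2 < r -> a `^ r = a ^+ 2 * a `^ (r - 2).
Proof.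
move=> a0 r2; rewrite -(powR_mulrn 2 a0) -powRD; first by rewrite addrC subrK.
by apply/implyP => /eqP; lra.
Qed.

Let K1 : R := (2 * C0) `^ (q - 2).
Let K2 : R := 4 * (2 * C0 * rho) `^ (q - 2) * N%:R `^ p.

(** Where [|u x|] exceeds [2 * C0], take the scale [j] with [|u x|] between [2 * C0 * rho ^+ j] and
    [2 * C0 * rho ^+ j.+1]. The average over that cube is at most half of [|u x|], so [u x ^+ 2] is
    controlled by the deviation from the average, of size [2^(-2sj)] times the inner integral. The
    remaining factor [|u x|^(q-2)] is of order [2^(2sj)] because [rho^(q-2) = 2^(2s)]: the powers
    cancel exactly at the critical exponent. *)
Let crit_pointwise u x : aform u u + bform u u <= 1 ->
  ((`|u x| `^ q)%:E <= (K1 * u x ^+ 2)%:E + K2%:E * \int[leb]_y (diffq s u (x, y) ^+ 2)%:E)%E.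
Proof.
move=> ab1; have q2 := crit_exp_gt2.
have C00 : 0 < C0 by apply: lt_le_trans C0_ge1.
have I0 := inner_ge0 u x.
have q20 : 0 <= q - 2 by lra.
have K20 : 0 <= K2 by rewrite !mulr_ge0 ?powR_ge0.
have rho0 : 0 < rho by apply: lt_trans rho1.
rewrite powR_sq_split// real_normK ?num_real//.
have [ule|ugt] := leP `|u x| (2 * C0).
  apply: (@le_trans _ _ (K1 * u x ^+ 2)%:E); last by rewrite leeDl// mule_ge0 ?lee_fin.
  rewrite lee_fin mulrC ler_wpM2r ?sqr_ge0//.
  by apply: ge0_ler_powR; rewrite ?nnegrE// mulr_ge0// ltW.
have y1 : 1 <= `|u x| / (2 * C0) by rewrite ler_pdivlMr ?mulr_gt0// mul1r ltW.
have [j /andP[jl ju]] := exists_expr_itv rho1 y1.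
rewrite ler_pdivlMr ?mulr_gt0// in jl; rewrite ltr_pdivrMr ?mulr_gt0// in ju.
have Pj := cube_avg_le j x ab1.
have dev : u x ^+ 2 <= 4 * (u x - cube_avg j u x) ^+ 2.
  have -> : 4 * (u x - cube_avg j u x) ^+ 2 = (2 * (u x - cube_avg j u x)) ^+ 2 by ring.
  rewrite -[leLHS]real_normK ?num_real// -[leRHS]real_normK ?num_real//.
  rewrite ler_pXn2r ?nnegrE// normrM normr_nat.
  have := ler_normD (u x - cube_avg j u x) (cube_avg j u x); rewrite subrK; nra.
have pw : `|u x| `^ (q - 2) <= (2 * C0 * rho) `^ (q - 2) * (2 `^ (2 * s)) ^+ j.
  apply: (@le_trans _ _ ((2 * C0 * rho * rho ^+ j) `^ (q - 2))).
    apply: ge0_ler_powR => //; rewrite ?nnegrE ?mulr_ge0 ?exprn_ge0 ?(ltW C00) ?(ltW rho0)//.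
    by rewrite -mulrA -exprS mulrC ltW.
  rewrite powRM ?mulr_ge0 ?exprn_ge0 ?(ltW C00) ?(ltW rho0)// ler_wpM2l ?powR_ge0//.
  rewrite -!(powR_mulrn j (powR_ge0 _ _)) -!powRrM le_eqVlt; apply/orP; left; apply/eqP.
  by congr powR; rewrite crit_expE; field; rewrite gt_eqF.
apply: (@le_trans _ _ (K2%:E * \int[leb]_y (diffq s u (x, y) ^+ 2)%:E)%E); last first.
  by rewrite leeDr// lee_fin mulr_ge0 ?powR_ge0 ?sqr_ge0.
pose c : R := 4 * ((2 * C0 * rho) `^ (q - 2) * (2 `^ (2 * s)) ^+ j).
have c0 : 0 <= c by rewrite !mulr_ge0 ?powR_ge0 ?exprn_ge0 ?powR_ge0.
apply: (@le_trans _ _ (c%:E * ((u x - cube_avg j u x) ^+ 2)%:E)%E).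
  rewrite -EFinM lee_fin /c mulrC; apply: (@le_trans _ _ (`|u x| `^ (q - 2) * (4 * (u x - cube_avg j u x) ^+ 2))).
    by rewrite ler_wpM2l ?powR_ge0.
  by rewrite mulrCA -[leRHS]mulrA ler_pM2l// ler_wpM2r ?sqr_ge0.
apply: le_trans (lee_wpmul2l _ (dev_le u j x)) _; first by rewrite lee_fin.
rewrite muleA -EFinM le_eqVlt; apply/orP; left; apply/eqP; congr (EFin _ * _)%E.
rewrite /c /K2 /dev_rate.
have : (2 `^ (2 * s)) ^+ j * (2 `^ (- (2 * s))) ^+ j = 1.
  by rewrite -exprMn -powRD ?subrr ?powRr0 ?expr1n// pnatr_eq0 implybT.
move: (_ ^+ j) (_ ^+ j) (N%:R `^ p) (_ `^ (q - 2)) => a b d e ab.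
transitivity (4 * e * d * (a * b)); first by ring.
by rewrite [a * b]mulrC ab mulr1.
Qed.

Let sobolev_unit u : aform u u + bform u u <= 1 ->
  (\int[leb]_x (`|u x| `^ q)%:E <= (K1 + K2)%:E)%E.
Proof.
move=> ab1; have a0 := ip_ge0 (@aform_psd R N s) u; have b0 := ip_ge0 (@bform_psd R N s) u.
have K10 : 0 <= K1 by rewrite powR_ge0.
have K20 : 0 <= K2 by rewrite !mulr_ge0 ?powR_ge0.
have mI := measurable_inner (hs_measurable u).
have msq := measurable_EFin_sq (hs_measurable u).
have mK : measurable_fun setT (fun x => (K1 * u x ^+ 2)%:E).
  apply/measurable_EFinP; apply: measurable_funM => //; apply: measurable_funX.
  exact: hs_measurable.
apply: (@le_trans _ _ (\int[leb]_x ((K1 * u x ^+ 2)%:E +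
    K2%:E * \int[leb]_y (diffq s u (x, y) ^+ 2)%:E))%E).
  apply: ge0_le_integral => //.
  - apply/measurable_EFinP; apply: (measurableT_comp (measurable_powR _)).
    by apply: measurableT_comp => //; exact: hs_measurable.
  - by apply: emeasurable_funD => //; apply: emeasurable_funM.
  - by move=> x _; exact: crit_pointwise.
rewrite ge0_integralD//; last 3 first.
- by move=> x _; rewrite lee_fin mulr_ge0// sqr_ge0.
- by move=> x _; rewrite mule_ge0 ?lee_fin// inner_ge0.
- exact: emeasurable_funM.
under eq_integral do rewrite EFinM.
rewrite (ge0_integralZl leb measurableT msq) ?lee_fin//; last first.
  by move=> x _; rewrite lee_fin sqr_ge0.
rewrite -bform_sqE (ge0_integralZl leb measurableT mI) ?lee_fin//; last first.
  by move=> x _; exact: inner_ge0.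
by rewrite integral_inner -!EFinM -EFinD lee_fin lerD// ler_piMr//; lra.
Qed.

Lemma sobolev (B : R) : 0 < B -> exists2 K : R, 0 <= K & forall u,
  aform u u + bform u u <= B -> (\int[leb]_x (`|u x| `^ q)%:E <= K%:E)%E.
Proof.
move=> B0; exists (Num.sqrt B `^ q * (K1 + K2)).
  by rewrite mulr_ge0 ?powR_ge0// addr_ge0 ?mulr_ge0 ?powR_ge0.
move=> u abB; have sB : 0 < Num.sqrt B by rewrite sqrtr_gt0.
have sqB : Num.sqrt B ^+ 2 = B by rewrite sqr_sqrtr// ltW.
pose v : hs := (Num.sqrt B)^-1 *: u.
have : aform v v + bform v v <= 1.
  rewrite (ip_sqZ (@aform_psd R N s)) (ip_sqZ (@bform_psd R N s)) -mulrDr.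
  by rewrite exprVn sqB mulrC ler_pdivrMr// mul1r.
move=> /sobolev_unit h.
rewrite EFinM; apply: le_trans (lee_wpmul2l _ h); last by rewrite lee_fin powR_ge0.
have mv : measurable_fun setT (fun x => (`|v x| `^ q)%:E).
  apply/measurable_EFinP; apply: (measurableT_comp (measurable_powR _)).
  by apply: measurableT_comp => //; exact: hs_measurable.
rewrite -(ge0_integralZl leb measurableT mv); last 2 first.
- by move=> x _; rewrite lee_fin powR_ge0.
- by rewrite lee_fin powR_ge0.
rewrite le_eqVlt; apply/orP; left; apply/eqP; apply: eq_integral => x _.
rewrite -EFinM -powRM ?sqrtr_ge0//; congr ((_ `^ _)%:E).
rewrite -{1}(gtr0_norm sB) -normrM; congr `|_|.
have -> : v x = (Num.sqrt B)^-1 * u x by [].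
by rewrite mulrA mulfV ?mul1r// gt_eqF.
Qed.

End sobolev_inequality.

(** * Compactness of rotation invariant functions *)

Lemma absz_shift (z : int) (Z : nat) : - Z%:Z <= z <= Z%:Z ->
  (absz (z + Z%:Z)%R < (2 * Z).+1)%N /\ (absz (z + Z%:Z))%:Z - Z%:Z = z.
Proof. by move=> h; split; lia. Qed.

Section radial_compactness.
Context {R : realType} {N : nat} {s : R}.
Hypotheses (s01 : 0 < s < 1) (N2 : (2 < N)%N).
Notation leb := (@Rn_lebesgue R N).
Local Notation hs := (@hs R N s).
Implicit Types (u w : hs) (x y : Rn R N).

(* A vanishing L2 distance encodes equality almost everywhere; the half turn
   [c = -1] is left out because [isometry_rot] does not cover it. *)
Definition rot_invariant u := forall (i j : 'I_N) (c t : R) (ij : i != j)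
  (ct : c ^+ 2 + t ^+ 2 = 1) (c1 : -1 < c),
  sq_dist (@bform R N s) (hs_comp (isometry_rot ij ct c1) u) u = 0.

Let bP := @bform_psd R N s.
Let aP := @aform_psd R N s.

Lemma sq_dist0_ae u w : sq_dist (@bform R N s) u w = 0 -> {ae leb, forall x, u x = w x}.
Proof.
rewrite /sq_dist => h.
have : (\int[leb]_x ((u - w) x ^+ 2)%:E = 0)%E by rewrite -bform_sqE h.
have mw := measurable_EFin_sq (hs_measurable (u - w)).
move=> h0; have : (\int[leb]_x `|((u - w) x ^+ 2)%:E| = 0)%E.
  by rewrite -[RHS]h0; apply: eq_integral => x _; rewrite gee0_abs ?lee_fin ?sqr_ge0.
move=> /(ae_eq_integral_abs leb measurableT mw).1; apply: filterS => x /(_ I)[] /eqP.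
by rewrite sqrf_eq0 => /eqP h1; apply/eqP; rewrite -subr_eq0; apply/eqP; exact: h1.
Qed.

Lemma rot_invariant_lin c u w : rot_invariant u -> rot_invariant w -> rot_invariant (c *: u + w).
Proof.
move=> su sw i j d t ij ct c1; set g := isometry_rot _ _ _.
have {}su : sq_dist (@bform R N s) (hs_comp g u) u = 0 by exact: su.
have {}sw : sq_dist (@bform R N s) (hs_comp g w) w = 0 by exact: sw.
rewrite /sq_dist hs_compD hs_compZ.
have -> : c *: hs_comp g u + hs_comp g w - (c *: u + w) =
    c *: (hs_comp g u - u) + (hs_comp g w - w).
  by rewrite scalerBr opprD addrACA.
rewrite (ip_sqD bP) (ip_sqZ bP) (ipZl bP) [bform (_ u - u) (_ u - u)]su.
rewrite [bform (_ w - w) (_ w - w)]sw (ip_eq0 bP _ su); ring.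
Qed.

Lemma rot_invariantZ c u : rot_invariant u -> rot_invariant (c *: u).
Proof.
move=> su; rewrite -[c *: u]addr0; apply: rot_invariant_lin => //.
move=> i j d t ij ct c1; rewrite /sq_dist.
by rewrite -(scale0r u) hs_compZ !scale0r subr0 (ip0l bP).
Qed.

Lemma rot_invariantB u w : rot_invariant u -> rot_invariant w -> rot_invariant (u - w).
Proof.
by move=> su sw; rewrite addrC -scaleN1r; exact: rot_invariant_lin.
Qed.

Lemma rot_invariant_dil t u : 0 < t -> rot_invariant u -> rot_invariant (hs_dil t u).
Proof.
move=> t0 su i j c r ij cr c1; rewrite -[RHS](su i j c r ij cr c1) /sq_dist.
have -> : hs_comp (isometry_rot ij cr c1) (hs_dil t u) =
    hs_dil t (hs_comp (isometry_rot ij cr c1) u).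
  apply: val_inj => /=; rewrite !hs_dilE//; apply/funext => x /=.
  rewrite /dilate /=; congr (_ * u _).
  apply: eq_from_tnth => k; rewrite tnth_dil !tnth_rot !tnth_dil.
  by case: (k == j); [ring|case: (k == i); [ring|]].
by rewrite -hs_dilB// bform_dil.
Qed.

Lemma rot_invariant_limit (v : nat -> hs) u : (forall n, rot_invariant (v n)) ->
  (forall e : R, 0 < e -> exists n, sq_dist (@bform R N s) (v n) u <= e) -> rot_invariant u.
Proof.
move=> sv vu i j c t ij ct c1; set g := isometry_rot _ _ _.
apply/eqP; rewrite eq_le; apply/andP; split; last exact: (ip_ge0 bP).
apply/ler_addgt0Pr => e e0; rewrite add0r.
have [|n hn] := vu (e / 4); first by rewrite divr_gt0.
have vn0 : nrm (@bform R N s) (hs_comp g (v n) - v n) = 0.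
  by rewrite /nrm; have := sv n i j c t ij ct c1; rewrite /sq_dist => ->; rewrite sqrtr0.
have E : hs_comp g u - u = (v n - u) - (hs_comp g (v n - u)) + (hs_comp g (v n) - v n).
  rewrite hs_compB opprB addrA -[_ + _ + hs_comp g (v n)]addrA subrK.
  by rewrite addrAC [v n - u]addrC addrK addrC.
rewrite /sq_dist -(nrm_sq bP) E.
have h1 : nrm (@bform R N s) (v n - u) ^+ 2 <= e / 4 by rewrite (nrm_sq bP).
have h2 : nrm (@bform R N s) (hs_comp g (v n - u)) ^+ 2 <= e / 4.
  by rewrite (nrm_sq bP) bform_comp.
have := ler_nrmD bP (v n - u - hs_comp g (v n - u)) (hs_comp g (v n) - v n).
rewrite vn0 addr0 => h3.
have := ler_nrmD bP (v n - u) (- hs_comp g (v n - u)); rewrite (nrmN bP) => h4.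
have key (a b d f : R) : a ^+ 2 <= e / 4 -> b ^+ 2 <= e / 4 -> f <= d -> d <= a + b ->
    0 <= a -> 0 <= b -> 0 <= f -> f ^+ 2 <= e.
  move=> k1 k2 k3 k4 a0 b0 f0; have : f <= a + b by lra.
  have := sqr_ge0 (a - b); nra.
by apply: key h1 h2 h3 h4 _ _ _; exact: nrm_ge0.
Qed.

Let near_ball (r : R) x y : R := (edist x y < r)%R%:R.

Let measurable_near_ball r x : measurable_fun setT (near_ball r x).
Proof.
pose A := (fun y => edist x y) @^-1` `]-oo, r[%classic.
have mA : measurable A.
  rewrite -[A]setTI; apply: (measurableT_comp measurable_edist (measurable_pair1 x)) => //.
rewrite (_ : near_ball r x = \1_A); first exact: measurable_indic.
apply/funext => y; rewrite /near_ball indicE; congr (_%:R); congr nat_of_bool.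
by apply/idP/idP => [h|/set_mem]; [apply/mem_set|]; rewrite /A /= in_itv.
Qed.

Let ball_mass (r : R) u x : \bar R := (\int[leb]_y (u y ^+ 2 * near_ball r x y)%:E)%E.

Let measurable_ball_mass r u x : measurable_fun setT (fun y => (u y ^+ 2 * near_ball r x y)%:E).
Proof.
apply/measurable_EFinP; apply: measurable_funM; last exact: measurable_near_ball.
by apply: measurable_funX; exact: hs_measurable.
Qed.

Let ball_mass_rot r u x i j c t (ij : i != j) (ct : c ^+ 2 + t ^+ 2 = 1) (c1 : -1 < c) :
  rot_invariant u -> ball_mass r u (rot i j c t x) = ball_mass r u x.
Proof.
move=> su; have gP := isometry_rot ij ct c1; rewrite /ball_mass.
have nb0 z y : 0 <= near_ball r z y by rewrite /near_ball ler0n.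
rewrite -(isometry_integral gP); last 2 first.
- exact: measurable_ball_mass.
- by move=> y; rewrite lee_fin mulr_ge0 ?sqr_ge0.
apply: ge0_ae_eq_integral => //.
- exact: (measurableT_comp (measurable_ball_mass r u (rot i j c t x)) (isometry_measurable gP)).
- by move=> y _; rewrite lee_fin mulr_ge0 ?sqr_ge0.
- by move=> y _; rewrite lee_fin mulr_ge0 ?sqr_ge0.
have := sq_dist0_ae (su i j c t ij ct c1); apply: filterS => y /= -> _.
by rewrite /near_ball (isometry_edist gP).
Qed.

Let ball_mass_sum r u n (p : 'I_n -> Rn R N) :
  (forall k l, k != l -> 2 * r <= edist (p k) (p l)) ->
  (\sum_(k < n) ball_mass r u (p k) <= (bform u u)%:E)%E.
Proof.
move=> sep; have nb0 z y : 0 <= near_ball r z y by rewrite /near_ball ler0n.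
rewrite -(ge0_integral_sum leb measurableT (f := fun k y => (u y ^+ 2 * near_ball r (p k) y)%:E));
  [|by move=> k; exact: measurable_ball_mass|by move=> k y _; rewrite lee_fin mulr_ge0 ?sqr_ge0].
rewrite bform_sqE; apply: ge0_le_integral => //.
- by move=> y _; apply: sume_ge0 => k _; rewrite lee_fin mulr_ge0 ?sqr_ge0.
- by apply: emeasurable_sum => k; exact: measurable_ball_mass.
- by apply: measurable_EFin_sq; exact: hs_measurable.
move=> y _; rewrite sumEFin lee_fin -mulr_sumr ler_piMr ?sqr_ge0//.
have [[k hk]|h] := pselect (exists k, edist (p k) y < r); last first.
  rewrite big1// => k _; rewrite /near_ball; case: (ltP (edist (p k) y) r) => // hk.
  by exfalso; apply: h; exists k.
rewrite (bigD1 k)//= [X in _ + X]big1 ?addr0 /near_ball ?hk// => l lk.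
case: (ltP (edist (p l) y) r) => // hl; have := sep k l; rewrite eq_sym => /(_ lk).
have := edist_triangle y (p k) (p l); rewrite (edistC y); lra.
Qed.

(** A substitute for the radial decay lemma: on the orbit of a point far from the origin there is
    room for [n + 1] disjoint balls of radius [r], and rotation invariance gives all of them the
    same mass. *)
Let ball_mass_far (r : R) (n : nat) u x : 0 < r -> rot_invariant u ->
  2 * r * N%:R * n.+1%:R <= enorm x -> (n.+1%:R%:E * ball_mass r u x <= (bform u u)%:E)%E.
Proof.
move=> r0 su xfar; have N0 : (0 : R) < N%:R by rewrite ltr0n (leq_trans _ N2).
have n0 : (0 : R) < n.+1%:R by rewrite ltr0n.
have N00 : (0 < N)%N by exact: leq_trans N2.
pose i0 := Ordinal N00.
(* The largest coordinate has modulus at least [enorm x / N]; rotating in a plane that contains it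
   moves [x] by a controlled amount. *)
have [i hi] : exists i : 'I_N, forall k, `|tnth x k| <= `|tnth x i|.
  by case: (@arg_maxP _ R 'I_N i0 xpredT (fun i => `|tnth x i|) isT) => i _ hi; exists i => k; exact: hi.
have {hi} xi : 2 * r * n.+1%:R <= `|tnth x i|.
  have := enorm_le_coord (normr_ge0 _) hi => h.
  by rewrite -(ler_pM2l N0); apply: le_trans h; apply: le_trans xfar; rewrite mulrCA !mulrA.
have [i' ii'] : exists i' : 'I_N, i != i'.
  have N1 : (1 < N)%N by exact: leq_trans N2.
  have [iE|iE] := eqVneq i (Ordinal N00); last by exists (Ordinal N00).
  by exists (Ordinal N1); rewrite iE.
(* Equally spaced cosines: distinct ones differ by at least [1 / (n + 1)], and none is negative, so
   the excluded half turn does not occur. *)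
pose c (l : 'I_n.+1) : R := l%:R / n.+1%:R.
have c0 l : 0 <= c l by rewrite divr_ge0.
have c1 l : c l <= 1 by rewrite ler_pdivrMr// mul1r ler_nat ltnW.
pose t l := Num.sqrt (1 - c l ^+ 2).
have ct l : c l ^+ 2 + t l ^+ 2 = 1.
  by rewrite sqr_sqrtr; [rewrite addrC subrK|rewrite subr_ge0 exprn_ile1].
pose p l := rot i i' (c l) (t l) x.
have sep k l : k != l -> 2 * r <= edist (p k) (p l).
  move=> kl; rewrite -(@ler_pXn2r _ 2)// ?nnegrE ?edist_ge0 ?mulr_ge0 ?(ltW r0)//.
  apply: le_trans (edist_rot_coord _ _ _ _ _ ii').
  have h1 : n.+1%:R ^- 2 <= (c k - c l) ^+ 2.
    rewrite /c -mulrBl exprMn exprVn ler_peMl ?invr_ge0 ?exprn_ge0//.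
    rewrite -[leRHS]real_normK ?num_real// exprn_ege1//.
    move: kl; rewrite neq_ltn -!(ltr_nat R) => /orP[] kl; rewrite ler_normr.
      by apply/orP; right; rewrite opprB lerBrDl natr1 ler_nat -(ltr_nat R).
    by apply/orP; left; rewrite lerBrDl natr1 ler_nat -(ltr_nat R).
  have h2 : (2 * r * n.+1%:R) ^+ 2 <= tnth x i ^+ 2.
    rewrite -[leRHS]real_normK ?num_real// ler_pXn2r ?nnegrE//.
    by rewrite !mulr_ge0 ?(ltW r0) ?(ltW n0).
  apply: le_trans (ler_pM _ _ h1 h2); rewrite ?sqr_ge0 ?invr_ge0 ?exprn_ge0//.
  by rewrite le_eqVlt; apply/orP; left; apply/eqP; field; rewrite gt_eqF.
apply: le_trans (ball_mass_sum u sep).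
rewrite (eq_bigr (fun=> ball_mass r u x)); last first.
  by move=> l _; apply: ball_mass_rot => //; exact: lt_le_trans (c0 l).
rewrite le_eqVlt; apply/orP; left; apply/eqP.
rewrite sumr_const card_ord.
by rewrite -[RHS]mule_natl.
Qed.

Definition lattice_pt (j : nat) (z : {ffun 'I_N -> int}) : Rn R N :=
  [tuple (z i)%:~R / 2 ^+ j | i < N].

(** An enumeration of all dyadic cubes, of all sizes, by pickling; numbers that code no cube give
    the zero function. *)
Definition cube_test (k : nat) : Rn R N -> R :=
  if unpickle k is Some (j, z) then cube j (lattice_pt j z) else 0.

Lemma cube_test_L2 k : L2 leb (cube_test k).
Proof. by rewrite /cube_test; case: unpickle => [[j z]|]; [exact: cube_L2|exact: L2_0]. Qed.

Lemma measurable_gt (v : Rn R N -> R) (e : R) : measurable_fun setT v ->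
  measurable_fun setT (fun x => (e < `|v x|)%R%:R : R).
Proof.
move=> mv; pose A := (fun y => `|v y|) @^-1` `]e, +oo[%classic.
have mn : measurable_fun setT (fun y => `|v y|) by exact: measurableT_comp.
have mA : measurable A by rewrite -[A]setTI; apply: mn => //; exact: measurable_itv.
rewrite (_ : (fun x => _) = \1_A); first exact: measurable_indic.
apply/funext => y; rewrite indicE; congr (_%:R); congr nat_of_bool.
by apply/idP/idP => [h|/set_mem]; [apply/mem_set|]; rewrite /A /= in_itv/= andbT.
Qed.

Definition measure_gt (e : R) (v : Rn R N -> R) : \bar R :=
  (\int[leb]_x ((e < `|v x|)%R%:R)%:E)%E.

Lemma measure_gt_markov (e : R) (v : Rn R N -> R) : 0 < e -> measurable_fun setT v ->
  (measure_gt e v <= (e ^- 2)%:E * \int[leb]_x (v x ^+ 2)%:E)%E.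
Proof.
move=> e0 mv; have msq := measurable_EFin_sq mv.
rewrite -(ge0_integralZl leb measurableT msq); last 2 first.
- by move=> x _; rewrite lee_fin sqr_ge0.
- by rewrite lee_fin invr_ge0 exprn_ge0// ltW.
apply: ge0_le_integral => //.
- by apply/measurable_EFinP; exact: measurable_gt.
- exact: emeasurable_funM.
move=> x _; rewrite -EFinM lee_fin; case: ltP => [h|_] /=.
  rewrite mulrC ler_pdivlMr ?exprn_gt0// mul1r -[leRHS]real_normK ?num_real//.
  by rewrite ler_pXn2r ?nnegrE ?(ltW e0)// ltW.
by rewrite mulr_ge0 ?sqr_ge0// invr_ge0 exprn_ge0// ltW.
Qed.

(** On a fine enough grid [w] is close in measure to its cube averages, uniformly on bounded sets.
    These averages are small far away by [ball_mass_far], and the cubes near the origin are finitely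
    many, so testing them makes every average at most [e / 2]. Then [|w| > e] only where the
    deviation exceeds [e / 2]. *)
Lemma cube_small_measure (B e : R) : 0 < B -> 0 < e -> exists (K : nat) (eta : R),
  0 < eta /\ forall w, rot_invariant w -> aform w w + bform w w <= B ->
  (forall k, (k < K)%N -> `|l2 leb w (cube_test k)| <= eta) ->
  (measure_gt e w <= e%:E)%E.
Proof.
move=> B0 e0.
have s0 : 0 < s by case/andP: s01.
pose C := N%:R `^ (N%:R + 2 * s).
have C0 : 0 <= C by rewrite powR_ge0.
have tau1 : 1 < 2 `^ (2 * s).
  have : (1 : R) `^ (2 * s) < 2 `^ (2 * s); last by rewrite powR1.
  by apply: gt0_ltr_powR; rewrite ?nnegrE ?ltr1n// mulr_gt0.
(* The scale: the left side is the Markov bound, at level [e / 2], for the deviation from the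
   averages. *)
have [j hj] : exists j, C * (2 `^ (- (2 * s))) ^+ j * B * (e / 2) ^- 2 <= e.
  pose y := Num.max 1 (C * B * (e / 2) ^- 2 / e).
  have y1 : 1 <= y by rewrite le_max lexx.
  have [j /andP[_ hj]] := exists_expr_itv tau1 y1; exists j.+1.
  rewrite powRN exprVn; have t0 : 0 < (2 `^ (2 * s)) ^+ j.+1 by rewrite exprn_gt0// (lt_trans ltr01).
  rewrite -(ler_pM2r t0); move: hj; rewrite gt_max => /andP[_]; rewrite ltr_pdivrMr// => /ltW h.
  move: h t0; move: (_ ^+ j.+1) => a h a0.
  apply: le_trans (_ : C * B * (e / 2) ^- 2 <= _).
    by rewrite le_eqVlt; apply/orP; left; apply/eqP; field; rewrite !gt_eqF.
  by rewrite [leRHS]mulrC.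
have p0 : (0 : R) < 2 ^+ (j * N) by rewrite exprn_gt0.
(* With at least [Y] disjoint balls sharing a mass at most [B], the average over a cube inside one
   of them is at most [e / 2]. *)
pose Y := 2 ^+ (j * N) * B / (e / 2) ^+ 2.
have Y0 : 0 <= Y by rewrite divr_ge0 ?mulr_ge0 ?exprn_ge0 ?divr_ge0 ?(ltW p0) ?(ltW B0) ?(ltW e0).
pose n := Num.bound Y.
have hn : Y <= n.+1%:R by apply: le_trans (ltW (archi_boundP Y0)) _; rewrite ler_nat.
(* Larger than the diameter of any cube of side at most 1, so that the cube of [x] lies in the ball
   of radius [r] about [x]. *)
pose r : R := N%:R + 1.
have r0 : 0 < r by rewrite ltr_wpDl.
pose R0 := 2 * r * N%:R * n.+1%:R.
have R00 : 0 <= R0 by rewrite !mulr_ge0// ltW.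
pose Z := Num.bound (2 ^+ j * R0 + 1).
have hZ : 2 ^+ j * R0 + 1 < Z%:R by apply: archi_boundP; rewrite addr_ge0// mulr_ge0// exprn_ge0.
(* Integer multi-indices with entries between [-Z] and [Z], shifted into a finite type; they cover
   all cubes that meet the ball of radius [R0], and [K] exceeds all their codes. *)
pose zf (g : {ffun 'I_N -> 'I_(2 * Z).+1}) : {ffun 'I_N -> int} := [ffun i => (g i)%:Z - Z%:Z].
pose K := (\max_(g : {ffun 'I_N -> 'I_(2 * Z).+1}) pickle (j, zf g)).+1.
exists K, (e / 2 / 2 ^+ (j * N)); split; first by rewrite !divr_gt0.
move=> w sw wB small.
have a0 := ip_ge0 aP w; have b0 := ip_ge0 bP w.
have avg x : `|cube_avg j w x| <= e / 2.
  have [xfar|xnear] := leP R0 (enorm x).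
    rewrite -(@ler_pXn2r _ 2)// ?nnegrE ?divr_ge0 ?(ltW e0)// real_normK ?num_real//.
    apply: le_trans (cube_avg_bound j x (hs_L2 w)) _.
    have := ball_mass_far r0 sw xfar.
    have LE : ((l2 leb (w \* cube j x) (w \* cube j x))%:E <= ball_mass r w x)%E.
      rewrite l2_sqE; last by apply: L2_mul_cube; exact: hs_L2.
      apply: ge0_le_integral => //.
      - by move=> y _; rewrite lee_fin sqr_ge0.
      - apply: measurable_EFin_sq; apply: measurable_funM; first exact: hs_measurable.
        exact: measurable_cube.
      - move=> y _; rewrite lee_fin /= exprMn ler_wpM2l ?sqr_ge0// expr2 cube_sq.
        rewrite /cube /near_ball; case: (boolP (same_cube j x y)) => //= xy.
        suff -> : edist x y < r by [].
        apply: le_lt_trans (same_cube_edist xy) _.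
        apply: (@le_lt_trans _ _ N%:R); last by rewrite /r ltrDl.
        by rewrite ler_piMr// invf_le1 ?exprn_gt0// exprn_ege1// ler1n.
    move=> h2; have {h2 LE} : (n.+1%:R%:E * (l2 leb (w \* cube j x) (w \* cube j x))%:E <= (bform w w)%:E)%E.
      by apply: le_trans h2; rewrite lee_wpmul2l// lee_fin.
    rewrite -EFinM lee_fin; move: (l2 _ _ _) (l2_ge0 leb (w \* cube j x)) => l l0 nl.
    have n0 : (0 : R) < n.+1%:R by rewrite ltr0n.
    move: hn; rewrite /Y ler_pdivrMr ?exprn_gt0 ?divr_gt0// => hn.
    rewrite -(ler_pM2l n0) mulrCA; apply: le_trans hn; rewrite ler_pM2l//.
    by apply: le_trans nl _; lra.
  pose z i := Num.floor (2 ^+ j * tnth x i).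
  have j0 : (0 : R) < 2 ^+ j by rewrite exprn_gt0.
  have zZ i : - Z%:Z <= z i <= Z%:Z.
    have : `|2 ^+ j * tnth x i| <= 2 ^+ j * R0.
      rewrite normrM (gtr0_norm j0) ler_pM2l//.
      exact: le_trans (ler_enorm_coord x i) (ltW xnear).
    have := floor_itv (2 ^+ j * tnth x i); rewrite -/(z i) ler_norml rmorphD/=.
    move=> /andP[h1 h2] /andP[h3 h4].
    rewrite -!(ler_int R) rmorphN /= -[Z%:Z%:~R]/(Z%:R : R); apply/andP; split; lra.
  pose g : {ffun 'I_N -> 'I_(2 * Z).+1} := [ffun i => inord (absz (z i + Z%:Z))].
  have gz : zf g = [ffun i => z i].
    by apply/ffunP => i; have [h1 h2] := absz_shift (zZ i); rewrite !ffunE inordK.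
  have xl : same_cube j x (lattice_pt j (zf g)).
    apply/same_cubeP => i; rewrite tnth_mktuple gz ffunE mulrCA mulfV ?gt_eqF// mulr1.
    by rewrite intrKfloor.
  rewrite (cube_avg_same w xl) /cube_avg normrM gtr0_norm// mulrC -ler_pdivlMr//.
  have kK : (pickle (j, zf g) < K)%N.
    by rewrite /K ltnS (leq_bigmax (F := fun g => pickle (j, zf g)) g).
  by have := small _ kK; rewrite /cube_test pickleK.
have mP : measurable_fun setT (cube_avg j w) by apply: measurable_cube_avg; exact: hs_L2.
have md : measurable_fun setT (fun x => w x - cube_avg j w x).
  by apply: measurable_funB => //; exact: hs_measurable.
have e20 : 0 < e / 2 by rewrite divr_gt0.
apply: (@le_trans _ _ (measure_gt (e / 2) (fun x => w x - cube_avg j w x))).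
  apply: ge0_le_integral => //.
  - by apply/measurable_EFinP; apply: measurable_gt; exact: hs_measurable.
  - by apply/measurable_EFinP; exact: measurable_gt.
  move=> x _; rewrite lee_fin; case: (ltP e) => //= ew.
  suff -> : e / 2 < `|w x - cube_avg j w x| by [].
  have := ler_normD (w x - cube_avg j w x) (cube_avg j w x).
  by rewrite subrK; have := avg x; lra.
apply: le_trans (measure_gt_markov e20 md) _.
apply: (@le_trans _ _ ((e / 2) ^- 2 * (C * (2 `^ (- (2 * s))) ^+ j * aform w w))%:E).
  rewrite [leRHS]EFinM lee_wpmul2l ?lee_fin ?invr_ge0 ?exprn_ge0 ?(ltW e20)//.
  exact: cube_avg_L2_dist.
rewrite lee_fin mulrC; apply: le_trans hj.
rewrite ler_wpM2r ?invr_ge0 ?exprn_ge0 ?(ltW e20)// ler_wpM2l//; last lra.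
by rewrite mulr_ge0// exprn_ge0// powR_ge0.
Qed.

End radial_compactness.

(** * Subcritical nonlinearities *)

Section continuous_on_segment.
Context {R : realType}.
Implicit Types (k : R -> R) (L e : R).

Lemma uniform_continuity k L e : continuous k -> 0 < e -> exists2 d : R, 0 < d &
  forall x y, `|x| <= L -> `|x - y| <= d -> `|k x - k y| <= e.
Proof.
move=> ck e0.
have := @segment_compact R (- L) L; rewrite compact_near_coveringP => cov.
have [|d /= d0 hd] := cov _ (0 : R)^'+
    (fun d x => forall y, `|x - y| <= d -> `|k x - k y| <= e) _.
  move=> x _; have e20 : 0 < e / 2 by rewrite divr_gt0.
  have /cvgrPdist_lt/(_ _ e20)[r /= r0 hr] := ck x.
  exists (ball x (r / 2), ball 0 (r / 2)) => [|[x' d] /= [xx' d0 y xy]].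
    split; first by apply: nbhsx_ballx; rewrite divr_gt0.
    by exists (r / 2) => /= [|y h _]; first by rewrite divr_gt0.
  have h1 : `|k x - k x'| < e / 2 by apply: hr; apply: lt_trans xx' _; rewrite ltr_pdivrMr// ltr_pMr// ltr1n.
  have h2 : `|k x - k y| < e / 2.
    apply: hr; rewrite /ball/=; have := ler_normD (x - x') (x' - y).
    rewrite addrA subrK; move: xx' d0; rewrite /ball/= sub0r normrN => xx' d0.
    have := ler_norm d; lra.
  have := ler_normB (k x - k y) (k x - k x').
  by rewrite opprB addrC addrA subrK; lra.
exists (d / 2); first by rewrite divr_gt0.
move=> x y xL xy; apply: (hd (d / 2)) => //=.
- by rewrite sub0r normrN gtr0_norm ?divr_gt0// ltr_pdivrMr// ltr_pMr// ltr1n.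
- by rewrite divr_gt0.
- by rewrite in_itv/= -ler_norml.
Qed.

Lemma bounded_on_segment k L : continuous k -> exists2 C : R, 0 < C &
  forall x, `|x| <= L -> `|k x| <= C.
Proof.
move=> ck; have [L0|L0] := leP 0 L; last first.
  by exists 1 => // x xL; have := normr_ge0 x; lra.
have [||c _ hc] := @EVT_max R (fun x => `|k x|) (- L) L; first lra.
  apply: continuous_subspaceT => x; apply: cvg_norm; exact: ck.
exists (`|k c| + 1) => [|x xL]; first by have := normr_ge0 (k c); lra.
by have := hc x; rewrite in_itv/= -ler_norml => /(_ xL); lra.
Qed.

Lemma positive_on_annulus k a L : continuous k -> (forall x, x != 0 -> 0 < k x) -> 0 < a -> a <= L ->
  exists2 c : R, 0 < c & forall x, a <= `|x| -> `|x| <= L -> c <= k x.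
Proof.
move=> ck k0 a0 aL.
have [|c1 c1I h1] := @EVT_min R k a L aL; first exact: continuous_subspaceT.
have [||c2 c2I h2] := @EVT_min R k (- L) (- a); first lra.
  exact: continuous_subspaceT.
move: c1I c2I; rewrite !in_itv/= => /andP[a1 _] /andP[_ a2].
have k1 : 0 < k c1 by apply: k0; rewrite gt_eqF//; lra.
have k2 : 0 < k c2 by apply: k0; rewrite lt_eqF//; lra.
exists (Num.min (k c1) (k c2)); first by rewrite lt_min k1.
move=> x; have [x0|x0] := leP 0 x; rewrite ge_min.
  by rewrite ger0_norm// => ax xL; rewrite h1// in_itv/= ax.
by rewrite ltr0_norm// => ax xL; rewrite h2 ?orbT// in_itv/=; apply/andP; split; lra.
Qed.

End continuous_on_segment.

Section subcritical.
Context {R : realType}.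
Variable (q : R).
Hypothesis q2 : 2 < q.
Implicit Types (k z : R -> R) (d : nat) (x a c M e L : R).

(** The weight whose integral is bounded on bounded sets of H^s: the mass plus the critical power.
    Every nonlinear integrand is compared with it. *)
Definition crit_growth x : R := x ^+ 2 + `|x| `^ q.
Local Notation W := crit_growth.

Let q0 : 0 < q. Proof. by apply: lt_trans q2. Qed.

Lemma crit_growth_ge0 x : 0 <= W x.
Proof. by rewrite addr_ge0 ?sqr_ge0 ?powR_ge0. Qed.

Lemma ler_crit_growth x y : `|x| <= `|y| -> W x <= W y.
Proof.
move=> xy; rewrite /W -(real_normK (num_real x)) -(real_normK (num_real y)).
by rewrite lerD ?ler_pXn2r ?nnegrE//; apply: ge0_ler_powR; rewrite ?nnegrE// ltW.
Qed.

Lemma crit_growth_gt0 x : x != 0 -> 0 < W x.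
Proof. by move=> x0; rewrite ltr_pwDl ?powR_ge0// exprn_even_gt0. Qed.

(* The parameter d distinguishes the energy density (d = 0) from its
   derivative (d = 1), which is paired with a test function. *)
Definition subcrit d k : Prop := continuous k /\ forall e, 0 < e ->
  exists eta L, [/\ 0 < eta, eta <= L & forall M, 0 <= M -> M < eta \/ L < M ->
    forall x, `|x| <= 8 * M -> `|k x| * M ^+ d <= e * W M].

Lemma subcrit_continuous d k : subcrit d k -> continuous k. Proof. by case. Qed.

Lemma subcrit_bound d k : subcrit d k -> exists2 C : R, 0 < C &
  forall M x, 0 <= M -> `|x| <= 8 * M -> `|k x| * M ^+ d <= C * W M.
Proof.
move=> [ck hk]; have [eta [L [eta0 eL hL]]] := hk 1 ltr01.
have [C0 C00 hC0] := bounded_on_segment (8 * L) ck.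
have W0 : 0 < W eta by apply: crit_growth_gt0; rewrite gt_eqF.
have L0 : 0 < L by apply: lt_le_trans eL.
exists (1 + C0 * L ^+ d / W eta).
  by rewrite addr_gt0 ?divr_gt0 ?mulr_gt0 ?exprn_gt0.
move=> M x M0 xM; have WM := crit_growth_ge0 M; rewrite mulrDl.
have T0 : 0 <= C0 * L ^+ d / W eta * W M.
  by rewrite mulr_ge0// divr_ge0 ?mulr_ge0 ?exprn_ge0 ?(ltW W0) ?(ltW C00) ?(ltW L0).
have [Me|Me] := ltP M eta.
  by have := hL M M0 (or_introl Me) x xM; lra.
have [ML|ML] := ltP L M.
  by have := hL M M0 (or_intror ML) x xM; lra.
apply: (@le_trans _ _ (C0 * L ^+ d)).
  apply: ler_pM; rewrite ?exprn_ge0//.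
    by apply: hC0; apply: le_trans xM _; rewrite ler_pM2l.
  by rewrite lerXn2r ?nnegrE// ltW.
apply: (@le_trans _ _ (C0 * L ^+ d / W eta * W M)); last by rewrite lerDr mul1r.
rewrite -mulrA ler_peMr ?mulr_ge0 ?exprn_ge0 ?(ltW C00) ?(ltW L0)//.
by rewrite mulrC ler_pdivlMr// mul1r ler_crit_growth// !ger0_norm// ltW.
Qed.

Lemma crit_growth_max3 x y w : exists2 M, [/\ 0 <= M, `|x| <= M, `|y| <= M & `|w| <= M] &
  W M <= W x + W y + W w.
Proof.
have Wx := crit_growth_ge0 x; have Wy := crit_growth_ge0 y; have Ww := crit_growth_ge0 w.
have Wn v : W `|v| = W v by rewrite /W normr_id real_normK ?num_real.
exists (Num.max `|x| (Num.max `|y| `|w|)).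
  by rewrite !le_max !lexx !normr_ge0 !orbT.
by case: (leP (Num.max _ _)); case: (leP `|y|) => _ _; rewrite Wn; lra.
Qed.

(** Take [M] as the largest of [|a|], [|c|], [|w|]. For small or large [M] both values of [k] are
    absorbed by [e * W M]; in between uniform continuity on a segment applies. Only continuity of
    [k] is required, and the estimate is uniform in the unbounded variables. *)
Lemma subcrit_perturb d k e : subcrit d k -> 0 < e -> exists2 eta : R, 0 < eta <= 1 / 2 &
  forall t r a c w, `|t - 1| <= eta -> `|r| <= eta ->
    `|k (t * (a + r * c)) - k a| * `|w| ^+ d <= e * (W a + W c + W w).
Proof.
move=> [ck hk] e0; have e20 : 0 < e / 2 by rewrite divr_gt0.
have [eta0 [L [eta00 eL hL]]] := hk _ e20.
have L0 : 0 < L by apply: lt_le_trans eL.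
have W0 : 0 < W eta0 by apply: crit_growth_gt0; rewrite gt_eqF.
have rho0 : 0 < e * W eta0 / L ^+ d by rewrite divr_gt0 ?mulr_gt0 ?exprn_gt0.
have [dl dl0 hd] := uniform_continuity L ck rho0.
exists (Num.min (1 / 2) (dl / (3 * L))).
  by rewrite lt_min ge_min lexx !divr_gt0 ?mulr_gt0.
move=> t r a c w; rewrite !le_min => /andP[t1 t2] /andP[r1 r2].
have [M [M0 aM cM wM] WM] := crit_growth_max3 a c w.
apply: (@le_trans _ _ (e * W M)); last by rewrite ler_pM2l.
have wMd : `|w| ^+ d <= M ^+ d by rewrite lerXn2r ?nnegrE.
have rc : `|r * c| <= M / 2.
  by rewrite normrM; apply: le_trans (ler_pM _ _ r1 cM) _ => //; lra.
have arc : `|a + r * c| <= M + M / 2 by apply: le_trans (ler_normD _ _) _; lra.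
have t3 : `|t| <= 1 + 1 / 2 by have := ler_normD (t - 1) 1; rewrite subrK normr1; lra.
(* Here [|t|] is at most 3/2 and [|a + r * c|] at most [3/2 * M]; the factor 8 in [subcrit] leaves
   room for this. *)
have tarc : `|t * (a + r * c)| <= 8 * M.
  by rewrite normrM; apply: le_trans (ler_pM _ _ t3 arc) _ => //; lra.
have aM8 : `|a| <= 8 * M by lra.
have far : M < eta0 \/ L < M -> `|k (t * (a + r * c)) - k a| * `|w| ^+ d <= e * W M.
  move=> ML; have h1 := hL M M0 ML _ tarc; have h2 := hL M M0 ML _ aM8.
  apply: le_trans (ler_wpM2l (normr_ge0 _) wMd) _.
  apply: le_trans (ler_wpM2r (exprn_ge0 _ M0) (ler_normB _ _)) _; rewrite mulrDl; lra.
have [Me|Me] := ltP M eta0; first by apply: far; left.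
have [ML|ML] := ltP L M; first by apply: far; right.
have close : `|a - t * (a + r * c)| <= dl.
  have -> : a - t * (a + r * c) = (1 - t) * (a + r * c) - r * c by ring.
  apply: le_trans (ler_normB _ _) _; rewrite !normrM distrC.
  have dL : dl = dl / (3 * L) * (3 * L) by field; rewrite gt_eqF.
  have := ler_pM (normr_ge0 _) (normr_ge0 _) t2 arc.
  have := ler_pM (normr_ge0 _) (normr_ge0 _) r2 cM.
  have D0 : 0 < dl / (3 * L) by rewrite divr_gt0 ?mulr_gt0.
  move=> h1 h2; rewrite [leRHS]dL.
  by move: (dl / _) D0 h1 h2 => D D0; nra.
have := hd _ _ (le_trans aM ML) close; rewrite distrC => hk1.
apply: le_trans (ler_pM (normr_ge0 _) (exprn_ge0 _ (normr_ge0 _)) hk1 wMd) _.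
apply: (@le_trans _ _ (e * W eta0)).
  rewrite mulrAC ler_pdivrMr ?exprn_gt0// ler_pM2l ?mulr_gt0//.
  by rewrite lerXn2r ?nnegrE// ltW.
by rewrite ler_pM2l// ler_crit_growth// !ger0_norm// ltW.
Qed.

Lemma subcrit_le_cutoff k e : subcrit 0 k -> 0 < e -> exists dl C, [/\ 0 < dl, 0 < C &
  forall a, `|k a| <= e * W a + C * (dl < `|a|)%R%:R].
Proof.
move=> [ck hk] e0; have [eta [L [eta0 eL hL]]] := hk _ e0.
have [C C0 hC] := bounded_on_segment L ck.
exists (eta / 2), C; split; rewrite ?divr_gt0// => a.
have Wa := mulr_ge0 (ltW e0) (crit_growth_ge0 a).
have Wn v : W `|v| = W v by rewrite /W normr_id real_normK ?num_real.
have [ae|ae] := ltP `|a| eta.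
  have := hL `|a| (normr_ge0 _) (or_introl ae) a; rewrite Wn expr0 mulr1 => h.
  apply: le_trans (h _) _; first by rewrite ler_peMl ?ler1n.
  by rewrite lerDl mulr_ge0 ?(ltW C0).
have [aL|aL] := ltP L `|a|.
  have := hL `|a| (normr_ge0 _) (or_intror aL) a; rewrite Wn expr0 mulr1 => h.
  apply: le_trans (h _) _; first by rewrite ler_peMl ?ler1n.
  by rewrite lerDl mulr_ge0 ?(ltW C0).
have -> : (eta / 2 < `|a|) = true by apply/idP; lra.
by have := hC a aL; rewrite mulr1; lra.
Qed.

(** The cutoff bears on [c] rather than on [a]: in applications [c] is a difference of two
    functions, known to be small in measure, while [a] is only bounded in H^s. *)
Lemma subcrit_mul_le_cutoff k e : subcrit 1 k -> 0 < e -> exists dl C, [/\ 0 < dl, 0 < C &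
  forall a c, `|k a| * `|c| <= e * (W a + W c) + C * (dl < `|c|)%R%:R].
Proof.
move=> [ck hk] e0; have [eta [L [eta0 eL hL]]] := hk _ e0.
have L0 : 0 < L by apply: lt_le_trans eL.
have [C C0 hC] := bounded_on_segment L ck.
have W0 : 0 < W eta by apply: crit_growth_gt0; rewrite gt_eqF.
exists (e * W eta / C), (C * L); split; rewrite ?mulr_gt0 ?invr_gt0//.
move=> a c; have [M [M0 aM cM _] ] := crit_growth_max3 a c 0.
have -> : W 0 = 0 by rewrite /W expr0n normr0 powR0 ?addr0// gt_eqF.
rewrite addr0 => WM; have I0 : 0 <= C * L * (e * W eta / C < `|c|)%R%:R.
  by rewrite mulr_ge0// mulr_ge0// ltW.
have WMe : e * W M <= e * (W a + W c) by rewrite ler_pM2l.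
have aM8 : `|a| <= 8 * M by lra.
have kc : `|k a| * `|c| <= `|k a| * M by rewrite ler_wpM2l.
have [Me|Me] := ltP M eta.
  by have := hL M M0 (or_introl Me) a aM8; rewrite expr1; lra.
have [ML|ML] := ltP L M.
  by have := hL M M0 (or_intror ML) a aM8; rewrite expr1; lra.
have kC := hC a (le_trans aM ML).
have [|cs] := ltP _ `|c|.
  move=> _; rewrite mulr1; have := ler_pM (normr_ge0 _) (normr_ge0 _) kC (le_trans cM ML).
  have : 0 <= e * (W a + W c).
    by rewrite mulr_ge0 ?(ltW e0)// addr_ge0// crit_growth_ge0.
  lra.
rewrite mulr0 addr0; apply: le_trans WMe.
apply: le_trans (ler_pM (normr_ge0 _) (normr_ge0 _) kC cs) _.
have -> : C * (e * W eta / C) = e * W eta by field; rewrite gt_eqF.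
by rewrite ler_pM2l// ler_crit_growth// !ger0_norm// ltW.
Qed.

(** On the annulus where [k] is not absorbed by [W], the positive continuous [z] has a positive
    minimum. Lower bounds on one integral can thus be transferred to any other positive
    integrand. *)
Lemma subcrit_le_pos k z e : subcrit 0 k -> continuous z -> (forall x, x != 0 -> 0 < z x) ->
  0 <= z 0 -> 0 < e -> exists2 C : R, 0 < C & forall a, `|k a| <= e * W a + C * z a.
Proof.
move=> [ck hk] cz z0 z00 e0; have [eta [L [eta0 eL hL]]] := hk _ e0.
have [C C0 hC] := bounded_on_segment L ck.
have [c c0 hc] := positive_on_annulus cz z0 eta0 eL.
have zp x : 0 <= z x by have [->//|/z0/ltW] := eqVneq x 0.
exists (C / c); first by rewrite divr_gt0.
move=> a; have Wa := mulr_ge0 (ltW e0) (crit_growth_ge0 a).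
have Wn v : W `|v| = W v by rewrite /W normr_id real_normK ?num_real.
have Z0 : 0 <= C / c * z a by rewrite mulr_ge0// divr_ge0// ltW.
have [ae|ae] := ltP `|a| eta.
  have := hL `|a| (normr_ge0 _) (or_introl ae) a; rewrite Wn expr0 mulr1 => h.
  by apply: le_trans (h _) _; [rewrite ler_peMl ?ler1n|rewrite lerDl].
have [aL|aL] := ltP L `|a|.
  have := hL `|a| (normr_ge0 _) (or_intror aL) a; rewrite Wn expr0 mulr1 => h.
  by apply: le_trans (h _) _; [rewrite ler_peMl ?ler1n|rewrite lerDl].
apply: le_trans (hC a aL) _; apply: (@le_trans _ _ (C / c * z a)); last by rewrite lerDr.
by rewrite -mulrA ler_peMr ?(ltW C0)// mulrC ler_pdivlMr// mul1r hc.
Qed.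

End subcritical.

(** * The primitive of the nonlinearity *)

Section primitive_theory.
Context {R : realType}.
Variable f : R -> R.
Hypotheses (f_cont : continuous f) (f_odd : forall t, f (- t) = - f t).
Local Notation F := (primitive f).

Let leb1 := @lebesgue_measure R.

Let f_int (a b : R) : leb1.-integrable `[a, b] (EFin \o f).
Proof.
apply: continuous_compact_integrable; first exact: segment_compact.
exact: continuous_subspaceT.
Qed.

Let f_int_oc (a b : R) : leb1.-integrable `]a, b] (EFin \o f).
Proof.
apply: integrableS (f_int a b) => //.
by apply: subset_itv; rewrite bnd_simp.
Qed.

Let primitiveE (a t : R) : a < 0 -> a < t ->
  F t = \int[leb1]_(r in `[a, t]) f r - \int[leb1]_(r in `[a, 0]) f r.
Proof.
move=> a0 at_; rewrite /primitive; case: leP => [t0|/ltW t0].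
  have -> := @Rintegral_itvB _ f (BLeft a) (BRight t) 0 (f_int a t); rewrite ?bnd_simp ?(ltW a0)//.
  by rewrite Rintegral_itv_obnd_cbnd//; exact: f_int_oc.
rewrite -opprB; congr (- _).
have -> := @Rintegral_itvB _ f (BLeft a) (BRight 0) t (f_int a 0); rewrite ?bnd_simp ?(ltW at_)//.
by rewrite Rintegral_itv_obnd_cbnd//; exact: f_int_oc.
Qed.

(** The primitive is defined by cases at 0. Near [t] it is rewritten with a base point [a] below
    both 0 and [t], for which the fundamental theorem of calculus applies without cases. *)
Lemma primitive_is_derive (t : R) : is_derive t 1 F (f t).
Proof.
pose a : R := Num.min 0 t - 1.
have m0 : Num.min 0 t <= 0 by rewrite ge_min lexx.
have mt : Num.min 0 t <= t by rewrite ge_min lexx orbT.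
have a0 : a < 0 by rewrite /a; lra.
have at_ : a < t by rewrite /a; lra.
have t1 : t < t + 1 by rewrite ltrDl.
have [d1 d2] := continuous_FTC1_closed t1 (f_int a (t + 1)) at_ (@f_cont t).
have D : is_derive t 1 (fun x => \int[leb1]_(r in `[a, x]) f r - \int[leb1]_(r in `[a, 0]) f r) (f t).
  rewrite -[f t]subr0; apply: is_deriveB; split => //.
  by rewrite -derive1E.
apply: near_eq_is_derive D; near=> x; rewrite (primitiveE a0)//.
by near: x; exact: lt_nbhsr.
Unshelve. all: by end_near. Qed.

Lemma primitive_continuous : continuous F.
Proof.
move=> t; apply: differentiable_continuous; apply/derivable1_diffP.
exact: (@ex_derive _ _ _ _ _ _ _ (primitive_is_derive t)).
Qed.

Lemma primitive0 : F 0 = 0.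
Proof. by rewrite /primitive lexx set_itv1 Rintegral_set1. Qed.

Lemma primitive_even t : F (- t) = F t.
Proof.
have D (x : R) : is_derive x 1 (fun y => F (- y) - F y) 0.
  rewrite (_ : 0 = - f (- x) - f x); last by rewrite f_odd opprK subrr.
  apply: is_deriveB; last exact: primitive_is_derive.
  have -> : - f (- x) = -1 *: f (- x) by rewrite scaleN1r.
  have dN : is_derive x 1 (-%R : R -> R) (-1) by apply: is_deriveN.
  by have := @is_derive1_comp _ F -%R x _ _ (primitive_is_derive (- x)) dN; rewrite mulrN1 scaleN1r.
have := is_derive_0_is_cst t 0 D.
by rewrite oppr0 subrr => /eqP; rewrite subr_eq0 => /eqP.
Qed.

Lemma primitive_mean_value x : exists xi, (`|xi| <= `|x|) /\ (x != 0 -> 0 < `|xi|) /\ F x = f xi * x.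
Proof.
have pos (y : R) : 0 < y -> exists xi, [/\ 0 < xi, xi < y & F y = f xi * y].
  move=> y0; have [||xi] := @MVT _ F f 0 y y0 _ _.
  - by move=> z _; exact: primitive_is_derive.
  - by apply: continuous_subspaceT => z; exact: primitive_continuous.
  by rewrite in_itv/= primitive0 !subr0 => /andP[? ?] ?; exists xi.
have [x0|x0|->] := ltgtP x 0.
- have [|xi [xi0 xix E]] := pos (- x); first by rewrite oppr_gt0.
  exists (- xi); rewrite normrN (gtr0_norm xi0) (ltr0_norm x0) (ltW xix); split=> //; split=> //.
  by rewrite -primitive_even E f_odd mulrN mulNr.
- have [xi [xi0 xix E]] := pos x x0.
  by exists xi; rewrite !gtr0_norm// ltW.
- by exists 0; split; rewrite ?mulr0 ?primitive0.
Qed.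

Lemma Ftilde_continuous : continuous (Ftilde f).
Proof.
move=> t; rewrite /Ftilde; apply: cvgB; first by apply: cvgM; [exact: f_cont|exact: cvg_id].
by apply: cvgMr; exact: primitive_continuous.
Qed.

Lemma Ftilde_even t : Ftilde f (- t) = Ftilde f t.
Proof. by rewrite /Ftilde f_odd mulrNN primitive_even. Qed.

End primitive_theory.

Lemma powR_add (R : realType) (x a b : R) : 0 < a + b -> x `^ (a + b) = x `^ a * x `^ b.
Proof. by move=> ab; rewrite powRD// gt_eqF. Qed.

Lemma powR_addp (R : realType) (x a b : R) : 0 < x -> x `^ (a + b) = x `^ a * x `^ b.
Proof. by move=> x0; rewrite powRD// (gt_eqF x0) implybT. Qed.

(* Sealed definitions keep conversion from unfolding powers and integrals when
   two real numbers are compared. *)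
Fact seal : unit. Proof. exact: tt. Qed.
Notation sealed x := (locked_with seal x).

(** * Consequences of the growth and monotonicity hypotheses on f *)

Section nonlinearity.
Context {R : realType}.
Variables (s : R) (N : nat) (f : R -> R).
Hypotheses (s01 : 0 < s < 1) (N2 : (2 < N)%N).
Hypotheses (f_odd : forall t, f (- t) = - f t) (f_cont : continuous f).
Hypothesis f_zero : f t / `|t| `^ (1 + 4 * s / N%:R) @[t --> 0^'] --> 0.
Hypothesis f_infty :
  f t / `|t| `^ ((N%:R + 2 * s) / (N%:R - 2 * s)) @[t --> +oo] --> 0.
Hypothesis F_infty :
  primitive f t / `|t| `^ (2 + 4 * s / N%:R) @[t --> +oo] --> +oo.
Hypothesis Ftilde_incr : forall t1 t2, 0 < t1 -> t1 < t2 ->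
  Ftilde f t1 / `|t1| `^ (2 + 4 * s / N%:R)
    < Ftilde f t2 / `|t2| `^ (2 + 4 * s / N%:R).
Hypothesis f_F : forall t, t != 0 ->
  f t * t < 2 * N%:R / (N%:R - 2 * s) * primitive f t.

Local Notation F := (primitive f).
Local Notation Ft := (Ftilde f).
Local Notation q := (@crit_exp R N s).
Local Notation W := (crit_growth q).
(** The mass-critical exponent: under mass-preserving dilations the integral of [|u|^p] and the
    squared seminorm both scale by [t^(2s)]. *)
Definition mass_exp : R := 2 + 4 * s / N%:R.
Local Notation p := mass_exp.

Let N3 : (3 : R) <= N%:R. Proof. by rewrite ler_nat. Qed.
Let N0 : (0 : R) < N%:R. Proof. by have := N3; lra. Qed.
Let s0 : 0 < s. Proof. by case/andP: s01. Qed.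
Let s1 : s < 1. Proof. by case/andP: s01. Qed.
Let N2s : 0 < N%:R - 2 * s. Proof. by have := N3; have := s1; lra. Qed.
Let q2 : 2 < q. Proof. exact: crit_exp_gt2. Qed.

Lemma mass_exp_gt2 : 2 < p.
Proof. by rewrite ltrDl divr_gt0// mulr_gt0. Qed.
Let p2 := mass_exp_gt2.

Lemma mass_exp_lt_crit : p < q.
Proof.
rewrite -subr_gt0 (_ : q - p = 4 * s * (2 * s) / ((N%:R - 2 * s) * N%:R)).
  by rewrite divr_gt0 ?mulr_gt0.
by rewrite /mass_exp opprD addrA crit_expE//; field; rewrite !gt_eqF.
Qed.

Let f0 : f 0 = 0.
Proof. by have := f_odd 0; rewrite oppr0 => h; lra. Qed.

Let f_small (e : R) : 0 < e -> exists2 r : R, 0 < r &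
  forall x, `|x| < r -> `|f x| <= e * `|x| `^ (p - 1).
Proof.
move=> e0; have /cvgr0Pnorm_le/(_ _ e0)[r /= r0 hr] := f_zero.
exists r => // x xr; have [->|x0] := eqVneq x 0.
  by rewrite f0 normr0 mulr_ge0 ?powR_ge0// ltW.
have := hr x; rewrite /ball_/= sub0r normrN => /(_ xr x0).
have nx : 0 < `|x| by rewrite normr_gt0.
have -> : p - 1 = 1 + 4 * s / N%:R by rewrite /mass_exp; ring.
by rewrite normrM normfV (gtr0_norm (powR_gt0 _ nx)) ler_pdivrMr ?powR_gt0.
Qed.

Let f_large (e : R) : 0 < e -> exists2 L : R, 0 < L &
  forall x, L < `|x| -> `|f x| <= e * `|x| `^ (q - 1).
Proof.
move=> e0; have /cvgr0Pnorm_le/(_ _ e0)[L [Lr hL]] := f_infty.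
exists (Num.max L 1); first by rewrite lt_max ltr01 orbT.
have pos x : Num.max L 1 < x -> `|f x| <= e * `|x| `^ (q - 1).
  rewrite gt_max => /andP[Lx x1]; have x0 : 0 < x by lra.
  have := hL x Lx; have nx : 0 < `|x| by rewrite normr_gt0 gt_eqF.
  have -> : q - 1 = (N%:R + 2 * s) / (N%:R - 2 * s).
    by rewrite /crit_exp; field; rewrite gt_eqF.
  by rewrite normrM normfV (gtr0_norm (powR_gt0 _ nx)) ler_pdivrMr ?powR_gt0.
move=> x Lx; have [x0|x0] := leP 0 x; first by apply: pos; rewrite ger0_norm in Lx.
have := pos (- x); rewrite f_odd !normrN; apply.
by rewrite ltr0_norm in Lx.
Qed.

Lemma subcrit_f : subcrit q 1 f.
Proof.
split=> // e e0.
have E80 : 0 < 8 `^ (p - 1) :> R by rewrite powR_gt0.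
have [r r0 hr] := f_small ltr01.
have E8q : 0 < e / (2 * 8 `^ (q - 1)) by rewrite divr_gt0// mulr_gt0// powR_gt0.
have [L L0 hL] := f_large E8q.
have [C C0 hC] := bounded_on_segment L f_cont.
have p20 : 0 < p - 2 by have := p2; lra.
(* Below [r / 8] all arguments up to [8 * M] fall under [f_small]; the second entry gives
   [8^(p-1) * M^(p-2) <= e]. *)
pose m := Num.min (r / 8) ((e / 8 `^ (p - 1)) `^ (p - 2)^-1).
have m0 : 0 < m by rewrite lt_min divr_gt0//= powR_gt0// divr_gt0.
(* Beyond [2 * C / e] the bound [C] of [f] on the segment satisfies [C * M <= e * M ^+ 2]; arguments
   outside the segment are left to [f_large]. *)
exists m, (Num.max m (2 * C / e)); rewrite le_max lexx; split=> // M M0 Mcase x xM.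
rewrite expr1; case: Mcase.
  rewrite lt_min => /andP[M1 M2].
  have := hr x; rewrite mul1r; have -> : `|x| < r by lra.
  move=> /(_ isT) h.
  have h2 : `|x| `^ (p - 1) <= 8 `^ (p - 1) * M `^ (p - 1).
    rewrite -powRM//; apply: ge0_ler_powR; rewrite ?nnegrE ?mulr_ge0//.
    by have := p2; lra.
  have h3 : M `^ (p - 2) <= e / 8 `^ (p - 1).
    have -> : e / 8 `^ (p - 1) = ((e / 8 `^ (p - 1)) `^ (p - 2)^-1) `^ (p - 2).
      by rewrite -powRrM mulVf ?gt_eqF// powRr1// divr_ge0// ltW.
    by apply: ge0_ler_powR; rewrite ?nnegrE ?powR_ge0// ltW.
  apply: (@le_trans _ _ (8 `^ (p - 1) * M `^ (p - 1) * M)).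
    by rewrite ler_wpM2r//; lra.
  have -> : 8 `^ (p - 1) * M `^ (p - 1) * M = 8 `^ (p - 1) * M `^ (p - 2) * M ^+ 2.
    have := p2; rewrite -!mulrA -(powR_mulrn 2 M0) -{2}(powRr1 M0) => p2'.
    by rewrite -!powR_add; [congr (_ * powR _ _); ring|lra|lra].
  apply: (@le_trans _ _ (e * M ^+ 2)).
    by rewrite ler_wpM2r ?sqr_ge0// mulrC -ler_pdivlMr.
  by rewrite ler_pM2l// lerDl powR_ge0.
rewrite gt_max => /andP[M1]; rewrite ltr_pdivrMr// => M2.
rewrite /crit_growth mulrDr (ger0_norm M0); have [xL|xL] := leP `|x| L.
  apply: (@le_trans _ _ (C * M)); first by rewrite ler_wpM2r// hC.
  apply: (@le_trans _ _ (e * M ^+ 2)); last by rewrite lerDl mulr_ge0 ?powR_ge0// ltW.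
  by rewrite expr2 mulrA ler_wpM2r//; lra.
have h := hL x xL.
apply: (@le_trans _ _ (e * M `^ q)); last by rewrite lerDr mulr_ge0 ?sqr_ge0// ltW.
have h2 : `|x| `^ (q - 1) <= 8 `^ (q - 1) * M `^ (q - 1).
  rewrite -powRM//; apply: ge0_ler_powR; rewrite ?nnegrE ?mulr_ge0//.
  by have := q2; lra.
have -> : M `^ q = M `^ (q - 1) * M.
  have := q2; rewrite -{3}(powRr1 M0) => q2'.
  by rewrite -powR_add; [congr powR; ring|lra].
rewrite mulrA ler_wpM2r//; apply: le_trans h _.
apply: le_trans (ler_wpM2l (ltW E8q) h2) _; rewrite mulrA ler_wpM2r ?powR_ge0//.
have : 0 < 8 `^ (q - 1) :> R by rewrite powR_gt0.
move: (8 `^ (q - 1)) => a a0; rewrite invfM mulrA divfK ?gt_eqF//; lra.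
Qed.

Let f_mul_le (e M x y : R) : 0 <= M -> `|x| <= 8 * M -> `|f y| * M ^+ 1 <= e -> `|f y * x| <= 8 * e.
Proof.
rewrite expr1 normrM => M0 xM h; apply: le_trans (ler_wpM2l (normr_ge0 _) xM) _.
by rewrite mulrCA ler_pM2l.
Qed.

Lemma subcrit_F : subcrit q 0 F.
Proof.
split=> [|e e0]; first exact: primitive_continuous.
have [|m [L [m0 mL hL]]] := (subcrit_f).2 (e / 8); first by rewrite divr_gt0.
exists m, L; split=> // M M0 Mc x xM; rewrite expr0 mulr1.
have [xi [xix [_ ->]]] := primitive_mean_value f_cont f_odd x.
apply: le_trans (f_mul_le M0 xM (hL M M0 Mc xi (le_trans xix xM))) _; lra.
Qed.

Lemma subcrit_Ftilde : subcrit q 0 Ft.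
Proof.
split=> [|e e0]; first exact: Ftilde_continuous.
have [|m [L [m0 mL hL]]] := (subcrit_f).2 (e / 24); first by rewrite divr_gt0.
exists m, L; split=> // M M0 Mc x xM; rewrite expr0 mulr1 /Ftilde.
have [xi [xix [_ ->]]] := primitive_mean_value f_cont f_odd x.
have h1 := f_mul_le M0 xM (hL M M0 Mc xi (le_trans xix xM)).
have h2 := f_mul_le M0 xM (hL M M0 Mc x xM).
apply: le_trans (ler_normB _ _) _; rewrite [`|2 * _|]normrM (gtr0_norm (ltr0n R 2)); lra.
Qed.

Let Ft_small (e : R) : 0 < e -> exists2 r : R, 0 < r &
  forall x, `|x| < r -> `|Ft x| <= e * `|x| `^ p.
Proof.
move=> e0; have [|r r0 hr] := @f_small (e / 3); first by rewrite divr_gt0.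
exists r => // x xr; have px : `|x| `^ p = `|x| `^ (p - 1) * `|x|.
  by have := p2 => p2'; rewrite -{3}(powRr1 (normr_ge0 x)) -powR_add; [congr powR; ring|lra].
have [xi [xix [_ E]]] := primitive_mean_value f_cont f_odd x.
have h1 := hr x xr; have h2 := hr xi (le_lt_trans xix xr).
have h3 : `|xi| `^ (p - 1) <= `|x| `^ (p - 1).
  by have := p2 => p2'; apply: ge0_ler_powR; rewrite ?nnegrE//; lra.
have h4 : `|f xi| <= e / 3 * `|x| `^ (p - 1).
  by apply: le_trans h2 _; rewrite ler_wpM2l// ltW// divr_gt0.
rewrite /Ftilde E px; apply: le_trans (ler_normB _ _) _.
rewrite !normrM (gtr0_norm (ltr0n R 2)).
have := ler_wpM2r (normr_ge0 x) h1; have := ler_wpM2r (normr_ge0 x) h4.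
rewrite -!mulrA; lra.
Qed.

Let h x := Ft x / `|x| `^ p.

Let h_lt x y : 0 < x -> x < y -> h x < h y.
Proof. exact: Ftilde_incr. Qed.

Let h_le x y : 0 < x -> x <= y -> h x <= h y.
Proof. by move=> x0; rewrite le_eqVlt => /orP[/eqP->//|/(h_lt x0)/ltW]. Qed.

(** The quotient [h] is strictly increasing on the positive axis and tends to 0 at 0 by the
    smallness of [f]; a negative value at [y / 2] would keep it away from 0. Evenness covers the
    negative axis. *)
Lemma Ftilde_gt0 x : x != 0 -> 0 < Ft x.
Proof.
have pos (y : R) : 0 < y -> 0 < Ft y.
  move=> y0; suff : 0 <= h (y / 2).
    move=> h0; have : 0 < h y by apply: le_lt_trans h0 _; apply: h_lt; lra.
    by rewrite /h pmulr_lgt0// invr_gt0 powR_gt0// normr_gt0 gt_eqF.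
  rewrite leNgt; apply/negP => hneg.
  have [|r r0 hr] := @Ft_small (- h (y / 2) / 2); first by rewrite divr_gt0// oppr_gt0.
  pose z := Num.min (y / 2) (r / 2).
  have z0 : 0 < z by rewrite lt_min !divr_gt0.
  have zr : `|z| < r by rewrite gtr0_norm// gt_min; apply/orP; right; lra.
  have hz : h z <= h (y / 2) by apply: h_le; rewrite // ge_min lexx.
  have := hr z zr; have pz : 0 < `|z| `^ p by rewrite powR_gt0// normr_gt0 gt_eqF.
  rewrite -ler_pdivrMr// -{1}(gtr0_norm pz) -normfV -normrM -/(h z).
  by have := ler_norm (- h z); rewrite normrN; lra.
have [x0|x0|//] := ltgtP x 0; last by move=> _; exact: pos.
by move=> _; rewrite -(Ftilde_even f_cont f_odd); apply: pos; rewrite oppr_gt0.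
Qed.

Lemma crit_defect_gt0 x : x != 0 -> 0 < q * F x - f x * x.
Proof. by move=> x0; rewrite subr_gt0 f_F. Qed.

(** The derivative of [F z / z^2] is [z^(p-3) * h z], and [z^(p-3) * c] is that of
    [c * z^(p-2) / (p-2)]; the mean value theorem is applied to the difference. A well chosen [c]
    then fixes the sign of [h xi - c]. *)
Let ratio (x y c : R) : 0 < x -> x < y -> exists xi, [/\ x < xi, xi < y &
  F y / y ^+ 2 - F x / x ^+ 2 - c / (p - 2) * (y `^ (p - 2) - x `^ (p - 2)) =
  xi `^ (p - 3) * (h xi - c) * (y - x)].
Proof.
move=> x0 xy; have p20 : p - 2 != 0 by have := p2; rewrite subr_eq0 => p2'; rewrite gt_eqF.
pose g z := F z * z `^ (-2) - c / (p - 2) * z `^ (p - 2).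
have gd (z : R) : 0 < z -> is_derive z 1 g (z `^ (p - 3) * (h z - c)).
  move=> z0.
  have d1 : is_derive z 1 (fun z => F z * z `^ (-2)) (F z *: (-2 * z `^ (-2 - 1)) + z `^ (-2) *: f z).
    by apply: is_deriveM; [exact: primitive_is_derive|exact: is_derive1_powR].
  have d2 : is_derive z 1 (fun z => c / (p - 2) * z `^ (p - 2)) (c / (p - 2) *: ((p - 2) * z `^ (p - 2 - 1))).
    by apply: is_deriveZ; exact: is_derive1_powR.
  apply: (is_derive_eq (is_deriveB d1 d2)).
  have -> : p - 2 - 1 = p - 3 by ring.
  have -> : -2 - 1 = -3 :> R by ring.
  have e3 : z `^ (p - 3) = z `^ p * z `^ (-3) by rewrite -powR_addp.
  have e2 : z `^ (-2) = z `^ (-3) * z.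
    by rewrite -{3}(powRr1 (ltW z0)) -powR_addp//; congr powR; ring.
  rewrite /h (gtr0_norm z0) e3 e2 /Ftilde /GRing.scale/=; field.
  by rewrite p20 gt_eqF// powR_gt0.
have [||xi] := @MVT _ g (fun z => z `^ (p - 3) * (h z - c)) x y xy.
- by move=> z; rewrite in_itv/= => /andP[xz _]; apply: gd; exact: lt_trans xz.
- apply: derivable_within_continuous => z; rewrite in_itv/= => /andP[xz _].
  exact: (@ex_derive _ _ _ _ _ _ _ (gd z (lt_le_trans x0 xz))).
rewrite in_itv/= => /andP[xxi xiy] E; exists xi; split=> //; rewrite -E.
have e (z : R) : 0 < z -> z `^ (-2) = (z ^+ 2)^-1 by move=> z0; rewrite powRN powR_mulrn// ltW.
rewrite /g !e//; last exact: lt_trans xy.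
by ring.
Qed.

(** If [h] were bounded by [A], [ratio] with [c = A] would bound [F y / y^p] for large [y], against
    the superquadratic growth in [F_infty]. Monotonicity turns one large value into all later
    ones. *)
Let h_large A : exists2 Y, 0 < Y & forall y, Y <= y -> A <= h y.
Proof.
apply: contrapT => nex.
have hA x : 0 < x -> h x <= A.
  move=> x0; rewrite leNgt; apply/negP => Ah; apply: nex; exists x => // y xy.
  by apply: le_trans (ltW Ah) _; exact: h_le.
pose K : R := `|F 1| + `|A| / (p - 2).
have p20 : 0 < p - 2 by have := p2; rewrite subr_gt0.
have K0 : 0 <= K by rewrite addr_ge0// divr_ge0// ltW.
have /cvgryPge/(_ (K + 1))[M [Mr hM]] := F_infty.
pose y := Num.max M 1 + 1.
have m1 : 1 <= Num.max M 1 by rewrite le_max lexx orbT.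
have mM : M <= Num.max M 1 by rewrite le_max lexx.
have y1 : 1 < y by rewrite /y; lra.
have yM : M < y by rewrite /y; lra.
have := hM y yM; have y0 : 0 < y by lra.
rewrite (gtr0_norm y0) -/p ler_pdivlMr ?powR_gt0//.
have [xi [xi1 _ E]] := ratio A ltr01 y1.
have : F y / y ^+ 2 - F 1 / 1 ^+ 2 - A / (p - 2) * (y `^ (p - 2) - 1 `^ (p - 2)) <= 0.
  rewrite E; apply: mulr_le0_ge0; last lra.
  by apply: mulr_ge0_le0; rewrite ?powR_ge0// subr_le0 hA//; lra.
rewrite powR1 expr1n divr1.
have -> : y `^ p = y `^ (p - 2) * y ^+ 2.
  by rewrite -(powR_mulrn 2 (ltW y0)) -powR_addp ?subrK.
have yp : 1 <= y `^ (p - 2).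
  by rewrite -[leLHS](powRr0 y); apply: ler_powR; exact: ltW.
move: yp; move: (y `^ (p - 2)) => z z1 h1; apply/negP; rewrite -ltNge mulrA -ltr_pdivrMr ?exprn_gt0//.
apply: (@le_lt_trans _ _ (K * z)); last by lra.
have : F y / y ^+ 2 <= F 1 + A / (p - 2) * (z - 1) by lra.
move=> /le_trans; apply; rewrite /K mulrDl lerD//.
  by apply: le_trans (ler_norm _) _; rewrite ler_peMr.
apply: (@le_trans _ _ (`|A| / (p - 2) * (z - 1))).
  by rewrite ler_wpM2r ?subr_ge0// ler_pM2r ?invr_gt0// ler_norm.
by rewrite ler_wpM2l ?divr_ge0 ?(ltW p20)//; lra.
Qed.

(** The integrand of [Ftilde] along a dilation ray after the change of variables, with the factor
    [t^(2s)] of the seminorm divided out. The Pohozaev equation for the dilated function then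
    compares a constant with an integral that is increasing in [t]. *)
Definition dil_Ftilde (t x : R) : R :=
  sealed (t `^ (- (N%:R + 2 * s)) * Ft (t `^ (N%:R / 2) * x)).

Lemma dil_FtildeE t x : dil_Ftilde t x = t `^ (- (N%:R + 2 * s)) * Ft (t `^ (N%:R / 2) * x).
Proof. by rewrite /dil_Ftilde locked_withE. Qed.
Local Notation Ftt := dil_Ftilde.

Let tN (t : R) : (t `^ (N%:R / 2)) `^ p = t `^ (N%:R + 2 * s).
Proof. by rewrite -powRrM; congr powR; rewrite /mass_exp; field; rewrite gt_eqF. Qed.

Let FttE t x : 0 < t -> x != 0 -> Ftt t x = h (t `^ (N%:R / 2) * `|x|) * `|x| `^ p.
Proof.
move=> t0 x0; have nx : 0 < `|x| by rewrite normr_gt0.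
have T0 : 0 < t `^ (N%:R / 2) by rewrite powR_gt0.
rewrite /h normrM normr_id (gtr0_norm T0) powRM ?powR_ge0// tN dil_FtildeE.
have -> : Ft (t `^ (N%:R / 2) * `|x|) = Ft (t `^ (N%:R / 2) * x).
  have [x1|x1] := leP 0 x; first by rewrite ger0_norm.
  by rewrite ltr0_norm// mulrN (Ftilde_even f_cont f_odd).
by rewrite powRN; field; rewrite !gt_eqF// powR_gt0.
Qed.

Lemma dil_Ftilde_lt t1 t2 x : 0 < t1 -> t1 < t2 -> x != 0 -> Ftt t1 x < Ftt t2 x.
Proof.
move=> t10 t12 x0; have nx : 0 < `|x| by rewrite normr_gt0.
have t20 : 0 < t2 by lra.
rewrite !FttE// ltr_pM2r ?powR_gt0//; apply: h_lt.
  by rewrite mulr_gt0// powR_gt0.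
by rewrite ltr_pM2r//; apply: gt0_ltr_powR; rewrite ?nnegrE ?divr_gt0// ltW.
Qed.

Let Ft0 : Ft 0 = 0.
Proof. by rewrite /Ftilde mulr0 primitive0 mulr0 subrr. Qed.

Lemma dil_Ftilde_large A : exists2 Y, 0 < Y & forall t x, 0 < t -> x != 0 ->
  Y <= t `^ (N%:R / 2) * `|x| -> A * `|x| `^ p <= Ftt t x.
Proof.
have [Y Y0 hY] := h_large A; exists Y => // t x t0 x0 tx.
by rewrite FttE// ler_pM2r ?powR_gt0 ?normr_gt0// hY.
Qed.

Let h_growth (e : R) : 0 < e -> exists2 C : R, 0 < C & forall y, 0 < y -> h y <= e + C * y `^ (q - p).
Proof.
move=> e0; have [r r0 hr] := Ft_small e0.
have [C C0 hC] := subcrit_bound q2 subcrit_Ftilde.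
have pq := mass_exp_lt_crit; have p2' := p2.
exists (C * (1 + r `^ (2 - q))); first by rewrite mulr_gt0// addr_gt0// powR_gt0.
move=> y y0; have yp : 0 < `|y| `^ p by rewrite powR_gt0// normr_gt0 gt_eqF.
have B0 : 0 <= C * (1 + r `^ (2 - q)) * y `^ (q - p).
  by rewrite mulr_ge0 ?powR_ge0// mulr_ge0 ?(ltW C0)// addr_ge0 ?powR_ge0.
rewrite /h ler_pdivrMr//; apply: le_trans (ler_norm _) _.
have [yr|yr] := ltP `|y| r.
  by apply: le_trans (hr y yr) _; rewrite ler_pM2r// lerDl.
have := hC `|y| y (normr_ge0 _); rewrite expr0 mulr1.
have -> : `|y| <= 8 * `|y| by rewrite ler_peMl ?ler1n.
move=> /(_ isT)/le_trans; apply.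
apply: (@le_trans _ _ (C * (1 + r `^ (2 - q)) * y `^ (q - p) * `|y| `^ p)); last first.
  by rewrite ler_pM2r// lerDr ltW.
rewrite /crit_growth normr_id (gtr0_norm y0) -!mulrA ler_pM2l//.
rewrite -powR_addp// subrK mulrDl mul1r addrC lerD2l.
have -> : y ^+ 2 = y `^ (2 - q) * y `^ q.
  by rewrite -powR_addp// subrK powR_mulrn// ltW.
rewrite ler_pM2r ?powR_gt0//.
have inv (z : R) : z `^ (2 - q) = (z `^ (q - 2))^-1 by rewrite -powRN opprB.
rewrite !inv.
rewrite lef_pV2 ?posrE ?powR_gt0//; rewrite (gtr0_norm y0) in yr.
by apply: ge0_ler_powR; rewrite ?nnegrE ?(ltW r0) ?(ltW y0)//; lra.
Qed.

Lemma dil_Ftilde_small e : 0 < e -> exists2 t0, 0 < t0 & forall x, Ftt t0 x <= e * W x.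
Proof.
move=> e0; have [|C C0 hC] := @h_growth (e / 2); first by rewrite divr_gt0.
have pq := mass_exp_lt_crit; have p2' := p2.
have qp0 : 0 < N%:R / 2 * (q - p) by rewrite mulr_gt0 ?subr_gt0// divr_gt0.
(* Solves [C * t0^(N/2 * (q-p)) = e / 2], possible since the critical exponent exceeds the
   mass-critical one. *)
pose t0 : R := (e / 2 / C) `^ (N%:R / 2 * (q - p))^-1.
have t00 : 0 < t0 by rewrite powR_gt0// !divr_gt0.
have Ct : C * t0 `^ (N%:R / 2 * (q - p)) = e / 2.
  rewrite /t0 -powRrM mulVf ?gt_eqF// powRr1 ?divr_ge0 ?(ltW e0) ?(ltW C0)//.
  by field; rewrite gt_eqF.
exists t0 => // x; have [->|x0] := eqVneq x 0.
  rewrite dil_FtildeE mulr0 Ft0 mulr0 mulr_ge0 ?(ltW e0)//; exact: crit_growth_ge0.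
have nx : 0 < `|x| by rewrite normr_gt0.
rewrite FttE//; apply: (@le_trans _ _ ((e / 2 + C * (t0 `^ (N%:R / 2) * `|x|) `^ (q - p)) * `|x| `^ p)).
  by rewrite ler_wpM2r ?powR_ge0// hC// mulr_gt0// powR_gt0.
rewrite powRM ?powR_ge0// -powRrM [C * (_ * _)]mulrA Ct mulrDl.
have -> : e / 2 * `|x| `^ (q - p) * `|x| `^ p = e / 2 * `|x| `^ q.
  by rewrite -mulrA -powR_addp// subrK.
have xp : `|x| `^ p <= W x.
  rewrite /crit_growth; have [x1|x1] := leP `|x| 1.
    apply: (@le_trans _ _ (x ^+ 2)); last by rewrite lerDl powR_ge0.
    by rewrite -(real_normK (num_real x)) -powR_mulrn//; apply: ger_powR; [rewrite nx|exact: ltW].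
  apply: (@le_trans _ _ (`|x| `^ q)); last by rewrite lerDr sqr_ge0.
  by apply: ler_powR; exact: ltW.
have xq : `|x| `^ q <= W x by rewrite /crit_growth lerDr sqr_ge0.
have : e / 2 * `|x| `^ p <= e / 2 * W x by rewrite ler_pM2l// divr_gt0.
have : e / 2 * `|x| `^ q <= e / 2 * W x by rewrite ler_pM2l// divr_gt0.
lra.
Qed.

(** The pointwise reason why the energy is largest at the Pohozaev point of a ray. In [ratio] take
    [c = h y]: as [h] increases, [h xi - h y] has the sign of [z - y], so the same inequality holds
    for dilations in either direction. *)
Lemma primitive_dil_ge t x : 0 < t ->
  N%:R / (4 * s) * (t `^ (2 * s) - 1) * Ft x <= t ^- N * F (t `^ (N%:R / 2) * x) - F x.
Proof.
move=> t0; have T0 : 0 < t `^ (N%:R / 2) by rewrite powR_gt0.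
have pos (y : R) : 0 < y ->
    N%:R / (4 * s) * (t `^ (2 * s) - 1) * Ft y <= t ^- N * F (t `^ (N%:R / 2) * y) - F y.
  move=> y0; set z := t `^ (N%:R / 2) * y.
  have z0 : 0 < z by rewrite mulr_gt0.
  have zp : z `^ (p - 2) = t `^ (2 * s) * y `^ (p - 2).
    rewrite powRM ?powR_ge0 ?(ltW y0)// -powRrM; congr (powR _ _ * _).
    by rewrite /mass_exp; field; rewrite gt_eqF.
  have z2 : z ^+ 2 = t ^+ N * y ^+ 2 by rewrite exprMn powR_half_sq.
  have p20 : p - 2 = 4 * s / N%:R by rewrite /mass_exp; ring.
  have key : h y / (p - 2) * (z `^ (p - 2) - y `^ (p - 2)) <= F z / z ^+ 2 - F y / y ^+ 2.
    rewrite -subr_ge0; have [yz|zy|<-] := ltgtP y z; last by rewrite !subrr mulr0 subrr.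
      have [xi [yxi xiz ->]] := ratio (h y) y0 yz.
      by rewrite mulr_ge0 ?subr_ge0 ?(ltW yz)// mulr_ge0 ?powR_ge0// subr_ge0 h_le// ltW.
    have [xi [zxi xiy E]] := ratio (h y) z0 zy.
    have : xi `^ (p - 3) * (h xi - h y) * (y - z) <= 0.
      apply: mulr_le0_ge0; last by rewrite subr_ge0 ltW.
      by apply: mulr_ge0_le0; rewrite ?powR_ge0// subr_le0 h_le// ?(ltW xiy)//; lra.
    rewrite -E; lra.
  have y20 : 0 < y ^+ 2 by rewrite exprn_gt0.
  have := ler_wpM2r (ltW y20) key; rewrite zp z2 p20 /h (gtr0_norm y0).
  have yp0 : 0 < y `^ (p - 2) by rewrite powR_gt0.
  have -> : y `^ p = y `^ (p - 2) * y ^+ 2.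
    by rewrite -(powR_mulrn 2 (ltW y0)) -powR_addp ?subrK.
  rewrite p20 in yp0 *; move: (y `^ (4 * s / N%:R)) yp0 => Y Y0; move: (t `^ (2 * s)) => S.
  have tn0 : t ^+ N != 0 by rewrite expf_neq0// gt_eqF.
  have -> : (Ft y / (Y * y ^+ 2) / (4 * s / N%:R) * (S * Y - Y)) * y ^+ 2 =
      N%:R / (4 * s) * (S - 1) * Ft y.
    field; rewrite !gt_eqF//.
  move=> /le_trans; apply; rewrite le_eqVlt; apply/orP; left; apply/eqP.
  by move: (t ^+ N) tn0 => T T0'; field; rewrite T0' gt_eqF.
have [x0|x0|->] := ltgtP x 0; [|exact: pos|].
  have := pos (- x); rewrite oppr_gt0 => /(_ x0).
  by rewrite (Ftilde_even f_cont f_odd) mulrN !(primitive_even f_cont f_odd).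
by rewrite Ft0 !mulr0 primitive0 mulr0 subrr.
Qed.

End nonlinearity.

(** Interface between the hypotheses on [f] and the variational argument, which sees only growth,
    positivity and monotonicity along dilation rays. *)
Record admissible (R : realType) (s : R) (N : nat) (f : R -> R) : Prop := Admissible {
  adm_s : 0 < s < 1;
  adm_N : (2 < N)%N;
  adm_odd : forall t, f (- t) = - f t;
  adm_derive : forall t : R, is_derive t 1 (primitive f) (f t);
  adm_even : forall t, primitive f (- t) = primitive f t;
  adm_f : subcrit (@crit_exp R N s) 1 f;
  adm_F : subcrit (@crit_exp R N s) 0 (primitive f);
  adm_Ft : subcrit (@crit_exp R N s) 0 (Ftilde f);
  adm_Ft_gt0 : forall x, x != 0 -> 0 < Ftilde f x;
  adm_crit_defect : forall x, x != 0 -> 0 < @crit_exp R N s * primitive f x - f x * x;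
  adm_lt : forall t1 t2 x, 0 < t1 -> t1 < t2 -> x != 0 ->
    dil_Ftilde s N f t1 x < dil_Ftilde s N f t2 x;
  adm_small : forall e, 0 < e -> exists2 t0, 0 < t0 &
    forall x, dil_Ftilde s N f t0 x <= e * crit_growth (@crit_exp R N s) x;
  adm_large : forall A, exists2 Y, 0 < Y & forall t x, 0 < t -> x != 0 ->
    Y <= t `^ (N%:R / 2) * `|x| -> A * `|x| `^ (mass_exp s N) <= dil_Ftilde s N f t x;
  adm_ray : forall t x, 0 < t -> N%:R / (4 * s) * (t `^ (2 * s) - 1) * Ftilde f x <=
    t ^- N * primitive f (t `^ (N%:R / 2) * x) - primitive f x }.

Lemma admissible_intro (R : realType) (s : R) (N : nat) (f : R -> R) :
  0 < s < 1 -> (2 < N)%N -> (forall t, f (- t) = - f t) -> continuous f ->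
  f t / `|t| `^ (1 + 4 * s / N%:R) @[t --> 0^'] --> 0 ->
  f t / `|t| `^ ((N%:R + 2 * s) / (N%:R - 2 * s)) @[t --> +oo] --> 0 ->
  primitive f t / `|t| `^ (2 + 4 * s / N%:R) @[t --> +oo] --> +oo ->
  (forall t1 t2, 0 < t1 -> t1 < t2 ->
      Ftilde f t1 / `|t1| `^ (2 + 4 * s / N%:R)
        < Ftilde f t2 / `|t2| `^ (2 + 4 * s / N%:R)) ->
  (forall t, t != 0 -> f t * t < 2 * N%:R / (N%:R - 2 * s) * primitive f t) ->
  admissible s N f.
Proof.
move=> s01 N2 fo fc fz fi Fi Fti fF; split=> //.
- exact: primitive_is_derive.
- exact: primitive_even.
- exact: subcrit_f.
- exact: subcrit_F.
- exact: subcrit_Ftilde.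
- exact: (Ftilde_gt0 (s := s) (N := N)).
- exact: crit_defect_gt0.
- exact: dil_Ftilde_lt.
- exact: dil_Ftilde_small.
- exact: dil_Ftilde_large.
- by move=> t x t0; exact: primitive_dil_ge.
Qed.

(** * Integral functionals on H^s *)

Section summable_functions.
Context d {T : measurableType d} {R : realType} (mu : {measure set T -> \bar R}).
Implicit Types (g h : T -> R) (c : R).

Definition summable g : Prop := mu.-integrable setT (EFin \o g).

Lemma summable_integrable g : summable g -> mu.-integrable setT (EFin \o g).
Proof. by []. Qed.

Lemma Summable g : mu.-integrable setT (EFin \o g) -> summable g.
Proof. by []. Qed.

Lemma summableD g h : summable g -> summable h -> summable (fun x => g x + h x).
Proof.
move=> ig ih; rewrite /summable (_ : _ \o _ = (EFin \o g) \+ (EFin \o h))%E//.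
exact: integrableD.
Qed.

Lemma summableZ c g : summable g -> summable (fun x => c * g x).
Proof.
move=> ig; have := integrableZl measurableT c ig.
by apply: eq_integrable => // x _ /=; rewrite EFinM.
Qed.

Lemma summableB g h : summable g -> summable h -> summable (fun x => g x - h x).
Proof.
move=> ig ih; have := summableD ig (summableZ (-1) ih).
by apply: eq_integrable => // x _ /=; rewrite mulN1r.
Qed.

Lemma summable_le g h : measurable_fun setT g -> (forall x, `|g x| <= h x) ->
  summable h -> summable g.
Proof. exact: integrable_le. Qed.

Lemma summable_norm g : summable g -> summable (fun x => `|g x|).
Proof. by move=> ig; have := integrable_abse ig. Qed.

Lemma summable_eq g h : (forall x, g x = h x) -> summable g -> summable h.
Proof. by move=> /funext ->. Qed.

Lemma Rint_le g h : summable g -> summable h -> (forall x, g x <= h x) ->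
  \int[mu]_x g x <= \int[mu]_x h x.
Proof. by move=> ig ih gh; apply: le_Rintegral. Qed.

Lemma Rint_norm_le g h : summable g -> summable h -> (forall x, `|g x| <= h x) ->
  `|\int[mu]_x g x| <= \int[mu]_x h x.
Proof.
move=> ig ih gh; apply: le_trans (le_normr_Rintegral measurableT (summable_integrable ig)) _.
by apply: Rint_le => //; exact: summable_norm.
Qed.

Lemma RintE g : summable g -> (\int[mu]_x g x)%:E = (\int[mu]_x (g x)%:E)%E.
Proof. by move=> ig; rewrite /Rintegral fineK//; exact: integrable_fin_num ig. Qed.

Lemma RintD g h : summable g -> summable h ->
  \int[mu]_x (g x + h x) = \int[mu]_x g x + \int[mu]_x h x.
Proof. by move=> ig ih; rewrite RintegralD. Qed.

Lemma RintB g h : summable g -> summable h ->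
  \int[mu]_x (g x - h x) = \int[mu]_x g x - \int[mu]_x h x.
Proof. by move=> ig ih; rewrite RintegralB. Qed.

Lemma RintZ c g : summable g -> \int[mu]_x (c * g x) = c * \int[mu]_x g x.
Proof. by move=> ig; rewrite RintegralZl. Qed.

End summable_functions.
(* Otherwise conversion unfolds integrals when comparing real numbers. *)
#[global] Opaque summable Rintegral powR.

Section superposition.
Context {R : realType} {N : nat} {s : R}.
Hypotheses (s01 : 0 < s < 1) (N2 : (2 < N)%N).
Notation leb := (@Rn_lebesgue R N).
Local Notation hs := (@hs R N s).
Local Notation q := (@crit_exp R N s).
Local Notation W := (crit_growth q).
Implicit Types (u w v phi : hs) (k z : R -> R) (B e : R).

Let aP := @aform_psd R N s.
Let bP := @bform_psd R N s.
Let q2 : 2 < q. Proof. exact: crit_exp_gt2. Qed.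

Definition hs_sq u : R := aform u u + bform u u.

Lemma hs_sq_ge0 u : 0 <= hs_sq u.
Proof. by rewrite addr_ge0 ?(ip_ge0 aP) ?(ip_ge0 bP). Qed.

Lemma hs_sqZ (c : R) u : hs_sq (c *: u) = c ^+ 2 * hs_sq u.
Proof. by rewrite /hs_sq (ip_sqZ aP) (ip_sqZ bP) -mulrDr. Qed.

Lemma hs_sqD_le u v : hs_sq (u + v) <= 2 * hs_sq u + 2 * hs_sq v.
Proof.
have := hs_sq_ge0 (u - v).
by rewrite /hs_sq (ip_sqB aP) (ip_sqB bP) (ip_sqD aP) (ip_sqD bP); lra.
Qed.

Lemma measurable_superposition k u : continuous k -> measurable_fun setT (k \o u).
Proof.
move=> ck; apply: measurableT_comp (hs_measurable u).
exact: continuous_measurable_fun.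
Qed.

Lemma summable_sq u : summable leb (fun x => u x ^+ 2).
Proof. by apply: Summable; exact: L2_sq_integrable (hs_L2 u). Qed.

Let measurable_crit u : measurable_fun setT (fun x => `|u x| `^ q).
Proof.
apply: (measurableT_comp (measurable_powR _)).
by apply: measurableT_comp => //; exact: hs_measurable.
Qed.

Lemma summable_crit u : summable leb (fun x => `|u x| `^ q).
Proof.
apply: Summable; apply/integrableP; split; first exact/measurable_EFinP.
have [|K K0 hK] := sobolev s01 N2 (B := hs_sq u + 1).
  by rewrite ltr_wpDl ?hs_sq_ge0.
have := hK u; rewrite -/(hs_sq u) lerDl => /(_ ler01) h.
apply: le_lt_trans (ltry K); apply: le_trans h; rewrite le_eqVlt; apply/orP; left; apply/eqP.
by apply: eq_integral => x _ /=; rewrite ger0_norm ?powR_ge0.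
Qed.

Lemma summable_growth u : summable leb (fun x => W (u x)).
Proof. by apply: summableD; [exact: summable_sq|exact: summable_crit]. Qed.

Lemma growth_bounded B : exists2 K, 0 < K & forall u, hs_sq u <= B ->
  \int[leb]_x W (u x) <= K.
Proof.
have [|K K0 hK] := sobolev s01 N2 (B := `|B| + 1); first by rewrite ltr_wpDl.
exists (`|B| + K + 1); first by rewrite ltr_wpDl ?addr_ge0.
move=> u uB; have ub1 : hs_sq u <= `|B| by apply: le_trans uB (ler_norm _).
rewrite RintD; [|exact: summable_sq|exact: summable_crit].
have h1 : \int[leb]_x (u x ^+ 2) <= `|B|.
  have E : \int[leb]_x (u x ^+ 2) = bform u u.
    by apply: eq_Rintegral => x _; rewrite expr2.
  by have := ip_ge0 aP u; move: ub1; rewrite E /hs_sq; lra.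
have h2 : \int[leb]_x (`|u x| `^ q) <= K.
  rewrite -lee_fin (RintE (summable_crit u)).
  by apply: hK; rewrite -/(hs_sq u); apply: le_trans ub1 _; rewrite lerDl.
lra.
Qed.

Lemma summable_subcrit_mul d k u phi : subcrit q d k ->
  summable leb (fun x => k (u x) * phi x ^+ d).
Proof.
move=> kS; have [C C0 hC] := subcrit_bound q2 kS.
apply: (@summable_le _ _ _ _ _ (fun x => C * (W (u x) + W (phi x)))).
- apply: measurable_funM; first exact: measurable_superposition (subcrit_continuous kS).
  by apply: measurable_funX; exact: hs_measurable.
- move=> x; have [M [M0 h1 h2 _]] := crit_growth_max3 q (u x) (phi x) 0.
  have -> : W 0 = 0 by rewrite /crit_growth expr0n normr0 powR0 ?addr0// gt_eqF// (lt_trans _ q2).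
  rewrite addr0 => WM; rewrite normrM normrX.
  apply: le_trans (_ : `|k (u x)| * M ^+ d <= _).
    by rewrite ler_wpM2l// lerXn2r ?nnegrE.
  apply: le_trans (hC M (u x) M0 _) _; last by rewrite ler_pM2l.
  by apply: le_trans h1 _; rewrite ler_peMl ?ler1n.
- by apply: summableZ; apply: summableD; exact: summable_growth.
Qed.

Lemma summable_subcrit k u : subcrit q 0 k -> summable leb (fun x => k (u x)).
Proof.
move=> kS; have := summable_subcrit_mul u u kS.
by apply: summable_eq => x; rewrite expr0 mulr1.
Qed.

Lemma summable_measure_gt e u : 0 < e -> summable leb (fun x => (e < `|u x|)%R%:R).
Proof.
move=> e0; apply: (@summable_le _ _ _ _ _ (fun x => e ^- 2 * u x ^+ 2)).
- by apply: measurable_gt; exact: hs_measurable.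
- move=> x; rewrite ger0_norm ?ler0n//; case: ltP => [h|_] /=.
    rewrite mulrC ler_pdivlMr ?exprn_gt0// mul1r -[leRHS]real_normK ?num_real//.
    by rewrite ler_pXn2r ?nnegrE ?(ltW e0)// ltW.
  by rewrite mulr_ge0 ?sqr_ge0// invr_ge0 exprn_ge0// ltW.
- by apply: summableZ; exact: summable_sq.
Qed.

Definition meas_gt e u : R := \int[leb]_x (e < `|u x|)%R%:R.

Lemma meas_gtE e u : 0 < e -> (meas_gt e u)%:E = measure_gt e u.
Proof.
by move=> e0; rewrite /meas_gt (RintE (summable_measure_gt u e0)).
Qed.

Lemma superposition_continuous d k B e : subcrit q d k -> 0 < e ->
  exists2 eta : R, 0 < eta & forall w v phi (t : R), hs_sq w <= B -> hs_sq phi <= B ->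
    hs_sq v <= eta -> `|t - 1| <= eta ->
    `|\int[leb]_x (k ((t *: (w + v)) x) * phi x ^+ d) - \int[leb]_x (k (w x) * phi x ^+ d)| <= e.
Proof.
move=> kS e0; have [K K0 hK] := growth_bounded (`|B| + 1).
have e1 : 0 < e / (3 * K) by rewrite divr_gt0 ?mulr_gt0.
have [eta /andP[eta0 etah] h] := subcrit_perturb q2 kS e1.
exists (Num.min eta (eta ^+ 2)); first by rewrite lt_min eta0 exprn_gt0.
move=> w v phi t wB phiB; rewrite !le_min => /andP[_ vB] /andP[t1 _].
have wK : \int[leb]_x W (w x) <= K.
  by apply: hK; have := ler_norm B; lra.
have phiK : \int[leb]_x W (phi x) <= K.
  by apply: hK; have := ler_norm B; lra.
(* A perturbation small in H^s is written as the small number [eta] times a bounded function, the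
   form [a + r * c] expected by [subcrit_perturb]. *)
pose c := eta^-1 *: v.
have vc x : v x = eta * c x.
  have -> : c x = eta^-1 * v x by [].
  by rewrite mulrA divff ?mul1r// gt_eqF.
have cK : \int[leb]_x W (c x) <= K.
  apply: hK; rewrite hs_sqZ; apply: (@le_trans _ _ 1); last by rewrite lerDr.
  by rewrite exprVn mulrC ler_pdivrMr ?exprn_gt0// mul1r.
have S u := summable_subcrit_mul u phi kS.
have WS u := summable_growth u.
rewrite -RintB//; apply: le_trans (_ : \int[leb]_x (e / (3 * K) * (W (w x) + W (c x) + W (phi x))) <= _).
  apply: Rint_norm_le; first exact: summableB.
    by apply: summableZ; apply: summableD => //; exact: summableD.
  move=> x; rewrite -mulrBl normrM normrX.
  have -> : (t *: (w + v)) x = t * (w x + eta * c x) by rewrite -vc.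
  by apply: h => //; rewrite gtr0_norm.
have S2 := summableD (WS w) (WS c).
rewrite RintZ; last exact: summableD.
rewrite (RintD S2 (WS phi)) (RintD (WS w) (WS c)).
have E : e = e / (3 * K) * (3 * K) by field; rewrite gt_eqF.
rewrite [leRHS]E ler_pM2l//.
by apply: le_trans (lerD (lerD wK cK) phiK) _; rewrite (_ : 3 * K = K + K + K)//; ring.
Qed.

Lemma superposition_continuous0 k B e : subcrit q 0 k -> 0 < e ->
  exists2 eta : R, 0 < eta & forall w v (t : R), hs_sq w <= B ->
    hs_sq v <= eta -> `|t - 1| <= eta ->
    `|\int[leb]_x k ((t *: (w + v)) x) - \int[leb]_x k (w x)| <= e.
Proof.
move=> kS e0; have [eta eta0 h] := superposition_continuous B kS e0.
exists eta => // w v t wB vB tB; have := h w v w t wB wB vB tB.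
have E (y : hs) : \int[leb]_x (k (y x) * w x ^+ 0) = \int[leb]_x k (y x).
  by apply: eq_Rintegral => x _; rewrite expr0 mulr1.
by rewrite !E.
Qed.

Lemma superposition_le_cutoff k B e : subcrit q 0 k -> 0 < e ->
  exists dl C, [/\ 0 < dl, 0 < C & forall u, hs_sq u <= B ->
    \int[leb]_x `|k (u x)| <= e + C * meas_gt dl u].
Proof.
move=> kS e0; have [K K0 hK] := growth_bounded B.
have e1 : 0 < e / K by rewrite divr_gt0.
have [dl [C [dl0 C0 h]]] := subcrit_le_cutoff kS e1.
exists dl, C; split=> // u uB.
have S1 := summableZ (e / K) (summable_growth u).
have S2 := summableZ C (summable_measure_gt u dl0).
apply: le_trans (Rint_le (summable_norm (summable_subcrit u kS)) (summableD S1 S2) _) _.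
  by move=> x; exact: h.
rewrite RintD// RintZ; last exact: summable_growth.
rewrite RintZ; last exact: summable_measure_gt.
rewrite lerD2r; have := hK u uB; rewrite -(ler_pM2l e1) => /le_trans; apply.
by rewrite divfK// gt_eqF.
Qed.

Lemma superposition_mul_le_cutoff k B e : subcrit q 1 k -> 0 < e ->
  exists dl C, [/\ 0 < dl, 0 < C & forall u phi, hs_sq u <= B -> hs_sq phi <= B ->
    `|\int[leb]_x (k (u x) * phi x)| <= e + C * meas_gt dl phi].
Proof.
move=> kS e0; have [K K0 hK] := growth_bounded B.
have e1 : 0 < e / (2 * K) by rewrite divr_gt0 ?mulr_gt0.
have [dl [C [dl0 C0 h]]] := subcrit_mul_le_cutoff q2 kS e1.
exists dl, C; split=> // u phi uB phiB.
have WS := summableD (summable_growth u) (summable_growth phi).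
have S1 := summableZ (e / (2 * K)) WS.
have S2 := summableZ C (summable_measure_gt phi dl0).
apply: le_trans (Rint_norm_le (summable_subcrit_mul u phi kS) (summableD S1 S2) _) _.
  by move=> x; rewrite normrM; exact: h.
rewrite RintD// RintZ// RintZ; last exact: summable_measure_gt.
rewrite (RintD (summable_growth u) (summable_growth phi)).
rewrite lerD2r; have := hK u uB; have := hK phi phiB => h1 h2.
have E : e = e / (2 * K) * (2 * K) by field; rewrite gt_eqF.
rewrite [leRHS]E ler_pM2l//.
by apply: le_trans (lerD h2 h1) _; rewrite (_ : 2 * K = K + K)//; ring.
Qed.

Lemma superposition_le_pos k z B e : subcrit q 0 k -> continuous z ->
  (forall x, x != 0 -> 0 < z x) -> 0 <= z 0 -> (forall u, summable leb (fun x => z (u x))) ->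
  0 < e -> exists2 C : R, 0 < C & forall u, hs_sq u <= B ->
    \int[leb]_x `|k (u x)| <= e + C * \int[leb]_x z (u x).
Proof.
move=> kS cz z0 z00 zS e0; have [K K0 hK] := growth_bounded B.
have e1 : 0 < e / K by rewrite divr_gt0.
have [C C0 h] := subcrit_le_pos kS cz z0 z00 e1.
exists C => // u uB.
have S1 := summableZ (e / K) (summable_growth u).
have S2 := summableZ C (zS u).
apply: le_trans (Rint_le (summable_norm (summable_subcrit u kS)) (summableD S1 S2) _) _.
  by move=> x; exact: h.
rewrite RintD// RintZ; last exact: summable_growth.
rewrite RintZ// lerD2r; have := hK u uB; rewrite -(ler_pM2l e1) => /le_trans; apply.
by rewrite divfK// gt_eqF.
Qed.

Lemma superposition_gt0 z u : (forall x, x != 0 -> 0 < z x) -> 0 <= z 0 ->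
  summable leb (fun x => z (u x)) -> 0 < bform u u -> 0 < \int[leb]_x z (u x).
Proof.
move=> z0 z00 zS b0.
have zp x : 0 <= z x by have [->//|/z0/ltW] := eqVneq x 0.
rewrite lt_def Rintegral_ge0 ?andbT//; apply/eqP => I0.
have : (\int[leb]_x `|(EFin \o (fun x => z (u x))) x| = 0)%E.
  transitivity ((\int[leb]_x z (u x))%R%:E); last by rewrite I0.
  by rewrite RintE//; apply: eq_integral => x _ /=; rewrite ger0_norm.
have mz := measurable_int leb (summable_integrable zS).
move=> /(ae_eq_integral_abs leb measurableT mz).1 u0.
have {}u0 : {ae leb, forall x, z (u x) = 0}.
  by move: u0; apply: filterS => x /(_ I)[].
suff : (bform u u)%:E = 0%E by move=> [] b00; rewrite b00 ltxx in b0.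
rewrite bform_sqE -(integral0 leb setT); apply: ge0_ae_eq_integral => //.
- by apply: measurable_EFin_sq; exact: hs_measurable.
- by move=> x _; rewrite lee_fin sqr_ge0.
move: u0; apply: filterS => x zu0 _ /=.
have [->|/z0] := eqVneq (u x) 0; first by rewrite expr0n.
by rewrite zu0 ltxx.
Qed.

Lemma superposition_dil k (t : R) u : 0 < t -> summable leb (fun x => k ((t `^ (N%:R / 2) *: u) x)) ->
  summable leb (fun x => k (hs_dil t u x)) /\
  \int[leb]_x k (hs_dil t u x) = t ^- N * \int[leb]_x k ((t `^ (N%:R / 2) *: u) x).
Proof.
move=> t0 kS; have ts := dil_scales (N := N) t0.
rewrite (_ : (fun x => k (hs_dil t u x)) = (fun x => k ((t `^ (N%:R / 2) *: u) x)) \o dil t).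
  have ki := summable_integrable kS.
  by split; [apply: Summable; exact: scales_integrable ts ki|exact: scales_Rintegral ts ki].
by apply/funext => x; rewrite hs_dilE.
Qed.

End superposition.

(** * The Pohozaev functional *)

Lemma ip_close (R : realType) (V : lmodType R) (ip : V -> V -> R) (B e : R) :
  psd_form ip -> 0 < e -> exists2 dl : R, 0 < dl & forall w v, ip w w <= B ->
    ip v v <= dl -> `|ip (w + v) (w + v) - ip w w| <= e.
Proof.
(* Weight in [2 * |ip w v| <= r * ip w w + r^-1 * ip v v], chosen so that the first term is at most
   [e / 2]. *)
move=> P e0; pose r := e / (2 * (`|B| + 1)).
have B0 : 0 < `|B| + 1 by rewrite ltr_wpDl.
have r0 : 0 < r by rewrite divr_gt0 ?mulr_gt0.
exists (e / (2 * (1 + r^-1))); first by rewrite divr_gt0 ?mulr_gt0 ?addr_gt0 ?invr_gt0.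
move=> w v wB vd; have w0 := ip_ge0 P w; have v0 := ip_ge0 P v.
have rB : r * (`|B| + 1) = e / 2 by rewrite /r; field; rewrite gt_eqF.
have h1 : r * ip w w <= e / 2 by rewrite -rB ler_pM2l//; have := ler_norm B; lra.
have h2 : ip v v * (1 + r^-1) <= e / 2.
  have r1 : 0 < 1 + r^-1 by rewrite addr_gt0 ?invr_gt0.
  rewrite -ler_pdivlMr//; apply: le_trans vd _; rewrite le_eqVlt; apply/orP; left; apply/eqP.
  by move: r1; move: (1 + _) => z z0; field; rewrite gt_eqF.
have := ip_ge0 P (r *: w + v); have := ip_ge0 P (r *: w - v).
rewrite (ip_sqB P) !(ip_sqD P) !(ip_sqZ P) !(ipZl P) => k1 k2.
have k3 : 2 * `|ip w v| <= r * ip w w + r^-1 * ip v v.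
  rewrite -(ler_pM2l r0) mulrDr [r * (r^-1 * _)]mulrA mulfV ?gt_eqF// mul1r.
  have -> : r * (2 * `|ip w v|) = 2 * `|r * ip w v| by rewrite normrM (gtr0_norm r0); ring.
  have : `|r * ip w v| <= (r * (r * ip w w) + ip v v) / 2 by rewrite ler_norml; apply/andP; split; lra.
  lra.
have -> : ip w w + 2 * ip w v + ip v v - ip w w = 2 * ip w v + ip v v by ring.
apply: le_trans (ler_normD _ _) _; rewrite normrM (gtr0_norm (ltr0n R 2)) (ger0_norm v0).
by move: h2; rewrite mulrDr mulr1 [ip v v * _]mulrC; lra.
Qed.

Lemma Ftilde0 (R : realType) (f : R -> R) : Ftilde f 0 = 0.
Proof. by rewrite /Ftilde primitive0 !mulr0 subrr. Qed.

Section pohozaev.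
Context {R : realType} {N : nat} {s : R} {f : R -> R}.
Hypothesis A : admissible s N f.
Notation leb := (@Rn_lebesgue R N).
Local Notation hs := (@hs R N s).
Local Notation F := (primitive f).
Local Notation Ft := (Ftilde f).
Local Notation Ftt := (dil_Ftilde s N f).
Implicit Types (u w v : hs) (t B e m : R).

Let aP := @aform_psd R N s.
Let bP := @bform_psd R N s.
Let s01 := adm_s A.
Let N2 := adm_N A.
Let s0 : 0 < s. Proof. by case/andP: s01. Qed.
Let N0 : (0 : R) < N%:R. Proof. by rewrite ltr0n (leq_trans _ N2). Qed.

Definition energy_hs u : R := sealed (aform u u / 2 - \int[leb]_x F (u x)).
Local Notation J := energy_hs.
Definition pohozaev u : R := sealed (s * aform u u - N%:R / 2 * \int[leb]_x Ft (u x)).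
Local Notation P := pohozaev.
Definition Gt t u : R := sealed (\int[leb]_x Ftt t (u x)).

Lemma energy_hsE u : J u = aform u u / 2 - \int[leb]_x F (u x).
Proof. by rewrite /energy_hs locked_withE. Qed.

Lemma pohozaevE u : P u = s * aform u u - N%:R / 2 * \int[leb]_x Ft (u x).
Proof. by rewrite /pohozaev locked_withE. Qed.

Lemma pohozaev0 u : P u = 0 <-> s * aform u u = N%:R / 2 * \int[leb]_x Ft (u x).
Proof. by rewrite pohozaevE; split=> [/eqP|->]; rewrite ?subrr// subr_eq0 => /eqP. Qed.

Let Gt_def t u : Gt t u = \int[leb]_x Ftt t (u x).
Proof. by rewrite /Gt locked_withE. Qed.

Let Ftt0 t : Ftt t 0 = 0.
Proof. by rewrite dil_FtildeE mulr0 Ftilde0 mulr0. Qed.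

Let Ftt1 x : Ftt 1 x = Ft x.
Proof. by rewrite dil_FtildeE !powR1 !mul1r. Qed.

Let Ftt_scale t u x : Ftt t (u x) = t `^ (- (N%:R + 2 * s)) * Ft ((t `^ (N%:R / 2) *: u) x).
Proof. by rewrite dil_FtildeE. Qed.

Let Ftt_summable t u : summable leb (fun x => Ftt t (u x)).
Proof.
have h := summableZ (t `^ (- (N%:R + 2 * s))) (summable_subcrit s01 N2 (t `^ (N%:R / 2) *: u) (adm_Ft A)).
by apply: summable_eq h => x; rewrite Ftt_scale.
Qed.

Let GtE t u : Gt t u = t `^ (- (N%:R + 2 * s)) * \int[leb]_x Ft ((t `^ (N%:R / 2) *: u) x).
Proof.
rewrite Gt_def -(RintZ _ (summable_subcrit s01 N2 _ (adm_Ft A))).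
by apply: eq_Rintegral => x _; rewrite Ftt_scale.
Qed.

Let Gt1 u : Gt 1 u = \int[leb]_x Ft (u x).
Proof. by rewrite Gt_def; apply: eq_Rintegral => x _; rewrite Ftt1. Qed.

Let Ftt_continuous t : continuous (Ftt t).
Proof.
have -> : Ftt t = fun x => t `^ (- (N%:R + 2 * s)) * Ft (t `^ (N%:R / 2) * x).
  by apply/funext => x; exact: dil_FtildeE.
move=> x; apply: cvgMr; apply: continuous_comp; first by apply: cvgMr; exact: cvg_id.
exact: subcrit_continuous (adm_Ft A) _.
Qed.

Let Ftt_gt0 t x : 0 < t -> x != 0 -> 0 < Ftt t x.
Proof.
move=> t0 x0; rewrite dil_FtildeE mulr_gt0 ?powR_gt0//; apply: (adm_Ft_gt0 A).
by rewrite mulf_neq0// gt_eqF// powR_gt0.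
Qed.

Let Ftt_ge0 t x : 0 < t -> 0 <= Ftt t x.
Proof. by move=> t0; have [->|/(Ftt_gt0 t0)/ltW//] := eqVneq x 0; rewrite Ftt0. Qed.

Let Ftt_le t1 t2 x : 0 < t1 -> t1 <= t2 -> Ftt t1 x <= Ftt t2 x.
Proof.
move=> t10; rewrite le_eqVlt => /orP[/eqP->//|t12].
by have [->|/(adm_lt A t10 t12)/ltW//] := eqVneq x 0; rewrite !Ftt0.
Qed.

Lemma Gt_le t1 t2 u : 0 < t1 -> t1 <= t2 -> Gt t1 u <= Gt t2 u.
Proof.
move=> t10 t12; rewrite !Gt_def; apply: Rint_le; [exact: Ftt_summable|exact: Ftt_summable|].
by move=> x; exact: Ftt_le.
Qed.

Lemma Gt_gt0 t u : 0 < t -> 0 < bform u u -> 0 < Gt t u.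
Proof. by move=> t0 b0; rewrite Gt_def; apply: superposition_gt0; rewrite ?Ftt0// => x; exact: Ftt_gt0. Qed.

Lemma Gt_small B e : 0 < e -> exists2 t0, 0 < t0 & forall t u, 0 < t -> t <= t0 ->
  hs_sq u <= B -> Gt t u <= e.
Proof.
move=> e0; have [K K0 hK] := growth_bounded s01 N2 B.
have [|t0 t00 h] := adm_small A (e := e / K); first by rewrite divr_gt0.
exists t0 => // t u t0' tt0 uB; apply: le_trans (Gt_le u t0' tt0) _.
have WS := summable_growth s01 N2 u.
rewrite Gt_def; apply: le_trans (Rint_le (Ftt_summable t0 u) (summableZ (e / K) WS) _) _; first by move=> x; exact: h.
rewrite RintZ//; apply: le_trans (_ : e / K * K <= _); last by rewrite divfK// gt_eqF.
by rewrite ler_pM2l ?divr_gt0//; exact: hK.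
Qed.

(** The dilation time depends on [u] only through a lower bound for the measure where [|u| > l];
    this uniformity is what makes coercivity work. *)
Lemma Gt_large B l c : 0 < l -> 0 < c -> exists2 T, 0 < T & forall t u, T < t ->
  c <= meas_gt l u -> B < Gt t u.
Proof.
move=> l0 c0; pose p := mass_exp (R := R) s N.
have lp : 0 < l `^ p by rewrite powR_gt0.
pose D := (`|B| + 1) / (l `^ p * c).
have D0 : 0 < D by rewrite divr_gt0 ?mulr_gt0// ltr_wpDl.
have [Y Y0 hY] := adm_large A D.
have N20 : (0 : R) < N%:R / 2 by rewrite divr_gt0.
have T0 : 0 < (Y / l) `^ (N%:R / 2)^-1 by rewrite powR_gt0// divr_gt0.
exists ((Y / l) `^ (N%:R / 2)^-1) => // t u Tt uc.
have t0 : 0 < t by apply: lt_trans Tt.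
have YT : Y / l <= t `^ (N%:R / 2).
  have -> : Y / l = ((Y / l) `^ (N%:R / 2)^-1) `^ (N%:R / 2).
    by rewrite -powRrM mulVf ?gt_eqF// powRr1// divr_ge0 ?ltW.
  by apply: ge0_ler_powR; rewrite ?nnegrE ?(ltW N20) ?(ltW T0) ?(ltW t0) ?(ltW Tt).
have MS := summable_measure_gt u l0.
apply: (@lt_le_trans _ _ (D * l `^ p * meas_gt l u)).
  apply: (@lt_le_trans _ _ (D * l `^ p * c)); last by rewrite ler_pM2l// mulr_gt0.
  have -> : D * l `^ p * c = `|B| + 1 by rewrite /D; field; rewrite !gt_eqF.
  by have := ler_norm B; lra.
rewrite -RintZ// Gt_def; apply: Rint_le; [exact: summableZ|exact: Ftt_summable|].
move=> x; case: ltP => [lx|_]; last by rewrite mulr0 Ftt_ge0.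
have ux : u x != 0 by rewrite -normr_gt0; apply: lt_trans lx.
rewrite mulr1; apply: le_trans (_ : D * `|u x| `^ p <= _).
  rewrite ler_pM2l//; have p2 : 2 < p by apply: mass_exp_gt2 => //.
  by apply: ge0_ler_powR; rewrite ?nnegrE ?(ltW l0) ?(ltW lx)//; lra.
apply: hY => //; move: YT; rewrite ler_pdivrMr// => /le_trans; apply.
by rewrite ler_pM2l ?powR_gt0// ltW.
Qed.

Lemma Gt_close t B e : 0 < t -> 0 < e -> exists2 dl, 0 < dl & forall w v,
  hs_sq w <= B -> hs_sq v <= dl -> `|Gt t (w + v) - Gt t w| <= e.
Proof.
move=> t0 e0; set c := t `^ (N%:R / 2); set d := t `^ (- (N%:R + 2 * s)).
have c0 : 0 < c by rewrite powR_gt0.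
have d0 : 0 < d by rewrite powR_gt0.
have [|eta eta0 h] := superposition_continuous0 s01 N2 (c ^+ 2 * B) (adm_Ft A) (e := e / d).
  by rewrite divr_gt0.
exists (eta / c ^+ 2); first by rewrite divr_gt0 ?exprn_gt0.
move=> w v wB vd; rewrite !GtE -/c -/d -mulrBr normrM (gtr0_norm d0) mulrC -ler_pdivlMr//.
have := h (c *: w) (c *: v) 1; rewrite !hs_sqZ subrr normr0 (ltW eta0) scale1r -scalerDr.
apply=> //; first by rewrite ler_pM2l ?exprn_gt0.
by rewrite mulrC -ler_pdivlMr ?exprn_gt0.
Qed.

Let powR_at (a t : R) : 0 < t -> {for t, continuous (fun x : R => x `^ a)}.
Proof.
move=> t0; apply: differentiable_continuous; apply/derivable1_diffP.
exact: (@ex_derive _ _ _ _ _ _ _ (is_derive1_powR a t0)).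
Qed.

Lemma Gt_continuous u t : 0 < t -> {for t, continuous (fun t => Gt t u)}.
Proof.
move=> t0.
have cN : (fun t => \int[leb]_x Ft ((t `^ (N%:R / 2) *: u) x)) r @[r --> t] -->
    \int[leb]_x Ft ((t `^ (N%:R / 2) *: u) x).
  set c := t `^ (N%:R / 2); have c0 : 0 < c by rewrite powR_gt0.
  apply/cvgrPdist_le => e e0.
  have [eta eta0 h] := superposition_continuous0 s01 N2 (hs_sq (c *: u)) (adm_Ft A) e0.
  have /cvgrPdist_le/(_ (eta * c)) : (r `^ (N%:R / 2)) @[r --> t] --> c by exact: powR_at.
  rewrite mulr_gt0// => /(_ isT); apply: filterS => r; rewrite distrC => hr.
  have := h (c *: u) 0 (r `^ (N%:R / 2) / c) (lexx _).
  rewrite addr0 scalerA divfK ?gt_eqF// => h2; rewrite distrC; apply: h2.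
    by rewrite -(scale0r 0) hs_sqZ expr0n mul0r ltW.
  rewrite -[X in _ - X](divff (lt0r_neq0 c0)) -mulrBl normrM normfV (gtr0_norm c0).
  by rewrite ler_pdivrMr.
have -> : (fun t => Gt t u) = (fun t => t `^ (- (N%:R + 2 * s)) * \int[leb]_x Ft ((t `^ (N%:R / 2) *: u) x)).
  by apply/funext => r; exact: GtE.
by apply: cvgM => //; exact: powR_at.
Qed.

Lemma Ftilde_dil t u : 0 < t -> \int[leb]_x Ft (hs_dil t u x) = t `^ (2 * s) * Gt t u.
Proof.
move=> t0; have S := summable_subcrit s01 N2 (t `^ (N%:R / 2) *: u) (adm_Ft A).
rewrite (superposition_dil t0 S).2 GtE mulrA; congr (_ * _).
rewrite -powR_addp// -(powR_mulrn N (ltW t0)) -powRN; congr powR; ring.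
Qed.

Lemma pohozaev_dil t u : 0 < t ->
  P (hs_dil t u) = t `^ (2 * s) * (s * aform u u - N%:R / 2 * Gt t u).
Proof. by move=> t0; rewrite pohozaevE aform_dil// Ftilde_dil//; ring. Qed.

Lemma pohozaev_dil0 t u : 0 < t -> P (hs_dil t u) = 0 <-> s * aform u u = N%:R / 2 * Gt t u.
Proof.
move=> t0; rewrite pohozaev_dil//; split=> [/eqP|->]; last by rewrite subrr mulr0.
by rewrite mulf_eq0 gt_eqF ?powR_gt0//= subr_eq0 => /eqP.
Qed.

(** If the seminorm vanished, all dilates of [u] would stay in one bounded set, so [Gt t0] of them
    would be at most 1. But [Gt t0 (hs_dil r u)] equals [r^(2s) * Gt (r * t0) u], hence is at least
    [r^(2s) * Gt t0 u], which is unbounded. *)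
Lemma aform_gt0 u : 0 < bform u u -> 0 < aform u u.
Proof.
move=> b0; rewrite lt_def (ip_ge0 aP) andbT; apply/eqP => a0.
have [t0 t00 h] := Gt_small (bform u u) ltr01.
have g0 := Gt_gt0 t00 b0.
have key r : 1 <= r -> r `^ (2 * s) * Gt t0 u <= 1.
  move=> r1; have r0 : 0 < r by apply: lt_le_trans r1.
  apply: (@le_trans _ _ (Gt t0 (hs_dil r u))); last first.
    by apply: h => //; rewrite /hs_sq aform_dil// bform_dil// a0 mulr0 add0r.
  have E : hs_dil t0 (hs_dil r u) = hs_dil (r * t0) u by exact: hs_dilM.
  have := Ftilde_dil (hs_dil r u) t00; rewrite E (Ftilde_dil u (mulr_gt0 r0 t00)).
  rewrite (powRM _ (ltW r0) (ltW t00)).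
  have tr : t0 <= r * t0 by rewrite ler_peMl// ltW.
  have := Gt_le u t00 tr; have := powR_gt0 (2 * s) t00; have := powR_ge0 r (2 * s).
  move: (r `^ _) (t0 `^ _) (Gt t0 u) (Gt _ u) (Gt t0 _) => x y G1 G2 G3 x0 y0 G12.
  by rewrite [x * y]mulrC -mulrA => /(mulfI (lt0r_neq0 y0)) <-; rewrite ler_wpM2l.
have s20 : 0 < 2 * s by rewrite mulr_gt0.
pose r := Num.max 1 ((2 / Gt t0 u) `^ (2 * s)^-1).
have := key r; rewrite le_max lexx => /(_ isT).
have : 2 / Gt t0 u <= r `^ (2 * s).
  have -> : 2 / Gt t0 u = ((2 / Gt t0 u) `^ (2 * s)^-1) `^ (2 * s).
    by rewrite -powRrM mulVf ?gt_eqF// powRr1// divr_ge0 ?ltW.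
  apply: ge0_ler_powR; rewrite ?nnegrE ?(ltW s20) ?powR_ge0//.
    by rewrite le_max ler01.
  by rewrite le_max lexx orbT.
by rewrite ler_pdivrMr//; lra.
Qed.

Lemma meas_gt_gt0 u : 0 < bform u u -> exists2 l, 0 < l & 0 < meas_gt l u.
Proof.
move=> b0; have g0 := Gt_gt0 ltr01 b0; rewrite Gt1 in g0.
have [|l [C [l0 C0 h]]] := superposition_le_cutoff s01 N2 (hs_sq u) (adm_Ft A)
  (e := \int[leb]_x Ft (u x) / 2); first by rewrite divr_gt0.
exists l => //; have := h u (lexx _).
have -> : \int[leb]_x `|Ft (u x)| = \int[leb]_x Ft (u x).
  by apply: eq_Rintegral => x _; rewrite ger0_norm// -Ftt1 Ftt_ge0.
move=> h1; rewrite -(pmulr_rgt0 _ C0); lra.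
Qed.

Lemma pohozaev_zero u : 0 < bform u u -> exists2 t, 0 < t & P (hs_dil t u) = 0.
Proof.
move=> b0; have a0 := aform_gt0 b0.
pose c := 2 * s * aform u u / N%:R.
have c0 : 0 < c by rewrite divr_gt0 ?mulr_gt0.
have [t0 t00 h0] := Gt_small (hs_sq u) c0.
have [l l0 ml] := meas_gt_gt0 b0.
have [T T0 hT] := Gt_large c l0 ml.
pose t1 := Num.max t0 (T + 1).
have t01 : t0 <= t1 by rewrite le_max lexx.
have Tt1 : T < t1 by rewrite lt_max; apply/orP; right; lra.
have [||t] := @IVT R (fun t => Gt t u) t0 t1 c t01.
- apply: (@continuous_in_subspaceT R R) => t /set_mem /=; rewrite in_itv/= => /andP[tt _].
  by apply: Gt_continuous; exact: lt_le_trans tt.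
- have h1 := h0 t0 u t00 (lexx _) (lexx _); have h2 := hT t1 u Tt1 (lexx _).
  move: h1 h2; move: (Gt t0 u) (Gt t1 u) => x y h1 h2.
  by rewrite ge_min h1 le_max (ltW h2) orbT.
rewrite in_itv/= => /andP[tt _] E; exists t; first exact: lt_le_trans tt.
apply/pohozaev_dil0; first exact: lt_le_trans tt.
by rewrite E /c; field; rewrite gt_eqF.
Qed.

(** Integrate [adm_ray]; the equation [P w = 0] converts the integral of [Ftilde] into the seminorm
    term, which cancels. *)
Lemma energy_ray_le w t : P w = 0 -> 0 < t -> J (hs_dil t w) <= J w.
Proof.
move=> Pw t0.
have key (x y z T U : R) : (T - 1) / 2 * x <= U * y - z -> T * x / 2 - U * y <= x / 2 - z by lra.
have S1 := summable_subcrit s01 N2 w (adm_Ft A).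
have S2 := summable_subcrit s01 N2 w (adm_F A).
have S3 := summable_subcrit s01 N2 (t `^ (N%:R / 2) *: w) (adm_F A).
have [_ E3] := superposition_dil t0 S3; rewrite !energy_hsE (aform_dil w w t0) E3.
have := Rint_le (summableZ _ S1) (summableB (summableZ _ S3) S2) (fun x => adm_ray A (w x) t0).
rewrite RintZ// RintB//; last exact: summableZ.
rewrite RintZ//; move/pohozaev0: Pw => Pw.
have -> : N%:R / (4 * s) * (t `^ (2 * s) - 1) * \int[leb]_x Ft (w x) =
  (t `^ (2 * s) - 1) / (2 * s) * (N%:R / 2 * \int[leb]_x Ft (w x)) by field; rewrite gt_eqF.
rewrite -Pw (_ : _ / _ * (s * _) = (t `^ (2 * s) - 1) / 2 * aform w w); last by field; rewrite gt_eqF.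
exact: key.
Qed.

Lemma normalize_aform w : 0 < aform w w -> exists T v, [/\ 0 < T, aform v v = 1,
  bform v v = bform w w, w = hs_dil T v & aform w w = T `^ (2 * s)].
Proof.
move=> a0; have s20 : 2 * s != 0 by rewrite mulf_neq0// gt_eqF.
pose T := aform w w `^ (2 * s)^-1.
have T0 : 0 < T by rewrite powR_gt0.
have Ta : T `^ (2 * s) = aform w w by rewrite -powRrM mulVf// powRr1// ltW.
exists T, (hs_dil T^-1 w); split=> //.
- rewrite aform_dil ?invr_gt0// -Ta -powRM ?invr_ge0 ?(ltW T0)//.
  by rewrite mulVf ?gt_eqF// powR1.
- by rewrite bform_dil ?invr_gt0.
- by rewrite hs_dilM ?invr_gt0// mulVf ?gt_eqF// hs_dil1.
Qed.

(** Write [w = hs_dil T v] with [aform v v = 1]. The Pohozaev equation says [Gt T v = 2 * s / N],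
    while [Gt] is at most [s / N] for short times, so [T] cannot be small. *)
Lemma pohozaev_aform_ge m : 0 < m -> exists2 c, 0 < c & forall w, bform w w = m ->
  P w = 0 -> c <= aform w w.
Proof.
move=> m0; have [|t0 t00 h] := Gt_small (1 + m) (e := s / N%:R); first by rewrite divr_gt0.
exists (t0 `^ (2 * s)); first by rewrite powR_gt0.
move=> w wm Pw; have a0 : 0 < aform w w by apply: aform_gt0; rewrite wm.
have [T [v [T0 va vb wE ->]]] := normalize_aform a0.
apply: ge0_ler_powR; rewrite ?nnegrE ?(ltW t00) ?(ltW T0) ?mulr_ge0 ?(ltW s0)//.
rewrite leNgt; apply/negP => Tt0.
have := h T v T0 (ltW Tt0); rewrite /hs_sq va vb wm => /(_ (lexx _)).
move: Pw; rewrite wE => /(pohozaev_dil0 v T0).1; rewrite va mulr1 => E.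
rewrite ler_pdivlMr// => G; have s0' := s0.
by have := E; move: G s0'; move: (Gt T v) => g; lra.
Qed.

(** Compare [w] with the point [u] of its ray whose squared seminorm is the fixed number [a]. As
    [J u <= J w <= C], the integral of [F] over [u] is at least 1, so [u] is not small in measure.
    Then [Gt_large] bounds the time from [u] to [w], hence the seminorm of [w]. *)
Lemma pohozaev_coercive m C : 0 < m -> exists2 B, 0 < B & forall w, bform w w = m ->
  P w = 0 -> J w <= C -> aform w w <= B.
Proof.
move=> m0; have s20 : 0 < 2 * s by rewrite mulr_gt0.
(* Chosen so that [a / 2 - C >= 1]. *)
pose a := 2 * (`|C| + 1); have a0 : 0 < a by rewrite mulr_gt0// ltr_wpDl.
pose r := a `^ (2 * s)^-1; have r0 : 0 < r by rewrite powR_gt0.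
have ra : r `^ (2 * s) = a by rewrite -powRrM mulVf ?gt_eqF// powRr1// ltW.
have [|l [D [l0 D0 h]]] := superposition_le_cutoff s01 N2 (a + m) (adm_F A) (e := 1 / 2); first by [].
have [|T T0 hT] := Gt_large (2 * s * a / N%:R) l0 (c := (2 * D)^-1); first by rewrite invr_gt0 mulr_gt0.
have key (x y z : R) : y <= 1 / 2 + D * x -> z <= y -> 1 <= z -> 1 <= x * (2 * D) by lra.
exists ((T * r) `^ (2 * s)); first by rewrite powR_gt0 ?mulr_gt0.
move=> w wm Pw JC; have aw0 : 0 < aform w w by apply: aform_gt0; rewrite wm.
have [t [v [t0 va vb wE ->]]] := normalize_aform aw0.
pose u := hs_dil r v.
have ua : aform u u = a by rewrite aform_dil// va mulr1.
have ub : bform u u = m by rewrite bform_dil// vb.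
have wu : w = hs_dil (t / r) u.
  by rewrite /u hs_dilM ?divr_gt0// mulrC divfK ?gt_eqF// mulrC divfK ?gt_eqF.
have uw : u = hs_dil (r / t) w.
  by rewrite wE hs_dilM ?divr_gt0// mulrC divfK ?gt_eqF.
have Fu : 1 <= \int[leb]_x F (u x).
  have := energy_ray_le Pw (divr_gt0 r0 t0); rewrite -uw [J u]energy_hsE ua /a.
  by have := ler_norm C; lra.
have Mu : (2 * D)^-1 <= meas_gt l u.
  have := h u; rewrite /hs_sq ua ub lexx => /(_ isT) h1.
  have := Rint_le (summable_subcrit s01 N2 u (adm_F A))
     (summable_norm (summable_subcrit s01 N2 u (adm_F A))) (fun x => ler_norm _) => h2.
  rewrite -[leLHS]div1r ler_pdivrMr ?mulr_gt0//.
  exact: key h1 h2 Fu.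
have tr0 : 0 < t / r by rewrite divr_gt0.
have : t / r <= T.
  rewrite leNgt; apply/negP => /(hT _ u) /(_ Mu).
  move: Pw; rewrite wu => /(pohozaev_dil0 u tr0).1; rewrite ua => E.
  by rewrite ltr_pdivrMr//; lra.
rewrite ler_pdivrMr// => tT.
by apply: ge0_ler_powR; rewrite ?nnegrE ?(ltW s20) ?(ltW t0) ?(ltW (mulr_gt0 T0 r0)).
Qed.

Let Ft_lower m : 0 < m -> exists2 c, 0 < c & forall w, bform w w = m ->
  P w = 0 -> c <= \int[leb]_x Ft (w x).
Proof.
move=> m0; have [c c0 h] := pohozaev_aform_ge m0.
exists (2 * s * c / N%:R); first by rewrite divr_gt0 ?mulr_gt0.
move=> w wm Pw; have := h w wm Pw; rewrite -(ler_pM2l s0).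
move/pohozaev0: Pw => -> h1.
by rewrite ler_pdivrMr//; lra.
Qed.

Let abs_Ft u : \int[leb]_x `|Ft (u x)| = \int[leb]_x Ft (u x).
Proof. by apply: eq_Rintegral => x _; rewrite ger0_norm// -Ftt1 Ftt_ge0. Qed.

(** On the Pohozaev set the integral of [Ftilde] is bounded below, and up to a small multiple of the
    growth weight it is dominated by any positive [z]. Used for the strict growth of [Gt] in time
    and for the sign of the multiplier. *)
Lemma pohozaev_positive_part m B (z : R -> R) : 0 < m -> continuous z -> (forall x, x != 0 -> 0 < z x) ->
  0 <= z 0 -> (forall u, summable leb (fun x => z (u x))) ->
  exists2 c, 0 < c & forall w, bform w w = m -> aform w w <= B -> P w = 0 ->
    c <= \int[leb]_x z (w x).
Proof.
move=> m0 cz z0 z00 zS; have [c c0 h] := Ft_lower m0.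
have [|C C0 hC] := superposition_le_pos s01 N2 (B + m) (adm_Ft A) cz z0 z00 zS (e := c / 2).
  by rewrite divr_gt0.
exists (c / (2 * C)); first by rewrite divr_gt0 ?mulr_gt0.
move=> w wm wB Pw; have := hC w; rewrite /hs_sq wm lerD2r => /(_ wB).
rewrite abs_Ft; have := h w wm Pw => h1 h2.
by rewrite ler_pdivrMr ?mulr_gt0//; lra.
Qed.

Lemma pohozaev_not_small m B : 0 < m -> exists2 e, 0 < e & forall w, bform w w = m ->
  aform w w <= B -> P w = 0 -> e < meas_gt e w.
Proof.
move=> m0; have [c c0 h] := Ft_lower m0.
have [|l [C [l0 C0 hC]]] := superposition_le_cutoff s01 N2 (B + m) (adm_Ft A) (e := c / 2).
  by rewrite divr_gt0.
pose e := Num.min l (c / (4 * C)).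
have e0 : 0 < e by rewrite lt_min l0 divr_gt0 ?mulr_gt0.
exists e => // w wm wB Pw; have := hC w; rewrite /hs_sq wm lerD2r => /(_ wB).
rewrite abs_Ft; have := h w wm Pw => h1 h2.
have : c / (2 * C) <= meas_gt l w by rewrite ler_pdivrMr ?mulr_gt0//; lra.
have : meas_gt l w <= meas_gt e w.
  apply: Rint_le; [exact: summable_measure_gt|exact: summable_measure_gt|move=> x].
  case: (ltP l) => [lx|_]; last by rewrite ler0n.
  suff -> : e < `|w x| by [].
  by apply: le_lt_trans lx; rewrite ge_min lexx.
have : e <= c / (4 * C) by rewrite ge_min lexx orbT.
have : c / (4 * C) < c / (2 * C).
  by rewrite ltr_pM2l// ltf_pV2 ?posrE ?mulr_gt0// ltr_pM2r// ltr_nat.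
lra.
Qed.

Let Gt_gap m B t1 t2 : 0 < m -> 0 < t1 -> t1 < t2 -> exists2 c, 0 < c & forall w,
  bform w w = m -> aform w w <= B -> P w = 0 -> Gt t1 w + c <= Gt t2 w.
Proof.
move=> m0 t10 t12.
have zS u : summable leb (fun x => Ftt t2 (u x) - Ftt t1 (u x)) by exact: summableB.
have [|x x0||c c0 h] := @pohozaev_positive_part m B (fun x => Ftt t2 x - Ftt t1 x) m0 _ _ _ zS.
- by move=> x; apply: cvgB; exact: Ftt_continuous.
- by rewrite subr_gt0 (adm_lt A).
- by rewrite !Ftt0 subrr.
exists c => // w wm wB Pw; have := h w wm wB Pw; rewrite RintB//.
by move=> h1; rewrite !Gt_def -lerBrDl.
Qed.

(** Quantitative uniqueness of the Pohozaev time. At the times [1 - e] and [1 + e] the increasing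
    function [Gt] misses its value at 1 by a uniform gap [c]; a small perturbation moves the
    seminorm and these two values by less than the gap, so a root cannot leave the interval. *)
Lemma pohozaev_zero_close m B eta : 0 < m -> 0 < eta -> exists2 dl, 0 < dl & forall w v t,
  bform w w = m -> aform w w <= B -> P w = 0 -> hs_sq v <= dl ->
  0 < t -> P (hs_dil t (w + v)) = 0 -> `|t - 1| <= eta.
Proof.
move=> m0 eta0; pose e := Num.min eta (1 / 2).
have e0 : 0 < e by rewrite lt_min eta0/=.
have e1 : e <= 1 / 2 by rewrite ge_min lexx orbT.
have ee : e <= eta by rewrite ge_min lexx.
have [||c1 c10 g1] := @Gt_gap m B 1 (1 + e) m0; [by []|lra|].
have [||c2 c20 g2] := @Gt_gap m B (1 - e) 1 m0; [lra|lra|].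
pose c := Num.min c1 c2; have c0 : 0 < c by rewrite lt_min c10.
have cc1 : c <= c1 by rewrite ge_min lexx.
have cc2 : c <= c2 by rewrite ge_min lexx orbT.
(* A change of this size in [aform] moves the level [2 * s * aform / N] by [c / 4]. *)
have k0 : 0 < N%:R * c / (8 * s) by rewrite divr_gt0 ?mulr_gt0.
have [da da0 ha] := ip_close B aP k0.
have c40 : 0 < c / 4 by rewrite divr_gt0.
have [||d1 d10 h1] := @Gt_close (1 + e) (B + m) (c / 4); [lra|by []|].
have [||d2 d20 h2] := @Gt_close (1 - e) (B + m) (c / 4); [lra|by []|].
have low (r : R) : r - 1 < - eta -> r <= 1 - e by lra.
have high (r : R) : eta < r - 1 -> 1 + e <= r by lra.
have fin1 (x y y' z : R) : `|x - z| <= c / 4 -> `|y' - y| <= c / 4 -> y + c2 <= z -> x <= y' -> False.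
  by rewrite !ler_norml; lra.
have fin2 (x y y' z : R) : `|x - z| <= c / 4 -> `|y' - y| <= c / 4 -> z + c1 <= y -> y' <= x -> False.
  by rewrite !ler_norml; lra.
have ep : 0 < 1 + e by lra.
exists (Num.min da (Num.min d1 d2)); first by rewrite !lt_min da0 d10.
move=> w v t wm wB Pw; rewrite !le_min => /and3P[va v1 v2] t0 Pt.
have wBm : hs_sq w <= B + m by rewrite /hs_sq wm lerD2r.
have av : aform v v <= da by apply: le_trans va; rewrite /hs_sq lerDl (ip_ge0 bP).
have A1 := ha w v wB av; have G1 := h1 w v wBm v1; have G2 := h2 w v wBm v2.
have gg1 := g1 w wm wB Pw; have gg2 := g2 w wm wB Pw.
move/(pohozaev_dil0 _ t0): Pt => Pt.
have Pw1 : s * aform w w = N%:R / 2 * Gt 1 w.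
  by move/pohozaev0: Pw => ->; rewrite Gt1.
have As : `|s * aform (w + v) (w + v) - s * aform w w| <= N%:R / 2 * (c / 4).
  rewrite -mulrBr normrM (gtr0_norm s0); apply: le_trans (ler_wpM2l (ltW s0) A1) _.
  by rewrite le_eqVlt; apply/orP; left; apply/eqP; field; rewrite gt_eqF.
have E : `|Gt t (w + v) - Gt 1 w| <= c / 4.
  have N20 : (0 : R) < N%:R / 2 by rewrite divr_gt0.
  move: As; rewrite Pt Pw1 -mulrBr normrM (gtr0_norm N20) (ler_pM2l N20) => h.
  exact: h.
rewrite ler_norml; apply/andP; split.
  rewrite leNgt; apply/negP => /low tl.
  exact: fin1 E G2 gg2 (Gt_le _ t0 tl).
rewrite leNgt; apply/negP => /high tl.
exact: fin2 E G1 gg1 (Gt_le _ ep tl).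
Qed.

End pohozaev.

(** * Convergence in H^s *)

Lemma cvg0_le (R : realType) I (F : set_system I) {FF : Filter F} (x y : I -> R) :
  (\forall i \near F, `|x i| <= y i) -> y i @[i --> F] --> 0 -> x i @[i --> F] --> 0.
Proof.
move=> xy /cvgr0Pnorm_le y0; apply/cvgr0Pnorm_le => e e0; near=> i.
have h1 : `|x i| <= y i by near: i.
have h2 : `|y i| <= e by near: i; exact: y0.
by apply: le_trans h1 _; apply: le_trans h2; exact: ler_norm.
Unshelve. all: by end_near. Qed.

Section hs_convergence.
Context {R : realType} {N : nat} {s : R}.
Hypotheses (s01 : 0 < s < 1) (N2 : (2 < N)%N).
Notation leb := (@Rn_lebesgue R N).
Local Notation hs := (@hs R N s).
Local Notation q := (@crit_exp R N s).
Implicit Types (u w v phi : hs) (k : R -> R) (B e : R).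

Let aP := @aform_psd R N s.
Let bP := @bform_psd R N s.
Let tP : psd_form (@tform R N s 1). Proof. exact: tform_psd. Qed.

Definition hn u : R := nrm (tform 1) u.

Lemma hn_sq u : hn u ^+ 2 = hs_sq u.
Proof. by rewrite /hn (nrm_sq tP) /tform mul1r. Qed.

Lemma hn_ge0 u : 0 <= hn u. Proof. exact: nrm_ge0. Qed.

Lemma hnE u : hn u = Num.sqrt (hs_sq u).
Proof. by rewrite -hn_sq sqrtr_sqr ger0_norm ?hn_ge0. Qed.

Lemma hnD u v : hn (u + v) <= hn u + hn v. Proof. exact: (ler_nrmD tP). Qed.
Lemma hnN u : hn (- u) = hn u. Proof. exact: (nrmN tP). Qed.
Lemma hnZ (c : R) u : hn (c *: u) = `|c| * hn u. Proof. exact: (nrmZ tP). Qed.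
Lemma hn0 : hn 0 = 0. Proof. exact: (nrm0 tP). Qed.
Lemma ler_hnB u v : `|hn u - hn v| <= hn (u - v). Proof. exact: (ler_nrmB tP). Qed.

Lemma hn_le u B : 0 <= B -> (hn u <= B) = (hs_sq u <= B ^+ 2).
Proof. by move=> B0; rewrite -hn_sq ler_pXn2r ?nnegrE ?hn_ge0. Qed.

Let nrm_aform_le u : nrm (@aform R N s) u <= hn u.
Proof.
by rewrite hnE /nrm ler_wsqrtr// /hs_sq lerDl (ip_ge0 bP).
Qed.

Let nrm_bform_le u : nrm (@bform R N s) u <= hn u.
Proof.
by rewrite hnE /nrm ler_wsqrtr// /hs_sq lerDr (ip_ge0 aP).
Qed.

Lemma ler_aform u v : `|aform u v| <= hn u * hn v.
Proof.
apply: le_trans (ler_ip_nrm aP u v) _.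
by apply: ler_pM => //; exact: nrm_ge0.
Qed.

Lemma ler_bform u v : `|bform u v| <= hn u * hn v.
Proof.
apply: le_trans (ler_ip_nrm bP u v) _.
by apply: ler_pM => //; exact: nrm_ge0.
Qed.

Lemma bform0_hs_sq u : bform u u = 0 -> hs_sq u = 0.
Proof.
move=> b0; have u0 : {ae leb, forall x, u x = 0}.
  have h : sq_dist (@bform R N s) u 0 = 0 by rewrite /sq_dist subr0.
  by have := sq_dist0_ae h; apply: filterS => x ->.
rewrite /hs_sq b0 addr0; apply: EFin_inj; rewrite aform_sqE.
transitivity (\int[leb \x leb]_z 0%:E)%E; last by rewrite integral0.
apply: ge0_ae_eq_integral => //.
- by apply: measurable_EFin_sq; apply: measurable_diffq; exact: hs_measurable.
- by move=> z _; rewrite lee_fin sqr_ge0.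
move: (ae_fst leb u0) (ae_snd leb u0); apply: filterS2 => z z1 z2 _.
by rewrite /diffq z1 z2 subrr mul0r expr0n.
Qed.

Section filters.
Context {I : Type} (F : set_system I) {FF : Filter F}.
Implicit Types (ui vi : I -> hs) (ci : I -> R).

Definition hcvg ui u : Prop := hn (ui i - u) @[i --> F] --> (0 : R).

Lemma hcvg_cst u : hcvg (fun=> u) u.
Proof. by rewrite /hcvg subrr hn0; exact: cvg_cst. Qed.

Lemma hcvgD ui u vi v : hcvg ui u -> hcvg vi v -> hcvg (fun i => ui i + vi i) (u + v).
Proof.
move=> cu cv; apply: (cvg0_le (y := fun i => hn (ui i - u) + hn (vi i - v))).
  apply: nearW => i; rewrite ger0_norm ?hn_ge0// opprD addrACA; exact: hnD.
by rewrite -(addr0 (0 : R)); apply: cvgD.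
Qed.

Lemma hcvgZ ci (c : R) ui u : ci i @[i --> F] --> c -> hcvg ui u ->
  hcvg (fun i => ci i *: ui i) (c *: u).
Proof.
move=> cc cu.
apply: (cvg0_le (y := fun i => `|ci i| * hn (ui i - u) + `|ci i - c| * hn u)).
  apply: nearW => i; rewrite ger0_norm ?hn_ge0// -!hnZ.
  apply: le_trans (hnD _ _); rewrite scalerBr scalerBl addrA subrK.
  exact: lexx.
rewrite (_ : 0 = `|c| * 0 + `|0 : R| * hn u); last by rewrite normr0 mulr0 mul0r addr0.
apply: cvgD; first by apply: cvgM => //; exact: cvg_norm.
apply: cvgMr_tmp; apply: cvg_norm; rewrite -(subrr c); apply: cvgB => //; exact: cvg_cst.
Qed.

Lemma hcvg_hn ui u : hcvg ui u -> hn (ui i) @[i --> F] --> hn u.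
Proof.
move=> cu; apply/cvgrPdist_le => e e0; near=> i.
rewrite distrC; apply: le_trans (ler_hnB _ _) _.
have : `|hn (ui i - u)| <= e by near: i; move: e e0; apply/cvgr0Pnorm_le.
by rewrite ger0_norm ?hn_ge0.
Unshelve. all: by end_near. Qed.

Let hcvg_form (ip : hs -> hs -> R) ui u vi v : psd_form ip ->
  (forall u v, `|ip u v| <= hn u * hn v) -> hcvg ui u -> hcvg vi v ->
  ip (ui i) (vi i) @[i --> F] --> ip u v.
Proof.
move=> P ipn cu cv; rewrite -[X in _ --> X]subr0.
rewrite (_ : (fun i => ip (ui i) (vi i)) = (fun i => ip u v - (ip u v - ip (ui i) (vi i)))); last first.
  by apply/funext => i; rewrite subKr.
apply: cvgB; first exact: cvg_cst.
apply: (cvg0_le (y := fun i => hn (ui i - u) * hn (vi i) + hn u * hn (vi i - v))).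
  apply: nearW => i.
  have -> : ip u v - ip (ui i) (vi i) = - (ip (ui i - u) (vi i) + ip u (vi i - v)).
    by rewrite (ipBl P) (ipBr P); ring.
  by rewrite normrN; apply: le_trans (ler_normD _ _) _; rewrite lerD.
rewrite (_ : 0 = 0 * hn v + hn u * 0); last by rewrite mul0r mulr0 addr0.
apply: cvgD; first by apply: cvgM => //; exact: hcvg_hn.
by apply: cvgM => //; exact: cvg_cst.
Qed.

Lemma hcvg_aform ui u vi v : hcvg ui u -> hcvg vi v -> aform (ui i) (vi i) @[i --> F] --> aform u v.
Proof. by move=> cu cv; apply: hcvg_form => //; exact: ler_aform. Qed.

Lemma hcvg_bform ui u vi v : hcvg ui u -> hcvg vi v -> bform (ui i) (vi i) @[i --> F] --> bform u v.
Proof. by move=> cu cv; apply: hcvg_form => //; exact: ler_bform. Qed.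

Lemma hcvg_sq ui u : hcvg ui u -> hs_sq (ui i - u) @[i --> F] --> 0.
Proof.
move=> cu; under eq_fun do rewrite -hn_sq expr2.
by rewrite -(mul0r (0 : R)); apply: cvgM.
Qed.

Lemma hcvg_near ui u e : hcvg ui u -> 0 < e -> \forall i \near F, hs_sq (ui i - u) <= e.
Proof.
move=> /hcvg_sq/cvgr0Pnorm_le h e0; near=> i.
by apply: le_trans (ler_norm _) _; near: i; exact: h.
Unshelve. all: by end_near. Qed.

Lemma hn_dil_le (t : R) u : 0 < t -> hn (hs_dil t u) <= (t `^ s + 1) * hn u.
Proof.
move=> t0; have c0 : 0 <= t `^ s + 1 by rewrite addr_ge0 ?powR_ge0.
rewrite hn_le ?mulr_ge0 ?hn_ge0// exprMn hn_sq /hs_sq aform_dil// bform_dil//.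
have -> : t `^ (2 * s) = (t `^ s) ^+ 2 by rewrite -powR_mulrn ?powR_ge0// -powRrM mulrC.
have := ip_ge0 aP u; have := ip_ge0 bP u; have := powR_ge0 t s.
by move: (t `^ s) (aform u u) (bform u u) => x a b; nra.
Qed.

Lemma hcvg_dil (t : R) ui u : 0 < t -> hcvg ui u -> hcvg (fun i => hs_dil t (ui i)) (hs_dil t u).
Proof.
move=> t0 cu; apply: (cvg0_le (y := fun i => (t `^ s + 1) * hn (ui i - u))).
  by apply: nearW => i; rewrite ger0_norm ?hn_ge0// -hs_dilB//; exact: hn_dil_le.
by rewrite -(mulr0 (t `^ s + 1)); apply: cvgM => //; exact: cvg_cst.
Qed.

Lemma hcvg_superposition k ui u ci : subcrit q 0 k -> ci i @[i --> F] --> (1 : R) ->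
  hcvg ui u -> \int[leb]_x k ((ci i *: ui i) x) @[i --> F] --> \int[leb]_x k (u x).
Proof.
move=> kS c1 cu; apply/cvgrPdist_le => e e0.
have [eta eta0 h] := superposition_continuous0 s01 N2 (hs_sq u) kS e0.
near=> i; rewrite distrC; have := h u (ui i - u) (ci i) (lexx _).
rewrite [u + _]addrC subrK; apply; first by near: i; exact: hcvg_near.
by rewrite distrC; near: i; move: eta eta0 {h}; apply/cvgrPdist_le.
Unshelve. all: by end_near. Qed.

Lemma hcvg_superposition_mul k ui u ci (wi : I -> hs) B : subcrit q 1 k -> ci i @[i --> F] --> (1 : R) ->
  hcvg ui u -> (\forall i \near F, hs_sq (wi i) <= B) ->
  (\int[leb]_x (k ((ci i *: ui i) x) * wi i x) - \int[leb]_x (k (u x) * wi i x))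
    @[i --> F] --> (0 : R).
Proof.
move=> kS c1 cu pB; apply/cvgr0Pnorm_le => e e0.
have [eta eta0 h] := superposition_continuous s01 N2 (Num.max B (hs_sq u)) kS e0.
near=> i; have := h u (ui i - u) (wi i) (ci i).
rewrite [u + _]addrC subrK !le_max lexx orbT; apply=> //.
- by apply/orP; left; near: i.
- by near: i; exact: hcvg_near.
by rewrite distrC; near: i; move: eta eta0 {h}; apply/cvgrPdist_le.
Unshelve. all: by end_near. Qed.

End filters.
End hs_convergence.

(** * The constrained gradient *)

Lemma meas_gt_le (R : realType) (N : nat) (s e : R) (u : @hs R N s) : 0 < e ->
  meas_gt e u <= e ^- 2 * bform u u.
Proof.
move=> e0; rewrite -lee_fin meas_gtE// EFinM bform_sqE.
exact: measure_gt_markov (hs_measurable u).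
Qed.

Lemma le_sqr_succ (R : realType) (x y : R) : x <= y -> 0 <= y -> x <= (y + 1) ^+ 2.
Proof. by move=> xy y0; nra. Qed.

Section constrained_gradient.
Context {R : realType} {N : nat} {s : R} {f : R -> R}.
Hypothesis A : admissible s N f.
Notation leb := (@Rn_lebesgue R N).
Local Notation hs := (@hs R N s).
Local Notation q := (@crit_exp R N s).
Implicit Types (u w v phi : hs) (t B e m : R).

Let aP := @aform_psd R N s.
Let bP := @bform_psd R N s.
Let tP : psd_form (@tform R N s 1). Proof. exact: tform_psd. Qed.
Let s01 := adm_s A.
Let N2 := adm_N A.
Let fS := adm_f A.

Definition nonlin w phi : R := sealed (\int[leb]_x (f (w x) * phi x)).

Lemma nonlinE w phi : nonlin w phi = \int[leb]_x (f (w x) * phi x).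
Proof. by rewrite /nonlin locked_withE. Qed.

Lemma summable_nonlin w phi : summable leb (fun x => f (w x) * phi x).
Proof. exact: (summable_subcrit_mul s01 N2 w phi fS). Qed.

Lemma nonlinD w phi v : nonlin w (phi + v) = nonlin w phi + nonlin w v.
Proof.
rewrite !nonlinE -(RintD (summable_nonlin w phi) (summable_nonlin w v)).
by apply: eq_Rintegral => x _; rewrite -mulrDr.
Qed.

Lemma nonlinZ w c phi : nonlin w (c *: phi) = c * nonlin w phi.
Proof.
rewrite !nonlinE -(RintZ c (summable_nonlin w phi)).
by apply: eq_Rintegral => x _; rewrite mulrCA.
Qed.

Lemma nonlinB w phi v : nonlin w (phi - v) = nonlin w phi - nonlin w v.
Proof. by rewrite -[- v]scaleN1r nonlinD nonlinZ mulN1r. Qed.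

Lemma nonlinNl w phi : nonlin (- w) phi = - nonlin w phi.
Proof.
rewrite !nonlinE -mulN1r -(RintZ (-1) (summable_nonlin w phi)).
by apply: eq_Rintegral => x _; rewrite (adm_odd A) mulN1r mulNr.
Qed.

(** On the unit ball the cutoff estimate applies, and the measure of the set where the test function
    is large is bounded by Chebyshev. Linearity in [phi] extends the bound by scaling. *)
Lemma nonlin_bound B : exists2 C, 0 < C & forall w phi, hs_sq w <= B ->
  `|nonlin w phi| <= C * hn phi.
Proof.
have [dl [C [dl0 C0 h]]] := superposition_mul_le_cutoff s01 N2 (Num.max B 1) fS ltr01.
pose D := 1 + C * dl ^- 2.
have D0 : 0 < D by rewrite addr_gt0// mulr_gt0// invr_gt0 exprn_gt0.
exists D => // w phi wB.
have unit v : hn v <= 1 -> `|nonlin w v| <= D.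
  move=> v1; have v2 : hs_sq v <= 1 by move: v1; rewrite hn_le// expr1n.
  rewrite nonlinE; apply: le_trans (h w v _ _) _; rewrite ?le_max ?wB ?v2 ?orbT//.
  rewrite lerD2l ler_pM2l//; apply: le_trans (meas_gt_le v dl0) _.
  rewrite ler_piMr ?invr_ge0 ?exprn_ge0 ?(ltW dl0)//; apply: le_trans v2.
  by rewrite lerDr (ip_ge0 aP).
(* Dividing by [hn phi + e / D] rather than by [hn phi] covers test functions of norm zero. *)
apply/ler_addgt0Pr => e e0.
have r0 : 0 < hn phi + e / D by rewrite ltr_wpDl ?hn_ge0 ?divr_gt0.
have := unit ((hn phi + e / D)^-1 *: phi); rewrite hnZ nonlinZ normrM normfV (gtr0_norm r0).
have h1 : (hn phi + e / D)^-1 * hn phi <= 1.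
  by rewrite mulrC ler_pdivrMr// mul1r lerDl divr_ge0// ltW.
move=> /(_ h1); rewrite mulrC ler_pdivrMr// mulrDr.
by rewrite [D * (e / D)]mulrCA mulfV ?mulr1// gt_eqF.
Qed.

(** Chosen so that [constrained_diff w w = 0] when the mass is nonzero: the differential of the
    energy is projected along [w]. Its opposite is the [mu] of the equation. *)
Definition multiplier w : R := (aform w w - nonlin w w) / bform w w.
Definition constrained_diff w phi : R := aform w phi - nonlin w phi - multiplier w * bform w phi.
Local Notation lam := multiplier.
Local Notation ell := constrained_diff.

Let ell_bound w : exists C, forall phi, `|ell w phi| <= C * hn phi.
Proof.
have [C C0 h] := nonlin_bound (hs_sq w).
exists (hn w + C + `|lam w| * hn w) => phi; rewrite !mulrDl.
apply: le_trans (ler_normB _ _) _; apply: lerD.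
  by apply: le_trans (ler_normB _ _) _; apply: lerD; [exact: ler_aform|exact: h].
by rewrite normrM -mulrA ler_wpM2l//; exact: ler_bform.
Qed.

Let ell_riesz w : exists v, forall phi, tform 1 v phi = ell w phi.
Proof.
have [C hC] := ell_bound w.
apply: (riesz_representation tP (tform_complete ltr01) (C := C)) => //.
- by move=> u v; rewrite /ell (ipDr aP) (ipDr bP) nonlinD; ring.
- by move=> c v; rewrite /ell (ipZr aP) (ipZr bP) nonlinZ; ring.
Qed.

Let riesz_rep w : hs := projT1 (cid (ell_riesz w)).

Let riesz_repE w phi : tform 1 (riesz_rep w) phi = ell w phi.
Proof. exact: (projT2 (cid (ell_riesz w))). Qed.

Let multiplierN w : lam (- w) = lam w.
Proof.
rewrite /multiplier (ipNl aP) (ipNr aP) (ipNl bP) (ipNr bP) nonlinNl.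
by rewrite -(scaleN1r w) nonlinZ !opprK mulN1r.
Qed.

Let ellN w phi : ell (- w) phi = - ell w phi.
Proof. by rewrite /ell multiplierN (ipNl aP) (ipNl bP) nonlinNl; ring. Qed.

(* Representatives are only unique up to null sets: antisymmetrizing the chosen
   one makes the gradient exactly odd. *)
Definition grad w : hs := sealed (2^-1 *: (riesz_rep w - riesz_rep (- w))).

Let grad_def w : grad w = 2^-1 *: (riesz_rep w - riesz_rep (- w)).
Proof. by rewrite /grad locked_withE. Qed.

Lemma gradE w phi : tform 1 (grad w) phi = ell w phi.
Proof. by rewrite grad_def (ipZl tP) (ipBl tP) !riesz_repE ellN; field. Qed.

Lemma gradN w : grad (- w) = - grad w.
Proof. by rewrite !grad_def opprK -scalerN opprB. Qed.

Lemma hn_grad_sq w : hn (grad w) ^+ 2 = ell w (grad w).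
Proof. by rewrite -gradE /hn (nrm_sq tP). Qed.

Lemma multiplier_bound m B : 0 < m -> exists2 C, 0 < C & forall w, bform w w = m ->
  aform w w <= B -> `|lam w| <= C.
Proof.
move=> m0; have [C C0 h] := nonlin_bound (B + m).
exists ((`|B| + C * (`|B| + m + 1)) / m).
  by rewrite divr_gt0// ltr_wpDl// mulr_gt0// ltr_wpDl// addr_ge0// ltW.
move=> w wm wB; rewrite /multiplier wm normrM normfV (gtr0_norm m0) ler_pM2r ?invr_gt0//.
have wBm : hs_sq w <= B + m by rewrite /hs_sq wm lerD2r.
have wB1 : hn w <= `|B| + m + 1.
  have b0 : 0 <= `|B| + m by rewrite addr_ge0// ltW.
  rewrite (hn_le _ (addr_ge0 b0 ler01)); apply: le_trans wBm _.
  by apply: le_sqr_succ => //; rewrite lerD2r ler_norm.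
apply: le_trans (ler_normB _ _) _; apply: lerD.
  by rewrite ger0_norm ?(ip_ge0 aP)//; apply: le_trans wB (ler_norm _).
by apply: le_trans (h w w wBm) _; rewrite ler_pM2l.
Qed.

Lemma grad_bound m B : 0 < m -> exists2 C, 0 < C & forall w, bform w w = m ->
  aform w w <= B -> hn (grad w) <= C.
Proof.
move=> m0; have [C C0 h] := nonlin_bound (B + m); have [D D0 hD] := multiplier_bound B m0.
pose K := `|B| + m + 1; have K0 : 0 < K by rewrite ltr_wpDl// addr_ge0// ltW.
exists (K + C + D * K); first by rewrite addr_gt0 ?mulr_gt0// addr_gt0.
move=> w wm wB.
have wBm : hs_sq w <= B + m by rewrite /hs_sq wm lerD2r.
have wK : hn w <= K.
  have b0 : 0 <= `|B| + m by rewrite addr_ge0// ltW.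
  rewrite (hn_le _ (ltW K0)); apply: le_trans wBm _.
  by apply: le_sqr_succ => //; rewrite lerD2r ler_norm.
have [v0|v0] := leP (hn (grad w)) 0.
  by apply: le_trans v0 _; rewrite ltW// addr_gt0 ?mulr_gt0// addr_gt0.
rewrite -(ler_pM2r v0) -expr2 hn_grad_sq; apply: le_trans (ler_norm _) _.
rewrite /ell [(K + C + _) * _]mulrDl [(K + C) * _]mulrDl.
apply: le_trans (ler_normB _ _) _; apply: lerD.
  apply: le_trans (ler_normB _ _) _; apply: lerD; last exact: h.
  by apply: le_trans (ler_aform _ _) _; rewrite ler_pM2r.
rewrite normrM -mulrA; apply: ler_pM => //; first exact: hD.
by apply: le_trans (ler_bform _ _) _; rewrite ler_pM2r.
Qed.

Let nonlin_ae u w phi : hs_sq (u - w) = 0 -> nonlin u phi = nonlin w phi.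
Proof.
move=> uw; apply/eqP; rewrite -subr_eq0 -normr_le0; apply/ler_addgt0Pr => e e0; rewrite add0r.
have [eta eta0 h] := superposition_continuous s01 N2 (Num.max (hs_sq w) (hs_sq phi)) fS e0.
have := h w (u - w) phi 1; rewrite uw subrr normr0 !le_max !lexx orbT (ltW eta0).
by rewrite scale1r [w + _]addrC subrK !nonlinE; apply.
Qed.

Let form_ae (ip : hs -> hs -> R) u w phi : psd_form ip -> ip (u - w) (u - w) = 0 ->
  ip u phi = ip w phi.
Proof.
by move=> P h; have /eqP := ip_eq0 P phi h; rewrite (ipBl P) subr_eq0 => /eqP.
Qed.

(** Symmetric criticality: the functional [constrained_diff w] is invariant under rotations that fix
    [w], and its representer is unique up to null sets, which is the sense of [rot_invariant]. *)
Lemma grad_rot_invariant w : rot_invariant w -> rot_invariant (grad w).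
Proof.
move=> rw i j c t ij ct c1; have {rw} := rw i j c t ij ct c1.
set gP := isometry_rot _ _ _; rewrite /sq_dist => /bform0_hs_sq w0.
have [aw bw] : aform (hs_comp gP w - w) (hs_comp gP w - w) = 0 /\
    bform (hs_comp gP w - w) (hs_comp gP w - w) = 0.
  have := ip_ge0 aP (hs_comp gP w - w); have := ip_ge0 bP (hs_comp gP w - w).
  by move: w0; rewrite /hs_sq => w0 ? ?; split; lra.
have tcomp v phi : tform 1 (hs_comp gP v) (hs_comp gP phi) = tform 1 v phi.
  by rewrite /tform aform_comp bform_comp.
have ellg phi : ell w (hs_comp gP phi) = ell w phi.
  rewrite /ell -(form_ae _ aP aw) -(form_ae _ bP bw) aform_comp bform_comp.
  rewrite -(nonlin_ae (hs_comp gP phi) w0); congr (_ - _ - _).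
  have S := summable_integrable (summable_nonlin w phi).
  have := scales_Rintegral (isometry_scales gP) S; rewrite mul1r !nonlinE => <-.
  by [].
suff : hs_sq (hs_comp gP (grad w) - grad w) = 0.
  have := ip_ge0 aP (hs_comp gP (grad w) - grad w).
  have := ip_ge0 bP (hs_comp gP (grad w) - grad w).
  by rewrite /hs_sq => ? ? ?; lra.
rewrite -hn_sq /hn (nrm_sq tP) (ip_sqB tP) tcomp (ipC tP _ (grad w)) !gradE ellg.
by ring.
Qed.

Lemma nonlin_dil t w phi : 0 < t -> nonlin (hs_dil t w) (hs_dil t phi) =
  t ^- N * t `^ (N%:R / 2) * nonlin (t `^ (N%:R / 2) *: w) phi.
Proof.
move=> t0; have S := summable_nonlin (t `^ (N%:R / 2) *: w) phi.
have S2 := summableZ (t `^ (N%:R / 2)) S.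
have := scales_Rintegral (dil_scales t0) (summable_integrable S2).
rewrite (RintZ _ S) -nonlinE mulrA => <-; rewrite nonlinE.
by apply: eq_Rintegral => x _; rewrite !hs_dilE// /dilate mulrCA.
Qed.

Section filters.
Context {I : Type} (F : set_system I) {FF : Filter F}.
Variables (m : R) (wi : I -> hs) (w : hs) (ti : I -> R).
Hypotheses (m0 : 0 < m) (wim : forall i, bform (wi i) (wi i) = m) (wm : bform w w = m).
Hypotheses (cw : hcvg F wi w) (ti0 : forall i, 0 < ti i) (ct : ti i @[i --> F] --> (1 : R)).

Let cpow (a : R) : ti i `^ a @[i --> F] --> (1 : R).
Proof.
have e1 : (1 : R) `^ a = 1 by rewrite powR1.
have c : {for (1 : R), continuous (fun x : R => x `^ a)}.
  apply: differentiable_continuous; apply/derivable1_diffP.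
  exact: (@ex_derive _ _ _ _ _ _ _ (is_derive1_powR a ltr01)).
rewrite -[X in _ --> X]e1; exact: (cvg_comp _ _ ct c).
Qed.

Let rho i := ti i ^- N * ti i `^ (N%:R / 2).

Let crho : rho i @[i --> F] --> (1 : R).
Proof.
rewrite -(mulr1 (1 : R)) -{1}(invr1 R) -{1}(expr1n _ N); apply: cvgM.
  apply: cvgV; first by rewrite expr1n oner_eq0.
  exact: (cvg_comp _ _ ct (@exprn_continuous _ N _)).
exact: cpow.
Qed.

Let B := 2 * hs_sq w + 2.

Let nearB : \forall i \near F, hs_sq (wi i) <= B.
Proof.
near=> i; have h : hs_sq (wi i - w) <= 1 by near: i; exact: hcvg_near.
by have := hs_sqD_le (wi i - w) w; rewrite subrK /B; lra.
Unshelve. all: by end_near. Qed.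

Let near2 (x : I -> R) : x i @[i --> F] --> (1 : R) -> \forall i \near F, `|x i| <= 2.
Proof.
move=> x1; near=> i.
have h : `|1 - x i| <= 1 by near: i; move/cvgrPdist_le: x1; apply; exact: ltr01.
by have := ler_normB 1 (1 - x i); rewrite subKr normr1; lra.
Unshelve. all: by end_near. Qed.

Let cnonlin : nonlin (ti i `^ (N%:R / 2) *: wi i) (wi i) @[i --> F] --> nonlin w w.
Proof.
have [C C0 h] := nonlin_bound (hs_sq w).
have h1 := hcvg_superposition_mul s01 N2 fS (cpow (N%:R / 2)) cw nearB.
have h2 : nonlin w (wi i - w) @[i --> F] --> 0.
  apply: (cvg0_le (y := fun i => C * hn (wi i - w))); first by apply: nearW => i; exact: h.
  by rewrite -(mulr0 C); apply: cvgM => //; exact: cvg_cst.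
rewrite (_ : (fun i => _) = fun i => (\int[leb]_x (f ((ti i `^ (N%:R / 2) *: wi i) x) * wi i x) -
  \int[leb]_x (f (w x) * wi i x)) + nonlin w (wi i - w) + nonlin w w).
  by rewrite -[X in _ --> X]add0r -[X in X + _]addr0; apply: cvgD; [apply: cvgD; [exact: h1|exact: h2]|exact: cvg_cst].
by apply/funext => i; rewrite nonlinB -!nonlinE; ring.
Qed.

Let clam : lam (hs_dil (ti i) (wi i)) @[i --> F] --> lam w.
Proof.
rewrite (_ : (fun i => _) = fun i => (ti i `^ (2 * s) * aform (wi i) (wi i) -
    rho i * nonlin (ti i `^ (N%:R / 2) *: wi i) (wi i)) / m); last first.
  by apply/funext => i; rewrite /multiplier aform_dil// bform_dil// wim nonlin_dil.
rewrite /multiplier wm -[aform w w]mul1r -[nonlin w w]mul1r.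
apply: cvgM; last exact: cvg_cst.
apply: cvgB; apply: cvgM; [exact: cpow|exact: hcvg_aform|exact: crho|exact: cnonlin].
Qed.

(** The gradient is taken at a function dilated by a factor tending to 1 and then pulled back, so no
    limit of dilated functions has to be taken: dilations act on the forms and on [nonlin] by
    explicit factors, which tend to 1. *)
Lemma hcvg_grad : hcvg F (fun i => hs_dil (ti i)^-1 (grad (hs_dil (ti i) (wi i)))) (grad w).
Proof.
pose v i := hs_dil (ti i)^-1 (grad (hs_dil (ti i) (wi i))).
pose d i := v i - grad w.
have [Cn Cn0 hn_] := nonlin_bound (4 * B).
have [Cg Cg0 hg] := grad_bound (2 * B) m0.
pose K := 2 * Cg + hn (grad w) + B.
have B0 : 0 < B by rewrite /B; have := hs_sq_ge0 w; lra.
have K0 : 0 < K by rewrite /K ltr_wpDl// addr_ge0 ?hn_ge0// mulr_ge0// ltW.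
have g0 := hn_ge0 (grad w).
have Kd (x : R) : x <= 2 * Cg + hn (grad w) -> x <= K.
  by rewrite /K; move: B0 g0; move: B (hn _) => b g; lra.
have Kw (x : R) : x <= B -> x <= K.
  by rewrite /K; move: g0; move: (hn _) => g; lra.
have B1 : B <= B ^+ 2.
  by have := hs_sq_ge0 w; rewrite /B; move: (hs_sq w) => h; nra.
have e4 : (2 : R) ^+ 2 = 4 by ring.
have vE i : hs_dil (ti i) (v i) = grad (hs_dil (ti i) (wi i)).
  by rewrite /v hs_dilM ?invr_gt0// mulVf ?gt_eqF// hs_dil1.
(* Both defining equations are tested with the difference [d i]; each term on the right carries one
   factor tending to 0 against bounded ones. *)
have dE i : hn (d i) ^+ 2 = (1 - ti i `^ (2 * s)) * aform (v i) (d i) +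
    (ti i `^ (2 * s) - 1) * aform (wi i) (d i) + aform (wi i - w) (d i) -
    (rho i - 1) * nonlin (ti i `^ (N%:R / 2) *: wi i) (d i) -
    (nonlin (ti i `^ (N%:R / 2) *: wi i) (d i) - nonlin w (d i)) -
    (lam (hs_dil (ti i) (wi i)) - lam w) * bform (wi i) (d i) - lam w * bform (wi i - w) (d i).
  have : tform 1 (hs_dil (ti i) (v i)) (hs_dil (ti i) (d i)) =
      ell (hs_dil (ti i) (wi i)) (hs_dil (ti i) (d i)) by rewrite vE gradE.
  rewrite /ell /tform !aform_dil// !bform_dil// nonlin_dil// -/(rho i) mul1r => E1.
  have : tform 1 (grad w) (d i) = ell w (d i) by rewrite gradE.
  rewrite /ell /tform mul1r => E2.
  rewrite /hn (nrm_sq tP) {1}/d (ipBl tP) /tform !mul1r E2 (ipBl aP) (ipBl bP).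
  move: E1; move: (aform (v i) _) (bform (v i) _) => x y E1.
  have -> : y = (ti i `^ (2 * s) * x + y) - ti i `^ (2 * s) * x by ring.
  by rewrite E1; ring.
have bnds : \forall i \near F, [/\ hn (d i) <= K, hn (v i) <= K, hn (wi i) <= K &
    hs_sq (ti i `^ (N%:R / 2) *: wi i) <= 4 * B].
  near=> i.
  have wB : hs_sq (wi i) <= B by near: i; exact: nearB.
  have t1 : `|ti i `^ (2 * s)| <= 2 by near: i; exact: near2 (cpow _).
  have t2 : `|ti i `^ (- (2 * s))| <= 2 by near: i; exact: near2 (cpow _).
  have t3 : `|ti i `^ (N%:R / 2)| <= 2 by near: i; exact: near2 (cpow _).
  have a0 := ip_ge0 aP (wi i); have b0 := ip_ge0 bP (wi i).
  rewrite ger0_norm ?powR_ge0// in t1; rewrite ger0_norm ?powR_ge0// in t2.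
  have g1 : hn (grad (hs_dil (ti i) (wi i))) <= Cg.
    apply: hg; rewrite ?bform_dil// aform_dil//; apply: ler_pM; rewrite ?powR_ge0//.
    by move: wB; rewrite /hs_sq; lra.
  have v1 : hn (v i) <= 2 * Cg.
    have CC : 0 <= 2 * Cg by rewrite mulr_ge0// ltW.
    rewrite hn_le// /hs_sq aform_dil ?invr_gt0// bform_dil ?invr_gt0//.
    have -> : (ti i)^-1 `^ (2 * s) = ti i `^ (- (2 * s)) by rewrite -powR_inv1 ?(ltW (ti0 i))// -powRrM mulN1r.
    move: g1; rewrite hn_le ?(ltW Cg0)// /hs_sq exprMn.
    have := ip_ge0 aP (grad (hs_dil (ti i) (wi i))); have := ip_ge0 bP (grad (hs_dil (ti i) (wi i))).
    by move: t2; move: (_ `^ _) (aform _ _) (bform _ _) (Cg ^+ 2) => p x y z; nra.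
  have v2 : hn (v i) <= K by apply: Kd; apply: le_trans v1 _; rewrite lerDl.
  split=> //.
  - by apply: Kd; apply: le_trans (hnD _ _) _; rewrite hnN lerD2r.
  - have : hn (wi i) <= B.
      by rewrite (hn_le _ (ltW B0)); exact: le_trans wB _.
    exact: Kw.
  rewrite hs_sqZ; apply: ler_pM => //; rewrite ?sqr_ge0 ?hs_sq_ge0//.
  by rewrite -(real_normK (num_real _)) -e4 lerXn2r ?nnegrE.
have dn : \forall i \near F, hs_sq (d i) <= K ^+ 2.
  by apply: filterS bnds => i [h _ _ _]; move: h; rewrite hn_le// ltW.
have cn := hcvg_superposition_mul s01 N2 fS (cpow (N%:R / 2)) cw dn.
have sq0 : hn (d i) ^+ 2 @[i --> F] --> 0.
  apply: (cvg0_le (y := fun i => `|1 - ti i `^ (2 * s)| * (K * K) + `|ti i `^ (2 * s) - 1| * (K * K) +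
    hn (wi i - w) * K + `|rho i - 1| * (Cn * K) +
    `|\int[leb]_x (f ((ti i `^ (N%:R / 2) *: wi i) x) * d i x) - \int[leb]_x (f (w x) * d i x)| +
    `|lam (hs_dil (ti i) (wi i)) - lam w| * (K * K) + `|lam w| * (hn (wi i - w) * K))).
    apply: filterS bnds => i [d1 v1 w1 n1].
    have d0 := hn_ge0 (d i).
    have mul (x y : hs) : hn x <= K -> hn y <= K -> hn x * hn y <= K * K.
      by move=> hx hy; apply: ler_pM => //; exact: hn_ge0.
    rewrite dE -!nonlinE.
    have tri (x y X Y : R) : `|x| <= X -> `|y| <= Y -> `|x - y| <= X + Y.
      by move=> hx hy; apply: le_trans (ler_normB _ _) _; rewrite lerD.
    have triD (x y X Y : R) : `|x| <= X -> `|y| <= Y -> `|x + y| <= X + Y.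
      by move=> hx hy; apply: le_trans (ler_normD _ _) _; rewrite lerD.
    apply: (@tri); last first.
      rewrite normrM ler_wpM2l//; apply: le_trans (ler_bform _ _) _.
      by rewrite ler_wpM2l// hn_ge0.
    apply: (@tri); last first.
      by rewrite normrM ler_wpM2l//; apply: le_trans (ler_bform _ _) _; exact: (@mul).
    apply: (@tri) => //.
    apply: (@tri); last first.
      rewrite normrM ler_wpM2l//; apply: le_trans (hn_ _ _ n1) _.
      by rewrite ler_pM2l.
    apply: (@triD); last first.
      by apply: le_trans (ler_aform _ _) _; rewrite ler_wpM2l// hn_ge0.
    by apply: (@triD); rewrite normrM ler_wpM2l//; apply: le_trans (ler_aform _ _) _; exact: (@mul).
  have nz (x : I -> R) (l : R) : x i @[i --> F] --> l -> `|x i - l| @[i --> F] --> (0 : R).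
    move=> xl; rewrite -(normr0 R); apply: cvg_norm; rewrite -(subrr l).
    by apply: cvgB => //; exact: cvg_cst.
  have nz0 (x : I -> R) : x i @[i --> F] --> (0 : R) -> `|x i| @[i --> F] --> (0 : R).
    by move=> x0; have := nz x 0 x0; under eq_fun do rewrite subr0.
  have Z (x : I -> R) (c : R) : x i @[i --> F] --> (0 : R) -> x i * c @[i --> F] --> (0 : R).
    by move=> x0; rewrite -(mul0r c); apply: cvgM => //; exact: cvg_cst.
  rewrite (_ : (0 : R) = 0 + 0 + 0 + 0 + 0 + 0 + `|lam w| * 0); last by rewrite mulr0 !addr0.
  apply: cvgD; last by apply: cvgM; [exact: cvg_cst|exact: Z].
  apply: cvgD; last by apply: Z; exact: nz.
  have c4 := nz0 _ (cn FF).
  apply: cvgD; last exact: c4.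
  apply: cvgD; last by apply: Z; exact: nz.
  apply: cvgD; last exact: Z.
  apply: cvgD; apply: Z; last exact: nz (cpow _).
  by under eq_fun do rewrite distrC; exact: nz (cpow _).
rewrite /hcvg; apply/cvgr0Pnorm_le => e e0.
have e20 : 0 < e ^+ 2 by rewrite exprn_gt0.
move/cvgr0Pnorm_le: sq0 => /(_ _ e20); apply: filterS => i.
rewrite !ger0_norm ?sqr_ge0 ?hn_ge0// ler_pXn2r ?nnegrE ?hn_ge0//.
exact: ltW.
Unshelve. all: by end_near. Qed.

End filters.
End constrained_gradient.

(** * The descent step *)

(** Here [b] and [c] stand for [bform w v] and [bform v v], and [k] is the factor that restores the
    mass of [w - dl * v]. It behaves like [1 + dl * b / m] up to second order; all that follows uses
    only these explicit remainders. *)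
Lemma norm_expand (R : realType) (m C : R) : 0 < m -> 0 < C -> exists d0 D : R,
  [/\ 0 < d0, 0 < D & forall dl b c k, 0 < dl -> dl <= d0 -> `|b| <= C -> 0 <= c <= C -> 0 <= k ->
    m / 2 <= m - 2 * dl * b + dl ^+ 2 * c /\
    (k ^+ 2 * (m - 2 * dl * b + dl ^+ 2 * c) = m -> [/\ `|k - 1| <= D * dl,
      `|(k - 1) / dl| <= D & `|m * ((k - 1) / dl) - k * b| <= D * dl])].
Proof.
move=> m0 C0; pose D1 := 6 * C / m; have D10 : 0 < D1 by rewrite divr_gt0 ?mulr_gt0.
pose D := D1 + (4 * C * D1 + 4 * C + m * D1 ^+ 2).
have DD : D1 <= D.
  have := mulr_ge0 (ltW C0) (ltW D10); have := mulr_ge0 (ltW m0) (sqr_ge0 D1).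
  by rewrite /D -[4 * C * D1]mulrA; move: (C * D1) (m * _) => x y; lra.
exists (Num.min 1 (m / (6 * C))), D; split.
- by rewrite lt_min ltr01 divr_gt0 ?mulr_gt0.
- exact: lt_le_trans DD.
move=> dl b c k dl0; rewrite le_min => /andP[dl1 dlm] bC /andP[c0 cC] k0.
set Q := m - _ + _.
have C6 : 6 * C * dl <= m by move: dlm; rewrite ler_pdivlMr ?mulr_gt0// mulrC.
have cd : 0 <= dl * c <= C by apply/andP; split; nra.
have Qm : `|m - Q| <= 3 * C * dl.
  have -> : m - Q = dl * (2 * b - dl * c) by rewrite /Q; ring.
  rewrite normrM (gtr0_norm dl0) mulrC ler_pM2r//.
  apply: le_trans (ler_normB _ _) _; rewrite normrM (gtr0_norm (ltr0n R 2)).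
  by rewrite [`|dl * c|]ger0_norm; case/andP: cd => //; lra.
have Q2 : m / 2 <= Q by move: Qm; rewrite ler_norml => /andP[]; lra.
split=> // kQ.
have Q0 : 0 < Q by lra.
have k22 : k ^+ 2 <= 2.
  have m20 : 0 < m / 2 by lra.
  by rewrite -(ler_pM2r m20); have := ler_wpM2l (sqr_ge0 k) Q2; rewrite kQ; lra.
have k2 : k <= 2 by nra.
have k1 : `|k - 1| <= D1 * dl.
  have E : `|k - 1| * ((k + 1) * Q) = `|m - Q|.
    rewrite -{1}kQ -(gtr0_norm (_ : 0 < (k + 1) * Q)); last by rewrite mulr_gt0//; lra.
    by rewrite -normrM; congr `|_|; ring.
  have : `|k - 1| * (m / 2) <= 3 * C * dl.
    apply: le_trans Qm; rewrite -E ler_wpM2l//; nra.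
  rewrite /D1 => h; rewrite mulrAC ler_pdivlMr//; lra.
have kd : `|(k - 1) / dl| <= D1 by rewrite normrM normfV (gtr0_norm dl0) ler_pdivrMr.
split; [|exact: le_trans kd _|].
  by apply: le_trans k1 _; rewrite ler_pM2r.
have E : m * ((k - 1) / dl) - k * b =
    (2 * k * b * (k - 1) - k ^+ 2 * (dl * c) - m * ((k - 1) / dl) * (k - 1)) / 2.
  have : m * ((k - 1) / dl) * (k + 1) = k ^+ 2 * (2 * b - dl * c).
    have -> : m * ((k - 1) / dl) * (k + 1) = (m * k ^+ 2 - m) / dl by field; rewrite gt_eqF.
    by rewrite -{2}kQ /Q; field; rewrite gt_eqF.
  by move: ((k - 1) / dl) => z; lra.
rewrite E normrM [`|2^-1|]ger0_norm ?invr_ge0// ler_pdivrMr//.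
have n1 : `|2 * k * b * (k - 1)| <= 4 * C * (D1 * dl).
  rewrite -mulrA normrM [`|2 * k|]ger0_norm ?mulr_ge0// normrM.
  apply: (@le_trans _ _ (4 * (C * (D1 * dl)))); last by rewrite !mulrA.
  apply: ler_pM; rewrite ?mulr_ge0//; first lra.
  by apply: ler_pM.
have n2 : `|k ^+ 2 * (dl * c)| <= 4 * (C * dl).
  have C0' := ltW C0; rewrite ger0_norm ?mulr_ge0 ?sqr_ge0 ?(ltW dl0)//.
  apply: ler_pM; rewrite ?sqr_ge0 ?mulr_ge0 ?(ltW dl0)//; first nra.
  by rewrite mulrC ler_pM2r.
have n3 : `|m * ((k - 1) / dl) * (k - 1)| <= m * D1 * (D1 * dl).
  rewrite normrM normrM (gtr0_norm m0); apply: ler_pM; rewrite ?mulr_ge0 ?(ltW m0)//.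
  by rewrite ler_pM2l.
have P0 : 0 <= (D1 + D1 + (4 * C * D1 + 4 * C + m * D1 ^+ 2)) * dl.
  rewrite mulr_ge0 ?(ltW dl0)//; have := mulr_ge0 (ltW C0) (ltW D10).
  by have := mulr_ge0 (ltW m0) (sqr_ge0 D1); rewrite -[4 * C * D1]mulrA; move: (C * D1) (m * _) => x y; lra.
apply: le_trans (ler_normB _ _) _; apply: le_trans (lerD (ler_normB _ _) (lexx _)) _.
apply: le_trans (lerD (lerD n1 n2) n3) _; rewrite /D.
rewrite -subr_ge0; move: P0; congr (0 <= _); ring.
Qed.

Lemma descent_arith (R : realType) (r j x y V T a b n Z c e dl : R) :
  0 < dl -> 0 <= V -> 0 <= T -> a <= Z -> r <= j -> - (dl * e) <= y - x - dl * c * n ->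
  r + T * (2 * dl * b + dl ^+ 2 * a) / 2 - V * (y - x) - j <=
  dl * (T * b + T * (dl * Z) / 2 - V * c * n + V * e).
Proof.
move=> dl0 V0 T0 aZ rj Fexp.
have h1 : V * (- (dl * e)) <= V * (y - x - dl * c * n) by rewrite ler_wpM2l.
have h2 : T * (dl ^+ 2 * a) <= T * (dl ^+ 2 * Z) by rewrite ler_wpM2l// ler_wpM2l// sqr_ge0.
by move: h2; rewrite expr2; lra.
Qed.

Section descent.
Context {R : realType} {N : nat} {s : R} {f : R -> R}.
Hypothesis A : admissible s N f.
Variable m : R.
Hypothesis m0 : 0 < m.
Notation leb := (@Rn_lebesgue R N).
Local Notation hs := (@hs R N s).
Local Notation F := (primitive f).
Local Notation q := (@crit_exp R N s).
Local Notation P := (pohozaev (f := f)).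
Local Notation J := (energy_hs (f := f)).
Local Notation grad := (grad A).
Implicit Types (u w v z : hs) (t B e dl : R).

Let aP := @aform_psd R N s.
Let bP := @bform_psd R N s.
Let s01 := adm_s A.
Let N2 := adm_N A.

Lemma primitive_mean (x y : R) : exists2 th : R, 0 <= th <= 1 &
  F y - F x = f (x + th * (y - x)) * (y - x).
Proof.
have key (a b : R) : a < b -> exists2 th : R, 0 <= th <= 1 & F b - F a = f (a + th * (b - a)) * (b - a).
  move=> ab; have [||c] := @MVT _ F f a b ab.
  - by move=> z _; exact: adm_derive A _.
  - by apply: continuous_subspaceT => z; exact: subcrit_continuous (adm_F A) _.
  rewrite in_itv/= => /andP[ac cb] ->; have ba : 0 < b - a by rewrite subr_gt0.
  exists ((c - a) / (b - a)); last by rewrite divfK ?gt_eqF// [a + _]addrC subrK.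
  rewrite divr_ge0 ?subr_ge0 ?(ltW ac) ?(ltW ab)//= ler_pdivrMr// mul1r; lra.
have [xy|yx|->] := ltgtP x y; first exact: key.
  have [th /andP[th0 th1] E] := key _ _ yx; exists (1 - th); first by apply/andP; split; lra.
  rewrite -opprB E -mulrN opprB; congr (f _ * _); ring.
by exists 0; rewrite ?lexx ?ler01// !subrr mulr0.
Qed.

(** First order expansion with a remainder uniform over bounded sets and over scalings close to 1.
    The mean value theorem reduces it to the perturbation estimate for [f], so no derivative of [f]
    enters. *)
Lemma primitive_expand B e : 0 < e -> exists2 eta : R, 0 < eta <= 1 & forall w v t dl,
  hs_sq w <= B -> hs_sq v <= B -> `|t - 1| <= eta -> 0 < dl -> dl <= eta ->
  `|\int[leb]_x F ((t *: (w + dl *: v)) x) - \int[leb]_x F ((t *: w) x) - dl * t * nonlin (f := f) w v| <= dl * e.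
Proof.
move=> e0; have [K K0 hK] := growth_bounded s01 N2 B.
have e1 : 0 < e / (6 * K) by rewrite divr_gt0 ?mulr_gt0.
have q2 := crit_exp_gt2 s01 N2.
have [eta /andP[eta0 eta1] h] := subcrit_perturb q2 (adm_f A) e1.
exists eta; first by rewrite eta0/=; lra.
move=> w v t dl wB vB t1 dl0 dle.
have t0 : 0 <= t by move: t1; rewrite ler_norml; lra.
have t2 : t <= 2 by move: t1; rewrite ler_norml; lra.
have S1 := summable_subcrit s01 N2 (t *: (w + dl *: v)) (adm_F A).
have S2 := summable_subcrit s01 N2 (t *: w) (adm_F A).
have S3 := summable_nonlin A w v.
have Ww := summable_growth s01 N2 w; have Wv := summable_growth s01 N2 v.
have Wwv := summableD (summableD Ww Wv) Wv.
rewrite nonlinE -RintB// -RintZ// -RintB//; [|exact: summableB|exact: summableZ].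
apply: le_trans (Rint_norm_le _ (summableZ (dl * (2 * (e / (6 * K)))) Wwv) _) _.
- by apply: summableB; [exact: summableB|exact: summableZ].
- move=> x; have [th /andP[th0 th1] ->] := primitive_mean ((t *: w) x) ((t *: (w + dl *: v)) x).
  have -> : (t *: (w + dl *: v)) x = t * (w x + dl * v x) by [].
  have -> : (t *: w) x = t * w x by [].
  have -> : t * (w x + dl * v x) - t * w x = dl * t * v x by ring.
  have -> : t * w x + th * (dl * t * v x) = t * (w x + (th * dl) * v x) by ring.
  have -> (a b : R) : a * (dl * t * v x) - dl * t * (b * v x) = dl * (t * ((a - b) * v x)) by ring.
  rewrite normrM (gtr0_norm dl0) -[leRHS]mulrA ler_pM2l// normrM (ger0_norm t0) -[leRHS]mulrA.
  apply: ler_pM => //; rewrite normrM; have := h t (th * dl) (w x) (v x) (v x) t1.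
  rewrite expr1; apply; rewrite ger0_norm ?mulr_ge0 ?(ltW dl0)//; nra.
rewrite RintZ// (RintD (summableD Ww Wv) Wv) (RintD Ww Wv) -mulrA ler_pM2l//.
have -> : 2 * (e / (6 * K)) = e / (3 * K) by field; rewrite gt_eqF.
have := hK w wB; have := hK v vB; move: (\int[leb]_x _) (\int[leb]_x _) => x y hx hy.
have E : e = e / (3 * K) * (3 * K) by field; rewrite gt_eqF.
rewrite [leRHS]E ler_pM2l ?divr_gt0 ?mulr_gt0//; lra.
Qed.

Definition normalize z : hs := Num.sqrt (m / bform z z) *: z.

Lemma bform_normalize z : 0 < bform z z -> bform (normalize z) (normalize z) = m.
Proof.
move=> z0; rewrite (ip_sqZ bP) sqr_sqrtr ?divfK ?gt_eqF// divr_ge0 ?ltW//.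
Qed.

Lemma normalize_dil t z : 0 < t -> normalize (hs_dil t z) = hs_dil t (normalize z).
Proof. by move=> t0; rewrite /normalize bform_dil// hs_dilZ. Qed.

Lemma normalizeN z : normalize (- z) = - normalize z.
Proof. by rewrite /normalize (ipNl bP) (ipNr bP) opprK scalerN. Qed.

Lemma hcvg_normalize I (G : set_system I) {FG : Filter G} (zi : I -> hs) z :
  0 < bform z z -> hcvg G zi z -> hcvg G (fun i => normalize (zi i)) (normalize z).
Proof.
move=> z0 cz; apply: hcvgZ => //.
have c : m / bform (zi i) (zi i) @[i --> G] --> m / bform z z.
  by apply: cvgM; [exact: cvg_cst|apply: cvgV; [rewrite gt_eqF|exact: hcvg_bform]].
exact: (cvg_comp _ _ c (@sqrt_continuous R _)).
Qed.

(** An arbitrary choice among the roots. It is the same for [u] and [- u] because both have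
    literally the same set of roots, and [pohozaev_zero_close] makes the choice continuous. *)
Definition poh_time u : R := sealed (xget 1 [set t | 0 < t /\ P (hs_dil t u) = 0]).
Local Notation tz := poh_time.

Lemma poh_timeP u : 0 < bform u u -> 0 < tz u /\ P (hs_dil (tz u) u) = 0.
Proof.
move=> /(pohozaev_zero A)[t t0 Pt]; rewrite /poh_time locked_withE.
by case: xgetP => [r _ h|h]; [exact: h|exfalso; exact: h t (conj t0 Pt)].
Qed.

Lemma hs_dilN t u : 0 < t -> hs_dil t (- u) = - hs_dil t u.
Proof. by move=> t0; rewrite -scaleN1r hs_dilZ// scaleN1r. Qed.

Lemma pohozaevN u : P (- u) = P u.
Proof.
have E : \int[leb]_x Ftilde f ((- u) x) = \int[leb]_x Ftilde f (u x).
  by apply: eq_Rintegral => x _; rewrite /Ftilde (adm_odd A) mulrNN (adm_even A).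
by rewrite !pohozaevE E (ipNl aP) (ipNr aP) opprK.
Qed.

Lemma poh_timeN u : tz (- u) = tz u.
Proof.
have E : [set t | 0 < t /\ P (hs_dil t (- u)) = 0] = [set t | 0 < t /\ P (hs_dil t u) = 0].
  apply/seteqP; split=> t [t0 Pt]; split; rewrite ?(hs_dilN u t0); try exact: t0.
    by rewrite (hs_dilN u t0) pohozaevN in Pt.
  by rewrite pohozaevN.
exact: (congr1 (fun S : set R => sealed (xget 1 S)) E).
Qed.

Definition descent dl w : hs := normalize (w - dl *: grad w).
Definition step dl u : hs := hs_dil (tz u)^-1 (descent dl (hs_dil (tz u) u)).

Lemma descentN dl w : descent dl (- w) = - descent dl w.
Proof. by rewrite /descent gradN scalerN -opprD normalizeN. Qed.

Lemma stepN dl u : 0 < bform u u -> step dl (- u) = - step dl u.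
Proof.
move=> /poh_timeP[t0 _]; have t1 : 0 < (tz u)^-1 by rewrite invr_gt0.
by rewrite /step poh_timeN (hs_dilN u t0) descentN (hs_dilN _ t1).
Qed.

Lemma descent_rot_invariant dl w : rot_invariant w -> rot_invariant (descent dl w).
Proof.
move=> rw; apply: rot_invariantZ; apply: rot_invariantB => //.
by apply: rot_invariantZ; exact: grad_rot_invariant.
Qed.

Lemma step_rot_invariant dl u : 0 < bform u u -> rot_invariant u -> rot_invariant (step dl u).
Proof.
move=> /poh_timeP[t0 _] ru; apply: rot_invariant_dil; rewrite ?invr_gt0//.
by apply: descent_rot_invariant; exact: rot_invariant_dil.
Qed.

(** Commutation of the descent with dilations: a variable factor [r] is moved onto the gradient,
    where [hcvg_grad] controls it, and only the fixed dilation by [t^-1] remains outside. *)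
Let step_factor (t r dl : R) (z v : hs) : 0 < t -> 0 < r ->
  hs_dil (r * t)^-1 (normalize (hs_dil r z - dl *: v)) =
  hs_dil t^-1 (normalize (z - dl *: hs_dil r^-1 v)).
Proof.
move=> t0 r0; have ti : 0 < t^-1 by rewrite invr_gt0.
have ri : 0 < r^-1 by rewrite invr_gt0.
have -> : z - dl *: hs_dil r^-1 v = hs_dil r^-1 (hs_dil r z - dl *: v).
  by rewrite (hs_dilB _ _ ri) (hs_dilZ _ _ ri) (hs_dilVK _ r0).
by rewrite (normalize_dil _ ri) (hs_dilM _ ti ri) invfM.
Qed.

Lemma hcvg_poh_time I (G : set_system I) {FG : Filter G} (ui : I -> hs) u :
  (forall i, bform (ui i) (ui i) = m) -> bform u u = m -> hcvg G ui u ->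
  tz (ui i) / tz u @[i --> G] --> (1 : R).
Proof.
move=> uim um cu; have [|t0 Pt] := @poh_timeP u; first by rewrite um.
set t := tz u in t0 Pt *; set w := hs_dil t u.
pose wi i := hs_dil t (ui i).
have cw : hcvg G wi w by exact: hcvg_dil.
have wm : bform w w = m by rewrite bform_dil.
have wim i : bform (wi i) (wi i) = m by rewrite bform_dil.
have tui i : 0 < tz (ui i) /\ P (hs_dil (tz (ui i)) (ui i)) = 0.
  by apply: poh_timeP; rewrite uim.
pose r i := tz (ui i) / t.
have r0 i : 0 < r i by exact: divr_gt0 (tui i).1 t0.
have rE i : hs_dil (r i) (wi i) = hs_dil (tz (ui i)) (ui i).
  by rewrite /wi hs_dilM// /r mulrC divfK// gt_eqF.
apply/cvgrPdist_le => e e0.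
have [d d0 hd] := pohozaev_zero_close A (aform w w) m0 e0.
near=> i; rewrite distrC.
have h1 : hs_sq (wi i - w) <= d by near: i; exact: hcvg_near.
have h2 : P (hs_dil (r i) (w + (wi i - w))) = 0.
  by rewrite [w + _]addrC subrK rE; exact: (tui i).2.
exact: hd wm (lexx _) Pt h1 (r0 i) h2.
Unshelve. all: by end_near. Qed.

Lemma hcvg_step I (G : set_system I) {FG : Filter G} dl (ui : I -> hs) u :
  (forall i, bform (ui i) (ui i) = m) -> bform u u = m -> hcvg G ui u ->
  0 < bform (hs_dil (tz u) u - dl *: grad (hs_dil (tz u) u))
            (hs_dil (tz u) u - dl *: grad (hs_dil (tz u) u)) ->
  hcvg G (fun i => step dl (ui i)) (step dl u).
Proof.
move=> uim um cu; have [|t0 Pt] := @poh_timeP u; first by rewrite um.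
set t := tz u in t0 Pt *; set w := hs_dil t u => z0.
pose wi i := hs_dil t (ui i).
have cw : hcvg G wi w by exact: hcvg_dil.
have wm : bform w w = m by rewrite bform_dil.
have wim i : bform (wi i) (wi i) = m by rewrite bform_dil.
have tui i : 0 < tz (ui i) /\ P (hs_dil (tz (ui i)) (ui i)) = 0.
  by apply: poh_timeP; rewrite uim.
pose r i := tz (ui i) / t.
have r0 i : 0 < r i by exact: divr_gt0 (tui i).1 t0.
have rE i : hs_dil (r i) (wi i) = hs_dil (tz (ui i)) (ui i).
  by rewrite /wi hs_dilM// /r mulrC divfK// gt_eqF.
have cr : r i @[i --> G] --> (1 : R) by exact: hcvg_poh_time.
have cg : hcvg G (fun i => hs_dil (r i)^-1 (grad (hs_dil (r i) (wi i)))) (grad w).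
  exact: (@hcvg_grad _ _ _ _ A _ _ FG _ _ _ _ m0 wim wm cw r0 cr).
have -> : (fun i => step dl (ui i)) = fun i => hs_dil t^-1
    (normalize (wi i - dl *: hs_dil (r i)^-1 (grad (hs_dil (r i) (wi i))))).
  apply/funext => i; rewrite /step -rE /descent.
  have -> : tz (ui i) = r i * t by rewrite /r divfK// gt_eqF.
  exact: step_factor.
apply: hcvg_dil; first by rewrite invr_gt0.
apply: hcvg_normalize => //.
have c2 : hcvg G (fun i => (- dl) *: hs_dil (r i)^-1 (grad (hs_dil (r i) (wi i)))) ((- dl) *: grad w).
  by apply: hcvgZ cg; exact: cvg_cst.
have E i : wi i - dl *: hs_dil (r i)^-1 (grad (hs_dil (r i) (wi i))) =
    wi i + (- dl) *: hs_dil (r i)^-1 (grad (hs_dil (r i) (wi i))) by rewrite scaleNr.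
rewrite (funext E) -scaleNr; exact: (hcvgD cw c2).
Qed.

Let powR_near (a e : R) : 0 < e -> \forall t \near (1 : R), `|t `^ a - 1| <= e.
Proof.
move=> e0; have c : {for (1 : R), continuous (fun x : R => x `^ a)}.
  apply: differentiable_continuous; apply/derivable1_diffP.
  exact: (@ex_derive _ _ _ _ _ _ _ (is_derive1_powR a ltr01)).
by move/cvgrPdist_le: c => /(_ _ e0); apply: filterS => t; rewrite powR1 distrC.
Qed.

Lemma descent_bform_ge B : exists2 d0, 0 < d0 & forall dl w, 0 < dl -> dl <= d0 ->
  bform w w = m -> aform w w <= B ->
  0 < bform (w - dl *: grad w) (w - dl *: grad w).
Proof.
have [C C0 hC] := grad_bound A B m0.
pose K := (`|B| + m + 1) * C + C ^+ 2.
have mB : 0 <= `|B| + m by rewrite addr_ge0// ltW.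
have K0 : 0 < K by rewrite ltr_wpDl ?exprn_gt0// mulr_ge0 ?addr_ge0// ltW.
have [d0 [D [d00 D0 h]]] := norm_expand m0 K0; exists d0 => // dl w dl0 dle wm wB.
have gC := hC w wm wB; have g0 := hn_ge0 (grad w).
have wC : hn w <= `|B| + m + 1.
  rewrite (hn_le _ (addr_ge0 mB ler01)); apply: (@le_trans _ _ (B + m)).
    by rewrite /hs_sq wm lerD2r.
  by apply: le_sqr_succ => //; rewrite lerD2r ler_norm.
have bK : `|bform w (grad w)| <= K.
  apply: le_trans (ler_bform _ _) _; apply: le_trans (ler_pM (hn_ge0 _) g0 wC gC) _.
  by rewrite lerDl sqr_ge0.
have cK : 0 <= bform (grad w) (grad w) <= K.
  rewrite (ip_ge0 bP)/=; apply: (@le_trans _ _ (C ^+ 2)).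
    apply: (@le_trans _ _ (hn (grad w) ^+ 2)); last by rewrite lerXn2r ?nnegrE// ltW.
    by rewrite hn_sq lerDr (ip_ge0 aP).
  by rewrite lerDr mulr_ge0 ?addr_ge0// ltW.
have [+ _] := h dl (bform w (grad w)) (bform (grad w) (grad w)) 0 dl0 dle bK cK (lexx _).
rewrite (ip_sqB bP) (ip_sqZ bP) (ipZr bP) wm mulrA => h1; apply: lt_le_trans h1.
by rewrite divr_gt0.
Qed.

(** An envelope argument. The new Pohozaev time [t] is close to 1, and the undisturbed function has
    energy at most [J w] at that time. The first order change is therefore [aform w E - nonlin w E]
    up to factors close to 1, and by definition of the gradient this is [- hn (grad w) ^+ 2] up to
    terms of order [dl]. *)
Lemma descent_energy B e : 0 < e -> exists2 d0, 0 < d0 & forall dl w t, 0 < dl -> dl <= d0 ->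
  bform w w = m -> aform w w <= B -> P w = 0 -> 0 < t -> P (hs_dil t (descent dl w)) = 0 ->
  J (hs_dil t (descent dl w)) <= J w - dl * hn (grad w) ^+ 2 + dl * e.
Proof.
move=> e0.
have [C C0 hC] := grad_bound A B m0.
have [L L0 hL] := multiplier_bound A B m0.
have [Cn Cn0 hCn] := nonlin_bound A (B + m).
have mB : 0 <= `|B| + m by rewrite addr_ge0// ltW.
pose Cw := `|B| + m + 1; have Cw0 : 0 < Cw by rewrite ltr_wpDl.
pose K := Cw * C + C ^+ 2.
have K0 : 0 < K by rewrite ltr_wpDl ?exprn_gt0// mulr_ge0 ?ltW.
have [d1 [D [d10 D0 hD]]] := norm_expand m0 K0.
pose Ce := D * Cw + (D * d1 + 1) * C.
have Ce0 : 0 < Ce.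
  by rewrite addr_gt0 ?mulr_gt0// ltr_wpDl// mulr_ge0 ?ltW.
pose M := Cw * Ce + Cn * Ce; have M0 : 0 < M by rewrite addr_gt0 ?mulr_gt0.
have e8 : 0 < e / 8 by rewrite divr_gt0.
have [eF /andP[eF0 eF1] hF] := primitive_expand (Num.max (B + m) (Ce ^+ 2)) e8.
have eM : 0 < Num.min 1 (e / (4 * M)) by rewrite lt_min ltr01 divr_gt0 ?mulr_gt0.
have [r r0 hr] : exists2 r : R, 0 < r & forall t : R, `|t - 1| <= r ->
    [/\ `|t `^ (2 * s) - 1| <= Num.min 1 (e / (4 * M)),
        `|t `^ (- N%:R + N%:R / 2) - 1| <= Num.min 1 (e / (4 * M)),
        `|t `^ (N%:R / 2) - 1| <= eF & `|t `^ (- N%:R) - 1| <= 1].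
  have h : \forall t \near (1 : R), [/\ `|t `^ (2 * s) - 1| <= Num.min 1 (e / (4 * M)),
        `|t `^ (- N%:R + N%:R / 2) - 1| <= Num.min 1 (e / (4 * M)),
        `|t `^ (N%:R / 2) - 1| <= eF & `|t `^ (- N%:R) - 1| <= 1].
    near=> t; split; near: t; exact: powR_near.
  have [r /= r0 hr] := h; exists (r / 2); first by rewrite divr_gt0.
  move=> t tr; apply: hr; rewrite /ball_/= distrC; apply: le_lt_trans tr _.
  by rewrite ltr_pdivrMr// ltr_pMr// ltr1n.
have [dz dz0 hz] := pohozaev_zero_close A B m0 r0.
have fin4 (y z : R) : y * (4 * z) <= e -> y * z <= e / 4 by lra.
have V01 (x : R) : `|x - 1| <= 1 -> x <= 2 by rewrite ler_norml; lra.
(* The entries serve, in order: the expansion of the norm, that of the integral of [F], the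
   closeness of [t] to 1, and the terms of order [dl], kept below [e / 4]. *)
pose d0 := Num.min (Num.min 1 d1) (Num.min eF (Num.min (dz / Ce ^+ 2)
  (e / (4 * (D * C ^+ 2 + L * D + Ce ^+ 2))))).
have DL0 : 0 < D * C ^+ 2 + L * D + Ce ^+ 2.
  by rewrite addr_gt0 ?exprn_gt0// addr_gt0 ?mulr_gt0 ?exprn_gt0.
(* Error budget: [e / 4] for the factors [T] and [U], at most [e / 4] from [V * (e / 8)], and
   [e / 4] for the terms of order [dl]. *)
have fin (jw' jw a0 aw nw g2 kk lm T U V dl : R) : 0 < dl ->
    jw' - jw <= dl * (T * aw + T * (dl * Ce ^+ 2) / 2 - U * nw + V * (e / 8)) ->
    aw - nw = - kk * g2 + lm -> 0 <= g2 <= C ^+ 2 -> `|kk - 1| <= D * dl -> `|lm| <= L * (D * dl) ->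
    `|aw| <= Cw * Ce -> `|nw| <= Cn * Ce -> `|T - 1| <= Num.min 1 (e / (4 * M)) ->
    `|U - 1| <= Num.min 1 (e / (4 * M)) -> 0 <= V <= 2 ->
    dl * (D * C ^+ 2 + L * D + Ce ^+ 2) <= e / 4 ->
    jw' <= jw - dl * g2 + dl * e.
  move=> dl0 h1 h2 /andP[g0 gC] hk hl haw hnw; rewrite !le_min => /andP[T1 TM] /andP[U1 UM] /andP[V0 V2] hdl.
  suff : T * aw + T * (dl * Ce ^+ 2) / 2 - U * nw + V * (e / 8) <= - g2 + e.
    by rewrite -(ler_pM2l dl0); lra.
  have x1 : `|(T - 1) * aw| <= e / (4 * M) * (Cw * Ce) by rewrite normrM; apply: ler_pM.
  have x2 : `|(U - 1) * nw| <= e / (4 * M) * (Cn * Ce) by rewrite normrM; apply: ler_pM.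
  have x12 : e / (4 * M) * (Cw * Ce) + e / (4 * M) * (Cn * Ce) = e / 4.
    by rewrite -mulrDr -/M; field; rewrite gt_eqF.
  have x3 : T * (dl * Ce ^+ 2) / 2 <= dl * Ce ^+ 2.
    have : 0 <= dl * Ce ^+ 2 by rewrite mulr_ge0 ?sqr_ge0// ltW.
    by move: T1; rewrite ler_norml; move: (dl * Ce ^+ 2) => y; nra.
  have x4 : `|(1 - kk) * g2| <= D * dl * C ^+ 2.
    by rewrite normrM distrC (ger0_norm g0); apply: ler_pM.
  have x5 : V * (e / 8) <= 2 * (e / 8) by rewrite ler_pM2r.
  have k1 := ler_norm ((T - 1) * aw); have k2 := ler_norm (- ((U - 1) * nw)).
  have k3 := ler_norm lm; have k4 := ler_norm ((1 - kk) * g2); rewrite normrN in k2.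
  have : T * aw - U * nw = (T - 1) * aw - (U - 1) * nw + (aw - nw) by ring.
  rewrite h2; lra.
exists d0.
  rewrite !lt_min ltr01 d10 eF0 /= !divr_gt0 ?exprn_gt0//.
  by rewrite mulr_gt0.
move=> dl w t dl0; rewrite !le_min => /andP[/andP[_ dd1] /and3P[ddF ddz dde]] wm wB Pw t0.
have wBm : hs_sq w <= B + m by rewrite /hs_sq wm lerD2r.
have wC : hn w <= Cw.
  rewrite (hn_le _ (ltW Cw0)); apply: le_trans wBm _.
  by apply: le_sqr_succ => //; rewrite lerD2r ler_norm.
set v := grad w; have vC : hn v <= C by exact: hC.
have v0 := hn_ge0 v.
have vC2 : hn v ^+ 2 <= C ^+ 2 by rewrite lerXn2r ?nnegrE// ltW.
have bK : `|bform w v| <= K.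
  apply: le_trans (ler_bform _ _) _; apply: le_trans (ler_pM (hn_ge0 _) v0 wC vC) _.
  by rewrite lerDl sqr_ge0.
have cK : 0 <= bform v v <= K.
  rewrite (ip_ge0 bP)/=; apply: (@le_trans _ _ (C ^+ 2)).
    by apply: le_trans vC2; rewrite hn_sq lerDr (ip_ge0 aP).
  by rewrite lerDr mulr_ge0// ltW.
set z := w - dl *: v.
have zE : bform z z = m - 2 * dl * bform w v + dl ^+ 2 * bform v v.
  by rewrite (ip_sqB bP) (ip_sqZ bP) (ipZr bP) wm mulrA.
pose k := Num.sqrt (m / bform z z).
have [zm hk] := hD dl (bform w v) (bform v v) k dl0 dd1 bK cK (sqrtr_ge0 _).
have z0 : 0 < bform z z by rewrite zE; apply: lt_le_trans zm; rewrite divr_gt0.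
have [|kn k1 kb] := hk.
  by rewrite -zE /k sqr_sqrtr ?divr_ge0 ?ltW// divfK// gt_eqF.
(* The normalized step is [w + dl * E]: restoring the mass contributes [k' * w] to [E] and the
   gradient [- k * v]. *)
pose k' := (k - 1) / dl.
pose E := k' *: w - k *: v.
have wE : descent dl w = w + dl *: E.
  have kk : dl * k' = k - 1 by rewrite /k' mulrCA mulfV ?mulr1// gt_eqF.
  rewrite /descent /normalize -/z -/k /E /z !scalerBr !scalerA kk scalerBl scale1r addrA.
  by rewrite [w + _]addrC subrK [dl * k]mulrC.
have k2 : `|k| <= D * d1 + 1.
  have := ler_normD (k - 1) 1; rewrite subrK normr1 => /le_trans; apply.
  by rewrite lerD2r; apply: le_trans kn _; rewrite ler_pM2l.
have EC : hn E <= Ce.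
  apply: le_trans (hnD _ _) _; rewrite hnN !hnZ; apply: lerD; apply: ler_pM => //; exact: hn_ge0.
have EC2 : hs_sq E <= Ce ^+ 2 by rewrite -(hn_le _ (ltW Ce0)).
rewrite wE => Pt.
have tr : `|t - 1| <= r.
  apply: (hz w (dl *: E)) => //; rewrite hs_sqZ.
  apply: (@le_trans _ _ (dl * Ce ^+ 2)); last by rewrite -ler_pdivlMr ?exprn_gt0.
  apply: ler_pM; rewrite ?sqr_ge0 ?hs_sq_ge0//.
  rewrite expr2 ler_piMr ?(ltW dl0)//.
  by move: ddF eF1; exact: le_trans.
have [T1 U1 tF V1] := hr t tr.
have UE : t `^ (- N%:R + N%:R / 2) = t ^- N * t `^ (N%:R / 2).
  by rewrite powR_addp// powRN powR_mulrn// ltW.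
have VE : t `^ (- N%:R) = t ^- N by rewrite powRN powR_mulrn// ltW.
set c := t `^ (N%:R / 2) in tF UE.
have EB : hs_sq E <= Num.max (B + m) (Ce ^+ 2) by rewrite le_max EC2 orbT.
have wB' : hs_sq w <= Num.max (B + m) (Ce ^+ 2) by rewrite le_max wBm.
have Fexp := hF w E c dl wB' EB tF dl0 ddF.
have JE (u : hs) : J (hs_dil t u) = t `^ (2 * s) * aform u u / 2 - t ^- N * \int[leb]_x F ((c *: u) x).
  rewrite energy_hsE aform_dil//; congr (_ - _).
  by have [_ ->] := superposition_dil t0 (summable_subcrit s01 N2 (c *: u) (adm_F A)).
have aE : aform (w + dl *: E) (w + dl *: E) = aform w w + 2 * dl * aform w E + dl ^+ 2 * aform E E.
  by rewrite (ip_sqD aP) (ip_sqZ aP) (ipZr aP) mulrA.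
have aE2 : aform E E <= Ce ^+ 2 by apply: le_trans EC2; rewrite lerDl (ip_ge0 bP).
have V0 : 0 <= t ^- N by rewrite invr_ge0 exprn_ge0// ltW.
have T0 : 0 <= t `^ (2 * s) by exact: powR_ge0.
(* This is where the dependence of [t] on the step drops out. *)
have ray := energy_ray_le A Pw t0.
have ellE : aform w E - nonlin (f := f) w E = - k * hn v ^+ 2 + multiplier (f := f) w * (m * k' - k * bform w v).
  have vv : hn v ^+ 2 = aform w v - nonlin (f := f) w v - multiplier (f := f) w * bform w v.
    exact: hn_grad_sq.
  have lm : multiplier (f := f) w * m = aform w w - nonlin (f := f) w w.
    by rewrite /multiplier wm divfK// gt_eqF.
  rewrite vv /E (ipBr aP) !(ipZr aP) (nonlinB A) !(nonlinZ A).
  have -> : k' * aform w w - k * aform w v - (k' * nonlin (f := f) w w - k * nonlin (f := f) w v) =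
    k' * (aform w w - nonlin (f := f) w w) - k * (aform w v - nonlin (f := f) w v) by ring.
  by rewrite -lm; ring.
apply: (fin _ (J w) 0 (aform w E) (nonlin (f := f) w E) (hn v ^+ 2) k
  (multiplier (f := f) w * (m * k' - k * bform w v)) (t `^ (2 * s)) (t ^- N * c) (t ^- N) dl) => //.
- have -> : J (hs_dil t (w + dl *: E)) = J (hs_dil t w) + t `^ (2 * s) * (2 * dl * aform w E + dl ^+ 2 * aform E E) / 2
     - t ^- N * (\int[leb]_x F ((c *: (w + dl *: E)) x) - \int[leb]_x F ((c *: w) x)).
    rewrite !JE aE; move: (\int[leb]_x _) (\int[leb]_x _) (t ^- N) (t `^ (2 * s)).
    by move: (aform E E) (aform w E) (aform w w) => a1 a2 a3 x y V T; ring.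
  move: Fexp; rewrite ler_norml => /andP[Fexp _].
  exact: descent_arith dl0 V0 T0 aE2 ray Fexp.
- by rewrite sqr_ge0.
- by rewrite normrM; apply: ler_pM => //; exact: hL.
- by apply: le_trans (ler_aform _ _) _; apply: ler_pM => //; exact: hn_ge0.
- by apply: le_trans (hCn w E wBm) _; rewrite ler_pM2l.
- by rewrite -UE.
- by rewrite V0 -VE; exact: V01.
- by move: dde; rewrite ler_pdivlMr ?mulr_gt0//; exact: fin4.
Unshelve. all: by end_near. Qed.

End descent.

(** * The Borsuk-Ulam theorem *)

(** Facets of the simplex with the given vertex list; orientation is dropped, coefficients being
    taken mod 2. *)
Definition deletions (T : Type) := fix del (s : seq T) : seq (seq T) :=
  if s is x :: s' then s' :: map (cons x) (del s') else [::].

Lemma deletions_map (T U : Type) (g : T -> U) (s : seq T) :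
  deletions (map g s) = map (map g) (deletions s).
Proof.
elim: s => //= x s ->; rewrite -!map_comp; congr (_ :: _).
Qed.

Lemma mem_deletions (T : eqType) (c d : seq T) : d \in deletions c -> (size d).+1 = size c /\ {subset d <= c}.
Proof.
elim: c d => //= x c IH d; rewrite inE => /orP[/eqP ->|/mapP[e /IH[se es] ->]].
  by split => // y yc; rewrite inE yc orbT.
by split; rewrite /= ?se// => y; rewrite !inE => /orP[->//|/es ->]; rewrite orbT.
Qed.

(* Mod 2 cochains are boolean functions of vertex lists; [cobd] is dual to the
   augmented boundary, the empty list being the (-1)-simplex. *)
Section subdivision.
Context {R : realType} {V : normedModType R}.
Implicit Types (phi psi : seq V -> bool) (c d : seq V) (k r : nat).

Definition cobd phi c : bool := \big[addb/false]_(d <- deletions c) phi d.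

Lemma cobd_cons phi x c : cobd phi (x :: c) = phi c (+) cobd (fun d => phi (x :: d)) c.
Proof. by rewrite /cobd /= big_cons big_map. Qed.

Lemma cobdD phi psi c : cobd (fun d => phi d (+) psi d) c = cobd phi c (+) cobd psi c.
Proof. by rewrite /cobd big_split. Qed.

Lemma cobd_cobd phi c : cobd (cobd phi) c = false.
Proof.
elim: c phi => [|x c IH] phi; first by rewrite /cobd big_nil.
rewrite cobd_cons; have -> : (fun d => cobd phi (x :: d)) = fun d => phi d (+) cobd (fun e => phi (x :: e)) d.
  by apply/funext => d; rewrite cobd_cons.
by rewrite cobdD IH addbF addbb.
Qed.

Definition bary c : V := (size c)%:R^-1 *: \sum_(x <- c) x.

(** Top simplices of the barycentric subdivision: the barycentre of [c] is joined to the subdivision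
    of each facet. The parameter [k] is meant to be the size of [c]. *)
Fixpoint simplices k c : seq (seq V) :=
  if k is k'.+1 then
    map (cons (bary c)) (flatten [seq simplices k' d | d <- deletions c])
  else [:: [::]].

Definition subdiv k phi c : bool := \big[addb/false]_(d <- simplices k c) phi d.

Lemma subdivS k phi c : subdiv k.+1 phi c = cobd (subdiv k (fun d => phi (bary c :: d))) c.
Proof. by rewrite /subdiv /cobd /= big_map big_flatten /= big_map. Qed.

Lemma subdivD k phi psi c : subdiv k (fun d => phi d (+) psi d) c = subdiv k phi c (+) subdiv k psi c.
Proof. by rewrite /subdiv big_split. Qed.

(** Dual form of the fact that subdivision is a chain map. The cone formula at the barycentre leaves
    a double coboundary, which vanishes. *)
Lemma subdiv_cobd k phi : subdiv k.+1 (cobd phi) = cobd (subdiv k phi).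
Proof.
elim: k phi => [|k IH] phi; apply/funext => c; rewrite subdivS.
  rewrite /cobd; apply: eq_bigr => d _; rewrite /subdiv !big_seq1.
  by [].
have -> : (fun d => cobd phi (bary c :: d)) =
    fun d => phi d (+) cobd (fun e => phi (bary c :: e)) d.
  by apply/funext => d; rewrite cobd_cons.
have -> : subdiv k.+1 (fun d => phi d (+) cobd (fun e => phi (bary c :: e)) d) =
    fun d => subdiv k.+1 phi d (+) cobd (subdiv k (fun e => phi (bary c :: e))) d.
  by apply/funext => d; rewrite subdivD IH.
by rewrite cobdD cobd_cobd addbF.
Qed.

Definition subdivs r k phi : seq V -> bool := iter r (subdiv k) phi.

Lemma subdivs_cobd r k phi : subdivs r k.+1 (cobd phi) = cobd (subdivs r k phi).
Proof. by elim: r => //= r IH; rewrite /subdivs /= -/(subdivs r _ _) IH subdiv_cobd. Qed.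

Lemma subdivs0 r phi : subdivs r 0 phi [::] = phi [::].
Proof. by elim: r => //= r IH; rewrite /subdivs /= /subdiv big_seq1. Qed.

Fixpoint simplices_iter r k c : seq (seq V) :=
  if r is r'.+1 then flatten [seq simplices_iter r' k d | d <- simplices k c]
  else [:: c].

Lemma subdivsE r k phi c : subdivs r k phi c = \big[addb/false]_(d <- simplices_iter r k c) phi d.
Proof.
elim: r c => [|r IH] c; first by rewrite big_seq1.
rewrite /= big_flatten /= big_map /subdivs /= {1}/subdiv.
by apply: eq_bigr => d _; exact: IH.
Qed.

Lemma baryN c : bary (map -%R c) = - bary c.
Proof. by rewrite /bary size_map big_map sumrN scalerN. Qed.

Lemma simplicesN k c : simplices k (map -%R c) = map (map -%R) (simplices k c).
Proof.
elim: k c => //= k IH c; rewrite deletions_map baryN.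
have -> : flatten [seq simplices k d | d <- map (map -%R) (deletions c)] =
    map (map -%R) (flatten [seq simplices k d | d <- deletions c]).
  by rewrite map_flatten -!map_comp; congr flatten; apply: eq_map => d; exact: IH.
by rewrite -!map_comp; apply: eq_map.
Qed.

Lemma subdivsN r k phi c : subdivs r k phi (map -%R c) = subdivs r k (fun d => phi (map -%R d)) c.
Proof.
elim: r c => //= r IH c; rewrite /subdivs /= /subdiv simplicesN big_map.
by apply: eq_bigr => d _; exact: IH.
Qed.

(** Stands for convexity, in the form that passes to all iterated subdivisions. *)
Definition bary_closed (C : V -> Prop) := forall c, (0 < size c)%N ->
  (forall x, x \in c -> C x) -> C (bary c).

Lemma simplices_spec k c d : d \in simplices k c -> size c = k ->
  size d = k /\ forall C, bary_closed C -> (forall x, x \in c -> C x) -> forall x, x \in d -> C x.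
Proof.
elim: k c d => [|k IH] c d /=; first by rewrite inE => /eqP ->.
move=> /mapP[e /flattenP[es /mapP[c' /mem_deletions[sc c'c] ->] ee] ->] sk.
have /IH : e \in simplices k c' by [].
move=> [|se H]; first by apply: succn_inj; rewrite sc.
split => [|C CC cC x]; first by rewrite /= se.
rewrite inE => /orP[/eqP ->|xe]; first by apply: CC => //; rewrite sk.
by apply: (H C) xe => // y /c'c; exact: cC.
Qed.

Definition mesh_le (D : R) c := forall x y, x \in c -> y \in c -> `|x - y| <= D.

(** The vertex [x] is itself among the averaged points and contributes distance 0; this is the
    origin of the contraction factor. *)
Lemma bary_dist c x D : x \in c -> 0 <= D -> mesh_le D c ->
  `|bary c - x| <= (1 - (size c)%:R^-1) * D.
Proof.
move=> xc D0 cD; have s0 : (0 < size c)%N by case: c xc {cD}.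
have s1 : (size c)%:R != 0 :> R by rewrite pnatr_eq0 -lt0n.
have -> : bary c - x = (size c)%:R^-1 *: \sum_(y <- c) (y - x).
  rewrite sumrB scalerBr; congr (_ - _).
  by rewrite big_const_seq count_predT iter_addr_0 -[X in _ *: X]scaler_nat scalerA mulVf// scale1r.
rewrite normrZ ger0_norm ?invr_ge0//.
apply: (@le_trans _ _ ((size c)%:R^-1 * (((size c)%:R - 1) * D))); last first.
  by rewrite mulrA mulrBr mulVf// mulr1.
rewrite ler_pM2l ?invr_gt0 ?ltr0n//.
rewrite (big_rem x xc) /= subrr add0r.
apply: le_trans (ler_norm_sum _ _ _) _.
apply: (@le_trans _ _ (\sum_(y <- rem x c) D)).
  rewrite big_seq [leRHS]big_seq; apply: ler_sum => y yr; apply: cD => //.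
  exact: mem_rem yr.
rewrite big_const_seq count_predT iter_addr_0 size_rem//.
by rewrite -[D *+ _]mulr_natl -subn1 natrB.
Qed.

Lemma simplices_mesh k n c d D : d \in simplices k c -> size c = k -> (k <= n.+1)%N ->
  0 <= D -> mesh_le D c -> mesh_le ((1 - n.+1%:R^-1) * D) d.
Proof.
move=> + + + D0; elim: k c d => [|k IH] c d /=; first by rewrite inE => /eqP ->.
move=> /mapP[e /flattenP[es /mapP[c' c'c ->] ee] ->] sk kn cD.
have [sc c's] := mem_deletions c'c.
have sc' : size c' = k by apply: succn_inj; rewrite sc.
have M : mesh_le ((1 - n.+1%:R^-1) * D) e.
  by apply: IH ee sc' (ltnW kn) _ => x y /c's xc /c's; exact: cD.
have B x : x \in e -> `|bary c - x| <= (1 - n.+1%:R^-1) * D.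
  move=> xe; have [_ H] := simplices_spec ee sc'.
  apply: (H (fun x => `|bary c - x| <= (1 - n.+1%:R^-1) * D)) xe => [a a0 aD|y /c's yc].
    have a1 : (size a)%:R != 0 :> R by rewrite pnatr_eq0 -lt0n.
    have -> : bary c - bary a = (size a)%:R^-1 *: \sum_(y <- a) (bary c - y).
      rewrite sumrB scalerBr; congr (_ - _).
      by rewrite big_const_seq count_predT iter_addr_0 -[X in _ *: X]scaler_nat scalerA mulVf// scale1r.
    rewrite normrZ ger0_norm ?invr_ge0// ler_pdivrMl ?ltr0n//.
    apply: le_trans (ler_norm_sum _ _ _) _.
    apply: (@le_trans _ _ (\sum_(y <- a) ((1 - n.+1%:R^-1) * D))).
      by rewrite big_seq [leRHS]big_seq; apply: ler_sum.
    by rewrite big_const_seq count_predT iter_addr_0 mulr_natl.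
  apply: le_trans (bary_dist yc D0 cD) _; apply: ler_wpM2r => //.
  by rewrite lerD2l lerN2 sk lef_pV2 ?posrE ?ltr0n// ler_nat.
have r0 : 0 <= (1 - n.+1%:R^-1) * D.
  by rewrite mulr_ge0// subr_ge0 invf_le1 ?ltr0n// ler1n.
move=> x y; rewrite !inE => /orP[/eqP ->|xe] /orP[/eqP ->|ye].
- by rewrite subrr normr0.
- exact: B.
- by rewrite distrC; exact: B.
- exact: M.
Qed.

Lemma simplices_iter_spec r k n c d D : d \in simplices_iter r k c -> size c = k -> (k <= n.+1)%N ->
  0 <= D -> mesh_le D c ->
  [/\ size d = k, mesh_le ((1 - n.+1%:R^-1) ^+ r * D) d &
    forall C, bary_closed C -> (forall x, x \in c -> C x) -> forall x, x \in d -> C x].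
Proof.
move=> + + kn; elim: r c d D => [|r IH] c d D /=.
  by rewrite inE => /eqP -> ? ? ?; rewrite expr0 mul1r.
move=> /flattenP[es /mapP[e ec ->] ed] sk D0 cD.
have [se eC] := simplices_spec ec sk.
have eD := simplices_mesh ec sk kn D0 cD.
have r0 : 0 <= (1 - n.+1%:R^-1) * D.
  by rewrite mulr_ge0// subr_ge0 invf_le1 ?ltr0n// ler1n.
have [sd dM dC] := IH e d _ ed se r0 eD.
split => //; first by rewrite exprSr -mulrA.
by move=> C CC cC; apply: dC => // x; exact: eC.
Qed.

Variable e : nat -> V.

(** Top simplices of the boundary of the cross-polytope on [e 0], ..., [e k.-1], one for each choice
    of signs. At [k = 0] only the empty simplex remains, which starts the later induction. *)
Fixpoint octahedron k : seq (seq V) :=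
  if k is k'.+1 then map (cons (e k')) (octahedron k') ++ map (cons (- e k')) (octahedron k')
  else [:: [::]].

Definition octa k phi : bool := \big[addb/false]_(c <- octahedron k) phi c.

Lemma octaS k phi : octa k.+1 phi =
  octa k (fun c => phi (e k :: c)) (+) octa k (fun c => phi (- e k :: c)).
Proof. by rewrite /octa /= big_cat !big_map. Qed.

Lemma octaD k phi psi : octa k (fun c => phi c (+) psi c) = octa k phi (+) octa k psi.
Proof. by rewrite /octa big_split. Qed.

Lemma octa_cobd_cons k phi x : octa k (cobd phi) = false ->
  octa k (fun c => cobd phi (x :: c)) = octa k phi (+) octa k (cobd (fun c => phi (x :: c))).
Proof. by move=> _; rewrite -octaD; apply: eq_bigr => c _; rewrite cobd_cons. Qed.

(** The octahedral sphere is a cycle: in the two cones with apexes [e k] and [- e k] the equator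
    occurs twice and cancels mod 2. *)
Lemma octa_cobd k phi : octa k (cobd phi) = false.
Proof.
elim: k phi => [|k IH] phi; first by rewrite /octa big_seq1 /cobd big_nil.
by rewrite octaS !octa_cobd_cons// !IH !addbF addbb.
Qed.

Lemma octaN k phi : octa k (fun c => phi (map -%R c)) = octa k phi.
Proof.
elim: k phi => [|k IH] phi; first by rewrite /octa !big_seq1.
rewrite !octaS addbC /= opprK; congr (_ (+) _).
  exact: (IH (fun c => phi (e k :: c))).
exact: (IH (fun c => phi (- e k :: c))).
Qed.

(** Folding the sphere along the antipodal map leaves the sum of [alpha d] plus [alpha] at the
    antipode over a hemisphere. By hypothesis this is a coboundary, whose sum over the hemisphere is
    the sum of [alpha] over the equator, a sphere of one dimension less. *)
Lemma octa_antipodal r k alpha :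
  (forall c d, c \in octahedron k.+1 -> d \in simplices_iter r k.+1 c ->
     cobd alpha d = alpha d (+) alpha (map -%R d)) ->
  octa k.+1 (subdivs r k.+1 alpha) = octa k (subdivs r k alpha).
Proof.
move=> H; rewrite octaS -[X in _ (+) X]octaN -octaD.
transitivity (octa k (fun c => cobd (subdivs r k alpha) (e k :: c))); last first.
  by rewrite octa_cobd_cons ?octa_cobd// addbF.
rewrite -subdivs_cobd /octa big_seq [RHS]big_seq; apply: eq_bigr => c cO.
have -> : - e k :: map -%R c = map -%R (e k :: c) by [].
rewrite subdivsN !subdivsE -big_split big_seq [RHS]big_seq; apply: eq_bigr => d dc.
rewrite /= (H (e k :: c))// /=.
by rewrite mem_cat; apply/orP; left; apply/mapP; exists c.
Qed.

End subdivision.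

(** * Ky Fan's combinatorial identity *)

Section fan.
Implicit Types (s t : seq nat) (b : seq bool).

Fixpoint alternates (c : bool) b : bool :=
  if b is x :: b' then (x == c) && alternates (~~ c) b' else true.

(** A word alternating from [c] keeps this property only when its last letter is deleted, a word
    alternating from the opposite letter acquires it only when its first letter is deleted. For
    other words the deletions leaving an alternating word come in equal pairs, one for each letter
    of a repetition. *)
Lemma alternates_deletions c b : \big[addb/false]_(d <- deletions b) alternates c d =
  if b is [::] then false else alternates c b (+) alternates (~~ c) b.
Proof.
elim: b c => [|x b IH] c; first by rewrite big_nil.
rewrite /= big_cons big_map /=; have [-> /=|xc] := eqVneq x c.
  rewrite IH; have -> : (c == ~~ c) = false by case: c.
  rewrite addbF negbK; case: b {IH} => [|y b] //=.
  by rewrite addbA addbAC addbC; case: (_ && _); case: (_ && _).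
rewrite big1 ?addbF//= negbK.
by move: xc; case: x; case: c.
Qed.

Lemma perm_deletions (T : eqType) (s : seq T) (phi : seq T -> bool) :
  (forall u v, perm_eq u v -> phi u = phi v) ->
  \big[addb/false]_(d <- deletions s) phi d = \big[addb/false]_(x <- s) phi (rem x s).
Proof.
elim: s phi => [|x s IH] phi H; first by rewrite !big_nil.
rewrite /= !big_cons /= eqxx big_map (IH (fun d => phi (x :: d))); last first.
  by move=> u v uv; apply: H; rewrite perm_cons.
congr (_ (+) _); rewrite big_seq [RHS]big_seq; apply: eq_bigr => y ys; apply: H.
by case: ifP ys => [/eqP <-|//] ys; rewrite perm_sym; exact: perm_to_rem.
Qed.

(** A label [2 * i + b] codes the coordinate [i] with sign bit [b]; the antipodal map reverses the
    bit. *)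
Definition flip (l : nat) : nat := (l./2).*2 + ~~ odd l.

Lemma odd_flip l : odd (flip l) = ~~ odd l.
Proof. by rewrite /flip oddD odd_double; case: (odd l). Qed.

(** No complementary edge: a coordinate does not occur with both signs in one simplex. *)
Definition compatible s := {in s &, forall x y, x./2 = y./2 -> x = y}.

Definition alt_labels s : bool := alternates true (map odd (sort leq s)).

Lemma perm_alt_labels s t : perm_eq s t -> alt_labels s = alt_labels t.
Proof.
move=> st; rewrite /alt_labels; congr (alternates _ (map _ _)).
by apply/perm_sortP => //; [exact: leq_total|exact: leq_trans|exact: anti_leq].
Qed.

Lemma alternates_flip c b : alternates c (map negb b) = alternates (~~ c) b.
Proof. by elim: b c => //= x b IH c; rewrite IH; congr (_ && _); case: x; case: c. Qed.

Lemma flip_mono s : compatible s -> {in s &, forall x y, (x <= y -> flip x <= flip y)%N}.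
Proof.
move=> cs x y xs ys xy; have [->//|ne] := eqVneq x y.
have hxy : (x./2 <= y./2)%N by exact: half_leq.
have : (x./2 != y./2) by apply: contra_neq ne; exact: cs.
by rewrite /flip; lia.
Qed.

Lemma sort_flip s : compatible s -> sort leq (map flip s) = map flip (sort leq s).
Proof.
move=> cs; apply: (sorted_eq leq_trans anti_leq).
- exact: sort_sorted leq_total _.
- have : sorted leq (sort leq s) by exact: sort_sorted leq_total _.
  apply: (@homo_sorted_in _ _ (mem s)); first exact: flip_mono.
  by apply/allP => x; rewrite mem_sort.
- by rewrite perm_sort perm_map// perm_sym perm_sort.
Qed.

(** The local step of Ky Fan's lemma. Both sides are invariant under permutation, so the labels may
    be sorted; compatibility lets [flip] preserve the order, and what remains is the identity for
    words of signs. *)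
Lemma fan s : s != [::] -> compatible s ->
  \big[addb/false]_(d <- deletions s) alt_labels d = alt_labels s (+) alt_labels (map flip s).
Proof.
move=> s0 cs; rewrite [alt_labels (map flip s)]/alt_labels sort_flip//.
rewrite perm_deletions; last by move=> u v; exact: perm_alt_labels.
have st : perm_eq s (sort leq s) by rewrite perm_sym perm_sort.
rewrite (perm_alt_labels st) (perm_big _ st) /=.
have -> : \big[addb/false]_(x <- sort leq s) alt_labels (rem x s) =
    \big[addb/false]_(x <- sort leq s) alt_labels (rem x (sort leq s)).
  rewrite big_seq [RHS]big_seq; apply: eq_bigr => x xs; apply: perm_alt_labels.
  have xs' : x \in s by rewrite (perm_mem st).
  rewrite -(perm_cons x) -(permPl (perm_to_rem xs')) -(permPr (perm_to_rem xs)).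
  exact: st.
have : sorted leq (sort leq s) by exact: sort_sorted leq_total _.
have : sort leq s != [::] by rewrite -size_eq0 size_sort size_eq0.
move: (sort leq s) => t t0 tS.
rewrite -perm_deletions; last by move=> u v; exact: perm_alt_labels.
have -> : \big[addb/false]_(d <- deletions t) alt_labels d =
    \big[addb/false]_(d <- deletions (map odd t)) alternates true d.
  rewrite deletions_map big_map big_seq [RHS]big_seq; apply: eq_bigr => d dt.
  rewrite /alt_labels (_ : sort leq d = d)//; apply: sorted_sort; first exact: leq_trans.
  apply: (subseq_sorted leq_trans) tS.
  elim: {t0} t d dt => //= x t IH d; rewrite inE => /orP[/eqP ->|/mapP[d' /IH h ->]].
    exact: subseq_cons.
  by rewrite /= eqxx.
rewrite alternates_deletions; case: t t0 tS => // x t _ tS; congr (_ (+) _).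
  by rewrite /alt_labels (sorted_sort leq_trans).
by rewrite -alternates_flip -!map_comp; congr alternates; apply: eq_map => y; rewrite /= odd_flip.
Qed.

(** Consecutive labels of opposite sign cannot share a coordinate when they are compatible, so an
    alternating simplex uses as many coordinates as it has vertices. *)
Lemma alt_labels_pigeonhole n s : compatible s -> (n < size s)%N ->
  (forall x, x \in s -> (x./2 < n)%N) -> alt_labels s = false.
Proof.
move=> cs ns sn; apply/negP => al.
have : (size (map half (sort leq s)) <= size (iota 0 n))%N.
  apply: uniq_leq_size; last first.
    by move=> y /mapP[x]; rewrite mem_sort => /sn xn ->; rewrite mem_iota.
  apply: (@sorted_uniq _ ltn ltn_trans ltnn); rewrite sorted_map.
  move: al; rewrite /alt_labels.
  have : {subset sort leq s <= s} by move=> x; rewrite mem_sort.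
  have : sorted leq (sort leq s) by exact: sort_sorted leq_total _.
  move: (sort leq s) true; elim => //= x [|y t] //= IH c /andP[xy tS] ts /and3P[xc yc al].
  apply/andP; split; last first.
    by apply: (IH (~~ c)) => //=; [move=> z zt; apply: ts; rewrite inE zt orbT|rewrite yc].
  rewrite ltn_neqAle half_leq// andbT; apply/negP => /eqP /cs xyE.
  have := xyE (ts _ (mem_head _ _)) (ts _ _); rewrite !inE eqxx orbT => /(_ isT) xyE'.
  by move: yc; rewrite -xyE' (eqP xc); case: c {xc al}.
by rewrite size_map size_sort size_iota leqNgt ns.
Qed.

End fan.

(** * Approximate zeros of odd maps *)

Section borsuk_ulam.
Context {R : realType}.

Definition l1_sphere n : set 'rV[R]_n.+1 := [set x | \sum_j `|x 0 j| = 1].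
Arguments l1_sphere n : clear implicits.

Lemma l1_sphereN n x : l1_sphere n x -> l1_sphere n (- x).
Proof. by rewrite /l1_sphere /= => <-; apply: eq_bigr => j _; rewrite mxE normrN. Qed.

Lemma l1_sphere_compact n : compact (l1_sphere n).
Proof.
apply: (@subclosed_compact _ _ [set x : 'rV[R]_n.+1 | forall j, `[-1, 1]%classic (x 0 j)]).
- have -> : l1_sphere n = (fun x : 'rV[R]_n.+1 => \sum_j `|x 0 j|) @^-1` [set 1] by [].
  apply: closed_comp => [x _|]; last exact: closed_eq.
  apply: (@continuous_big _ _ +%R 0) => [|j _ y]; first exact: add_continuous.
  apply: (@continuous_comp _ _ _ (fun x : 'rV[R]_n.+1 => x 0 j) Num.norm); last exact: norm_continuous.
  exact: (@coord_continuous _ 1 n.+1 0 j y).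
- by have := @rV_compact R n.+1 (fun=> `[-1, 1]%classic) (fun=> @segment_compact R (-1) 1).
- move=> x /= x1 j; rewrite in_itv /= -ler_norml -x1 (bigD1 j)//= lerDl.
  by rewrite sumr_ge0.
Qed.

Section face.
Variables (n : nat) (sgn : nat -> R).

(** A face of the l1 sphere, given by its signs. It is flat, so iterated barycentres of its vertices
    stay on the sphere without projection. *)
Definition octant_face : 'rV[R]_n.+1 -> Prop := fun x =>
  (forall j : 'I_n.+1, 0 <= sgn j * x 0 j) /\ \sum_(j < n.+1) sgn j * x 0 j = 1.

Lemma octant_face_bary : bary_closed octant_face.
Proof.
move=> c c0 cf; have s0 : (size c)%:R != 0 :> R by rewrite pnatr_eq0 -lt0n.
have E (j : 'I_n.+1) : sgn j * bary c 0 j = (size c)%:R^-1 * \sum_(x <- c) sgn j * x 0 j.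
  by rewrite /bary mxE summxE mulrCA mulr_sumr.
split => [j|].
  rewrite E mulr_ge0 ?invr_ge0// big_seq sumr_ge0// => x /cf[+ _]; exact.
under eq_bigr do rewrite E.
rewrite -mulr_sumr exchange_big /= big_seq.
rewrite (eq_bigr (fun=> 1)); last by move=> x /cf[].
by rewrite -big_seq big_const_seq count_predT iter_addr_0 mulVf.
Qed.

Lemma octant_face_sphere x : (forall j, `|sgn j| = 1) -> octant_face x -> l1_sphere n x.
Proof.
move=> s1 [x0 x1]; rewrite /l1_sphere /= -x1; apply: eq_bigr => j _.
by rewrite -[RHS]ger0_norm// normrM s1 mul1r.
Qed.

End face.

Definition basis_vec n (j : nat) : 'rV[R]_n.+1 := delta_mx 0 (inord j).
Arguments basis_vec n j : clear implicits.

Lemma mem_octahedron n k c : (k <= n.+1)%N -> c \in octahedron (basis_vec n) k ->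
  size c = k /\ exists2 sgn : nat -> R, (forall j, `|sgn j| = 1) &
    forall x, x \in c -> exists2 j, (j < k)%N & x = sgn j *: basis_vec n j.
Proof.
elim: k c => [|k IH] c kn /=.
  by rewrite inE => /eqP ->; split => //; exists (fun=> 1) => // j; rewrite normr1.
have C (a : R) d : `|a| = 1 -> d \in octahedron (basis_vec n) k ->
    size (a *: basis_vec n k :: d) = k.+1 /\ exists2 sgn : nat -> R, (forall j, `|sgn j| = 1) &
    forall x, x \in a *: basis_vec n k :: d -> exists2 j, (j < k.+1)%N & x = sgn j *: basis_vec n j.
  move=> a1 /(IH _ (ltnW kn))[sd [sgn s1 H]]; split; first by rewrite /= sd.
  exists (fun j => if j == k then a else sgn j) => [j|x]; first by case: ifP.
  rewrite inE => /orP[/eqP ->|/H[j jk ->]]; first by exists k; rewrite ?eqxx.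
  by exists j; [exact: ltnW|rewrite ltn_eqF].
rewrite mem_cat => /orP[] /mapP[d dO ->].
  by have := C 1 d (normr1 _) dO; rewrite scale1r.
have := C (-1) d _ dO; rewrite scaleN1r; apply.
by rewrite normrN normr1.
Qed.

Lemma basis_vec_face n sgn j : (j <= n)%N -> (forall j, `|sgn j| = 1) ->
  octant_face sgn (sgn j *: basis_vec n j).
Proof.
move=> jn s1; have ss : sgn j * sgn j = 1 by rewrite -[LHS]ger0_norm ?normrM ?s1 ?mulr1// -expr2 sqr_ge0.
split => [i|].
  rewrite !mxE eqxx /=; case: eqP => [->|_]; last by rewrite !mulr0.
  by rewrite inordK// mulr1 ss.
rewrite (bigD1 (inord j))//= big1 => [|i /negPf ij]; last by rewrite !mxE ij andbF !mulr0.
by rewrite !mxE !eqxx mulr1 inordK// ss addr0.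
Qed.

Section approximate_zero.
Variables (n : nat) (h : 'rV[R]_n.+1 -> 'I_n -> R) (eta : R).
Hypothesis eta0 : 0 < eta.
Hypothesis hN : forall x, l1_sphere n x -> forall i, h (- x) i = - h x i.
Hypothesis h_large : forall x, l1_sphere n x -> exists i, eta < `|h x i|.

(** A coordinate where [h x] exceeds [eta], with its sign. On the sphere the pick succeeds, and it
    selects the same coordinate at [- x]. *)
Let label x : nat := if [pick i | eta < `|h x i|] is Some i then (i.*2 + (0 < h x i)%R)%N else 0%N.

Let label_spec x : l1_sphere n x -> exists i : 'I_n,
  [/\ eta < `|h x i|, label x = (i.*2 + (0 < h x i)%R)%N & label (- x) = (i.*2 + (h x i < 0)%R)%N].
Proof.
move=> xS; rewrite /label.
have -> : [pick i | eta < `|h (- x) i|] = [pick i | eta < `|h x i|].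
  by apply: eq_pick => i; rewrite hN// normrN.
case: pickP => [i hi|none]; last by have [i] := h_large xS; rewrite none.
by exists i; rewrite hN// oppr_gt0.
Qed.

Let labelN x : l1_sphere n x -> label (- x) = flip (label x).
Proof.
move=> /label_spec[i [hi -> ->]]; rewrite /flip.
have h0 : h x i != 0 by rewrite -normr_gt0 (lt_trans eta0).
have -> : (h x i < 0) = ~~ (0 < h x i) by rewrite -leNgt lt_neqAle h0.
by rewrite [X in X./2]addnC half_bit_double oddD odd_double; case: (0 < h x i).
Qed.

Let D : R := 2 * \sum_(j < n.+1) `|basis_vec n j|.

(** Without such a pair the labels are compatible on every simplex of the [r]-th subdivision. Fan's
    identity then verifies the hypothesis of [octa_antipodal], so the number of alternating
    simplices is odd in every dimension; in the last one they would need [n + 1] coordinates out of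
    [n]. *)
Lemma sign_jump r : exists x y i, [/\ l1_sphere n x, l1_sphere n y,
  `|x - y| <= (1 - n.+1%:R^-1) ^+ r * D & 2 * eta <= `|h x i - h y i|].
Proof.
apply: contrapT => none.
pose alpha (c : seq 'rV[R]_n.+1) := alt_labels (map label c).
have good k c d : (k <= n.+1)%N -> c \in octahedron (basis_vec n) k -> d \in simplices_iter r k c ->
    [/\ size d = k, compatible (map label d) & forall x, x \in d -> l1_sphere n x].
  move=> kn cO dc; have [sc [sgn s1 H]] := mem_octahedron kn cO.
  have D0 : 0 <= D by rewrite mulr_ge0// sumr_ge0.
  have cD : mesh_le D c.
    have B x : x \in c -> `|x| <= \sum_(j < n.+1) `|basis_vec n j|.
      move=> /H[j jk ->]; rewrite normrZ s1 mul1r.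
      have jn : (j < n.+1)%N by exact: leq_trans jk kn.
      by rewrite (bigD1 (Ordinal jn))//= lerDl sumr_ge0.
    move=> x y xc yc; apply: le_trans (ler_normB _ _) _.
    by rewrite /D mulr_natl mulr2n lerD ?B.
  have [sd dM dC] := simplices_iter_spec dc sc kn D0 cD.
  have dS x : x \in d -> l1_sphere n x.
    move=> xd; apply: (octant_face_sphere s1); apply: (dC _ (@octant_face_bary n sgn)) xd => y.
    by move=> /H[j jk ->]; apply: basis_vec_face => //; exact: leq_trans jk kn.
  split => // _ _ /mapP[x xd ->] /mapP[y yd ->].
  have [i [hi -> _]] := label_spec (dS _ xd); have [i' [hi' -> _]] := label_spec (dS _ yd).
  rewrite ![(_ .*2 + _)%N]addnC !half_bit_double => /val_inj ii; rewrite -ii in hi' *.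
  congr (_ + _)%N; apply: contrapT => ne; apply: none; exists x, y, i; split => //.
  - exact: dS.
  - exact: dS.
  - exact: dM.
  - move: hi hi' ne; move: (h x i) (h y i) => a b.
    case: (ltP 0 a) => a0; case: (ltP 0 b) => b0 //= ha hb _.
      by rewrite gtr0_norm in ha => //; rewrite ler0_norm in hb => //; rewrite ler_normr; apply/orP; left; lra.
    by rewrite ler0_norm in ha => //; rewrite gtr0_norm in hb => //; rewrite ler_normr; apply/orP; right; lra.
(* The induction starts at the empty simplex, which alternates trivially. *)
have rec k : (k <= n.+1)%N -> octa (basis_vec n) k (subdivs r k alpha).
  elim: k => [|k IH] kn.
    by rewrite /octa big_seq1 subdivs0.
  rewrite octa_antipodal ?IH ?(ltnW kn)// => c d cO dc.
  have [sd dl dS] := good _ _ _ kn cO dc.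
  have -> : cobd alpha d = \big[addb/false]_(t <- deletions (map label d)) alt_labels t.
    by rewrite /cobd deletions_map big_map.
  rewrite fan//; last by rewrite -size_eq0 size_map sd.
  congr (_ (+) _); rewrite /alpha -!map_comp; congr alt_labels.
  by apply/eq_in_map => x /dS; rewrite /= => /labelN.
have := rec n.+1 (leqnn _); rewrite /octa big_seq big1// => c cO.
rewrite subdivsE big_seq big1// => d dc; have [sd dl dS] := good _ _ _ (leqnn _) cO dc.
apply: (@alt_labels_pigeonhole n) => //; first by rewrite size_map sd.
move=> _ /mapP[x /dS/label_spec[i [_ -> _]] ->].
by rewrite addnC half_bit_double.
Qed.

End approximate_zero.

Let near_dist (V : normedModType R) (p : V) (d : R) : 0 < d -> \forall x \near p, `|p - x| < d.
Proof. by move=> d0; apply/nbhs_normP; exists d. Qed.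

(** Otherwise jumps of size [2 * eta] occur between points at arbitrarily small distance, and
    continuity fails at a cluster point. An approximate zero is the form in which smallness of cube
    integrals is needed. *)
Theorem borsuk_ulam n (h : 'rV[R]_n.+1 -> 'I_n -> R) (eta : R) : 0 < eta ->
  (forall x, l1_sphere n x -> forall i, h (- x) i = - h x i) ->
  (forall x, l1_sphere n x -> forall i, h z i @[z --> within (l1_sphere n) (nbhs x)] --> h x i) ->
  exists2 x, l1_sphere n x & forall i, `|h x i| <= eta.
Proof.
move=> eta0 hN hC; apply: contrapT => none.
have h_large x : l1_sphere n x -> exists i, eta < `|h x i|.
  move=> xS; apply: contrapT => nx; apply: none; exists x => // i.
  by rewrite leNgt; apply/negP => hi; apply: nx; exists i.
have [X HX] := choice (sign_jump eta0 hN h_large).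
pose D : R := 2 * \sum_(j < n.+1) `|basis_vec n j|.
have XS : (X r @[r --> \oo]) (l1_sphere n).
  by exists 0%N => // r _ /=; have [y [i []]] := HX r.
have [p [pS pcl]] := @l1_sphere_compact n _ _ XS.
have : \forall z \near p, forall i, l1_sphere n z -> `|h p i - h z i| < eta.
  apply: (@filter_forall _ _ (fun i z => l1_sphere n z -> `|h p i - h z i| < eta) (nbhs p) (nbhs_filter p)) => i.
  by have /cvgrPdist_lt/(_ _ eta0) := hC p pS i.
move=> /nbhs_normP[d /= d0 hd].
have d2 : 0 < d / 2 by rewrite divr_gt0.
have meshD : (1 - n.+1%:R^-1) ^+ r * D @[r --> \oo] --> (0 : R).
  rewrite -[X in _ --> X](mul0r D); apply: cvgM; last exact: cvg_cst.
  apply: cvg_expr; rewrite ger0_norm ?subr_ge0 ?invf_le1 ?ltr0n ?ler1n//.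
have /cvgrPdist_lt/(_ _ d2) near0 := meshD.
have nb := near_dist p d2.
have [x [[y [i [xS yS xy hxy]]] px]] : [set x | exists y i, [/\ l1_sphere n x, l1_sphere n y,
    `|x - y| < d / 2 & 2 * eta <= `|h x i - h y i|]] `&` [set x | `|p - x| < d / 2] !=set0.
  apply: pcl nb.
  apply: (filterS _ near0) => r; rewrite sub0r normrN => hr /=.
  have [y [i [xS yS xy hxy]]] := HX r; exists y, i; split => //.
  by apply: le_lt_trans xy _; apply: le_lt_trans (ler_norm _) hr.
have h1 : `|h p i - h x i| < eta by apply: hd => //=; rewrite (lt_trans px)// ltr_pdivrMr// ltr_pMr// ltr1n.
have h2 : `|h p i - h y i| < eta.
  apply: hd => //=; rewrite -(subrK x p) -addrA; apply: le_lt_trans (ler_normD _ _) _.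
  by rewrite [d]splitr ltrD.
have : `|h x i - h y i| < 2 * eta.
  rewrite -(subrK (h p i) (h x i)) -addrA; apply: le_lt_trans (ler_normD _ _) _.
  by rewrite distrC mulr_natl mulr2n ltrD.
by rewrite ltNge hxy.
Qed.

End borsuk_ulam.

Arguments l1_sphere {R} n _.
Arguments basis_vec {R} n j.

(** * Continuity of cube integrals *)

Section cube_test_continuity.
Context {R : realType} {N : nat}.
Notation leb := (@Rn_lebesgue R N).
Implicit Types (x y c : Rn R N) (w : Rn R N -> R).

Lemma measurable_coordinates (A : 'I_N -> set (measurableTypeR R)) : (forall i, measurable (A i)) ->
  measurable [set y : Rn R N | forall i, A i (tnth y i)].
Proof.
move=> mA; rewrite (_ : [set y | _] = \bigcap_(i in [set: 'I_N]) ((@tnth _ _)^~ i @^-1` A i)).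
  apply: fin_bigcap_measurable => // i _; rewrite -[X in measurable X]setTI.
  by apply: (@measurable_tnth _ (measurableTypeR R) N i measurableT); exact: mA.
by apply/seteqP; split => y /= Ay i; [move=> _|]; exact: Ay.
Qed.

Lemma ae_coordinate (A : set (measurableTypeR R)) : countable A ->
  {ae leb, forall x, forall i, ~ A (tnth x i)}.
Proof.
move=> cA; have mA : measurable A by apply: countable_measurable cA => t; exact: measurable_set1.
apply: (@filter_forall _ _ (fun i x => ~ A (tnth x i)) _ _) => i.
pose B (k : 'I_N) : set (measurableTypeR R) := if k == i then A else setT.
have mB k : measurable (B k) by rewrite /B; case: ifP.
exists [set x : Rn R N | forall k, B k (tnth x k)]; split.
- exact: measurable_coordinates.
- rewrite Rn_lebesgue_box// (bigD1 i)//= /B eqxx.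
  by rewrite [X in (X * _)%E](countable_lebesgue_measure0 cA) mul0e.
- move=> x /= /contrapT Ax k; rewrite /B; case: eqP => // ->; exact: Ax.
Qed.

Lemma floor_near (a : R) : a <> (Num.floor a)%:~R -> \forall b \near a, Num.floor b = Num.floor a.
Proof.
move=> na; have /andP[fa af] := floor_itv a.
have {}fa : (Num.floor a)%:~R < a by rewrite lt_neqAle fa andbT eq_sym; apply/eqP.
near=> b; apply: floor_def; apply/andP; split.
  by apply: ltW; near: b; exact: (cvgr_gt a cvg_id).
by near: b; exact: (cvgr_lt a cvg_id).
Unshelve. all: by end_near. Qed.

(** Off the walls of the grid, a null set, integer parts are locally constant. *)
Lemma ae_cube_dil j c : {ae leb, forall y, cube j c (dil t^-1 y) @[t --> (1 : R)] --> cube j c y}.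
Proof.
have cA : countable (range (fun z : int => z%:~R / 2 ^+ j : measurableTypeR R)).
  by apply: card_le_trans (card_image_le _ _) _; exact: countableP.
move: (ae_coordinate cA); apply: filterS => y hy.
have E : \forall t \near (1 : R), cube j c (dil t^-1 y) = cube j c y.
  have : \forall t \near (1 : R), forall i, Num.floor (2 ^+ j * (t^-1 * tnth y i)) = Num.floor (2 ^+ j * tnth y i).
    apply: (@filter_forall _ _ (fun i t => Num.floor (2 ^+ j * (t^-1 * tnth y i)) = Num.floor (2 ^+ j * tnth y i)) (nbhs (1 : R)) (nbhs_filter (1 : R))) => i.
    have : 2 ^+ j * (t^-1 * tnth y i) @[t --> (1 : R)] --> 2 ^+ j * ((1 : R)^-1 * tnth y i).
      apply: cvgM; first exact: cvg_cst.
      apply: cvgM; last exact: cvg_cst.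
      by apply: cvgV; rewrite ?oner_neq0//; exact: cvg_id.
    rewrite invr1 mul1r; move/(_ [set b | Num.floor b = Num.floor (2 ^+ j * tnth y i)]); apply.
    apply: floor_near => h; apply: (hy i); exists (Num.floor (2 ^+ j * tnth y i)) => //.
    by rewrite -h mulrAC mulfV ?mul1r// expf_neq0.
  apply: filterS => t h; rewrite /cube; congr (_%:R); congr nat_of_bool.
  by apply: eq_forallb => i; rewrite tnth_dil h.
apply: cvg_trans (cvg_cst (cube j c y)).
by apply: near_eq_cvg; move: E; apply: filterS => t ->.
Unshelve. all: exact: (nbhs_filter (1 : R)).
Qed.

Lemma box_L2 (M : R) : L2 leb (fun y : Rn R N => \1_[set y : Rn R N | forall i, `[- M, M]%classic (tnth y i)] y).
Proof.
have mA : measurable [set y : Rn R N | forall i, `[- M, M]%classic (tnth y i)].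
  by apply: (measurable_coordinates (A := fun=> `[- M, M]%classic)) => i; exact: measurable_itv.
split; first exact: measurable_indic.
rewrite (eq_integral (fun y => (\1_[set y : Rn R N | forall i, `[- M, M]%classic (tnth y i)] y)%:E)); last first.
  by move=> y _; rewrite indicE; case: (_ \in _); rewrite ?expr1n ?expr0n.
rewrite integral_indic// setIT.
apply: (eq_ind_r (fun z => (z < +oo)%E) _ (@Rn_lebesgue_box R N (fun=> `[- M, M]%classic) (fun=> measurable_itv _))).
under eq_bigr do rewrite lebesgue_measure_itv/= lte_fin.
have [h|h] := ltP (- M) M; last first.
  by case: (N) => [|n]; rewrite ?big_ord0 ?ltry// big_ord_recl mul0e ltry.
by under eq_bigr do rewrite -EFinB; rewrite prodEFin ltry.
Qed.

Lemma cube_dil_box j c : exists M : R, forall t y, t \in `]1/2, 2[ -> cube j c (dil t^-1 y) <=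
  \1_[set y : Rn R N | forall i, `[- M, M]%classic (tnth y i)] y.
Proof.
pose fl i : R := (Num.floor (2 ^+ j * tnth c i))%:~R.
exists (2 * \sum_i (`|fl i| + 1)) => t y; rewrite in_itv /= => /andP[t1 t2].
have t0 : 0 < t by move: t1; lra.
rewrite indicE /cube; case: same_cubeP => //= h; rewrite mem_set// => i.
rewrite /= in_itv /= -ler_norml.
have := h i; rewrite tnth_dil => hi.
have /andP[h1 h2] := floor_itv (2 ^+ j * (t^-1 * tnth y i)).
have j1 : 1 <= (2 : R) ^+ j by rewrite exprn_ege1// ler1n.
rewrite -hi -/(fl i) in h1; rewrite -hi rmorphD -/(fl i) /= in h2.
apply: (@le_trans _ _ (2 * (`|fl i| + 1))); last first.
  by rewrite ler_pM2l// (bigD1 i)//= lerDl sumr_ge0// => k _; rewrite addr_ge0.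
have -> : tnth y i = t * (2 ^+ j)^-1 * (2 ^+ j * (t^-1 * tnth y i)).
  by field; rewrite gt_eqF//= gt_eqF// (lt_le_trans ltr01).
rewrite normrM; apply: ler_pM => //.
  rewrite ger0_norm ?mulr_ge0 ?invr_ge0 ?(ltW t0) ?(le_trans ler01)//.
  by rewrite -[leRHS]mulr1; apply: ler_pM; rewrite ?invr_ge0 ?(ltW t0) ?(ltW t2) ?(le_trans ler01)// invf_le1 ?(lt_le_trans ltr01).
move: h1 h2; move: (2 ^+ j * _) => z h1 h2.
have := ler_norm (fl i); have := ler_norm (- fl i); rewrite normrN ler_norml; lra.
Qed.

Lemma l2_cube_dil_cvg j c w : L2 leb w ->
  \int[leb]_y (w y * cube j c (dil t^-1 y)) @[t --> (1 : R)] --> \int[leb]_y (w y * cube j c y).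
Proof.
move=> Lw; have [M hM] := cube_dil_box j c.
pose A := [set y : Rn R N | forall i, `[- M, M]%classic (tnth y i)].
have ig : leb.-integrable setT (EFin \o (fun y => `|w y * \1_A y|)).
  exact: integrable_norm (L2_mul_integrable Lw (box_L2 M)).
apply/(@cvg_nbhsP R R^o) => u u1.
have [n0 _ hn0] : \forall n \near \oo, u n \in `]1/2, 2[.
  near=> n; rewrite in_itv /=; apply/andP; split; near: n.
    by apply: (cvgr_gt (1 : R)) => //; lra.
  by apply: (cvgr_lt (1 : R)) => //; lra.
rewrite -(cvg_shiftn n0).
have mw := Lw.1.
have mc t : 0 < t -> measurable_fun setT (fun y => w y * cube j c (dil t^-1 y)).
  move=> t0; apply: measurable_funM => //.
  by apply: measurableT_comp (measurable_dil _); exact: measurable_cube.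
have up n : 0 < u (n + n0)%N.
  by have := hn0 (n + n0)%N (leq_addl _ _); rewrite /= in_itv /= => /andP[]; lra.
have cae : {ae leb, forall y, setT y -> (w y * cube j c (dil (u (n + n0)%N)^-1 y))%:E @[n --> \oo] --> (w y * cube j c y)%:E}.
  move: (ae_cube_dil j c); apply: filterS => y hy _; apply: cvg_EFin; first exact: nearW.
  apply: cvgM; first exact: cvg_cst.
  have us : u (n + n0)%N @[n --> \oo] --> (1 : R) by rewrite (cvg_shiftn n0).
  exact: (cvg_comp _ _ us hy).
have mf n : measurable_fun setT (fun y => (w y * cube j c (dil (u (n + n0)%N)^-1 y))%:E).
  by apply/measurable_EFinP; exact: mc (up n).
have mf0 : measurable_fun setT (fun y => (w y * cube j c y)%:E).
  by apply/measurable_EFinP; apply: measurable_funM => //; exact: measurable_cube.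
have dom : {ae leb, forall y n, setT y -> (`|(w y * cube j c (dil (u (n + n0)%N)^-1 y))%:E| <= `|w y * \1_A y|%:E)%E}.
  apply: aeW => y n _; rewrite abse_EFin lee_fin !normrM ler_wpM2l//.
  rewrite [`|cube _ _ _|]ger0_norm ?cube_ge0// [`|\1_A y|]ger0_norm; last by rewrite indicE ler0n.
  by apply: hM; exact: (hn0 (n + n0)%N (leq_addl _ _)).
have [_ _] := dominated_convergence measurableT mf mf0 cae ig dom.
have iw : leb.-integrable setT (EFin \o (fun y => w y * cube j c y)).
  exact: L2_mul_integrable Lw (cube_L2 j c).
have fw : (\int[leb]_y (w y * cube j c y)%:E)%E \is a fin_num by exact: integrable_fin_num.
rewrite -[X in _ --> X -> _](fineK fw) => /fine_cvg; apply: cvg_trans.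
by [].
Unshelve. all: by end_near. Qed.

End cube_test_continuity.

Section cube_test_dilation.
Context {R : realType} {N : nat} {s : R}.
Notation leb := (@Rn_lebesgue R N).
Local Notation hs := (@hs R N s).

(** A change of variables moves the dilation from [w] onto the cube, where dominated convergence
    applies. *)
Lemma l2_hs_dil_cube_cvg j c (w : hs) :
  l2 leb (hs_dil t w) (cube j c) @[t --> (1 : R)] --> l2 leb w (cube j c).
Proof.
have E : \forall t \near (1 : R), t `^ (- (N%:R / 2)) * \int[leb]_y (w y * cube j c (dil t^-1 y)) =
    l2 leb (hs_dil t w) (cube j c).
  near=> t; have t0 : 0 < t by near: t; exact: (cvgr_gt (1 : R) cvg_id).
  have ti : 0 < t^-1 by rewrite invr_gt0.
  have Lc : L2 leb (fun y => cube j c (dil t^-1 y)).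
    split; first by apply: measurableT_comp (measurable_dil _); exact: measurable_cube.
    rewrite (scales_integral (dil_scales ti) (f := fun y => (cube j c y ^+ 2)%:E)).
    - by rewrite lte_mul_pinfty// ?(cube_L2 j c).2// lee_fin invr_ge0 exprn_ge0// ltW.
    - exact: measurable_EFin_sq (measurable_cube _ _).
    - by move=> x; rewrite lee_fin sqr_ge0.
  have wi := L2_mul_integrable (hs_L2 w) Lc.
  have := scales_Rintegral (dil_scales t0) wi => I.
  transitivity (t `^ (N%:R / 2) * \int[leb]_x (w (dil t x) * cube j c (dil t^-1 (dil t x)))).
    rewrite I mulrA; congr (_ * _).
    rewrite -(powR_mulrn N (ltW t0)) -powRN -powR_addp//; congr (_ `^ _); lra.
  rewrite -RintegralZl//; last exact: scales_integrable (dil_scales t0) wi.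
  apply: eq_Rintegral => x _; rewrite hs_dilE// /dilate mulrA; congr (_ * cube j c _).
  by apply: eq_from_tnth => i; rewrite !tnth_dil mulrA mulVf ?mul1r// gt_eqF.
have pc : t `^ (- (N%:R / 2)) @[t --> (1 : R)] --> (1 : R).
  have p1 : (1 : R) `^ (- (N%:R / 2)) = 1 by rewrite powR1.
  rewrite -[X in _ --> X]p1.
  have c1 : {for (1 : R), continuous (fun x : R => x `^ (- (N%:R / 2)))}.
    apply: differentiable_continuous; apply/derivable1_diffP.
    exact: (@ex_derive _ _ _ _ _ _ _ (is_derive1_powR (- (N%:R / 2)) ltr01)).
  exact: c1.
have lc := cvgM pc (@l2_cube_dil_cvg R N j c _ (hs_L2 w)).
pose g t := l2 leb (hs_dil t w) (cube j c).
pose h (t : R) := t `^ (- (N%:R / 2)) * \int[leb]_y (w y * cube j c (dil t^-1 y)).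
have lim : h t @[t --> (1 : R)] --> l2 leb w (cube j c) by rewrite mul1r in lc; exact: lc.
have E' : {near (1 : R), h =1 g} by move: E; apply: filterS => t Et; rewrite /g -Et.
exact: cvg_trans (near_eq_cvg E') lim.
Unshelve. all: by end_near. Qed.

End cube_test_dilation.

Section cube_test_poh_time.
Context {R : realType} {N : nat} {s : R} {f : R -> R} (A : admissible s N f) (m : R) (m0 : 0 < m).
Notation leb := (@Rn_lebesgue R N).
Local Notation hs := (@hs R N s).
Local Notation tz := (poh_time (f := f)).

Lemma hcvg_dil_cube_test I (G : set_system I) {FG : Filter G} k (ui : I -> hs) u (ti : I -> R) (t : R) :
  0 < t -> (forall i, 0 < ti i) -> ti i / t @[i --> G] --> (1 : R) -> hcvg G ui u ->
  l2 leb (hs_dil (ti i) (ui i)) (cube_test k) @[i --> G] --> l2 leb (hs_dil t u) (cube_test k).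
Proof.
move=> t0 ti0 cr cu; rewrite /cube_test; case: unpickle => [[j z]|]; last first.
  have E (v : hs) : l2 leb v (0 : Rn R N -> R) = 0.
    have -> : (0 : Rn R N -> R) = (0 : R) *: (v : Rn R N -> R) by rewrite scale0r.
    by rewrite l2C l2Zl ?mul0r//; exact: hs_L2.
  by rewrite (funext (fun i => E _)) E; exact: cvg_cst.
set c := lattice_pt j z; pose w := hs_dil t u.
have cw : hcvg G (fun i => hs_dil t (ui i)) w by exact: hcvg_dil.
have r0 i : 0 < ti i / t by exact: divr_gt0.
have rE i : hs_dil (ti i / t) (hs_dil t (ui i)) = hs_dil (ti i) (ui i).
  by rewrite hs_dilM// mulrC divfK// gt_eqF.
have c1 := cvg_comp _ _ cr (@l2_hs_dil_cube_cvg R N s j c w).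
have c2 : l2 leb (hs_dil (ti i / t) (hs_dil t (ui i) - w)) (cube j c) @[i --> G] --> (0 : R).
  pose C := Num.sqrt (l2 leb (cube j c) (cube j c)).
  have bd i : `|l2 leb (hs_dil (ti i / t) (hs_dil t (ui i) - w)) (cube j c)| <=
      hn (hs_dil t (ui i) - w) * C.
    have C0 := l2_ge0 leb (cube j c).
    rewrite -(ler_pXn2r (n := 2)) ?nnegrE ?mulr_ge0 ?hn_ge0 ?sqrtr_ge0//.
    have CC : C ^+ 2 = l2 leb (cube j c) (cube j c) by exact: sqr_sqrtr.
    rewrite real_normK ?num_real// exprMn CC.
    apply: le_trans (l2_cauchy_schwarz (hs_L2 _) (cube_L2 _ _)) _.
    apply: ler_wpM2r => //; rewrite -/(bform _ _) bform_dil// hn_sq.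
    by rewrite lerDr (ip_ge0 (@aform_psd R N s)).
  apply: (@cvg0_le _ _ G FG _ (fun i => hn (hs_dil t (ui i) - w) * C)); first by apply: nearW.
  by rewrite -(mul0r C); apply: cvgM => //; exact: cvg_cst.
have E i : l2 leb (hs_dil (ti i) (ui i)) (cube j c) =
    l2 leb (hs_dil (ti i / t) w) (cube j c) +
    l2 leb (hs_dil (ti i / t) (hs_dil t (ui i) - w)) (cube j c).
  rewrite -l2Dl; [|exact: hs_L2|exact: hs_L2|exact: cube_L2].
  by rewrite -hs_funD -hs_dilD// [w + _]addrC subrK rE.
rewrite (funext E) -[X in _ --> X]addr0; exact: cvgD c1 c2.
Qed.

Lemma hcvg_cube_test I (G : set_system I) {FG : Filter G} k (ui : I -> hs) u :
  (forall i, bform (ui i) (ui i) = m) -> bform u u = m -> hcvg G ui u ->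
  l2 leb (hs_dil (tz (ui i)) (ui i)) (cube_test k) @[i --> G] --> l2 leb (hs_dil (tz u) u) (cube_test k).
Proof.
move=> uim um cu.
have t0 : 0 < tz u by have [|] := poh_timeP A (u := u); rewrite ?um.
have ti0 i : 0 < tz (ui i) by have [|] := poh_timeP A (u := ui i); rewrite ?uim.
have cr : tz (ui i) / tz u @[i --> G] --> (1 : R).
  exact: (@hcvg_poh_time _ _ _ _ A m m0 I G FG ui u uim um cu).
exact: hcvg_dil_cube_test t0 ti0 cr cu.
Qed.

End cube_test_poh_time.

(** * The minimax level *)

(** Either the value is already below [E - e], and the error term cannot bring it back to the level,
    or the gradient exceeds [e] and the descent beats the error. No cutoff of the step in the energy
    is needed. *)
Lemma near_critical_arith (R : realFieldType) (E e dl h j : R) : 0 < e -> 0 < dl -> dl * e <= 1 -> 0 <= h ->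
  j < E + dl * e ^+ 2 / 4 -> (E - e < j -> e < h) ->
  j - dl * h ^+ 2 + dl * (e ^+ 2 / 2) <= E - Num.min (dl * e ^+ 2 / 4) (e / 2).
Proof.
move=> e0 dl0 dle h0 jE hj.
have [Jlow|/hj eh] := leP j (E - e).
  apply: (@le_trans _ _ (E - e / 2)); last by rewrite lerD2l lerN2 ge_min lexx orbT.
  have a0 : 0 <= dl * h ^+ 2 by rewrite mulr_ge0 ?sqr_ge0// ltW.
  have h1 : dl * (e ^+ 2 / 2) <= e / 2 by rewrite mulrA ler_pM2r// expr2 mulrA ler_piMl// ltW.
  by move: a0 h1 Jlow; move: (dl * _) (dl * _) => a b; lra.
apply: (@le_trans _ _ (E - dl * e ^+ 2 / 4)); last by rewrite lerD2l lerN2 ge_min lexx.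
have h1 : dl * e ^+ 2 <= dl * h ^+ 2.
  by rewrite ler_pM2l// ler_pXn2r// ?nnegrE ?hn_ge0 ?ltW.
by move: h1 jE; rewrite mulrA; move: (dl * _) (dl * _) => a b; lra.
Qed.

Section minimax.
Context {R : realType} {N : nat} {s : R} {f : R -> R} (A : admissible s N f) (m : R) (m0 : 0 < m).
Notation leb := (@Rn_lebesgue R N).
Local Notation hs := (@hs R N s).
Local Notation tz := (poh_time (f := f)).
Local Notation J := (energy_hs (f := f)).
Local Notation P := (pohozaev (f := f)).
Local Notation grad := (grad A).
Let s01 := adm_s A.
Let N2 := adm_N A.

Implicit Types (u w : hs).

Definition peak u : R := J (hs_dil (tz u) u).

(** Families are total functions on R^(n+1), with the constraints imposed at every point, while
    oddness and continuity concern the sphere alone. Having the mass constraint everywhere spares a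
    side condition along filters. *)
Record odd_family n (g : 'rV[R]_n.+1 -> hs) : Prop := OddFamily {
  family_mass : forall x, bform (g x) (g x) = m;
  family_rot : forall x, rot_invariant (g x);
  family_odd : forall x, l1_sphere n x -> g (- x) = - g x;
  family_cvg : forall x, l1_sphere n x -> hcvg (within (l1_sphere n) (nbhs x)) g (g x) }.

Let tz0 u : bform u u = m -> 0 < tz u.
Proof. by move=> um; have [] := poh_timeP A (u := u); rewrite ?um. Qed.

Let Ptz u : bform u u = m -> P (hs_dil (tz u) u) = 0.
Proof. by move=> um; have [] := poh_timeP A (u := u); rewrite ?um. Qed.

Lemma peak_unbounded (C : R) : exists n, forall g, @odd_family n g ->
  exists2 x, l1_sphere n x & C < peak (g x).
Proof.
have [B B0 hB] := pohozaev_coercive A C m0.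
have [e e0 he] := pohozaev_not_small A B m0.
have Bm : 0 < B + m by exact: addr_gt0.
have [K [eta [eta0 hK]]] := cube_small_measure s01 N2 Bm e0.
(* The [K] cube tests on the sphere of R^(K+1) match the dimension count of Borsuk-Ulam. *)
exists K => g [gm gr go gc]; apply: contrapT => none.
have gC x : l1_sphere K x -> peak (g x) <= C.
  by move=> xS; rewrite leNgt; apply/negP => h; apply: none; exists x.
pose h x (i : 'I_K) := l2 leb (hs_dil (tz (g x)) (g x)) (cube_test (N := N) i).
have hN x : l1_sphere K x -> forall i, h (- x) i = - h x i.
  move=> xS i; rewrite /h go// (poh_timeN A) hs_dilN ?tz0//.
  rewrite -[- hs_dil _ _]scaleN1r hs_funZ l2Zl ?mulN1r//; first exact: hs_L2.
  exact: cube_test_L2.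
have hC x : l1_sphere K x -> forall i, h z i @[z --> within (l1_sphere K) (nbhs x)] --> h x i.
  move=> xS i; apply: (hcvg_cube_test A m0) => //; exact: gc.
have [x xS hx] := borsuk_ulam eta0 hN hC.
set w := hs_dil (tz (g x)) (g x).
have wm : bform w w = m by rewrite bform_dil// tz0.
have wB : aform w w <= B by apply: hB => //; [exact: Ptz|exact: gC].
have := he w wm wB (Ptz (gm x)).
apply/negP; rewrite -leNgt -lee_fin (meas_gtE _ e0); apply: hK.
- by apply: rot_invariant_dil; [exact: tz0|exact: gr].
- by rewrite wm lerD2r.
- by move=> k kK; exact: (hx (Ordinal kK)).
Qed.

Lemma step_family n g dl : @odd_family n g ->
  (forall x, 0 < bform (hs_dil (tz (g x)) (g x) - dl *: grad (hs_dil (tz (g x)) (g x)))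
    (hs_dil (tz (g x)) (g x) - dl *: grad (hs_dil (tz (g x)) (g x)))) ->
  odd_family (fun x => step A m dl (g x)).
Proof.
move=> [gm gr go gc] b0; split => [x|x|x xS|x xS].
- by rewrite /step bform_dil ?invr_gt0 ?tz0// bform_normalize.
- by apply: step_rot_invariant => //; rewrite gm.
- by rewrite go// stepN// gm.
- exact: (@hcvg_step _ _ _ _ A m m0 _ _ (within_filter _ (nbhs_filter x)) dl g (g x) gm (gm x) (gc x xS) (b0 x)).
Qed.

(** The level is the infimum of the upper bounds of [peak] over odd families. If no near critical
    point existed at precision [e], one descent step on an almost optimal family would lower its
    bound below the infimum by a fixed amount. *)
Lemma near_critical n (C : R) : (exists2 g, @odd_family n g & exists D, forall x, peak (g x) <= D) ->
  (forall g, @odd_family n g -> exists2 x, l1_sphere n x & C < peak (g x)) ->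
  exists2 E : R, C <= E & forall e : R, 0 < e -> exists w : hs,
    [/\ bform w w = m, rot_invariant w, P w = 0, `|J w - E| <= e & hn (grad w) <= e].
Proof.
move=> [g0 Gg0 up] low.
pose S := [set D | exists2 g, @odd_family n g & forall x, peak (g x) <= D].
have S0 : S !=set0 by have [D hD] := up; exists D, g0.
have SC D : S D -> C < D.
  by move=> [g Gg hD]; have [x xS h] := low g Gg; exact: lt_le_trans h (hD x).
have iS : has_inf S by split => //; exists C => D /SC/ltW.
exists (inf S); first by apply: lb_le_inf => // D /SC/ltW.
move=> e e0; apply: contrapT => none.
set E := inf S in none *.
have gradb w : bform w w = m -> rot_invariant w -> P w = 0 -> `|J w - E| <= e -> e < hn (grad w).
  by move=> *; rewrite ltNge; apply/negP => ?; apply: none; exists w.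
have [B B0 hB] := pohozaev_coercive A (E + e) m0.
have e2 : 0 < e ^+ 2 / 2 by rewrite divr_gt0 ?exprn_gt0.
have [d1 d10 hd1] := descent_energy A m0 B e2.
have [d2 d20 hd2] := descent_bform_ge A m0 B.
(* The entry [e^-1] keeps the error of the step at most [e / 2] where the energy is already below
   [E - e]. *)
pose dl := Num.min (Num.min d1 d2) (e^-1).
have dl0 : 0 < dl by rewrite !lt_min d10 d20 invr_gt0.
have dl1 : dl <= d1 by rewrite !ge_min lexx.
have dl2 : dl <= d2 by rewrite !ge_min lexx orbT.
have dle : dl * e <= 1 by rewrite -ler_pdivlMr// div1r !ge_min lexx orbT.
pose de := dl * e ^+ 2 / 4.
have de0 : 0 < de by rewrite divr_gt0 ?mulr_gt0 ?exprn_gt0.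
have dee : de <= e.
  by rewrite /de expr2 mulrA; move: dle e0; move: (dl * e) => y; nra.
have close (j : R) : j < E + de -> E - e < j -> `|j - E| <= e.
  by move=> h1 h2; rewrite ler_distlC; apply/andP; split; [rewrite lerBlDr; apply: (le_trans (ltW h1)); rewrite lerD2l|rewrite -lerBlDr ltW].
have [D [g Gg gD] DE] := inf_adherent de0 iS; rewrite -/E in DE.
have DE' : D <= E + e by apply: le_trans (ltW DE) _; rewrite lerD2l.
pose w x := hs_dil (tz (g x)) (g x).
have gm := family_mass Gg.
have wm x : bform (w x) (w x) = m by rewrite bform_dil// tz0.
have Pw x : P (w x) = 0 by exact: Ptz.
have JD0 x : J (w x) <= D by exact: (gD x).
have wB x : aform (w x) (w x) <= B := hB _ (wm x) (Pw x) (le_trans (JD0 x) DE').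
have b0 x : 0 < bform (w x - dl *: grad (w x)) (w x - dl *: grad (w x)) by exact: hd2 dl0 dl2 (wm x) (wB x).
have Gs := step_family Gg b0.
have stepP x : peak (step A m dl (g x)) <= J (w x) - dl * hn (grad (w x)) ^+ 2 + dl * (e ^+ 2 / 2).
  set v := step A m dl (g x); have vm : bform v v = m by exact: (family_mass Gs).
  have t0 := tz0 (gm x); have ti : 0 < (tz (g x))^-1 by rewrite invr_gt0.
  have r0 : 0 < (tz (g x))^-1 * tz v := mulr_gt0 ti (tz0 vm).
  have E1 : hs_dil (tz v) v = hs_dil ((tz (g x))^-1 * tz v) (descent A m dl (w x)).
    by rewrite {2}/v /step (hs_dilM _ (tz0 vm) ti).
  have Pd : P (hs_dil ((tz (g x))^-1 * tz v) (descent A m dl (w x))) = 0 by rewrite -E1; exact: Ptz.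
  by rewrite /peak E1; exact: (hd1 _ _ _ dl0 dl1 (wm x) (wB x) (Pw x) r0 Pd).
have : S (E - Num.min de (e / 2)).
  exists (fun x => step A m dl (g x)); first exact: Gs.
  move=> x; apply: (le_trans (stepP x)).
  apply: (near_critical_arith e0 dl0 dle (hn_ge0 (grad (w x))) (le_lt_trans (JD0 x) DE)) => Jlow.
  have rw : rot_invariant (w x) := rot_invariant_dil (tz0 (gm x)) (family_rot Gg x).
  apply: (gradb _ (wm x) rw (Pw x)); move: (le_lt_trans (JD0 x) DE) Jlow; exact: close.
move/(ge_inf iS.2); rewrite -/E; apply/negP; rewrite -ltNge ltrBlDr ltrDl.
by rewrite lt_min de0 divr_gt0.
Qed.

End minimax.

(** * Palais-Smale sequences *)

Lemma limit_unique (R : realType) (x : nat -> R) (a b : R) : x n @[n --> \oo] --> a ->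
  x n @[n --> \oo] --> b -> a = b.
Proof. by move=> ca cb; rewrite -(cvg_lim (@Rhausdorff R) ca) (cvg_lim (@Rhausdorff R) cb). Qed.

(** Multipliers and all cube integrals converge at once along an ultrafilter, which replaces a
    diagonal extraction. *)
Lemma ultra_bounded_cvg (R : realType) (U : set_system nat) (UU : UltraFilter U) (x : nat -> R) (M : R) :
  (forall n, `|x n| <= M) -> exists l : R, x n @[n --> U] --> l.
Proof.
move=> xM; have UM : (x n @[n --> U]) `[- M, M]%classic.
  apply: (@filterS _ U _ setT); last exact: filterT.
  by move=> n _; have := xM n; rewrite ler_norml /= in_itv.
have [l [_ xl]] := @segment_compact R (- M) M (x n @[n --> U]) _ UM.
exists l; apply/cvgrPdist_le => e e0.
have [//|nA] := in_ultra_setVsetC [set n | `|l - x n| <= e] UU.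
have [y [/= h1 h2]] : [set y | ~ (`|l - y| <= e)] `&` [set y | `|l - y| < e] !=set0.
  apply: xl; first exact: nA.
  by apply/nbhs_ballP; exists e.
by case: h1; exact: ltW.
Qed.

Section palais_smale.
Context {R : realType} {N : nat} {s : R} {f : R -> R} (A : admissible s N f) (m : R) (m0 : 0 < m).
Notation leb := (@Rn_lebesgue R N).
Local Notation hs := (@hs R N s).
Local Notation F := (primitive f).
Local Notation Ft := (Ftilde f).
Local Notation q := (@crit_exp R N s).
Local Notation J := (energy_hs (f := f)).
Local Notation P := (pohozaev (f := f)).
Local Notation grad := (grad A).
Local Notation lam := (multiplier (f := f)).
Local Notation nonlin := (nonlin (f := f)).
Implicit Types (u w v : hs) (B e : R).
Let aP := @aform_psd R N s.
Let bP := @bform_psd R N s.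
Let tP := @tform_psd R N s 1 ler01.
Let s01 := adm_s A.
Let N2 := adm_N A.

Let crit_arith (r n a X Y c : R) : 0 < r -> 0 < n - 2 * r -> r * a = n / 2 * (X - 2 * Y) ->
  c <= 2 * n / (n - 2 * r) * Y - X -> a - X <= - ((n - 2 * r) / (2 * r) * c).
Proof.
move=> r0 n0 E h; have aE : a = n / (2 * r) * (X - 2 * Y).
  apply: (mulfI (lt0r_neq0 r0)); rewrite E; field; exact: lt0r_neq0.
have k0 : 0 < (n - 2 * r) / (2 * r) by rewrite divr_gt0// mulr_gt0.
have : a - X = - ((n - 2 * r) / (2 * r) * (2 * n / (n - 2 * r) * Y - X)).
  by rewrite aE; field; rewrite !gt_eqF.
by move=> ->; rewrite lerN2 ler_pM2l.
Qed.

(** On the Pohozaev set, [aform w w - nonlin w w] equals [- (N - 2s) / (2s)] times the integral of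
    [q * F - f(t) * t]. The integrand is positive by hypothesis, and [pohozaev_positive_part] bounds
    its integral away from 0. *)
Lemma multiplier_negative B : exists2 mu, 0 < mu & forall w, bform w w = m -> aform w w <= B ->
  P w = 0 -> lam w <= - mu.
Proof.
pose z x := q * F x - f x * x.
have cz : continuous z.
  move=> x; apply: cvgB; apply: cvgM.
  - exact: cvg_cst.
  - exact: (subcrit_continuous (adm_F A)).
  - exact: (subcrit_continuous (adm_f A)).
  - exact: cvg_id.
have SF (u : hs) := summableZ q (summable_subcrit s01 N2 u (adm_F A)).
have Sf (u : hs) := summable_nonlin A u u.
have z00 : 0 <= z 0 by rewrite /z primitive0 !mulr0 subrr.
have [c c0 hc] := pohozaev_positive_part A B m0 cz (adm_crit_defect A) z00 (fun u => summableB (SF u) (Sf u)).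
have /andP[s0 s1] := s01.
have n0 : 0 < N%:R - 2 * s.
  have : 2 < N%:R :> R by rewrite ltr_nat.
  by move: s1; lra.
exists ((N%:R - 2 * s) / (2 * s) * c / m).
  by rewrite divr_gt0// mulr_gt0// divr_gt0// mulr_gt0.
move=> w wm wB Pw; rewrite /multiplier wm -mulNr ler_pM2r ?invr_gt0//.
have h := hc w wm wB Pw.
apply: (crit_arith (Y := \int[leb]_x F (w x)) s0 n0).
  have /pohozaev0 -> := Pw; congr (_ * _).
  rewrite nonlinE -(RintZ 2 (summable_subcrit s01 N2 w (adm_F A))).
  by rewrite -(RintB (Sf w) (summableZ 2 (summable_subcrit s01 N2 w (adm_F A)))).
apply: (le_trans h); rewrite nonlinE -(RintZ _ (summable_subcrit s01 N2 w (adm_F A))).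
by rewrite -(RintB (SF w) (Sf w)).
Qed.

Let ar0 (a b c p r C P0 Q : R) : `|c| <= C -> `|p| <= P0 -> `|r| <= Q ->
  a - b + c + (p - r) <= `|a| + `|b| + C + (P0 + Q).
Proof.
have := ler_norm a; have := ler_norm (- b); have := ler_norm c; have := ler_norm p; have := ler_norm (- r).
by rewrite !normrN; lra.
Qed.

(** Subtract the two gradient equations, both tested with [d]. For a negative multiplier the left
    side controls the full norm of [d]. *)
Lemma critical_dist w v d : d = w - v ->
  aform d d - lam w * bform d d <= `|nonlin w d| + `|nonlin v d| +
    `|lam w - lam v| * (hn v * hn d) + (hn (grad w) + hn (grad v)) * hn d.
Proof.
move=> dE; have Ew := gradE A w d; have Ev := gradE A v d.
have E : aform d d - lam w * bform d d = nonlin w d - nonlin v d +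
    (lam w - lam v) * bform v d + (tform 1 (grad w) d - tform 1 (grad v) d).
  rewrite Ew Ev /constrained_diff.
  have -> : aform d d = aform w d - aform v d by rewrite {1}dE (ipBl aP).
  have -> : bform d d = bform w d - bform v d by rewrite {1}dE (ipBl bP).
  by move: (aform w d) (aform v d) (bform w d) (bform v d) (nonlin w d) (nonlin v d) => *; ring.
have cs (x y : hs) : `|tform 1 x y| <= hn x * hn y by exact: ler_ip_nrm tP x y.
rewrite E; have h1 := cs (grad w) d; have h2 := cs (grad v) d.
have h3 : `|(lam w - lam v) * bform v d| <= `|lam w - lam v| * (hn v * hn d).
  by rewrite normrM ler_wpM2l//; exact: ler_bform.
rewrite [(hn _ + hn _) * _]mulrDl; exact: ar0 h3 h1 h2.
Qed.

Let ar1 (b x y : R) : 4 * x <= b -> 4 * y <= b -> 2 * x + 2 * y <= b. Proof. lra. Qed.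
Let ar2 (b : R) : 0 <= b -> b <= (b + 1) ^+ 2. Proof. by rewrite expr2; nra. Qed.
Let ar3 (c y : R) : y <= c / 8 -> c / 8 + y <= c / 4. Proof. lra. Qed.
Let ar4 (c y : R) : y <= c / 8 -> 2 * y <= c / 4. Proof. lra. Qed.
Let ar6 (x y : R) : 0 <= x -> 1 <= y -> (x + x) * y <= 2 * (x * y ^+ 2).
Proof.
move=> x0 y1; have -> : (x + x) * y = 2 * (x * y) by ring.
rewrite ler_pM2l// ler_wpM2l// expr2 ler_peMl//; exact: le_trans y1.
Qed.
Let ar5 (y : R) : 0 <= y -> y / 4 + y / 4 + y / 8 + y / 4 <= y. Proof. lra. Qed.

(** In [critical_dist] the two nonlinear terms are small because [d] is small in measure, by the
    cube tests; the others carry a small gradient or a small difference of multipliers. *)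
Lemma palais_smale_close B mu e : 0 < mu -> 0 < e -> exists (K : nat) (eta : R), 0 < eta /\
  forall w v, bform w w = m -> bform v v = m -> aform w w <= B -> aform v v <= B ->
    rot_invariant w -> rot_invariant v -> lam w <= - mu ->
    hn (grad w) <= eta -> hn (grad v) <= eta -> `|lam w - lam v| <= eta ->
    (forall k, (k < K)%N -> `|l2 leb w (cube_test k) - l2 leb v (cube_test k)| <= eta) ->
    hs_sq (w - v) <= e.
Proof.
move=> mu0 e0; pose B2 := 4 * (`|B| + m).
pose mu1 := Num.min 1 mu; have mu10 : 0 < mu1 by rewrite lt_min ltr01.
have e1 : 0 < mu1 * e / 8 by rewrite divr_gt0// mulr_gt0.
have [dl [C [dl0 C0 hC]]] := superposition_mul_le_cutoff s01 N2 B2 (adm_f A) e1.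
pose e2 := Num.min dl (mu1 * e / (8 * C)).
have e20 : 0 < e2 by rewrite lt_min dl0 divr_gt0// mulr_gt0.
have B20 : 0 < B2 by rewrite mulr_gt0// ltr_wpDl.
have [K [eta0 [eta00 hK]]] := cube_small_measure s01 N2 B20 e20.
pose M := B2 + 1.
have M0 : 0 < M by rewrite ltr_wpDl// ltW.
pose eta := Num.min eta0 (mu1 * e / (8 * M ^+ 2)).
have etap : 0 < eta by rewrite lt_min eta00 divr_gt0 ?mulr_gt0 ?exprn_gt0.
exists K, eta; split=> // w v wm vm wB vB rw rv lw gw gv lwv small.
set d := w - v.
have BB4 u : aform u u <= B -> bform u u = m -> 4 * hs_sq u <= B2.
  by move=> h um; rewrite /hs_sq um /B2 ler_pM2l// lerD2r (le_trans h)// ler_norm.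
have BB u : aform u u <= B -> bform u u = m -> hs_sq u <= B2.
  by move=> h um; apply: (le_trans _ (BB4 u h um)); rewrite ler_peMl ?hs_sq_ge0// ler1n.
have dB : hs_sq d <= B2.
  apply: (le_trans (hs_sqD_le w (- v))).
  have -> : hs_sq (- v) = hs_sq v by rewrite -scaleN1r hs_sqZ sqrrN expr1n mul1r.
  exact: ar1 (BB4 w wB wm) (BB4 v vB vm).
have M1 : 1 <= M by rewrite /M lerDr ltW.
have nB u : hs_sq u <= B2 -> hn u <= M.
  move=> h; rewrite (hn_le _ (ltW M0)); apply: (le_trans h).
  exact: ar2 (ltW B20).
have small' : meas_gt dl d <= mu1 * e / (8 * C).
  apply: (@le_trans _ _ e2); last by rewrite ge_min lexx orbT.
  apply: (@le_trans _ _ (meas_gt e2 d)).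
    apply: (Rint_le (summable_measure_gt d dl0) (summable_measure_gt d e20)) => x.
    have e2d : e2 <= dl by rewrite ge_min lexx.
    by rewrite ler_nat; have [h|//] := ltP dl `|d x|; rewrite (le_lt_trans e2d h).
  rewrite -lee_fin (meas_gtE _ e20); apply: hK => [||k kK].
  - exact: rot_invariantB.
  - exact: dB.
  have -> : l2 leb d (cube_test k) = l2 leb w (cube_test k) - l2 leb v (cube_test k).
    have Lk := cube_test_L2 (R := R) (N := N) k.
    rewrite /d -[- v]scaleN1r hs_funD l2Dl; [|exact: hs_L2|exact: hs_L2|exact: Lk].
    by rewrite hs_funZ (l2Zl _ (hs_L2 v) Lk) mulN1r.
  by apply: (le_trans (small k kK)); rewrite ge_min lexx.
have nl u : hs_sq u <= B2 -> `|nonlin u d| <= mu1 * e / 4.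
  move=> uB; rewrite nonlinE; apply: (le_trans (hC u d uB dB)).
  have h : C * meas_gt dl d <= mu1 * e / 8.
    apply: (@le_trans _ _ (C * (mu1 * e / (8 * C)))); first by rewrite ler_pM2l.
    by rewrite le_eqVlt; apply/orP; left; apply/eqP; field; exact: lt0r_neq0.
  exact: ar3 h.
have etaM : eta * M ^+ 2 <= mu1 * e / 8.
  apply: (@le_trans _ _ (mu1 * e / (8 * M ^+ 2) * M ^+ 2)).
    by rewrite ler_pM2r ?exprn_gt0// ge_min lexx orbT.
  by rewrite le_eqVlt; apply/orP; left; apply/eqP; field; exact: lt0r_neq0.
have h1 := nl w (BB w wB wm); have h2 := nl v (BB v vB vm).
have h3 : `|lam w - lam v| * (hn v * hn d) <= mu1 * e / 8.
  apply: (le_trans _ etaM); rewrite expr2.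
  apply: (ler_pM (normr_ge0 _) (mulr_ge0 (hn_ge0 v) (hn_ge0 d)) lwv).
  exact: ler_pM (hn_ge0 v) (hn_ge0 d) (nB v (BB v vB vm)) (nB d dB).
have h4 : (hn (grad w) + hn (grad v)) * hn d <= mu1 * e / 4.
  apply: (@le_trans _ _ ((eta + eta) * M)).
    exact: ler_pM (addr_ge0 (hn_ge0 _) (hn_ge0 _)) (hn_ge0 d) (lerD gw gv) (nB d dB).
  apply: (@le_trans _ _ (2 * (eta * M ^+ 2))); last exact: ar4 etaM.
  exact: ar6 (ltW etap) M1.
have h5 := critical_dist (erefl d).
have a0 : 0 <= aform d d := ip_ge0 aP d.
have b0 : 0 <= bform d d := ip_ge0 bP d.
have h6 : mu1 * hs_sq d <= aform d d - lam w * bform d d.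
  rewrite /hs_sq mulrDr; apply: lerD; first by rewrite -[leRHS]mul1r ler_wpM2r// ge_min lexx.
  rewrite -mulNr ler_wpM2r//; apply: (@le_trans _ _ mu); first by rewrite ge_min lexx orbT.
  by rewrite lerNr.
rewrite -(ler_pM2l mu10); apply: (le_trans h6); apply: (le_trans h5).
have me0 : 0 <= mu1 * e by rewrite mulr_ge0 ?ltW.
apply: (le_trans (lerD (lerD (lerD h1 h2) h3) h4)).
exact: ar5 me0.
Qed.

Lemma hcvg_energy (ui : nat -> hs) u : hcvg \oo ui u -> J (ui n) @[n --> \oo] --> J u.
Proof.
move=> cu; have one_cvg : (fun=> 1 : R) n @[n --> \oo] --> (1 : R) by exact: cvg_cst.
have cF : \int[leb]_x F ((1 *: ui n) x) @[n --> \oo] --> \int[leb]_x F (u x).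
  exact: (@hcvg_superposition _ _ _ s01 N2 _ _ _ _ _ _ _ (adm_F A) one_cvg cu).
have E n : \int[leb]_x F ((1 *: ui n) x) = \int[leb]_x F (ui n x) by rewrite scale1r.
rewrite (funext E) in cF.
rewrite (funext (fun n => energy_hsE (f := f) (ui n))) energy_hsE.
have ca : aform (ui n) (ui n) @[n --> \oo] --> aform u u by exact: hcvg_aform.
have c2 : aform (ui n) (ui n) / 2 @[n --> \oo] --> aform u u / 2.
  by apply: cvgM; [exact: ca|exact: cvg_cst].
by apply: cvgB; [exact: c2|exact: cF].
Qed.

Lemma palais_smale (E : R) :
  (forall e, 0 < e -> exists w : hs,
    [/\ bform w w = m, rot_invariant w, P w = 0, `|J w - E| <= e & hn (grad w) <= e]) ->
  exists u : hs, [/\ bform u u = m, rot_invariant u, J u = E &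
    forall phi, aform u phi = nonlin u phi + lam u * bform u phi].
Proof.
move=> near_crit.
have [w hw] := choice (fun n => near_crit (n.+1%:R^-1) (ltac:(by rewrite invr_gt0))).
have wm n : bform (w n) (w n) = m by have [] := hw n.
have wr n : rot_invariant (w n) by have [] := hw n.
have Pw n : P (w n) = 0 by have [] := hw n.
have gw n : hn (grad (w n)) <= n.+1%:R^-1 by have [] := hw n.
have [B B0 hB] := pohozaev_coercive A (E + 1) m0.
have wB n : aform (w n) (w n) <= B.
  apply: (hB _ (wm n) (Pw n)); have [_ _ _ Je _] := hw n.
  rewrite -lerBlDl; apply: (le_trans (ler_norm _)); apply: (le_trans Je).
  by rewrite invf_le1 ?ltr0n// ler1n.
have [mu mu0 hmu] := multiplier_negative B.
have [L L0 hL] := multiplier_bound A B m0.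
have [U [UU Uoo]] := @ultraFilterLemma nat \oo _.
have Ucvg (x : nat -> R) (M : R) (xM : forall n, `|x n| <= M) := @ultra_bounded_cvg R U UU x M xM.
have close e : 0 < e -> exists2 V, U V & forall i j, V i -> V j -> hs_sq (w i - w j) <= e.
  move=> e0; have [K [eta [eta0 hK]]] := palais_smale_close B mu0 e0.
  have eta2 : 0 < eta / 2 by rewrite divr_gt0.
  have nearl (x : nat -> R) M : (forall n, `|x n| <= M) -> exists l : R, \forall n \near U, `|l - x n| <= eta / 2.
    by move=> /Ucvg[l /cvgrPdist_le/(_ _ eta2)]; exists l.
  have [l hl] := nearl (fun n => lam (w n)) L (fun n => hL _ (wm n) (wB n)).
  have tests k : exists l : R, \forall n \near U, `|l - l2 leb (w n) (cube_test k)| <= eta / 2.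
    apply: (nearl _ (Num.sqrt (m * l2 leb (cube_test (N := N) k) (cube_test k)))) => n.
    rewrite -(sqrtr_sqr (l2 leb (w n) _)) ler_wsqrtr//.
    rewrite -{1}(wm n); exact: l2_cauchy_schwarz (hs_L2 _) (cube_test_L2 _).
  have [lk hlk] := choice tests.
  have gsmall : \forall n \near U, n.+1%:R^-1 <= eta.
    by apply: Uoo; near=> n; apply: ltW; near: n; exact: (near_infty_natSinv_lt (PosNum eta0)).
  have Vk : \forall n \near U, forall k : 'I_K, `|lk k - l2 leb (w n) (cube_test k)| <= eta / 2.
    by apply: filter_forall => k.
  exists [set n | [/\ `|l - lam (w n)| <= eta / 2, n.+1%:R^-1 <= eta &
     forall k : 'I_K, `|lk k - l2 leb (w n) (cube_test k)| <= eta / 2]].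
    by apply: filterS3 hl gsmall Vk => n *; split.
  have half (a x y : R) : `|a - x| <= eta / 2 -> `|a - y| <= eta / 2 -> `|x - y| <= eta.
    by rewrite (distrC a x) => h1 h2; apply: (le_trans (ler_distD a _ _)); rewrite [eta]splitr lerD.
  move=> i j [li gi ki] [lj gj kj]; apply: hK => //.
  - exact: hmu.
  - exact: le_trans (gw i) gi.
  - exact: le_trans (gw j) gj.
  - exact: half li lj.
  - by move=> k kK; exact: half (ki (Ordinal kK)) (kj (Ordinal kK)).
have [V hV] : exists V : nat -> set nat, forall n, U (V n) /\
    forall i j, V n i -> V n j -> hs_sq (w i - w j) <= n.+1%:R^-1.
  have ex n : exists V : set nat, U V /\ forall i j, V i -> V j -> hs_sq (w i - w j) <= n.+1%:R^-1.
    by have [|V UV hV] := close n.+1%:R^-1; [rewrite invr_gt0|exists V].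
  by have [V hV] := choice ex; exists V.
(* Indices from decreasing intersections of ultrafilter sets; [n <= k n] keeps the precision of the
   near critical sequence. *)
have [k hk] : exists k : nat -> nat, forall n, (n <= k n)%N /\ forall i, (i <= n)%N -> V i (k n).
  suff ex n : exists k, (n <= k)%N /\ forall i, (i <= n)%N -> V i k by have [k hk] := choice ex; exists k.
  apply: (@filter_ex _ U).
  have h1 : \forall k \near U, (n <= k)%N by apply: Uoo; exists n.
  have h2 : \forall k \near U, forall i : 'I_n.+1, V i k by apply: filter_forall => i; have [] := hV i.
  by apply: filterS2 h1 h2 => k h1 h2; split=> // i ni; exact: (h2 (Ordinal (ltnSE ni : (i < n.+1)%N))).
have sqE x y : sq_dist (tform 1) (w x) (w y) = hs_sq (w x - w y) by rewrite /sq_dist /tform mul1r.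
have cauchy e : 0 < e -> exists n0, forall i j, (n0 <= i)%N -> (n0 <= j)%N -> sq_dist (tform 1) (w (k i)) (w (k j)) <= e.
  move=> e0; have [n0 _ hn0] := near_infty_natSinv_lt (PosNum e0).
  exists n0 => i j ni nj; rewrite sqE; apply: (@le_trans _ _ n0.+1%:R^-1); last exact: ltW (hn0 n0 (leqnn _)).
  by apply: (hV n0).2; [exact: (hk i).2|exact: (hk j).2].
have [u hu] := tform_complete ltr01 cauchy.
have cu : hcvg \oo (fun n => w (k n)) u.
  apply/cvgr0Pnorm_le => e e0; have [|n0 h0] := hu (e ^+ 2); first by rewrite exprn_gt0.
  exists n0 => // n /= n0n; rewrite ger0_norm ?hn_ge0// (hn_le _ (ltW e0)).
  by have := h0 n n0n; rewrite /sq_dist /tform mul1r.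
have um : bform u u = m.
  have c : bform (w (k n)) (w (k n)) @[n --> \oo] --> bform u u by exact: hcvg_bform.
  rewrite (funext (fun n => wm (k n))) in c.
  exact: (limit_unique c (cvg_cst m)).
have small0 (x : nat -> R) : (forall n, `|x n| <= (k n).+1%:R^-1) -> x n @[n --> \oo] --> (0 : R).
  move=> hx; apply/cvgr0Pnorm_le => e e0; near=> n; apply: (le_trans (hx n)).
  apply: (@le_trans _ _ n.+1%:R^-1); first by rewrite lef_pV2 ?posrE ?ltr0n// ler_nat ltnS (hk n).1.
  by apply: ltW; near: n; exact: (near_infty_natSinv_lt (PosNum e0)).
have one_cvg : (fun=> 1 : R) n @[n --> \oo] --> (1 : R) by exact: cvg_cst.
exists u; split=> //.
- apply: rot_invariant_limit (fun n => wr (k n)) _ => e e0; have [n0 h0] := hu e e0.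
  exists n0; apply: (le_trans _ (h0 n0 (leqnn _))); rewrite /sq_dist /tform mul1r lerDr.
  exact: (ip_ge0 aP).
- have cJ : J (w (k n)) @[n --> \oo] --> J u by exact: hcvg_energy.
  apply/eqP; rewrite -subr_eq0; apply/eqP.
  apply: (limit_unique (cvgB cJ (cvg_cst E))); apply: small0 => n.
  by have [] := hw (k n).
- move=> phi.
  (* Continuity of the gradient itself, obtained from [hcvg_grad] with all dilation factors equal to
     1. *)
  have cg : hcvg \oo (fun n => hs_dil 1^-1 (grad (hs_dil 1 (w (k n))))) (grad u).
    exact: (@hcvg_grad _ _ _ _ A _ _ _ m _ _ _ m0 (fun n => wm (k n)) um cu (fun=> ltr01) one_cvg).
  have g0 : hn (grad u) = 0.
    apply: (limit_unique (hcvg_hn cg : _ --> hn (grad u))); apply: small0 => n.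
    by rewrite invr1 !hs_dil1 ger0_norm ?hn_ge0.
  have := ler_ip_nrm tP (grad u) phi; rewrite -/(hn (grad u)) g0 mul0r normr_le0 gradE /constrained_diff.
  by rewrite subr_eq0 => /eqP <-; rewrite addrC subrK.
Unshelve. all: by end_near. Qed.

End palais_smale.

(** * Radial representatives *)

#[local] Transparent Rintegral.

Lemma measurable_Rintegral_snd (R : realType) (N : nat) (h : Rn R N * Rn R N -> R) : measurable_fun setT h ->
  measurable_fun setT (fun x => \int[@Rn_lebesgue R N]_y h (x, y)).
Proof.
move=> mh; have mE : measurable_fun setT (EFin \o h) by exact/measurable_EFinP.
rewrite /Rintegral; apply: (measurableT_comp (@fine_measurable R setT measurableT)) => //.
pose Gp x := (\int[@Rn_lebesgue R N]_y (EFin \o h)^\+ (x, y))%E.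
pose Gn x := (\int[@Rn_lebesgue R N]_y (EFin \o h)^\- (x, y))%E.
rewrite (_ : (fun x => _) = (fun x => Gp x - Gn x)%E); last first.
  apply/funext => x; rewrite integralE; congr (_ - _)%E; apply: eq_integral => y _.
    by rewrite !funeposE.
  by rewrite !funenegE.
apply: emeasurable_funB.
  apply: (measurable_fun_fubini_tonelli_F (m2 := @Rn_lebesgue R N)); first exact: measurable_funepos.
  by move=> z; rewrite funeposE le_max lexx orbT.
apply: (measurable_fun_fubini_tonelli_F (m2 := @Rn_lebesgue R N)); first exact: measurable_funeneg.
by move=> z; rewrite funenegE le_max lexx orbT.
Qed.

Lemma ae_eq_Rintegral (R : realType) (N : nat) (g h : Rn R N -> R) : measurable_fun setT g ->
  measurable_fun setT h -> {ae @Rn_lebesgue R N, forall x, g x = h x} ->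
  \int[@Rn_lebesgue R N]_x g x = \int[@Rn_lebesgue R N]_x h x.
Proof.
move=> mg mh gh; rewrite /Rintegral; congr fine; apply: ae_eq_integral => //.
- exact/measurable_EFinP.
- exact/measurable_EFinP.
- by move: gh; apply: filterS => x -> _.
Qed.

#[local] Opaque Rintegral.

Section plane_rotation_transitivity.
Context {R : realType} {N : nat} (T : Type) (F : Rn R N -> T).
Hypothesis N2 : (2 < N)%N.
Hypothesis Frot : forall (i j : 'I_N) (c t : R) x, i != j -> c ^+ 2 + t ^+ 2 = 1 -> -1 < c ->
  F (rot i j c t x) = F x.

(** Rotations in the planes through the first axis clear the other coordinates one by one, leaving
    the norm on that axis up to sign. *)
Lemma rotations_transitive x y : enorm x = enorm y -> F x = F y.
Proof.
have N0 : (0 < N)%N by exact: leq_trans N2.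
pose o : 'I_N := Ordinal N0.
pose axis (a : R) : Rn R N := [tuple (if k == o then a else 0) | k < N].
have nx (z : Rn R N) : (forall k, k != o -> tnth z k = 0) -> z = axis (tnth z o).
  by move=> h; apply: eq_from_tnth => k; rewrite tnth_mktuple; case: eqP => [->|/eqP/h].
have clear_coord k z : exists z' : Rn R N, [/\ F z' = F z, enorm z' = enorm z & forall j : 'I_N, (j < k)%N -> j != o -> tnth z' j = 0].
  elim: k => [|k [z' [Fz ez hz]]]; first by exists z; split.
  have [kN|kN] := ltnP k N; last by exists z'; split => // j jk; apply: hz; exact: leq_trans (ltn_ord j) kN.
  pose j := Ordinal kN; have [zj0|zj0] := eqVneq (tnth z' j) 0.
    exists z'; split => // i; rewrite ltnS leq_eqVlt => /orP[/eqP ij _|]; last exact: hz.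
    by rewrite (_ : i = j)//; exact: val_inj.
  have [jo|jo] := eqVneq j o.
    exists z'; split => // i; rewrite ltnS leq_eqVlt => /orP[/eqP ij|]; last exact: hz.
    by rewrite -jo (_ : i = j) ?eqxx//; exact: val_inj.
  set a := tnth z' o; set b := tnth z' j in zj0; pose r := Num.sqrt (a ^+ 2 + b ^+ 2).
  have b2 : 0 < b ^+ 2 by rewrite lt_def sqr_ge0 sqrf_eq0 zj0.
  have r2 : r ^+ 2 = a ^+ 2 + b ^+ 2 by rewrite sqr_sqrtr// addr_ge0 ?sqr_ge0.
  have r0 : 0 < r by rewrite sqrtr_gt0 ltr_wpDl ?sqr_ge0.
  have ct : (a / r) ^+ 2 + (- (b / r)) ^+ 2 = 1.
    by rewrite sqrrN !expr_div_n -mulrDl -r2 mulfV// expf_neq0// gt_eqF.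
  have c1 : -1 < a / r by rewrite ltr_pdivlMr// mulN1r; nra.
  have oj : o != j by rewrite eq_sym.
  exists (rot o j (a / r) (- (b / r)) z'); split.
  - by rewrite Frot.
  - by rewrite enorm_rot.
  move=> i; rewrite ltnS leq_eqVlt tnth_rot -/a -/b => /orP[/eqP ij|ik] io.
    have -> : i = j by exact: val_inj.
    by rewrite eqxx; field; rewrite gt_eqF.
  have ijf : (i == j) = false by apply/negP => /eqP ij; rewrite ij /= ltnn in ik.
  by rewrite ijf (negPf io) hz.
(* The half turn, excluded by [-1 < c], is composed of two quarter turns. *)
have half_turn (a : R) : F (axis (- a)) = F (axis a).
  pose j : 'I_N := Ordinal (ltnW N2); have oj : o != j by [].
  have c2 : (0 : R) ^+ 2 + 1 ^+ 2 = 1 by rewrite expr0n expr1n add0r.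
  have c1 : -1 < (0 : R) by rewrite oppr_lt0.
  rewrite -(Frot (axis a) oj c2 c1) -[RHS](Frot _ oj c2 c1); congr F.
  apply: eq_from_tnth => k; rewrite !tnth_rot !tnth_mktuple eqxx !mul0r !mul1r.
  by case: (eqVneq k j) => [->|kj] /=; rewrite ?addr0 ?subr0 ?sub0r//; case: (eqVneq k o).
have canon z : F z = F (axis (enorm z)).
  have [z' [<- <- hz]] := clear_coord N z.
  have E := nx z' (fun k => hz k (ltn_ord k)); rewrite E.
  have -> : enorm (axis (tnth z' o)) = `|tnth z' o|.
    rewrite /enorm (bigD1 o)//= big1 => [|k ko]; last by rewrite tnth_mktuple (negPf ko) expr0n.
    by rewrite tnth_mktuple eqxx addr0 sqrtr_sqr.
  by have [h|h] := leP 0 (tnth z' o); [rewrite ger0_norm|rewrite ltr0_norm// half_turn].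
by move=> xy; rewrite canon [RHS]canon xy.
Qed.

End plane_rotation_transitivity.

Section ball_averages.
Context {R : realType} {N : nat} {s : R}.
Hypotheses (s0 : 0 < s) (N2 : (2 < N)%N).
Notation leb := (@Rn_lebesgue R N).
Local Notation hs := (@hs R N s).
Local Notation p := (N%:R + 2 * s).
Implicit Types (u : hs) (x y : Rn R N) (r : R).

Definition ball_ind r x y : R := (edist x y < r)%R%:R.
Definition ball_vol r x : R := l2 leb (ball_ind r x) (ball_ind r x).
(** Balls rather than cubes: a rotation carries balls to balls, so the averages of an almost
    everywhere invariant function are invariant at every point. *)
Definition ball_avg r (u : Rn R N -> R) x : R := (ball_vol r x)^-1 * l2 leb u (ball_ind r x).

Let N0 : 0 < N%:R :> R. Proof. by rewrite ltr0n (leq_trans _ N2). Qed.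

Lemma ball_ind_sq r x y : ball_ind r x y * ball_ind r x y = ball_ind r x y.
Proof. by rewrite /ball_ind; case: (_ < _); rewrite ?mulr0 ?mulr1. Qed.

Lemma ball_ind_ge0 r x y : 0 <= ball_ind r x y.
Proof. by rewrite /ball_ind ler0n. Qed.

Lemma measurable_ball_ind2 r : measurable_fun setT (fun z : Rn R N * Rn R N => ball_ind r z.1 z.2).
Proof.
rewrite (_ : (fun z => _) = \1_((fun z : Rn R N * Rn R N => edist z.1 z.2) @^-1` `]-oo, r[%classic)).
  apply: measurable_indic; rewrite -[X in measurable X]setTI; exact: measurable_edist.
apply/funext => z; rewrite indicE /ball_ind; congr (_%:R); congr nat_of_bool.
by apply/idP/idP => [h|/set_mem]; [apply/mem_set|]; rewrite /= in_itv/=.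
Qed.

Lemma measurable_ball_ind r x : measurable_fun setT (ball_ind r x).
Proof. exact: (measurableT_comp (measurable_ball_ind2 r) (measurable_pair1 x)). Qed.

Lemma box_measure (a : Rn R N) (h : R) : 0 < h ->
  leb [set y | forall i, `[tnth a i - h, tnth a i + h]%classic (tnth y i)] = ((2 * h) ^+ N)%:E.
Proof.
move=> h0; have := @Rn_lebesgue_box R N (fun i => `[tnth a i - h, tnth a i + h]%classic) (fun=> measurable_itv _).
move=> /= ->; rewrite -[N in RHS]card_ord -prodr_const -prodEFin; apply: eq_bigr => i _.
rewrite lebesgue_measure_itv/= lte_fin ltrBlDr -addrA ltrDl addr_gt0//.
by rewrite -EFinB; congr EFin; ring.
Qed.

Lemma box_measurable (a : Rn R N) (h : R) :
  measurable [set y : Rn R N | forall i, `[tnth a i - h, tnth a i + h]%classic (tnth y i)].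
Proof.
by apply: (measurable_coordinates (A := fun i => `[tnth a i - h, tnth a i + h]%classic)) => i; exact: measurable_itv.
Qed.

Lemma integral_box (a : Rn R N) (h : R) : 0 < h ->
  (\int[leb]_y (\1_[set y : Rn R N | forall i, `[tnth a i - h, tnth a i + h]%classic (tnth y i)] y)%:E = ((2 * h) ^+ N)%:E)%E.
Proof.
move=> h0; have mb := @box_measurable a h; rewrite integral_indic// setIT.
exact: box_measure.
Qed.

Lemma ball_ind_L2 r x : 0 < r -> L2 leb (ball_ind r x).
Proof.
move=> r0; split; first exact: measurable_ball_ind.
under eq_integral do rewrite expr2 ball_ind_sq.
apply: (@le_lt_trans _ _ ((2 * r) ^+ N)%:E); last exact: ltry.
rewrite -(integral_box x r0); apply: ge0_le_integral => //.
- by move=> y _; rewrite lee_fin ball_ind_ge0.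
- by apply/measurable_EFinP; exact: measurable_ball_ind.
- by apply/measurable_EFinP; apply: measurable_indic; exact: box_measurable.
move=> y _; rewrite lee_fin /ball_ind indicE ler_nat.
case: (ltP (edist x y) r) => //= xy; rewrite mem_set// => i.
have := le_trans (ler_edist_coord x y i) (ltW xy).
by rewrite /= in_itv /= ler_norml; lra.
Qed.

Lemma ball_vol_ge r x : 0 < r -> (r / N%:R) ^+ N <= ball_vol r x.
Proof.
move=> r0; have h0 : 0 < r / (2 * N%:R) by rewrite divr_gt0 ?mulr_gt0.
rewrite -lee_fin l2_sqE; last exact: ball_ind_L2.
have -> : r / N%:R = 2 * (r / (2 * N%:R)) by field; rewrite gt_eqF.
rewrite -(integral_box x h0); apply: ge0_le_integral => //.
- by apply/measurable_EFinP; apply: measurable_indic; exact: box_measurable.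
- by apply: measurable_EFin_sq; exact: measurable_ball_ind.
move=> y _; rewrite lee_fin expr2 ball_ind_sq indicE ler_nat /ball_ind.
have [|//] := boolP (y \in _); rewrite inE /= => yx.
suff -> : edist x y < r by [].
apply: (@le_lt_trans _ _ (N%:R * (r / (2 * N%:R)))).
  apply: edist_le_coord => [|i]; first exact: ltW.
  by have := yx i; rewrite in_itv /= ler_norml; lra.
have -> : N%:R * (r / (2 * N%:R)) = r / 2 by field; rewrite gt_eqF.
by rewrite ltr_pdivrMr// ltr_pMr// ltr1n.
Qed.

Lemma measurable_ball_avg r (u : Rn R N -> R) : 0 < r -> L2 leb u -> measurable_fun setT (ball_avg r u).
Proof.
move=> r0 Lu.
have mk := measurable_ball_ind2 r.
have m2 : measurable_fun setT (fun z : Rn R N * Rn R N => u z.2) by exact: measurableT_comp Lu.1 _.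
apply: measurable_funM; last first.
  exact: (measurable_Rintegral_snd (h := fun z => u z.2 * ball_ind r z.1 z.2) (measurable_funM m2 mk)).
rewrite (_ : (fun x => _) = (fun x => ball_vol r x `^ (-1))); last first.
  by apply/funext => x; rewrite powR_inv1// l2_ge0.
apply: (measurableT_comp (measurable_powR _)).
exact: (measurable_Rintegral_snd (h := fun z => ball_ind r z.1 z.2 * ball_ind r z.1 z.2) (measurable_funM mk mk)).
Qed.

Lemma ball_avg_dev r u x : 0 < r -> (((u x - ball_avg r u x) ^+ 2)%:E <=
  ((r / N%:R) ^- N)%:E * \int[leb]_y ((u x - u y) ^+ 2 * ball_ind r x y)%:E)%E.
Proof.
move=> r0; set c := u x; set k := ball_ind r x; set V := ball_vol r x.
have Lk : L2 leb k by exact: ball_ind_L2.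
have Lu := hs_L2 u.
have V1 : (r / N%:R) ^+ N <= V by exact: ball_vol_ge.
have V00 : 0 < (r / N%:R) ^+ N by rewrite exprn_gt0// divr_gt0.
have V0 : 0 < V := lt_le_trans V00 V1.
have Luk : L2 leb (fun y => u y * k y).
  apply: L2_le (L2_sq_integrable Lu); first by apply: measurable_funM; [exact: Lu.1|exact: measurable_ball_ind].
  by move=> y /=; rewrite /k /ball_ind; case: (_ < _); rewrite ?mulr1// mulr0 expr0n sqr_ge0.
pose w : Rn R N -> R := c *: k - (fun y => u y * k y).
have Lw : L2 leb w by apply: L2B => //; exact: L2Z.
have wE y : w y = (c - u y) * k y by rewrite mulrBl.
have wk : l2 leb w k = V * (c - ball_avg r u x).
  have -> : l2 leb w k = c * V - l2 leb u k.
    rewrite /w -[- (fun y => _)]scaleN1r l2Dl ?l2Zl ?mulN1r//; [|exact: L2Z|exact: L2Z].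
    congr (_ - _); apply: eq_Rintegral => y _; rewrite -mulrA; congr (_ * _); exact: ball_ind_sq.
  rewrite /ball_avg mulrBr mulrA mulfV ?mul1r ?gt_eqF//; ring.
have h : (c - ball_avg r u x) ^+ 2 <= V^-1 * l2 leb w w.
  have := l2_cauchy_schwarz Lw Lk; rewrite wk exprMn -/V => hh.
  rewrite [leRHS]mulrC ler_pdivlMr// -(ler_pM2r V0).
  by rewrite (_ : _ * V * V = V ^+ 2 * (c - ball_avg r u x) ^+ 2)//; ring.
apply: (@le_trans _ _ ((r / N%:R) ^- N * l2 leb w w)%:E).
  rewrite lee_fin; apply: le_trans h _; rewrite ler_wpM2r ?l2_ge0// lef_pV2 ?posrE//.
rewrite EFinM l2_sqE// lee_wpmul2l ?lee_fin ?invr_ge0 ?(ltW V00)//.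
rewrite le_eqVlt; apply/orP; left; apply/eqP; apply: eq_integral => y _.
by rewrite wE exprMn; congr (EFin (_ * _)); rewrite expr2 ball_ind_sq.
Qed.

(** Within distance [r] the kernel is at least [r^-(N+2s)], and the volume of the ball is at least
    of order [r^N]; what remains is of order [r^(2s)]. *)
Lemma ball_avg_L2_dist r u : 0 < r -> (\int[leb]_x ((u x - ball_avg r u x) ^+ 2)%:E <=
  ((r / N%:R) ^- N * r `^ p * aform u u)%:E)%E.
Proof.
move=> r0; have V0 : 0 <= (r / N%:R) ^- N by rewrite invr_ge0 exprn_ge0// divr_ge0// ltW.
pose h (z : Rn R N * Rn R N) := ((u z.1 - u z.2) ^+ 2 * ball_ind r z.1 z.2)%:E.
have mu := hs_measurable u.
have md : measurable_fun setT (fun z : Rn R N * Rn R N => (u z.1 - u z.2) ^+ 2).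
  by apply: measurable_funX; apply: measurable_funB; exact: measurableT_comp.
have mh : measurable_fun setT h.
  by apply/measurable_EFinP; apply: measurable_funM => //; exact: measurable_ball_ind2.
have h0 z : (0 <= h z)%E by rewrite lee_fin mulr_ge0 ?sqr_ge0 ?ball_ind_ge0.
apply: (@le_trans _ _ (((r / N%:R) ^- N)%:E * \int[(leb \x leb)%E]_z h z)%E).
  rewrite (fubini_tonelli1 _ mh h0) -(ge0_integralZl leb measurableT); last 3 first.
  - exact: (measurable_fun_fubini_tonelli_F (m2 := leb) _ mh h0).
  - by move=> x _; exact: integral_ge0.
  - by rewrite lee_fin.
  apply: ge0_le_integral => //.
  - by move=> x _; rewrite lee_fin sqr_ge0.
  - apply/measurable_EFinP; apply: measurable_funX; apply: measurable_funB => //.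
    by apply: measurable_ball_avg => //; exact: hs_L2.
  - by apply: emeasurable_funM => //; exact: (measurable_fun_fubini_tonelli_F (m2 := leb) _ mh h0).
  - by move=> x _; exact: ball_avg_dev.
rewrite -mulrA EFinM lee_wpmul2l ?lee_fin// EFinM aform_sqE -(ge0_integralZl (leb \x leb)%E measurableT); last 3 first.
- exact: measurable_EFin_sq (measurable_diffq s mu).
- by move=> z _; rewrite lee_fin sqr_ge0.
- by rewrite lee_fin powR_ge0.
apply: ge0_le_integral => //.
- by apply: emeasurable_funM => //; exact: measurable_EFin_sq (measurable_diffq s mu).
move=> z _; rewrite -EFinM lee_fin.
rewrite /ball_ind; case: (ltP (edist z.1 z.2) r) => [zr|_]; last first.
  by rewrite mulr0 mulr_ge0 ?powR_ge0 ?sqr_ge0.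
rewrite mulr1; have d0 := edist_ge0 z.1 z.2.
have [dE|dE] := eqVneq (edist z.1 z.2) 0.
  have -> : z.1 = z.2.
    apply: eq_from_tnth => i; have := ler_edist_coord z.1 z.2 i.
    by rewrite dE normr_le0 subr_eq0 => /eqP.
  by rewrite subrr expr0n mulr_ge0 ?powR_ge0 ?sqr_ge0.
have dp : 0 < edist z.1 z.2 by rewrite lt_def dE.
rewrite diffq_sq /= real_normK ?num_real// mulrCA ler_peMr ?sqr_ge0//.
rewrite /gag_kernel ler_pdivlMr ?powR_gt0// mul1r.
by apply: ge0_ler_powR; rewrite ?nnegrE ?(ltW r0) ?(ltW zr)// addr_ge0 ?mulr_ge0 ?(ltW s0) ?(ltW N0).
Qed.

Lemma ball_avg_isometry r u g : 0 < r -> isometry g -> {ae leb, forall x, u (g x) = u x} ->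
  forall x, ball_avg r u (g x) = ball_avg r u x.
Proof.
move=> r0 gP ug x; have gs := isometry_scales gP.
have kg y : ball_ind r (g x) (g y) = ball_ind r x y by rewrite /ball_ind (isometry_edist gP).
have Lk := ball_ind_L2 (g x) r0; have Lk' := ball_ind_L2 x r0.
have I1 := scales_Rintegral gs (L2_mul_integrable Lk Lk); rewrite mul1r in I1.
have I2 := scales_Rintegral gs (L2_mul_integrable (hs_L2 u) Lk); rewrite mul1r in I2.
rewrite /ball_avg /ball_vol /l2 -I1 -I2; congr (_^-1 * _).
  by apply: eq_Rintegral => y _; rewrite !kg.
apply: ae_eq_Rintegral.
- apply: measurable_funM; first exact: measurableT_comp (hs_measurable u) (isometry_measurable gP).
  exact: measurableT_comp (measurable_ball_ind r (g x)) (isometry_measurable gP).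
- by apply: measurable_funM; [exact: hs_measurable|exact: measurable_ball_ind].
by move: ug; apply: filterS => y ->; rewrite kg.
Qed.

Lemma ball_avg_cvg u : exists phi : nat -> nat,
  {ae leb, forall x, ball_avg (phi k).+1%:R^-1 u x @[k --> \oo] --> u x}.
Proof.
pose r (n : nat) : R := n.+1%:R^-1; have r0 n : 0 < r n by rewrite invr_gt0.
have mA n := measurable_ball_avg (r0 n) (hs_L2 u).
have mu := hs_measurable u.
pose D n := ((r n / N%:R) ^- N * r n `^ p * aform u u).
have D0 e : 0 < e -> exists n0, forall n, (n0 <= n)%N -> D n <= e.
  move=> e0; pose K := N%:R ^+ N * aform u u + 1.
  have K0 : 0 < K by rewrite ltr_wpDl// mulr_ge0 ?exprn_ge0 ?(ltW N0)// (ip_ge0 (@aform_psd R N s)).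
  pose d := (e / K) `^ (2 * s)^-1; have d0 : 0 < d by apply: powR_gt0; exact: divr_gt0.
  have [n0 _ hn0] := near_infty_natSinv_lt (PosNum d0).
  exists n0 => n n0n; have rd : r n <= d by apply: ltW; exact: hn0.
  have s20 : 0 < 2 * s by rewrite mulr_gt0.
  have rs : r n `^ (2 * s) <= e / K.
    apply: (@le_trans _ _ (d `^ (2 * s))).
      by apply: ge0_ler_powR => //; rewrite ?nnegrE ltW.
    by rewrite /d -powRrM mulVf ?gt_eqF// powRr1// ltW// divr_gt0.
  have DE : D n = r n `^ (2 * s) * (N%:R ^+ N * aform u u).
    rewrite /D powR_addp// powR_mulrn ?(ltW (r0 n))// expr_div_n; field.
    by rewrite !expf_neq0// gt_eqF.
  rewrite DE; apply: (@le_trans _ _ (e / K * K)); last by rewrite divfK// gt_eqF.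
  apply: ler_pM => //; first exact: powR_ge0.
    by rewrite mulr_ge0 ?exprn_ge0 ?(ltW N0)// (ip_ge0 (@aform_psd R N s)).
  by rewrite lerDl.
have dist n : (\int[leb]_x ((ball_avg (r n) u x - u x) ^+ 2)%:E <= (D n)%:E)%E.
  apply: le_trans (ball_avg_L2_dist u (r0 n)); rewrite le_eqVlt; apply/orP; left; apply/eqP.
  by apply: eq_integral => x _; rewrite -sqrrN opprB.
have md n : measurable_fun setT (fun x => ball_avg (r n) u x - u x) by exact: measurable_funB.
have [e e0||phi [l [phik ml phil]]] := @ae_cvg_subsequence _ _ _ leb (fun n => ball_avg (r n) u).
- exact: mA.
- move=> e e0; have [|n0 hn0] := D0 (e / 4); first by rewrite divr_gt0.
  exists n0 => i j ni nj; apply: (@le_trans _ _ (\int[leb]_x (2%:E * ((ball_avg (r i) u x - u x) ^+ 2)%:E + 2%:E * ((ball_avg (r j) u x - u x) ^+ 2)%:E))%E).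
    apply: ge0_le_integral => //.
    + by move=> x _; rewrite lee_fin sqr_ge0.
    + by apply: measurable_EFin_sq; exact: measurable_funB.
    + by apply: emeasurable_funD; apply: emeasurable_funM => //; exact: measurable_EFin_sq.
    move=> x _; rewrite -!EFinM -EFinD lee_fin.
    by move: (ball_avg _ _ _) (ball_avg _ _ _) (u x) => a b c; rewrite -subr_ge0 (_ : _ - _ = (a + b - 2 * c) ^+ 2) ?sqr_ge0//; ring.
  rewrite ge0_integralD//; last 4 first.
  + by move=> x _; rewrite -EFinM lee_fin mulr_ge0 ?sqr_ge0.
  + by apply: emeasurable_funM => //; exact: measurable_EFin_sq.
  + by move=> x _; rewrite -EFinM lee_fin mulr_ge0 ?sqr_ge0.
  + by apply: emeasurable_funM => //; exact: measurable_EFin_sq.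
  have half k : (n0 <= k)%N -> (\int[leb]_x (2%:E * ((ball_avg (r k) u x - u x) ^+ 2)%:E) <= (e / 2)%:E)%E.
    move=> nk; rewrite ge0_integralZl//; last 2 first.
    + exact: measurable_EFin_sq.
    + by move=> x _; rewrite lee_fin sqr_ge0.
    apply: (@le_trans _ _ (2%:E * (e / 4)%:E)%E).
      by rewrite lee_wpmul2l ?lee_fin//; apply: le_trans (dist k) _; rewrite lee_fin hn0.
    by rewrite -EFinM lee_fin; lra.
  have -> : e%:E = ((e / 2)%:E + (e / 2)%:E)%E by rewrite -EFinD -splitr.
  exact: leeD (half i ni) (half j nj).
exists phi.
have lu : (\int[leb]_x ((l x - u x) ^+ 2)%:E = 0)%E.
  apply/eqP; rewrite eq_le; apply/andP; split; last by apply: integral_ge0 => x _; rewrite lee_fin sqr_ge0.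
  apply/lee_addgt0Pr => e e0; rewrite add0e; have [n0 hn0] := D0 e e0.
  apply: (@fatou_sq _ _ _ leb (fun k x => ball_avg (r (phi k)) u x - u x) (fun x => l x - u x) e%:E n0).
  - by move=> n; exact: md.
  - exact: measurable_funB.
  - by move: phil; apply: filterS => x hx; apply: cvgB => //; exact: cvg_cst.
  - move=> n n0n; apply: le_trans (dist _) _; rewrite lee_fin hn0//; exact: leq_trans (phik n).
have mlu : measurable_fun setT (fun x => ((l x - u x) ^+ 2)%:E) by apply: measurable_EFin_sq; exact: measurable_funB.
have : (\int[leb]_x `|((l x - u x) ^+ 2)%:E| = 0)%E.
  by rewrite -[RHS]lu; apply: eq_integral => x _; rewrite gee0_abs ?lee_fin ?sqr_ge0.
move=> /(ae_eq_integral_abs leb measurableT mlu).1 lu0.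
move: phil lu0; apply: filterS2 => x hx /(_ I)[] /eqP.
by rewrite sqrf_eq0 subr_eq0 => /eqP <-.
Qed.

Lemma radial_representative u : rot_invariant u -> exists2 w : hs, radial w & {ae leb, forall x, w x = u x}.
Proof.
move=> ru; have [phi hphi] := ball_avg_cvg u.
pose a k x := ball_avg (phi k).+1%:R^-1 u x.
have r0 k : 0 < k.+1%:R^-1 :> R by rewrite invr_gt0.
have arot k (i j : 'I_N) (c t : R) x : i != j -> c ^+ 2 + t ^+ 2 = 1 -> -1 < c -> a k (rot i j c t x) = a k x.
  move=> ij ct c1; apply: ball_avg_isometry => //; first exact: isometry_rot.
  exact: (sq_dist0_ae (ru i j c t ij ct c1)).
(* Defined at every point by exactly invariant averages, hence exactly radial. *)
pose v x := fine (limn_esup (fun k => (a k x)%:E)).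
have mv : measurable_fun setT v.
  apply: (measurableT_comp (@fine_measurable R setT measurableT)).
  by apply: measurable_fun_limn_esup => k; apply/measurable_EFinP; exact: measurable_ball_avg (hs_L2 u).
have vu : {ae leb, forall x, v x = u x}.
  move: hphi; apply: filterS => x hx.
  have /cvg_limn_einf_sup[_ E] : (a k x)%:E @[k --> \oo] --> (u x)%:E by apply/cvg_EFin => //; exact: nearW.
  by rewrite /v E.
have vr : radial v.
  move=> x y xy; rewrite /v; congr (fine (limn_esup _)); apply/funext => k; congr EFin.
  by apply: (rotations_transitive N2 _ xy) => *; exact: arot.
have Hv : v \in @Hs_pred R N s.
  have mu := hs_measurable u.
  apply/Hs_predP; split; split => //.
  - rewrite (ae_eq_integral (fun x => (u x ^+ 2)%:E))//; first exact: (hs_L2 u).2.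
    + exact: measurable_EFin_sq.
    + exact: measurable_EFin_sq.
    + by move: vu; apply: filterS => x -> _.
  - exact: measurable_diffq.
  rewrite (ae_eq_integral (fun z => (diffq s u z ^+ 2)%:E))//; first exact: (hs_diffq u).2.
  - by apply: measurable_EFin_sq; exact: measurable_diffq.
  - by apply: measurable_EFin_sq; exact: measurable_diffq.
  move: (ae_fst leb vu) (ae_snd leb vu); apply: filterS2 => z h1 h2 _.
  by rewrite /diffq h1 h2.
by exists (HsElt Hv).
Qed.

End ball_averages.

(** * A tent function *)

Section tent_function.
Context {R : realType} {N : nat} {s : R}.
Hypotheses (s01 : 0 < s < 1) (N2 : (2 < N)%N).
Notation leb := (@Rn_lebesgue R N).
Local Notation leb2 := (leb \x leb)%E.
Local Notation p := (N%:R + 2 * s).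
Implicit Types (x y : Rn R N).

Let s0 : 0 < s. Proof. by case/andP: s01. Qed.
Let s1 : s < 1. Proof. by case/andP: s01. Qed.
Let N0 : 0 < N%:R :> R. Proof. by rewrite ltr0n (leq_trans _ N2). Qed.
Let p0 : 0 < p. Proof. by rewrite addr_gt0// mulr_gt0. Qed.
(** The factor of the kernel over one dyadic step in distance. Its two bounds below are the
    conditions [0 < s] and [s < 1]: integrability at infinity and at the diagonal. *)
Let tau : R := 2 `^ p.

Let tau0 : 0 < tau. Proof. exact: powR_gt0. Qed.

Let tau_gt : 2 ^+ N < tau.
Proof.
rewrite /tau -(powR_mulrn N (ler0n R 2)) powR_addp// ltr_pMr ?powR_gt0//.
have : (1 : R) `^ (2 * s) < 2 `^ (2 * s); last by rewrite powR1.
by apply: gt0_ltr_powR; rewrite ?nnegrE ?ltr1n// mulr_gt0.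
Qed.

Let tau_lt : tau < 4 * 2 ^+ N.
Proof.
rewrite /tau powR_addp// mulrC powR_mulrn// ltr_pM2r ?exprn_gt0//.
have -> : (4 : R) = 2 `^ 2%:R by rewrite powR_mulrn// -natrX.
have -> : (2 : R) `^ 2%:R = 2 `^ (2 * s) * 2 `^ (2 - 2 * s).
  by rewrite -powR_addp//; congr powR; ring.
rewrite ltr_pMr ?powR_gt0//.
have : (1 : R) `^ (2 - 2 * s) < 2 `^ (2 - 2 * s); last by rewrite powR1.
by apply: gt0_ltr_powR; rewrite ?nnegrE ?ltr1n//; move: s1; lra.
Qed.

Let powR_exp k : (2 ^+ k) `^ p = tau ^+ k.
Proof. by rewrite -(powR_mulrn k (ler0n R 2)) -powRrM mulrC powRrM powR_mulrn// ltW. Qed.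

(** A bounded 1-Lipschitz function with values in the unit interval has squared differences at most
    [Num.min 1 (edist x y ^+ 2)]; with this numerator the kernel becomes integrable in [y]. *)
Definition trunc_kernel x y : R := Num.min 1 (edist x y ^+ 2) * gag_kernel s x y.

(** Dyadic shells: the first term bounds the kernel for distances of order [2^k], the second one for
    distances of order [2^-k], where the numerator gains [4 ^- k]. *)
Let shells x y k : R := tau ^- k * ball_ind (2 ^+ k.+1) x y +
  4 ^- k * tau ^+ k.+1 * ball_ind (2 * 2 ^- k) x y.

Let shells_ge0 x y k : 0 <= shells x y k.
Proof.
by rewrite addr_ge0// !mulr_ge0 ?ball_ind_ge0 ?invr_ge0 ?exprn_ge0// ltW.
Qed.

Lemma trunc_kernel_ge0 x y : 0 <= trunc_kernel x y.
Proof. by rewrite mulr_ge0 ?gag_kernel_ge0// le_min ler01 sqr_ge0. Qed.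

Lemma trunc_kernel_le x y : exists k, trunc_kernel x y <= shells x y k.
Proof.
have d0 := edist_ge0 x y; have sh0 := shells_ge0 x y 0.
move: sh0; rewrite /trunc_kernel /gag_kernel /shells /ball_ind => sh0.
have [dE|dE] := eqVneq (edist x y) 0.
  by exists 0%N; apply: le_trans sh0; rewrite dE expr0n /= (min_idPr _) ?ler01// mul0r.
have dp : 0 < edist x y by rewrite lt_def dE.
set d := edist x y in d0 dE dp *.
have g0 : 0 <= (d `^ p)^-1 by rewrite invr_ge0 powR_ge0.
have two1 : 1 < 2 :> R by rewrite ltr1n.
have [d1|d1] := leP 1 d.
  have [k /andP[k1 k2]] := exists_expr_itv two1 d1; exists k.
  rewrite k2 mulr1 -[leLHS]addr0; apply: lerD; last first.
    by rewrite !mulr_ge0 ?invr_ge0 ?exprn_ge0// ltW.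
  apply: (@le_trans _ _ (1 * (d `^ p)^-1)); first by rewrite ler_wpM2r// ge_min lexx.
  rewrite mul1r lef_pV2 ?posrE ?powR_gt0 ?exprn_gt0// -powR_exp.
  by apply: ge0_ler_powR; rewrite ?nnegrE ?exprn_ge0// ltW.
have [k /andP[k1 k2]] : exists k, 2 ^+ k <= d^-1 < 2 ^+ k.+1.
  by apply: exists_expr_itv => //; rewrite invf_ge1// ltW.
exists k; have dk : d <= 2 ^- k by rewrite -[d]invrK lef_pV2 ?posrE ?invr_gt0 ?exprn_gt0.
have -> : d < 2 * 2 ^- k.
  by apply: le_lt_trans dk _; rewrite ltr_pMl ?invr_gt0 ?exprn_gt0.
rewrite mulr1 -[leLHS]add0r; apply: lerD.
  by rewrite mulr_ge0// invr_ge0 exprn_ge0// ltW.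
apply: ler_pM => //; first by rewrite le_min ler01 sqr_ge0.
  rewrite ge_min; apply/orP; right.
  have -> : (4 : R) ^- k = (2 ^- k) ^+ 2 by rewrite -exprVn exprAC -exprVn; congr (_ ^+ _); field.
  by rewrite ler_pXn2r ?nnegrE// invr_ge0 exprn_ge0.
rewrite -powR_exp -div1r ler_pdivrMr ?powR_gt0// -powRM ?exprn_ge0//.
have dk2 : 1 <= 2 ^+ k.+1 * d by rewrite -ler_pdivrMr// div1r ltW.
have : (1 : R) `^ p <= (2 ^+ k.+1 * d) `^ p; last by rewrite powR1.
by apply: ge0_ler_powR; rewrite ?nnegrE ?(ltW p0)// mulr_ge0// exprn_ge0.
Qed.

Let integral_ball_ind_le x r : 0 < r -> (\int[leb]_y (ball_ind r x y)%:E <= ((2 * r) ^+ N)%:E)%E.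
Proof.
move=> r0; rewrite -(integral_box x r0); apply: ge0_le_integral => //.
- by move=> y _; rewrite lee_fin ball_ind_ge0.
- by apply/measurable_EFinP; exact: measurable_ball_ind.
- by apply/measurable_EFinP; apply: measurable_indic; exact: box_measurable.
move=> y _; rewrite lee_fin /ball_ind indicE ler_nat.
case: (ltP (edist x y) r) => //= xy; rewrite mem_set// => i.
have := le_trans (ler_edist_coord x y i) (ltW xy).
by rewrite /= in_itv /= ler_norml; lra.
Qed.

Let geom_sum_le (c a : R) n : 0 <= c -> 0 <= a -> a < 1 -> \sum_(0 <= k < n) c * a ^+ k <= c / (1 - a).
Proof.
move=> c0 a0 a1; have a10 : 0 < 1 - a by rewrite subr_gt0.
suff -> : \sum_(0 <= k < n) c * a ^+ k = c / (1 - a) * (1 - a ^+ n).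
  by rewrite ler_piMr ?divr_ge0 ?(ltW a10)// gerBl exprn_ge0.
elim: n => [|n IH]; first by rewrite big_geq// expr0 subrr mulr0.
by rewrite big_nat_recr//= IH exprS; field; rewrite gt_eqF.
Qed.

Lemma measurable_trunc_kernel2 : measurable_fun setT (fun z : Rn R N * Rn R N => trunc_kernel z.1 z.2).
Proof.
apply: measurable_funM; last exact: measurable_gag_kernel.
by apply: measurable_minr => //; apply: measurable_funX; exact: measurable_edist.
Qed.

Lemma trunc_kernel_integral : exists2 C : R, 0 <= C & forall x,
  (\int[leb]_y (trunc_kernel x y)%:E <= C%:E)%E.
Proof.
pose a1 := 2 ^+ N / tau; pose a2 := tau / (4 * 2 ^+ N).
have pN : 0 < 2 ^+ N :> R by rewrite exprn_gt0.
have a10 : 0 <= a1 by rewrite divr_ge0 ?(ltW tau0) ?(ltW pN).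
have a20 : 0 <= a2 by rewrite divr_ge0 ?(ltW tau0)// mulr_ge0 ?(ltW pN).
have a11 : a1 < 1 by rewrite ltr_pdivrMr// mul1r.
have a21 : a2 < 1 by rewrite /a2 ltr_pdivrMr ?mul1r; [exact: tau_lt|exact: mulr_gt0].
pose c1 : R := 4 ^+ N; pose c2 := 4 ^+ N * tau.
have c10 : 0 <= c1 by rewrite exprn_ge0.
have c20 : 0 <= c2 by rewrite mulr_ge0// ltW.
exists (c1 / (1 - a1) + c2 / (1 - a2)).
  by rewrite addr_ge0// divr_ge0// subr_ge0 ltW.
move=> x; have ms k : measurable_fun setT (fun y => (shells x y k)%:E).
  by apply/measurable_EFinP; apply: measurable_funD; apply: measurable_funM => //; exact: measurable_ball_ind.
have s_0 k y : (0 <= (shells x y k)%:E)%E by rewrite lee_fin.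
apply: (@le_trans _ _ (\int[leb]_y \sum_(0 <= k <oo) (shells x y k)%:E)%E).
  apply: ge0_le_integral => //.
  - by move=> y _; rewrite lee_fin trunc_kernel_ge0.
  - by apply/measurable_EFinP; exact: (measurableT_comp measurable_trunc_kernel2 (measurable_pair1 x)).
  - by apply: ge0_emeasurable_sum.
  move=> y _; have [k hk] := trunc_kernel_le x y.
  apply: (@le_trans _ _ (shells x y k)%:E); first by rewrite lee_fin.
  apply: le_trans (nneseries_lim_ge k.+1 _) => //.
  by rewrite big_nat_recr//=; apply: leeDr; apply: sume_ge0.
rewrite integral_nneseries//; apply: lime_le.
  by apply: is_cvg_nneseries => n _ _; exact: integral_ge0.
apply: nearW => n; apply: (@le_trans _ _ (\sum_(0 <= k < n) (c1 * a1 ^+ k + c2 * a2 ^+ k)%:E)%E); last first.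
  by rewrite sumEFin lee_fin big_split /=; apply: lerD; exact: geom_sum_le.
apply: lee_sum => k _.
have k1 : 0 < 2 ^+ k.+1 :> R by rewrite exprn_gt0.
have k2 : 0 < 2 * 2 ^- k :> R by rewrite mulr_gt0 ?invr_gt0 ?exprn_gt0.
have mb r : measurable_fun setT (fun y => (ball_ind r x y)%:E) by apply/measurable_EFinP; exact: measurable_ball_ind.
have b0 r y : (0 <= (ball_ind r x y)%:E)%E by rewrite lee_fin ball_ind_ge0.
rewrite (eq_integral (fun y => (tau ^- k)%:E * (ball_ind (2 ^+ k.+1) x y)%:E +
   (4 ^- k * tau ^+ k.+1)%:E * (ball_ind (2 * 2 ^- k) x y)%:E)%E); last by move=> y _; rewrite -!EFinM -EFinD.
have t1 : (0 <= (tau ^- k)%:E)%E by rewrite lee_fin invr_ge0 exprn_ge0// ltW.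
have t2 : (0 <= (4 ^- k * tau ^+ k.+1)%:E)%E.
  by rewrite lee_fin mulr_ge0 ?invr_ge0 ?exprn_ge0// ltW.
rewrite ge0_integralD//; last 4 first.
- by move=> y _; exact: mule_ge0.
- exact: emeasurable_funM.
- by move=> y _; exact: mule_ge0.
- exact: emeasurable_funM.
rewrite !ge0_integralZl// EFinD; apply: leeD.
  apply: (le_trans (lee_wpmul2l t1 (integral_ball_ind_le x k1))).
  have e1 : (2 * 2 ^+ k.+1) ^+ N = 4 ^+ N * (2 ^+ N) ^+ k :> R.
    by rewrite exprS mulrA exprMn [(2 ^+ k) ^+ N]exprAC -natrM.
  rewrite -EFinM lee_fin /c1 /a1 e1 expr_div_n le_eqVlt; apply/orP; left; apply/eqP.
  by field; rewrite expf_neq0// gt_eqF.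
apply: (le_trans (lee_wpmul2l t2 (integral_ball_ind_le x k2))).
have e2 : (2 * (2 * 2 ^- k)) ^+ N = 4 ^+ N * (2 ^+ N) ^- k :> R.
  by rewrite mulrA exprMn exprVn [(2 ^+ k) ^+ N]exprAC -natrM.
rewrite -EFinM lee_fin /c2 /a2 e2 expr_div_n exprMn exprS le_eqVlt; apply/orP; left; apply/eqP.
by field; rewrite !expf_neq0// gt_eqF.
Qed.

Definition tent x : R := Num.max 0 (1 - enorm x).

Let unit_box (y : Rn R N) : R :=
  \1_[set y : Rn R N | forall i, `[tnth ([tuple 0 | _ < N] : Rn R N) i - 1, tnth ([tuple 0 | _ < N] : Rn R N) i + 1]%classic (tnth y i)] y.

Let unit_box_ge0 y : 0 <= unit_box y. Proof. by rewrite /unit_box indicE ler0n. Qed.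

Let measurable_unit_box : measurable_fun setT unit_box.
Proof. by apply: measurable_indic; exact: box_measurable. Qed.

Let unit_box_integral : (\int[leb]_y (unit_box y)%:E = ((2 * 1) ^+ N)%:E)%E.
Proof. exact: integral_box. Qed.

Let tent_box x : tent x = 0 \/ unit_box x = 1.
Proof.
rewrite /tent; have [h|h] := leP 0 (1 - enorm x); last by left.
right; rewrite /unit_box indicE mem_set// => i.
have := ler_enorm_coord x i; rewrite /= tnth_mktuple in_itv /= ler_norml; move: h; lra.
Qed.

Lemma tent01 x : 0 <= tent x <= 1.
Proof. by rewrite /tent le_max lexx /= ge_max ler01 gerBl enorm_ge0. Qed.

Lemma measurable_tent : measurable_fun setT tent.
Proof. by apply: measurable_maxr => //; apply: measurable_funB => //; exact: measurable_enorm. Qed.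

Lemma tent_sq_dist x y : (tent x - tent y) ^+ 2 <= (unit_box x + unit_box y) * Num.min 1 (edist x y ^+ 2).
Proof.
have /andP[x0 x1] := tent01 x; have /andP[y0 y1] := tent01 y.
have m0 : 0 <= Num.min 1 (edist x y ^+ 2) by rewrite le_min ler01 sqr_ge0.
have d0 := edist_ge0 x y.
have lip : (tent x - tent y) ^+ 2 <= Num.min 1 (edist x y ^+ 2).
  rewrite le_min; apply/andP; split.
    by rewrite expr2; move: x0 x1 y0 y1; move: (tent x) (tent y) => a b; nra.
  rewrite -(real_normK (num_real (tent x - tent y))) ler_pXn2r ?nnegrE//.
  apply: (le_trans _ (ler_enormB x y)); rewrite /tent.
  move: (enorm x) (enorm y) => a b; rewrite ler_normr !ler_norml /Num.max.
  by case: ltP => h1; case: ltP => h2; case: (leP 0 (a - b)) => h3; apply/orP; try (left; lra); right; lra.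
case: (tent_box x) => [xE|xE]; case: (tent_box y) => [yE|yE].
- by rewrite xE yE subrr expr0n mulr_ge0 ?addr_ge0.
- by apply: (le_trans lip); rewrite yE ler_peMl// lerDr.
- by apply: (le_trans lip); rewrite xE ler_peMl// lerDl.
- by apply: (le_trans lip); rewrite xE ler_peMl// lerDl.
Qed.

(** The support condition of [tent_sq_dist] splits the double integral into two symmetric ones, each
    with one variable confined to a box and the other integrated against the truncated kernel. *)
Lemma tent_in_Hs : tent \in @Hs_pred R N s.
Proof.
have mt := measurable_tent; have [C C0 hC] := trunc_kernel_integral.
have mK := measurable_trunc_kernel2.
apply/Hs_predP; split; split => //.
- apply: (@le_lt_trans _ _ (\int[leb]_y (unit_box y)%:E)%E); last by rewrite unit_box_integral ltry.
  apply: ge0_le_integral => //.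
  + by move=> x _; rewrite lee_fin sqr_ge0.
  + exact: measurable_EFin_sq.
  + by apply/measurable_EFinP.
  move=> x _; rewrite lee_fin; case: (tent_box x) => ->; first by rewrite expr0n.
  by have /andP[t0 t1] := tent01 x; rewrite expr_le1.
- exact: measurable_diffq.
pose g1 (z : Rn R N * Rn R N) := (unit_box z.1 * trunc_kernel z.1 z.2)%:E.
pose g2 (z : Rn R N * Rn R N) := (unit_box z.2 * trunc_kernel z.2 z.1)%:E.
have mg1 : measurable_fun setT g1.
  by apply/measurable_EFinP; apply: measurable_funM => //; exact: measurableT_comp measurable_unit_box _.
have mg2 : measurable_fun setT g2 by exact: (measurableT_comp mg1 (measurable_fun_pair measurable_snd measurable_fst)).
have g10 z : (0 <= g1 z)%E by rewrite lee_fin mulr_ge0 ?unit_box_ge0 ?trunc_kernel_ge0.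
have g20 z : (0 <= g2 z)%E by rewrite lee_fin mulr_ge0 ?unit_box_ge0 ?trunc_kernel_ge0.
have inner x : (\int[leb]_y (unit_box x * trunc_kernel x y)%:E <= (C * unit_box x)%:E)%E.
  under eq_integral do rewrite EFinM.
  rewrite ge0_integralZl//; last 3 first.
  - by apply/measurable_EFinP; exact: (measurableT_comp mK (measurable_pair1 x)).
  - by move=> y _; rewrite lee_fin trunc_kernel_ge0.
  - by rewrite lee_fin.
  by rewrite mulrC EFinM lee_wpmul2l// lee_fin.
have outer : (\int[leb]_x (C * unit_box x)%:E < +oo)%E.
  under eq_integral do rewrite EFinM.
  rewrite ge0_integralZl ?lee_fin//; last 2 first.
  - exact/measurable_EFinP.
  - by move=> x _; rewrite lee_fin.
  by rewrite unit_box_integral -EFinM ltry.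
apply: (@le_lt_trans _ _ (\int[leb2]_z (g1 z + g2 z))%E).
  apply: ge0_le_integral => //.
  - by move=> z _; rewrite lee_fin sqr_ge0.
  - by apply: measurable_EFin_sq; exact: measurable_diffq.
  - exact: emeasurable_funD.
  move=> z _; rewrite -EFinD lee_fin diffq_sq real_normK ?num_real// /trunc_kernel (edistC z.2 z.1).
  have -> : gag_kernel s z.2 z.1 = gag_kernel s z.1 z.2 by rewrite /gag_kernel edistC.
  by rewrite -mulrDl mulrA ler_wpM2r ?gag_kernel_ge0// tent_sq_dist.
have mF : measurable_fun setT (fun x => (C * unit_box x)%:E).
  by apply/measurable_EFinP; apply: measurable_funM.
rewrite ge0_integralD//; apply: lte_add_pinfty.
  rewrite (fubini_tonelli1 _ mg1 g10); apply: le_lt_trans outer.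
  apply: ge0_le_integral => //.
  - by move=> x _; exact: integral_ge0.
  - exact: (measurable_fun_fubini_tonelli_F (m2 := leb) _ mg1 g10).
  - by move=> x _; exact: inner.
rewrite (fubini_tonelli2 _ mg2 g20); apply: le_lt_trans outer.
apply: ge0_le_integral => //.
- by move=> x _; exact: integral_ge0.
- exact: (measurable_fun_fubini_tonelli_G (m1 := leb) _ mg2 g20).
- by move=> x _; exact: inner.
Qed.

Definition tent_hs : @hs R N s := HsElt tent_in_Hs.

Lemma tent_rot_invariant : rot_invariant tent_hs.
Proof.
move=> i j c t ij ct c1.
rewrite (_ : hs_comp _ tent_hs = tent_hs) /sq_dist ?subrr ?(ip0l (@bform_psd R N s))//.
by apply: val_inj; apply/funext => x /=; rewrite /tent enorm_rot.
Qed.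

End tent_function.

(** * The initial family *)

Section initial_family.
Context {R : realType} {N : nat} {s : R} {f : R -> R} (A : admissible s N f) (m : R) (m0 : 0 < m).
Notation leb := (@Rn_lebesgue R N).
Local Notation hs := (@hs R N s).
Local Notation F := (primitive f).
Local Notation q := (@crit_exp R N s).
Local Notation tz := (poh_time (f := f)).
Local Notation J := (energy_hs (f := f)).
Implicit Types (u w : hs).
Let aP := @aform_psd R N s.
Let bP := @bform_psd R N s.
Let s01 := adm_s A.
Let N2 := adm_N A.
Let s0 : 0 < s. Proof. by case/andP: s01. Qed.

(** [(q - 2) * F x] is the sum of the positive quantities [q * F x - f x * x] and [Ftilde f x]. *)
Lemma primitive_ge0 x : 0 <= F x.
Proof.
have [->|x0] := eqVneq x 0; first by rewrite primitive0.
have h1 := adm_crit_defect A x0; have h2 := adm_Ft_gt0 A x0; rewrite /Ftilde in h2.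
have n0 : 0 < N%:R - 2 * s.
  have : 2 < N%:R :> R by rewrite ltr_nat.
  by have /andP[_] := s01; lra.
have q2 : 0 < q - 2.
  rewrite /crit_exp subr_gt0 ltr_pdivlMr// mulrBr ltrBlDr ltrDl.
  by rewrite !mulr_gt0.
rewrite -(pmulr_rge0 _ q2) mulrBl; move: h1 h2; move: (f x * x) (q * F x) => a b; lra.
Qed.

Lemma peak_le u : bform u u = m -> peak (f := f) u <= tz u `^ (2 * s) * aform u u / 2.
Proof.
move=> um; have t0 : 0 < tz u by have [|] := poh_timeP A (u := u); rewrite ?um.
rewrite /peak energy_hsE aform_dil// gerBl; apply: Rintegral_ge0 => x _; exact: primitive_ge0.
Qed.

Let bump j : hs := hs_dil (2 ^+ j) (tent_hs s01 N2).

Definition combination n (x : 'rV[R]_n.+1) : hs := \sum_j x 0 j *: bump j.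

Lemma combinationN n (x : 'rV[R]_n.+1) : combination (- x) = - combination x.
Proof. by rewrite /combination -sumrN; apply: eq_bigr => j _; rewrite mxE scaleNr. Qed.

Lemma combination_rot n (x : 'rV[R]_n.+1) : rot_invariant (combination x).
Proof.
rewrite /combination; apply: (big_ind (@rot_invariant R N s)).
- by rewrite -(scale0r (bump 0)); apply: rot_invariantZ; apply: rot_invariant_dil; [exact: exprn_gt0|exact: tent_rot_invariant].
- by move=> u w ru rw; rewrite -[u]scale1r; exact: rot_invariant_lin.
- by move=> j _; apply: rot_invariantZ; apply: rot_invariant_dil; [exact: exprn_gt0|exact: tent_rot_invariant].
Qed.

Lemma hcvg_combination I (G : set_system I) {FG : Filter G} n (xi : I -> 'rV[R]_n.+1) (x : 'rV[R]_n.+1) :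
  (forall j, xi i 0 j @[i --> G] --> x 0 j) -> hcvg G (fun i => combination (xi i)) (combination x).
Proof.
move=> cx; rewrite /combination; elim: (index_enum _) => [|j r IH].
  rewrite (_ : (fun i => _) = fun=> 0) ?big_nil; first exact: hcvg_cst.
  by apply/funext => i; rewrite big_nil.
rewrite (_ : (fun i => _) = fun i => xi i 0 j *: bump j + \sum_(k <- r) xi i 0 k *: bump k); last first.
  by apply/funext => i; rewrite big_cons.
rewrite big_cons; apply: hcvgD => //; apply: hcvgZ => //; exact: hcvg_cst.
Qed.

Let bumpE j x : bump j x = (2 ^+ j) `^ (N%:R / 2) * tent (dil (2 ^+ j) x).
Proof. by rewrite /bump hs_dilE ?exprn_gt0. Qed.

Let enorm_dil c (x : Rn R N) : 0 < c -> enorm (dil c x) = c * enorm x.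
Proof.
move=> c0; rewrite /enorm -[in RHS](ger0_norm (ltW c0)) -sqrtr_sqr -sqrtrM ?sqr_ge0//.
by congr Num.sqrt; rewrite mulr_sumr; apply: eq_bigr => i _; rewrite tnth_dil exprMn.
Qed.

(* On the annulus [2^-(j+1) < |y| < 2^-j] the bumps of index above [j] vanish;
   take [j] minimal with [x_j != 0]. *)
Lemma combination_gt0 n (x : 'rV[R]_n.+1) : l1_sphere n x -> 0 < bform (combination x) (combination x).
Proof.
move=> xS; rewrite lt_def (ip_ge0 bP) andbT; apply/eqP => b0.
have ae0 : {ae leb, forall y, combination x y = 0}.
  have h : sq_dist (@bform R N s) (combination x) 0 = 0 by rewrite /sq_dist subr0.
  by move: (sq_dist0_ae h); apply: filterS => y ->.
have [j0 xj0] : exists j, x 0 j != 0.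
  apply: contrapT => none; have : \sum_j `|x 0 j| = 0.
    by apply: big1 => j _; apply/eqP; rewrite normr_eq0; apply: contrapT => h; apply: none; exists j; apply/negP.
  by move: xS; rewrite /l1_sphere /= => -> /eqP; rewrite oner_eq0.
have [j xj hj] := @arg_minnP _ j0 (fun j => x 0 j != 0) (fun j => j : nat) xj0.
have N0 : (0 < N)%N by exact: leq_trans N2.
have N0' : 0 < N%:R :> R by rewrite ltr0n.
pose r : R := 2 ^- j; have r0 : 0 < r by rewrite invr_gt0 exprn_gt0.
pose o : 'I_N := Ordinal N0.
(* A point in the middle of the annulus; the box of half-side [h] about it lies within distance
   [r / 8], hence inside, and has positive measure. *)
pose c : Rn R N := [tuple (if k == o then 3 / 4 * r else 0) | k < N].
pose h := r / (8 * N%:R); have h0 : 0 < h by rewrite divr_gt0 ?mulr_gt0.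
have cn : enorm c = 3 / 4 * r.
  rewrite /enorm (bigD1 o)//= big1 => [|k ko]; last by rewrite tnth_mktuple (negPf ko) expr0n.
  by rewrite tnth_mktuple eqxx addr0 sqrtr_sqr ger0_norm// mulr_ge0// ltW.
have [y [yh y0]] : exists y : Rn R N, (forall i, `[tnth c i - h, tnth c i + h]%classic (tnth y i)) /\ combination x y = 0.
  apply: contrapT => none; have [B [mB B0 hB]] := ae0.
  pose BX := [set y : Rn R N | forall i, `[tnth c i - h, tnth c i + h]%classic (tnth y i)].
  have mBX : measurable BX by exact: box_measurable.
  have BXE : leb BX = ((2 * h) ^+ N)%:E by exact: box_measure.
  have : (leb BX <= leb B)%E.
    apply: le_measure; rewrite ?inE//.
    by move=> y /= yh; apply: hB => /= y0; apply: none; exists y.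
  by rewrite BXE [X in (_ <= X)%E]B0 lee_fin leNgt exprn_gt0// mulr_gt0.
have yc : edist y c <= r / 8.
  have -> : r / 8 = N%:R * h by rewrite /h; field; rewrite gt_eqF.
  apply: edist_le_coord => [|i]; first exact: ltW.
  by have := yh i; rewrite /= in_itv /= ler_norml; lra.
have := le_trans (ler_enormB y c) yc; rewrite cn ler_norml => /andP[n1 n2].
have ylo : r / 2 < enorm y by move: n1 r0; lra.
have yhi : enorm y < r by move: n2 r0; lra.
have rj : 2 ^+ j * r = 1 by rewrite mulfV// expf_neq0.
move: y0; rewrite /combination.
have -> : (\sum_k x 0 k *: bump k) y = \sum_k x 0 k * bump k y.
  by elim/big_rec2: _ => // k v u _ <-; rewrite hs_funD hs_funZ.
rewrite (bigD1 j)//= big1 => [|k kj]; last first.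
  have [->|xk] := eqVneq (x 0 k) 0; first by rewrite mul0r.
  have jk : (j < k)%N by rewrite ltn_neqAle (hj _ xk) andbT eq_sym; apply: contra kj => /eqP/val_inj ->.
  rewrite bumpE; suff -> : tent (dil (2 ^+ k) y) = 0 by rewrite !mulr0.
  rewrite /tent enorm_dil ?exprn_gt0//; apply/max_idPl; rewrite subr_le0.
  have : 2 ^+ j.+1 * (r / 2) <= 2 ^+ k * enorm y.
    by apply: ler_pM; rewrite ?exprn_ge0 ?divr_ge0 ?(ltW r0) ?(ltW ylo)// ler_weXn2l// ler1n.
  apply: le_trans; rewrite exprS; move: rj; move: (2 ^+ j) => a; nra.
rewrite addr0 => /eqP; apply/negP; rewrite mulf_neq0// bumpE mulf_neq0//.
rewrite /tent enorm_dil ?exprn_gt0// gt_eqF// lt_max; apply/orP; right.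
rewrite subr_gt0; apply: (@lt_le_trans _ _ (2 ^+ j * r)); last by rewrite rj.
by rewrite ltr_pM2l ?exprn_gt0.
Qed.

Let near_eq n (prj : 'rV[R]_n.+1 -> 'rV[R]_n.+1) (x : 'rV[R]_n.+1) (j : 'I_n.+1) :
  (forall z, l1_sphere n z -> prj z = z) ->
  prj z 0 j @[z --> within (l1_sphere n) (nbhs x)] --> x 0 j.
Proof.
move=> prjE; have c : (z : 'rV[R]_n.+1) 0 j @[z --> within (l1_sphere n) (nbhs x)] --> x 0 j.
  by apply: cvg_within_filter; exact: (@coord_continuous _ 1 n.+1 0 j x).
apply: cvg_trans c; apply: near_eq_cvg; near=> z; rewrite prjE//.
by near: z; exact: withinT.
Unshelve. all: by end_near. Qed.

(** Local boundedness of [peak] suffices on a compact sphere, and it needs only the convergence of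
    the Pohozaev times and of the seminorms, through [peak_le]. *)
Lemma peak_near I (G : set_system I) {FG : Filter G} (ui : I -> hs) u :
  (forall i, bform (ui i) (ui i) = m) -> bform u u = m -> hcvg G ui u ->
  exists D, \forall i \near G, peak (f := f) (ui i) <= D.
Proof.
move=> uim um cu; have t0 : 0 < tz u by have [|] := poh_timeP A (u := u); rewrite ?um.
have ti0 i : 0 < tz (ui i) by have [|] := poh_timeP A (u := ui i); rewrite ?uim.
have cr : tz (ui i) / tz u @[i --> G] --> (1 : R).
  exact: (@hcvg_poh_time _ _ _ _ A m m0 I G FG ui u uim um cu).
have ca : aform (ui i) (ui i) @[i --> G] --> aform u u by exact: hcvg_aform.
have n1 : \forall i \near G, tz (ui i) / tz u <= 2.
  by apply: (cvgr_le (1 : R) cr); rewrite ltr1n.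
have n2 : \forall i \near G, aform (ui i) (ui i) <= aform u u + 1.
  by apply: (cvgr_le _ ca); rewrite ltrDl.
exists ((2 * tz u) `^ (2 * s) * (aform u u + 1) / 2).
move: n1 n2; apply: filterS2 => i h1 h2.
have s20 : 0 <= 2 * s by rewrite mulr_ge0// ltW.
have tt : tz (ui i) <= 2 * tz u by rewrite -ler_pdivrMr.
have tp : tz (ui i) `^ (2 * s) <= (2 * tz u) `^ (2 * s).
  have e1 : tz (ui i) \is Num.nneg by rewrite nnegrE; exact: ltW (ti0 i).
  have e2 : 2 * tz u \is Num.nneg by rewrite nnegrE; exact: (mulr_ge0 (ler0n R 2) (ltW t0)).
  exact: (ge0_ler_powR s20 e1 e2 tt).
apply: (le_trans (peak_le (uim i))); rewrite ler_pM2r ?invr_gt0//.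
exact: ler_pM (powR_ge0 _ _) (ip_ge0 aP _) tp h2.
Qed.

Lemma sphere_bounded n (p : 'rV[R]_n.+1 -> R) :
  (forall x, l1_sphere n x -> exists D, \forall z \near within (l1_sphere n) (nbhs x), p z <= D) ->
  exists D, forall x, l1_sphere n x -> p x <= D.
Proof.
move=> loc; apply: contrapT => none.
have ex (k : nat) : exists x, l1_sphere n x /\ k%:R < p x.
  apply: contrapT => nk; apply: none; exists k%:R => x xS.
  by rewrite leNgt; apply/negP => h; apply: nk; exists x.
have [X HX] := choice ex.
have XS : (X r @[r --> \oo]) (l1_sphere n) by exists 0%N => // r _ /=; have [] := HX r.
have [x [xS xcl]] := @l1_sphere_compact R n _ _ XS.
have [D hD] := loc x xS.
have [z [[zS zD] hz]] : [set z | l1_sphere n z /\ D < p z] `&` (fun z => l1_sphere n z -> p z <= D) !=set0.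
  apply: xcl; last exact: hD.
  exists (Num.truncn `|D|).+1 => // r /= rD; have [h1 h2] := HX r; split=> //; apply: le_lt_trans h2.
  apply: le_trans (ler_norm D) _; apply: le_trans (ltW (truncnS_gt _)) _; by rewrite ler_nat.
by have := hz zS; rewrite leNgt zD.
Qed.

Lemma initial_family n : exists2 g : 'rV[R]_n.+1 -> hs, odd_family m g & exists D, forall x, peak (f := f) (g x) <= D.
Proof.
have x0S : l1_sphere n (basis_vec n 0 : 'rV[R]_n.+1).
  rewrite -[basis_vec n 0]scale1r; apply: (octant_face_sphere (sgn := fun=> 1)) => [j|]; first by rewrite normr1.
  by apply: (@basis_vec_face R n (fun=> 1)) => // j; rewrite normr1.
(* Points off the sphere are sent to a fixed basis vector, so that the mass constraint and the bound
   hold everywhere. *)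
pose prj (x : 'rV[R]_n.+1) := if pselect (l1_sphere n x) then x else basis_vec n 0.
have prjS x : l1_sphere n (prj x) by rewrite /prj; case: pselect.
have prjE x : l1_sphere n x -> prj x = x by rewrite /prj; case: pselect.
pose g x := normalize m (combination (prj x)).
have gm x : bform (g x) (g x) = m by apply: (bform_normalize m0); exact: combination_gt0.
have gc x : l1_sphere n x -> hcvg (within (l1_sphere n) (nbhs x)) g (g x).
  move=> xS; apply: (@hcvg_normalize _ _ _ m _ _ (within_filter _ (nbhs_filter x))).
    exact: combination_gt0.
  apply: (@hcvg_combination _ _ (within_filter _ (nbhs_filter x))) => j.
  by rewrite (prjE x xS); exact: near_eq.
exists g.
  split => // x; first by apply: rot_invariantZ; exact: combination_rot.
  by move=> xS; rewrite /g !prjE//; [rewrite combinationN normalizeN|exact: l1_sphereN].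
have [D hD] : exists D, forall x, l1_sphere n x -> peak (f := f) (g x) <= D.
  apply: sphere_bounded => x xS.
  exact: (@peak_near _ _ (within_filter _ (nbhs_filter x)) g (g x) gm (gm x) (gc x xS)).
exists D => x; rewrite (_ : g x = g (prj x)); first exact: hD.
by rewrite /g [in RHS]prjE.
Qed.

End initial_family.

(** * Radial solutions *)

Section radial_solutions.
Context {R : realType} {N : nat} {s : R} {f : R -> R} (A : admissible s N f) (m : R) (m0 : 0 < m).
Notation leb := (@Rn_lebesgue R N).
Local Notation hs := (@hs R N s).
Let aP := @aform_psd R N s.
Let bP := @bform_psd R N s.
Let s01 := adm_s A.
Let N2 := adm_N A.

Lemma critical_point_above (C : R) : exists u : hs, [/\ bform u u = m, rot_invariant u, C <= energy_hs (f := f) u &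
  forall phi, aform u phi = nonlin (f := f) u phi + multiplier (f := f) u * bform u phi].
Proof.
have [n hn] := peak_unbounded A m0 C.
have [E CE hE] := near_critical A m0 (initial_family A m0 n) hn.
have [u [um ur uE uc]] := palais_smale m0 hE.
by exists u; split; rewrite ?uE.
Qed.

Let root_mul_root (c : R) : 0 <= c -> (c%:E `^ 2^-1 * c%:E `^ 2^-1 = c%:E)%E.
Proof. by move=> c0; rewrite poweR_EFin powR12_sqrt// -EFinM -expr2 sqr_sqrtr. Qed.

Lemma radial_solution_above (C : R) : exists (u : Rn R N -> R) (mu : R),
  [/\ weak_solution s f mu u, ('N[leb]_2%:E[EFin \o u] ^+ 2 = m%:E)%E, radial u & C <= energy s f u].
Proof.
have [u [um ur uC uc]] := critical_point_above C.
have s0 : 0 < s by case/andP: s01.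
(* All forms and integrals are unchanged on passing from [u] to the radial [w], which differs from
   it on a null set. *)
have [w wr wu] := radial_representative s0 N2 ur.
have mw := hs_measurable w; have mu := hs_measurable u.
have f_meas : measurable_fun setT f.
  by apply: continuous_measurable_fun; exact: (subcrit_continuous (adm_f A)).
have F_meas : measurable_fun setT (primitive f).
  by apply: continuous_measurable_fun; exact: (subcrit_continuous (adm_F A)).
have d0 : bform (w - u) (w - u) = 0.
  apply: EFin_inj; rewrite bform_sqE -[RHS]/(0%E : \bar R) -(integral0 leb setT); apply: ge0_ae_eq_integral => //.
  - by apply: measurable_EFin_sq; exact: hs_measurable.
  - by move=> x _; rewrite lee_fin sqr_ge0.
  move: wu; apply: filterS => x wx _.
  have -> : hs_fun (w - u) x = 0 by rewrite hs_funB -[LHS]/(w x - u x) wx subrr.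
  by rewrite expr0n.
have a0 : aform (w - u) (w - u) = 0.
  apply: EFin_inj; rewrite aform_sqE -[RHS]/(0%E : \bar R) -(integral0 (leb \x leb)%E setT); apply: ge0_ae_eq_integral => //.
  - by apply: measurable_EFin_sq; apply: measurable_diffq; exact: hs_measurable.
  - by move=> z _; rewrite lee_fin sqr_ge0.
  move: (ae_fst leb wu) (ae_snd leb wu); apply: filterS2 => z h1 h2 _.
  have -> : diffq s (w - u) z = 0.
    by rewrite hs_funB diffqB -[LHS]/(diffq s w z - diffq s u z) /diffq h1 h2 subrr.
  by rewrite expr0n.
have aw phi : aform w phi = aform u phi.
  by rewrite -[w](subrK u) (ipDl aP) (ip_eq0 aP _ a0) add0r.
have bw phi : bform w phi = bform u phi.
  by rewrite -[w](subrK u) (ipDl bP) (ip_eq0 bP _ d0) add0r.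
have nw phi : nonlin (f := f) w phi = nonlin (f := f) u phi.
  rewrite !nonlinE; apply: ae_eq_Rintegral.
  - by apply: measurable_funM; [exact: measurableT_comp|exact: hs_measurable].
  - by apply: measurable_funM; [exact: measurableT_comp|exact: hs_measurable].
  by move: wu; apply: filterS => x ->.
have bww : bform w w = m by rewrite bw (ipC bP) bw.
have aww : aform w w = aform u u by rewrite aw (ipC aP) aw.
have FE : \int[leb]_x primitive f (w x) = \int[leb]_x primitive f (u x).
  by apply: ae_eq_Rintegral; [exact: measurableT_comp|exact: measurableT_comp|move: wu; apply: filterS => x ->].
(* The equation carries [- mu u], whence the opposite sign. *)
exists w, (- multiplier (f := f) u); split.
- split; first exact/HsE/Hs_predP/hs_funP.
  move=> phi /HsE Hphi; have /Hs_predP Hp := Hphi; pose v := HsElt Hp.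
  have S1 := summable_nonlin A w v.
  have S2 : summable leb (fun x => w x * v x).
    by apply: Summable; exact: L2_mul_integrable (hs_L2 w) (hs_L2 v).
  have S3 := summableD S1 (summableZ (multiplier (f := f) u) S2).
  have E x : (f (w x) - - multiplier (f := f) u * w x) * phi x =
      f (w x) * v x + multiplier (f := f) u * (w x * v x).
    by rewrite mulNr opprK mulrDl mulrA.
  split.
    rewrite (_ : (fun x => _) = EFin \o (fun x => f (w x) * v x + multiplier (f := f) u * (w x * v x))).
      exact: summable_integrable S3.
    by apply/funext => x; rewrite /= -E.
  have h := uc v; rewrite -aw -nw -bw nonlinE in h.
  rewrite -[LHS]/(aform w v) h; apply/esym.
  transitivity (\int[leb]_x (f (w x) * v x + multiplier (f := f) u * (w x * v x))).
    by apply: eq_Rintegral => x _; exact: E.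
  by rewrite (RintD S1 (summableZ _ S2)) (RintZ _ S2).
- rewrite -bww unlock /= (eq_integral (fun x => (w x ^+ 2)%:E)); last first.
    by move=> x _; rewrite /= powR_mulrn// real_normK ?num_real.
  rewrite -bform_sqE; exact: root_mul_root (ip_ge0 bP w).
- exact: wr.
- move: uC; rewrite energy_hsE /energy aform_gagliardo aww FE /=.
  by rewrite mulrC.
Qed.

(** Used contrapositively: solutions of different energy differ on a set that is not null. *)
Lemma energy_ae (u v : Rn R N -> R) : Hs s u -> Hs s v -> {ae leb, forall x, u x = v x} ->
  energy s f u = energy s f v.
Proof.
move=> /HsE[[mu _] _] /HsE[[mv _] _] uv.
have F_meas : measurable_fun setT (primitive f).
  by apply: continuous_measurable_fun; exact: (subcrit_continuous (adm_F A)).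
have FE : \int[leb]_x primitive f (u x) = \int[leb]_x primitive f (v x).
  by apply: ae_eq_Rintegral; [exact: measurableT_comp|exact: measurableT_comp|move: uv; apply: filterS => x ->].
have GE : gagliardo_sq s u = gagliardo_sq s v.
  rewrite !gagliardo_sqE; apply: ae_eq_integral.
  - exact: measurableT.
  - by apply: measurable_EFin_sq; exact: measurable_diffq.
  - by apply: measurable_EFin_sq; exact: measurable_diffq.
  move: (ae_fst leb uv) (ae_snd leb uv); apply: filterS2 => z h1 h2 _.
  by rewrite /diffq h1 h2.
by rewrite /energy FE GE.
Qed.

End radial_solutions.

Theorem theorem1p5 (R : realType) (s : R) (N : nat) (f : R -> R)
    (hs : 0 < s < 1) (hN : (2 < N)%N)
    (f_odd : forall t, f (- t) = - f t)
    (f_cont : continuous f)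
    (f_zero : f t / `|t| `^ (1 + 4 * s / N%:R) @[t --> 0^'] --> 0)
    (f_infty :
      f t / `|t| `^ ((N%:R + 2 * s) / (N%:R - 2 * s)) @[t --> +oo] --> 0)
    (F_infty :
      primitive f t / `|t| `^ (2 + 4 * s / N%:R) @[t --> +oo] --> +oo)
    (Ftilde_decr : forall t1 t2, t1 < t2 -> t2 < 0 ->
      Ftilde f t2 / `|t2| `^ (2 + 4 * s / N%:R)
        < Ftilde f t1 / `|t1| `^ (2 + 4 * s / N%:R))
    (Ftilde_incr : forall t1 t2, 0 < t1 -> t1 < t2 ->
      Ftilde f t1 / `|t1| `^ (2 + 4 * s / N%:R)
        < Ftilde f t2 / `|t2| `^ (2 + 4 * s / N%:R))
    (f_F : forall t, t != 0 ->
      f t * t < 2 * N%:R / (N%:R - 2 * s) * primitive f t)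
    (m : R) (hm : 0 < m) :
  exists (u : nat -> Rn R N -> R) (mu : nat -> R),
    [/\ forall k, weak_solution s f (mu k) (u k),
        forall k, ('N[Rn_lebesgue N]_2%:E[EFin \o u k] ^+ 2 = m%:E)%E,
        forall k, radial (u k)
      & forall j k, j <> k -> ~ (u j = u k %[ae Rn_lebesgue N])]
    /\ (forall k, energy s f (u k) <= energy s f (u k.+1))
    /\ energy s f (u k) @[k --> \oo] --> +oo.
Proof.
have A := admissible_intro hs hN f_odd f_cont f_zero f_infty F_infty Ftilde_incr f_F.
pose sol (v : (Rn R N -> R) * R) := [/\ weak_solution s f v.2 v.1,
  ('N[Rn_lebesgue N]_2%:E[EFin \o v.1] ^+ 2 = m%:E)%E & radial v.1].
have next C : exists v, sol v /\ C <= energy s f v.1.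
  by have [u [mu [h1 h2 h3 h4]]] := radial_solution_above A hm C; exists (u, mu).
have [g hg] := choice next.
(* Each solution is asked to have energy at least 1 above the previous one; monotonicity, divergence
   and pairwise distinctness all follow from this gap. *)
pose v := fix v k := if k is k'.+1 then g (energy s f (v k').1 + 1) else g 0.
have vs k : sol (v k) by case: k => [|k]; [have [] := hg 0|have [] := hg (energy s f (v k).1 + 1)].
have vE k : energy s f (v k).1 + 1 <= energy s f (v k.+1).1.
  by have [] := hg (energy s f (v k).1 + 1).
have vlt j k : (j < k)%N -> energy s f (v j).1 < energy s f (v k).1.
  elim: k => // k IH; rewrite ltnS leq_eqVlt => /orP[/eqP ->|/IH h].
    by apply: (lt_le_trans _ (vE k)); rewrite ltrDl.
  by apply: (lt_trans h); apply: (lt_le_trans _ (vE k)); rewrite ltrDl.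
have vge k : k%:R <= energy s f (v k).1.
  elim: k => [|k IH]; first by have [] := hg 0.
  by apply: (le_trans _ (vE k)); rewrite -natr1 lerD2r.
exists (fun k => (v k).1), (fun k => (v k).2); split; first split.
- by move=> k; have [] := vs k.
- by move=> k; have [] := vs k.
- by move=> k; have [] := vs k.
- move=> j k jk E; have Ejk : energy s f (v j).1 = energy s f (v k).1.
    have [[Hj _] _ _] := vs j; have [[Hk _] _ _] := vs k.
    apply: (energy_ae A Hj Hk).
    by move: E; apply: filterS => x /(_ I).
  by move/eqP: jk; rewrite neq_ltn => /orP[] /vlt; rewrite Ejk ltxx.
split; first by move=> k; apply: (le_trans _ (vE k)); rewrite lerDl.
apply/cvgryPge => B; near=> k; apply: (le_trans _ (vge k)).
by near: k; exact: nbhs_infty_ger.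
Unshelve. all: by end_near. Qed.
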